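(* Let $T>0$, let $\lambda$ be a positive real number, and assume that $f(t,\eta)$ is Lipschitz continuous from $L^2(0,T;V)$ into $L^2(0,T;V^* )$; put $g:=f(\cdot,0)\in L^2(0,T;V^* )$. Then there exists a unique weak solution $\eta$ of $$\eta''+\lambda\mathcal{A}\eta'+\mathcal{A}\eta=f(t,\eta),\qquad \eta(0)=u_0\in V,\quad \eta'(0)=v_0\in H.$$ The solution satisfies the regularity properties $$\eta\in C([0,T];V),\quad \eta'\in C([0,T];H),\quad \eta''\in L^2(0,T;V^* ).$$ Moreover, for all $t\in[0,T]$, $$|\eta'(t)|^2+\|\eta(t)\|^2+\int_0^t\|\eta'(s)\|^2\,ds\le C\left(\|u_0\|^2+|v_0|^2+\|g\|^2_{L^2(0,T;V^* )}\right),$$ where $C$ is a constant depending on $T$ and $\lambda$.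
   Context: Let $I=(-L,L)$ with $L>0$, where $L$ may be infinite; all functions are real-valued. $H=L^2(I)$ with inner product $(u,v)=\int_{-L}^{L}uv\,dx$ and norm $|u|$. $V$ is a Hilbert space continuously embedded in $H$, with inner product $((u,v))$ and norm $\|u\|$ (the Sobolev $H^1$ norm or an equivalent one); the choices considered are $V=H^1_0(I)$ (homogeneous Dirichlet conditions) or $V=H^1_N(I)=\{u\in H^1(I): u_x(\pm L)=0\}$ (homogeneous Neumann conditions). $V^*$ is the dual of $V$, with pairing $\langle\cdot,\cdot\rangle$. The symmetric bilinear form $a(u,v)=(u_x,v_x)$ on $V\times V$ satisfies $|a(u,v)|\le\|u\|\,\|v\|$, and $\mathcal{A}\in\mathcal{L}(V,V^* )$ is defined by $\langle\mathcal{A}u,v\rangle=a(u,v)$ for $u,v\in V$. Standing assumption: $a$ is coercive, i.e. there is a constant $c_0>0$ with $a(u,u)\ge c_0\|u\|^2$ for all $u\in V$. Where $(u_x,v_x)$ itself is not coercive (as for $V=H^1_N(I)$), this is understood to be ensured by adding a regularization term such as $\epsilon u$, and coercivity is assumed without loss of generality. For a.e. $t\in(0,T)$, $f(t,\cdot)$ maps $V$ into $V^*$; the Lipschitz hypothesis means that $w\mapsto f(\cdot,w(\cdot))$ is a Lipschitz map from $L^2(0,T;V)$ into $L^2(0,T;V^* )$. The case of interest is $f(t,\eta)=\epsilon^{-1}\big(\sin\phi(\cdot,t)-\sin(\phi(\cdot,t)+\epsilon\eta)\big)+g(\cdot,t)$, with $\phi$ a soliton solution of $\phi_{tt}-\phi_{xx}+\sin\phi=0$,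 $0<\epsilon\le1$ and $g\in L^2(0,T;V^* )$, for which $f(t,0)=g(t)$. $'$ denotes the time derivative in the sense of distributions. $W_r(0,T)=\{u: u\in L^2(0,T;V),\ u'\in L^2(0,T;V),\ u''\in L^2(0,T;V^* )\}$. A weak solution is a function $\eta\in W_r(0,T)$ for which the equation is satisfied in $V^*$ a.e. on $[0,T]$ and the initial conditions are satisfied in $V$ and $H$ respectively.
   Formalization: For Neumann conditions V is the closure in H^1(I) of {u : u_x(±L)=0}, since that set itself is not complete; the constant C depends on T, λ, the coercivity constant c_0 and the Lipschitz constant of f (dependence on T and λ alone is impossible). *)

(* Defs.v *)
From HB Require Import structures.
From mathcomp Require Import all_boot all_order all_algebra.
From mathcomp Require Import all_classical all_reals all_analysis.

Set Implicit Arguments.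
Unset Strict Implicit.
Unset Printing Implicit Defensive.

Import Order.TTheory GRing.Theory Num.Theory.
Import numFieldNormedType.Exports.

Local Open Scope classical_set_scope.
Local Open Scope ring_scope.

(* C_c^oo(J), J open *)
Definition test_function {R : realType} (J : set R) (phi : R -> R) : Prop :=
  (forall (n : nat) (x : R), derivable (derive1n n phi) x 1) /\
  (exists2 A : set R, compact A /\ A `<=` J & forall x, ~ A x -> phi x = 0).

(* A normed space whose points are represented with repetition: the points are
   the elements of [pn_mem], and [x], [y] represent the same point when
   [pn_norm (x - y) = 0].  Function spaces are given in this way by their
   functions, rather than by their classes of almost everywhere equal
   functions. *)
Record prenormed (R : realType) := Prenormed {
  pn_sort :> lmodType R;
  pn_mem : set pn_sort;
  pn_norm : pn_sort -> R }.

Section Dual.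
Context {R : realType} (X : prenormed R).

Definition dual_mem : set (X -> R^o) := [set l |
  (forall (k : R) (x y : X), pn_mem x -> pn_mem y ->
     l (k *: x + y) = k * l x + l y) /\
  (exists M : R, forall x : X, pn_mem x -> `|l x| <= M * pn_norm x)].

Definition dual_norm (l : X -> R^o) : R :=
  sup [set r | exists2 x : X, pn_mem x /\ pn_norm x <= 1 & r = `|l x|].

Definition dual : prenormed R :=
  @Prenormed R (X -> R^o : lmodType R) dual_mem dual_norm.

End Dual.

Section Bochner.
Context {R : realType} (X : prenormed R) (T : R).
Local Notation mu := (@lebesgue_measure R).

Record simple_function := SimpleFunction {
  sf_size : nat;
  sf_dom : 'I_sf_size -> set R;
  sf_val : 'I_sf_size -> X;
  sf_measurable : forall i, measurable (sf_dom i);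
  sf_sub : forall i, sf_dom i `<=` `]0, T[;
  sf_mem : forall i, pn_mem (sf_val i) }.

Definition sf_eval (s : simple_function) (t : R) : X :=
  \sum_(i < sf_size s) (\1_(sf_dom i) t : R) *: sf_val i.

Definition sf_integral (s : simple_function) : X :=
  \sum_(i < sf_size s) fine (mu (sf_dom i)) *: sf_val i.

Definition strongly_measurable (u : R -> X) : Prop :=
  {ae mu, forall t, t \in `]0, T[ -> pn_mem (u t)} /\
  exists s : nat -> simple_function,
    {ae mu, forall t, t \in `]0, T[ ->
      pn_norm (u t - sf_eval (s n) t) @[n --> \oo] --> (0 : R)}.

Definition bochner_integral (u : R -> X) (x : X) : Prop :=
  [/\ strongly_measurable u, pn_mem x &
   exists s : nat -> simple_function,
     (\int[mu]_(t in `]0%R, T[) (pn_norm (u t - sf_eval (s n) t))%:E)%E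
       @[n --> \oo] --> (0 : \bar R)%E /\
     pn_norm (sf_integral (s n) - x) @[n --> \oo] --> (0 : R)].

Definition L2_time (u : R -> X) : Prop :=
  strongly_measurable u /\
  (\int[mu]_(t in `]0%R, T[) ((pn_norm (u t)) ^+ 2)%:E < +oo)%E.

Definition L2_time_norm (u : R -> X) : R :=
  Num.sqrt (\int[mu]_(t in `]0%R, T[) (pn_norm (u t)) ^+ 2).

(* [u'] is the derivative of [u] in the sense of X-valued distributions on
   (0,T): int u phi' = - int u' phi for all phi in C_c^oo(0,T) *)
Definition time_derivative (u u' : R -> X) : Prop :=
  forall phi : R -> R, test_function `]0, T[ phi ->
    exists2 x : X, bochner_integral (fun t => derive1 phi t *: u t) x &
                   bochner_integral (fun t => phi t *: u' t) (- x).

Definition ae_equal (u v : R -> X) : Prop :=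
  {ae mu, forall t, t \in `]0, T[ -> pn_norm (u t - v t) = 0}.

Definition continuous_time (u : R -> X) : Prop :=
  (forall t, t \in `[0, T] -> pn_mem (u t)) /\
  (forall t, t \in `[0, T] ->
     pn_norm (u s - u t) @[s --> within `[0, T] (nbhs t)] --> (0 : R)).

(* [u(0) = x], for the continuous representative of [u] *)
Definition initial_value (u : R -> X) (x : X) : Prop :=
  exists w : R -> X,
    [/\ continuous_time w, ae_equal w u & pn_norm (w 0 - x) = 0].

End Bochner.

Section Spaces.
Context {R : realType} (L : \bar R).
Local Notation mu := (@lebesgue_measure R).

Definition I_ : set R := [set x | (- L < x%:E < L)%E].

Definition L2 : set (R -> R) := [set u | (u \_ I_) \in Lfun mu 2%:E].

Definition L2_dot (u v : R -> R) : R := \int[mu]_(x in I_) (u x * v x).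

Definition L2_norm (u : R -> R) : R := Num.sqrt (L2_dot u u).

Definition H : prenormed R := @Prenormed R (R -> R^o : lmodType R) L2 L2_norm.

Definition weak_derivative (u w : R -> R) : Prop :=
  forall phi : R -> R, test_function I_ phi ->
    \int[mu]_(x in I_) (u x * derive1 phi x) = - \int[mu]_(x in I_) (w x * phi x).

Definition H1 : set (R -> R) :=
  [set u | L2 u /\ exists2 w, L2 w & weak_derivative u w].

(* u_x; defined up to equality almost everywhere on I, for u in H1 *)
Definition dx (u : R -> R) : R -> R :=
  xget (cst 0) [set w | L2 w /\ weak_derivative u w].

Definition H1_dot (u v : R -> R) : R := L2_dot u v + L2_dot (dx u) (dx v).

Definition H1_norm (u : R -> R) : R := Num.sqrt (H1_dot u u).

Definition H1_closure (S : set (R -> R)) : set (R -> R) :=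
  [set u | H1 u /\
    forall e : R, 0 < e -> exists2 v, S v & H1_norm (u - v) < e].

Definition H1_0 : set (R -> R) := H1_closure (test_function I_).

Definition vanishes_at_ends (w : R -> R) : Prop :=
  match L with
  | r%:E => w x @[x --> r^'-] --> (0 : R) /\ w x @[x --> (- r)^'+] --> (0 : R)
  | +oo%E => w x @[x --> +oo] --> (0 : R) /\ w x @[x --> -oo] --> (0 : R)
  | -oo%E => True
  end.

(* The condition u_x(+-L) = 0 makes sense only when the class u_x has a
   representative with limits at the ends of I, and the functions which satisfy
   it are not closed in H1: the Hilbert space H^1_N is their closure. *)
Definition H1_N : set (R -> R) :=
  H1_closure [set u | H1 u /\
    exists w, [/\ L2 w, weak_derivative u w & vanishes_at_ends w]].

End Spaces.

Variant boundary_condition := Dirichlet | Neumann.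

Section Setting.
Context {R : realType} (L : \bar R) (bc : boundary_condition).
Context (ip : (R -> R) -> (R -> R) -> R).

Definition V_mem : set (R -> R) :=
  match bc with Dirichlet => H1_0 L | Neumann => H1_N L end.

Definition V_inner_product : Prop :=
  [/\ forall u v, V_mem u -> V_mem v -> ip u v = ip v u,
      forall (k : R) u v w, V_mem u -> V_mem v -> V_mem w ->
        ip (k \*: (u : R -> R^o) + v) w = k * ip u w + ip v w
    & exists m M : R, [/\ 0 < m, 0 < M &
        forall u, V_mem u ->
          m * H1_dot L u u <= ip u u <= M * H1_dot L u u]].

Definition V_norm (u : R -> R) : R := Num.sqrt (ip u u).

Definition V : prenormed R :=
  @Prenormed R (R -> R^o : lmodType R) V_mem V_norm.

Definition Vstar : prenormed R := dual V.

(* H is identified with its dual: u in H is the functional v |-> (u, v) on V *)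
Definition H_to_Vstar (u : R -> R) : Vstar := fun v : V => L2_dot L u v.

(* a(u, v) = (u_x, v_x) + kappa (u, v); kappa > 0 is the regularization,
   kappa = 0 its absence *)
Definition form_a (kappa : R) (u v : R -> R) : R :=
  L2_dot L (dx L u) (dx L v) + kappa * L2_dot L u v.

Definition op_A (kappa : R) (u : R -> R) : Vstar :=
  fun v : V => form_a kappa u v.

Definition form_bounded (kappa : R) : Prop :=
  forall u v, V_mem u -> V_mem v ->
    `|form_a kappa u v| <= V_norm u * V_norm v.

Definition form_coercive (kappa c0 : R) : Prop :=
  forall u, V_mem u -> c0 * V_norm u ^+ 2 <= form_a kappa u u.

Context (T : R) (f : R -> V -> Vstar).
Local Notation mu := (@lebesgue_measure R).

(* the second half of the condition says that the map does not depend on the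
   functions which represent a point of V *)
Definition maps_V_to_Vstar (F : V -> Vstar) : Prop :=
  (forall u : V, V_mem u -> pn_mem (F u)) /\
  (forall u v : V, V_mem u -> V_mem v -> V_norm (u - v) = 0 ->
     forall w : V, V_mem w -> F u w = F v w).

Definition lipschitz_rhs (K : R) : Prop :=
  [/\ {ae mu, forall t, t \in `]0, T[ -> maps_V_to_Vstar (f t)},
      forall w : R -> V, L2_time T w ->
        L2_time T (fun t => f t (w t))
    & forall w1 w2 : R -> V, L2_time T w1 -> L2_time T w2 ->
        L2_time_norm T (fun t => f t (w1 t) - f t (w2 t)) <=
        K * L2_time_norm T (fun t => w1 t - w2 t)].

(* eta'' = eta2 as V*-valued distributions, eta' = eta1 being identified with a
   V*-valued function through V c H c V* *)
Definition in_Wr (eta eta1 : R -> V) (eta2 : R -> Vstar) : Prop :=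
  [/\ L2_time T eta, L2_time T eta1, L2_time T eta2,
      time_derivative T eta eta1
    & time_derivative T (fun t => H_to_Vstar (eta1 t)) eta2].

Definition weak_solution (kappa lambda : R) (u0 v0 : R -> R) (eta : R -> V)
    : Prop :=
  exists (eta1 : R -> V) (eta2 : R -> Vstar),
    [/\ in_Wr eta eta1 eta2,
        {ae mu, forall t, t \in `]0, T[ -> forall v : V, V_mem v ->
          eta2 t v + lambda * op_A kappa (eta1 t) v + op_A kappa (eta t) v =
          f t (eta t) v},
        @initial_value R V T eta u0
      & @initial_value R (H L) T eta1 v0].

End Setting.

(* Main.v *)
(* The spaces V, V* and H of functions are modelled by abstract semi-Hilbert spaces;
   V carries the scalar product a, so that A becomes the identity after the Riesz
   identification of V* with V.

   The velocity v = eta' solves v' + lam A v = h with h = f(eta) - A eta. For fixed h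
   this linear parabolic problem is solved by density: a pair (initial value, h)
   orthogonal to the data of all smooth solutions vanishes, and the energy identity
   extends solvability from the dense set of data to all data. The Lipschitz bound
   holds on every [0,t], since two inputs may be glued after time t; hence the map
   v |-> (solution for h(v)) is a contraction for a norm with an exponential weight in
   time. Its iterates converge to the velocity of a weak solution, and the energy
   inequality with Gronwall's lemma gives the estimate.

   Conversely, by the lemma of du Bois-Reymond, the distributional derivatives of any
   weak solution are a.e. derivatives of primitives, so its velocity is a fixed point
   of the same map: this gives uniqueness. *)
Require Import Defs.
From HB Require Import structures.
From mathcomp Require Import all_boot all_order all_algebra.
From mathcomp Require Import all_classical all_reals all_analysis.
From mathcomp Require Import measurable_realfun.
From mathcomp Require Import ring lra.

Set Implicit Arguments.
Unset Strict Implicit.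
Unset Printing Implicit Defensive.

Import Order.TTheory GRing.Theory Num.Theory.
Import numFieldNormedType.Exports.

Local Open Scope classical_set_scope.
Local Open Scope ring_scope.

(** The given spaces consist of functions and not of classes, and no quotient is taken: identities
    between vectors are stated as vanishing norms or tested by scalar products, and [realization]
    translates between the given spaces and the abstract ones. Density replaces a Galerkin basis
    because a dense set of data costs nothing: v' is chosen freely among the square integrable
    functions with values in V, and h is read off from the equation. The energy identity needs a
    product rule for primitives. Instead of differentiability almost everywhere it uses that a
    function is constant when its increments over [s, t] are at most sqrt(t - s) times the
    increments of a fixed function. The rate of the exponential weight is chosen once, so that the
    contraction and Gronwall's argument both gain a definite factor; the latter is an iteration too,
    not a differential inequality. The map f is controlled only as a map between square integrable
    functions of time. Its pointwise character enters through locality in time and through its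
    independence of representatives. *)

(** * Limits of real sequences *)

Lemma cvg_scale (R : realType) (k : R) (u : nat -> R) (l : R) :
  u n @[n --> \oo] --> l -> k * u n @[n --> \oo] --> k * l.
Proof. by move=> h; apply: cvgM h; exact: cvg_cst. Qed.

Lemma cvg_shift (R : realType) (k : R) (u : nat -> R) (l : R) :
  u n @[n --> \oo] --> l -> k + u n @[n --> \oo] --> k + l.
Proof. by move=> h; apply: cvgD h; exact: cvg_cst. Qed.

Lemma le_cvg_seq (R : realType) (u v : nat -> R) (l l' : R) :
  u n @[n --> \oo] --> l -> v n @[n --> \oo] --> l' -> (forall n, u n <= v n) -> l <= l'.
Proof. by move=> hu hv h; apply: (ler_cvg_to hu hv); exact: nearW. Qed.

Lemma cvg_harmonic_shift (R : realType) (k : R) : n.+1%:R^-1 + k @[n --> \oo] --> k.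
Proof. by rewrite -[X in _ --> X]add0r; apply: cvgD; [exact: cvg_harmonic|exact: cvg_cst]. Qed.

Lemma cvg0_le (R : realType) (u v : nat -> R) :
  (forall n, 0 <= u n <= v n) -> v n @[n --> \oo] --> (0 : R) -> u n @[n --> \oo] --> (0 : R).
Proof.
move=> uv v0; apply: (@squeeze_cvgr _ _ _ _ (fun=> 0) v) => //; last exact: cvg_cst.
exact: nearW.
Qed.

Lemma cvg_le_near (R : realType) (u : nat -> R) (l e : R) (N : nat) :
  u n @[n --> \oo] --> l -> (forall n, (N <= n)%N -> u n <= e) -> l <= e.
Proof. by move=> hu h; apply: (ler_cvg_to hu (cvg_cst e)); exists N. Qed.

Lemma cvg_uniq (R : realType) (u v : nat -> R) (l l' : R) : u =1 v ->
  u n @[n --> \oo] --> l -> v n @[n --> \oo] --> l' -> l = l'.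
Proof. by move=> /funext -> h h'; exact: (cvg_unique _ h h'). Qed.

Lemma cvg0_lt (R : realType) (u : nat -> R) (e : R) :
  u n @[n --> \oo] --> (0 : R) -> 0 < e -> exists N, forall n, (N <= n)%N -> u n < e.
Proof.
move=> /cvgrPdist_lt h /h[N _ hN]; exists N => n /hN/=.
by rewrite sub0r normrN; apply: le_lt_trans; exact: ler_norm.
Qed.

(** * Semi-Hilbert spaces *)

Record subspace (R : realType) (E : lmodType R) := Subspace {
  ss_set :> E -> Prop;
  ss_0 : ss_set 0;
  ss_lin : forall (k : R) x y, ss_set x -> ss_set y -> ss_set (k *: x + y) }.

Section SubspaceType.
Context {R : realType} (E : lmodType R) (P : subspace E).

(** Membership is made boolean by classical logic, so that the subtype inherits the module
    structure. The L2 space, H1 and V below are all subtypes of this kind. *)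
Definition ss_pred : {pred E} := fun x => `[< P x >].

Lemma ss_predE x : (x \in ss_pred) = `[< P x >]. Proof. by []. Qed.

Lemma ss_pred_closed : GRing.submod_closed ss_pred.
Proof.
split=> [|k x y]; rewrite !ss_predE; first exact/asboolP/ss_0.
by move=> /asboolP Px /asboolP Py; exact/asboolP/ss_lin.
Qed.

HB.instance Definition _ := GRing.isSubmodClosed.Build R E ss_pred ss_pred_closed.

Record sub_of := SubOf { sub_val : E; _ : sub_val \in ss_pred }.

HB.instance Definition _ := [isSub for sub_val].
HB.instance Definition _ := [Choice of sub_of by <:].
HB.instance Definition _ := [SubChoice_isSubLmodule of sub_of by <:].

Lemma sub_valP (x : sub_of) : P (sub_val x).
Proof. by case: x => x Px; exact: (elimT (asboolP _) Px). Qed.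

Definition sub_mk (x : E) (Px : P x) : sub_of := SubOf (introT (asboolP _) Px).

End SubspaceType.

(* Complete for a semi-definite scalar product: vectors are not identified when
   their difference has norm zero. *)
Record semiHilbert (R : realType) := SemiHilbert {
  sh_sort :> lmodType R;
  dot : sh_sort -> sh_sort -> R;
  dotC : forall x y, dot x y = dot y x;
  dot_linl : forall k x y z, dot (k *: x + y) z = k * dot x z + dot y z;
  dot_ge0 : forall x, 0 <= dot x x;
  sh_complete : forall u : nat -> sh_sort,
    (forall e : R, 0 < e -> exists N, forall m n, (N <= m)%N -> (N <= n)%N ->
       dot (u m - u n) (u m - u n) < e) ->
    exists x, dot (u n - x) (u n - x) @[n --> \oo] --> (0 : R) }.

Section SemiHilbertTheory.
Context {R : realType} (X : semiHilbert R).
Implicit Types (x y z : X) (k : R).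

Definition nrm x : R := Num.sqrt (dot x x).

Lemma dotDl x y z : dot (x + y) z = dot x z + dot y z.
Proof. by rewrite -[x]scale1r dot_linl scale1r mul1r. Qed.

Lemma dot0l y : dot (0 : X) y = 0.
Proof. by apply: (addrI (dot (0 : X) y)); rewrite -dotDl !addr0. Qed.

Lemma dotZl k x z : dot (k *: x) z = k * dot x z.
Proof. by rewrite -[k *: x]addr0 dot_linl dot0l addr0. Qed.

Lemma dotNl x z : dot (- x) z = - dot x z.
Proof. by rewrite -scaleN1r dotZl mulN1r. Qed.

Lemma dotBl x y z : dot (x - y) z = dot x z - dot y z.
Proof. by rewrite dotDl dotNl. Qed.

Lemma dotDr x y z : dot x (y + z) = dot x y + dot x z.
Proof. by rewrite dotC dotDl !(dotC x). Qed.

Lemma dot0r y : dot y (0 : X) = 0.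
Proof. by rewrite dotC dot0l. Qed.

Lemma dotZr k x z : dot x (k *: z) = k * dot x z.
Proof. by rewrite dotC dotZl dotC. Qed.

Lemma dotNr x z : dot x (- z) = - dot x z.
Proof. by rewrite dotC dotNl dotC. Qed.

Lemma dotBr x y z : dot x (y - z) = dot x y - dot x z.
Proof. by rewrite dotDr dotNr. Qed.

Definition dotE := (dotDl, dotDr, dotBl, dotBr, dotZl, dotZr, dotNl, dotNr, dot0l, dot0r).

Lemma nrm_ge0 x : 0 <= nrm x. Proof. exact: sqrtr_ge0. Qed.

Lemma nrm_sqr x : nrm x ^+ 2 = dot x x.
Proof. by rewrite sqr_sqrtr // dot_ge0. Qed.

Lemma nrm0 : nrm (0 : X) = 0.
Proof. by rewrite /nrm dot0l sqrtr0. Qed.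

Lemma nrmN x : nrm (- x) = nrm x.
Proof. by rewrite /nrm !dotE opprK. Qed.

Lemma nrm_sym x y : nrm (x - y) = nrm (y - x).
Proof. by rewrite -nrmN opprB. Qed.

Lemma nrmZ k x : nrm (k *: x) = `|k| * nrm x.
Proof. by rewrite /nrm !dotE mulrA -expr2 sqrtrM ?sqr_ge0// sqrtr_sqr. Qed.

Lemma dot_sqr_le x y : dot x y ^+ 2 <= dot x x * dot y y.
Proof.
have h t : 0 <= dot x x + 2 * t * dot x y + t ^+ 2 * dot y y.
  have := dot_ge0 (x + t *: y); rewrite !dotE (dotC y x); lra.
have xx := dot_ge0 x; have yy := dot_ge0 y.
have [y0|y0] := eqVneq (dot y y) 0.
  have {}h t : 0 <= dot x x + 2 * t * dot x y by have := h t; rewrite y0 mulr0 addr0.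
  have [->|xy0] := eqVneq (dot x y) 0; first by rewrite expr0n/= y0 mulr0.
  (* When y has norm zero the quadratic polynomial is affine; at this point it would equal -1. *)
  have := h (- (dot x x + 1) / (2 * dot x y)).
  have -> : 2 * (- (dot x x + 1) / (2 * dot x y)) * dot x y = - (dot x x + 1) by field.
  lra.
have {}yy : 0 < dot y y by rewrite lt_neqAle eq_sym y0.
have := h (- dot x y / dot y y).
have -> : dot x x + 2 * (- dot x y / dot y y) * dot x y + (- dot x y / dot y y) ^+ 2 * dot y y
  = (dot x x * dot y y - dot x y ^+ 2) / dot y y by field.
by rewrite pmulr_lge0 ?invr_gt0// subr_ge0.
Qed.

Lemma dot_le x y : `|dot x y| <= nrm x * nrm y.
Proof.
rewrite -(@ler_pXn2r _ 2) ?nnegrE ?mulr_ge0 ?nrm_ge0//.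
by rewrite real_normK ?num_real// exprMn !nrm_sqr dot_sqr_le.
Qed.

Lemma dot_le_nrm x y : dot x y <= nrm x * nrm y.
Proof. exact: le_trans (ler_norm _) (dot_le x y). Qed.

Lemma nrmD x y : nrm (x + y) <= nrm x + nrm y.
Proof.
rewrite -(@ler_pXn2r _ 2) ?nnegrE ?addr_ge0 ?nrm_ge0//.
rewrite sqrrD !nrm_sqr !dotE (dotC y x); have := dot_le_nrm x y; lra.
Qed.

Lemma nrmB x y : nrm (x - y) <= nrm x + nrm y.
Proof. by rewrite -(nrmN y) nrmD. Qed.

Lemma nrm_dist x y z : nrm (x - z) <= nrm (x - y) + nrm (y - z).
Proof. by apply: le_trans (nrmD _ _); rewrite addrA subrK. Qed.

Lemma nrm_distl x y : `|nrm x - nrm y| <= nrm (x - y).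
Proof.
rewrite ler_norml lerBlDl; apply/andP; split.
  by have := nrmD (y - x) x; rewrite subrK nrm_sym; lra.
by have := nrmD (x - y) y; rewrite subrK; lra.
Qed.

Lemma nrm_eq0P x : (nrm x = 0) <-> (dot x x = 0).
Proof.
split=> [h|h]; last by rewrite /nrm h sqrtr0.
by rewrite -nrm_sqr h expr0n.
Qed.

Lemma dot0_nrm x y : nrm x = 0 -> dot x y = 0.
Proof.
move=> x0; have := dot_le x y; rewrite x0 mul0r => h.
by apply/eqP; rewrite -normr_le0.
Qed.

Lemma nrm_sub0_trans y x z : nrm (x - y) = 0 -> nrm (y - z) = 0 -> nrm (x - z) = 0.
Proof.
move=> xy yz; apply/eqP; rewrite eq_le nrm_ge0 andbT.
by apply: le_trans (nrm_dist x y z) _; rewrite xy yz addr0.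
Qed.

Lemma eq_nrm x y : nrm (x - y) = 0 -> nrm x = nrm y.
Proof.
move=> h; apply/eqP; rewrite -subr_eq0 -normr_le0.
by apply: le_trans (nrm_distl _ _) _; rewrite h.
Qed.

Lemma sqr_nrmD x y : dot (x + y) (x + y) <= 2 * dot x x + 2 * dot y y.
Proof. have := dot_ge0 (x - y); rewrite !dotE (dotC y x); lra. Qed.

Lemma sqr_nrmB x y : dot (x - y) (x - y) <= 2 * dot x x + 2 * dot y y.
Proof. have := dot_ge0 (x + y); rewrite !dotE (dotC y x); lra. Qed.

Definition ncvg (u : nat -> X) x := nrm (u n - x) @[n --> \oo] --> (0 : R).

Definition ncauchy (u : nat -> X) := forall e : R, 0 < e -> exists N, forall m n,
  (N <= m)%N -> (N <= n)%N -> nrm (u m - u n) < e.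

Lemma ncvgP u x : ncvg u x <-> forall e : R, 0 < e -> exists N, forall n, (N <= n)%N -> nrm (u n - x) < e.
Proof.
split=> [/cvgrPdist_lt h e /h [N _ hN]|h].
  by exists N => n Nn; have := hN n Nn; rewrite /= sub0r normrN ger0_norm ?nrm_ge0.
apply/cvgrPdist_lt => e /h [N hN]; exists N => // n /= Nn.
by rewrite sub0r normrN ger0_norm ?nrm_ge0//; exact: hN.
Qed.

Lemma ncauchy_cvg u : ncauchy u -> exists x, ncvg u x.
Proof.
move=> h; have [e e0|x hx] := @sh_complete _ X u.
  have [|N hN] := h (Num.sqrt e); first by rewrite sqrtr_gt0.
  exists N => m n Nm Nn; have := hN m n Nm Nn.
  by rewrite ltr_sqrt.
exists x; rewrite /ncvg /nrm -(sqrtr0 R).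
exact: (cvg_comp _ _ hx (@sqrt_continuous R 0)).
Qed.

Lemma ncvg_dot u x y : ncvg u x -> dot (u n) y @[n --> \oo] --> dot x y.
Proof.
move=> /cvgrPdist_lt h; apply/cvgrPdist_lt => e e0.
have k0 : 0 < nrm y + 1 by have := nrm_ge0 y; lra.
have [N _ hN] := h _ (divr_gt0 e0 k0); exists N => // n /= Nn.
have := hN n Nn; rewrite /= sub0r normrN ger0_norm ?nrm_ge0// ltr_pdivlMr// => {}hN.
rewrite -dotBl; apply: le_lt_trans (dot_le _ _) _; rewrite nrm_sym.
apply: le_lt_trans hN; rewrite ler_wpM2l ?nrm_ge0//; lra.
Qed.

Lemma ncvg_sqr u x : ncvg u x <-> dot (u n - x) (u n - x) @[n --> \oo] --> (0 : R).
Proof.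
split=> h; last by rewrite /ncvg /nrm -(sqrtr0 R); exact: (cvg_comp _ _ h (@sqrt_continuous R 0)).
rewrite (_ : (fun n => _) = (fun n => nrm (u n - x) * nrm (u n - x))).
  by rewrite -[X in _ --> X](mulr0 (0 : R)); exact: cvgM.
by apply/funext => n; rewrite -expr2 nrm_sqr.
Qed.

Lemma ncvg_nrm u x : ncvg u x -> nrm (u n) @[n --> \oo] --> nrm x.
Proof.
move=> /ncvgP h; apply/cvgrPdist_lt => e /h[N hN]; exists N => // n /= Nn.
by rewrite distrC; apply: le_lt_trans (nrm_distl _ _) (hN n Nn).
Qed.

Lemma ncvg_cauchy u x : ncvg u x -> ncauchy u.
Proof.
move=> /ncvgP h e e0; have [|N hN] := h (e / 2); first lra.
exists N => m n /hN um /hN un; apply: le_lt_trans (nrm_dist _ x _) _.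
by rewrite (nrm_sym x); lra.
Qed.

Lemma ncvg_sqr_cauchy u x : (nrm (u n - x) @[n --> \oo] --> (0 : R)) ->
  forall e : R, 0 < e -> exists N, forall m n, (N <= m)%N -> (N <= n)%N -> dot (u m - u n) (u m - u n) < e.
Proof.
move=> h e e0; have hc := ncvg_cauchy h; have [|N hN] := hc (Num.sqrt e); first by rewrite sqrtr_gt0.
exists N => m n Nm Nn; rewrite -nrm_sqr -[e]sqr_sqrtr ?(ltW e0)//.
by rewrite ltrXn2r ?nnegrE ?nrm_ge0 ?sqrtr_ge0//; exact: hN.
Qed.

Lemma ncvg_unique u x y : ncvg u x -> ncvg u y -> nrm (x - y) = 0.
Proof.
move=> /ncvgP hx /ncvgP hy; apply/eqP; rewrite eq_le nrm_ge0 andbT.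
suff h (e : R) : 0 < e -> nrm (x - y) <= 0 + e by apply/ler_addgt0Pr.
move=> e0; have e2 : 0 < e / 2 by lra.
have [N hN] := hx _ e2; have [M hM] := hy _ e2.
have := hN _ (leq_maxl N M); have := hM _ (leq_maxr N M).
have := nrm_dist x (u (maxn N M)) y; rewrite (nrm_sym x (u _)); lra.
Qed.

Lemma ncvg_lin k u v x y : ncvg u x -> ncvg v y -> ncvg (fun n => k *: u n + v n) (k *: x + y).
Proof.
move=> hu hv; apply: (@squeeze_cvgr _ _ _ _ (fun=> 0) (fun n => `|k| * nrm (u n - x) + nrm (v n - y))).
- apply: nearW => n; rewrite nrm_ge0 /=.
  have -> : k *: u n + v n - (k *: x + y) = k *: (u n - x) + (v n - y).
    by rewrite scalerBr opprD addrACA.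
  by apply: le_trans (nrmD _ _) _; rewrite nrmZ.
- exact: cvg_cst.
- rewrite -[X in _ --> X](addr0 0) -[X in _ --> X + _](mulr0 `|k|).
  by apply: cvgD hv; apply: cvgM hu; exact: cvg_cst.
Qed.

Lemma ncvg_subr u x y : ncvg u x -> ncvg (fun n => y - u n) (y - x).
Proof.
rewrite /ncvg => h; rewrite (_ : (fun n => _) = (fun n => nrm (u n - x)))//.
by apply/funext => n; rewrite opprB addrC addrA subrK nrm_sym.
Qed.

Lemma ncvg_cst x : ncvg (fun=> x) x.
Proof. by rewrite /ncvg subrr nrm0; exact: cvg_cst. Qed.

End SemiHilbertTheory.
Arguments ncvg {R X}.

(** * Orthogonal projection and Riesz representation *)

Section Projection.
Context {R : realType} (X : semiHilbert R).
Variable N : subspace X.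
Implicit Types x y z n : X.

(* The parallelogram law makes a minimizing sequence Cauchy. *)
Theorem projection z : exists y (s : nat -> X),
  [/\ forall k, N (s k), ncvg s y & forall n, N n -> dot (z - y) n = 0].
Proof.
pose D := [set dot (z - n) (z - n) | n in [set n | N n]].
have D0 : has_inf D.
  split; first by exists (dot (z - 0) (z - 0)), 0 => //; exact: ss_0.
  by exists 0 => _ [n _ <-]; exact: dot_ge0.
pose d := inf D.
have dle n : N n -> d <= dot (z - n) (z - n).
  by move=> Nn; apply: ge_inf => //; [case: D0|exists n].
have /choice[s hs] (k : nat) : exists n, N n /\ dot (z - n) (z - n) < d + k.+1%:R^-1.
  have [|_ [n Nn <-] h] := @inf_adherent _ D k.+1%:R^-1 _ D0.
    by rewrite invr_gt0 ltr0n.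
  by exists n.
have Ns k : N (s k) by have [] := hs k.
have sC k l : dot (s k - s l) (s k - s l) <= 2 * (k.+1%:R^-1 + l.+1%:R^-1).
  have hm : N (2^-1 *: (s k + s l)).
    rewrite -[_ *: _]addr0; apply: ss_lin; last exact: ss_0.
    by rewrite -[s k]scale1r; apply: ss_lin.
  have := dle _ hm; have [_] := hs k; have [_] := hs l.
  rewrite !dotE !(dotC (s k) z) !(dotC (s l) z) (dotC (s l) (s k)).
  move: (dot z z) (dot z (s l)) (dot z (s k)) (dot (s k) (s l)) (dot (s k) (s k)) (dot (s l) (s l)).
  move: k.+1%:R^-1 l.+1%:R^-1 => *; lra.
have cs : ncauchy s.
  move=> e e0.
  have e2 : 0 < e ^+ 2 / 4 by rewrite divr_gt0// exprn_gt0.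
  have [M _ hM] := near_infty_natSinv_lt (PosNum e2).
  exists M => k l Mk Ml.
  rewrite -(@ltr_pXn2r _ 2) ?nnegrE ?nrm_ge0 ?(ltW e0)// nrm_sqr.
  apply: le_lt_trans (sC k l) _.
  have hk : k.+1%:R^-1 < e ^+ 2 / 4 := hM k Mk.
  have hl : l.+1%:R^-1 < e ^+ 2 / 4 := hM l Ml.
  by move: k.+1%:R^-1 l.+1%:R^-1 hk hl => *; lra.
have [y hy] := ncauchy_cvg cs.
exists y, s; split=> // n Nn.
(* The limit y may lie outside N, which is not assumed closed. Minimality is therefore compared at
   the points [t *: n + s k] of N, with error 1 / (k + 1), before passing to the limit. *)
have key (t : R) (k : nat) : 2 * t * dot (z - s k) n <= k.+1%:R^-1 + t ^+ 2 * dot n n.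
  have hm : N (t *: n + s k) by apply: ss_lin.
  have := dle _ hm; have [_] := hs k.
  rewrite !dotE !(dotC n) !(dotC (s k) z).
  by move: k.+1%:R^-1 => *; lra.
have lim t : 2 * t * dot (z - y) n <= t ^+ 2 * dot n n.
  apply: (@le_cvg_seq R (fun k => 2 * t * dot (z - s k) n) (fun k => k.+1%:R^-1 + t ^+ 2 * dot n n)).
  - apply: cvg_scale; rewrite dotBl; under eq_fun do rewrite dotBl.
    by apply: cvg_shift; apply: cvgN; exact: ncvg_dot.
  - exact: cvg_harmonic_shift.
  - exact: key.
have [n0|n0] := eqVneq (dot n n) 0.
  by rewrite dotC dot0_nrm//; exact/nrm_eq0P.
have n1 : 0 < dot n n by rewrite lt_neqAle eq_sym n0 dot_ge0.
(* The optimal t: with p = <z - y, n> the bound becomes 2 p^2 <= p^2 after multiplication by <n,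
   n>. *)
have := lim (dot (z - y) n / dot n n).
have -> : 2 * (dot (z - y) n / dot n n) * dot (z - y) n = 2 * (dot (z - y) n ^+ 2 / dot n n) by field.
have -> : (dot (z - y) n / dot n n) ^+ 2 * dot n n = dot (z - y) n ^+ 2 / dot n n by field.
move=> h; have {h} : dot (z - y) n ^+ 2 / dot n n <= 0 by lra.
rewrite pmulr_lle0 ?invr_gt0// => h.
by apply/eqP; rewrite -sqrf_eq0 eq_le h sqr_ge0.
Qed.

(** The difference of z and its projection is orthogonal to N, hence of norm zero, and the
    projection is by construction a limit of points of N. *)
Theorem dense_of_orthogonal :
  (forall q, (forall n, N n -> dot q n = 0) -> nrm q = 0) ->
  forall z, exists s : nat -> X, (forall k, N (s k)) /\ ncvg s z.
Proof.
move=> h z; have [y [s [Ns sy yz]]] := projection z.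
exists s; split=> //; have zy := h _ yz.
apply/ncvgP => e e0; have [M hM] := (ncvgP _ _).1 sy e e0; exists M => n Mn.
apply: le_lt_trans (nrm_dist _ y _) _.
by rewrite (nrm_sym y) zy addr0; exact: hM.
Qed.

End Projection.

Section Riesz.
Context {R : realType} (X : semiHilbert R).

(** The projection y of w onto the kernel is only a limit of points of the kernel; boundedness of l
    gives l y = 0. Then p = w - y is orthogonal to the kernel, and a multiple of p represents l
    because x - (l x / l w) p lies in the kernel. *)
Theorem riesz (l : X -> R) (M : R) :
  (forall k x y, l (k *: x + y) = k * l x + l y) ->
  (forall x, `|l x| <= M * nrm x) ->
  exists z, forall x, dot z x = l x.
Proof.
move=> ll lM.
have l0 : l 0 = 0.
  by apply/eqP; rewrite -normr_le0; apply: le_trans (lM _) _; rewrite nrm0 mulr0.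
have lZ k x : l (k *: x) = k * l x by rewrite -[_ *: x]addr0 ll l0 addr0.
have lD x y : l (x + y) = l x + l y by rewrite -[x]scale1r ll mul1r scale1r.
have Kl k x y (hx : l x = 0) (hy : l y = 0) : l (k *: x + y) = 0.
  by rewrite ll hx hy mulr0 addr0.
pose K := @Subspace R X (fun x => l x = 0) l0 Kl.
have [[w w0]|h] := pselect (exists w, l w != 0); last first.
  exists 0 => x; rewrite dot0l; apply/esym/eqP; apply/negPn/negP => hx.
  by apply: h; exists x.
have [y [s [Ks sy yz]]] := projection K w.
have ly : l y = 0.
  suff : l (s n) @[n --> \oo] --> l y.
    under eq_fun do rewrite Ks.
    by move=> h; exact: (cvg_unique _ h (cvg_cst (0 : R))).
  apply/cvgrPdist_lt => e e0.
  have M0 : 0 < `|M| + 1 by rewrite ltr_wpDl.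
  have [n0 hn] := (ncvgP _ _).1 sy _ (divr_gt0 e0 M0).
  exists n0 => // n /= /hn; rewrite ltr_pdivlMr// => {}hn.
  rewrite -mulN1r -lZ -lD scaleN1r; apply: le_lt_trans (lM _) _.
  rewrite nrm_sym; apply: le_lt_trans hn; rewrite mulrC ler_wpM2l ?nrm_ge0//.
  by have := ler_norm M; lra.
pose p := w - y.
have lp : l p = l w by rewrite /p lD -scaleN1r lZ ly mulr0 addr0.
have pp : dot p p != 0.
  apply/eqP => /nrm_eq0P p0; move: w0; rewrite -lp -normr_le0.
  by rewrite (le_trans (lM _))// p0 mulr0.
exists ((l w / dot p p) *: p) => x.
have : dot p (x - (l x / l w) *: p) = 0.
  apply: yz => /=; rewrite lD -scaleN1r !lZ lp; field.
  by [].
rewrite dotBr dotZr dotZl => /eqP; rewrite subr_eq0 => /eqP ->.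
by field; rewrite w0 pp.
Qed.

End Riesz.

Section ProductSpace.
Context {R : realType} (X Y : semiHilbert R).

Definition prod_dot (p q : (X * Y)%type) : R := dot p.1 q.1 + dot p.2 q.2.

Lemma prod_complete (u : nat -> (X * Y)%type) :
  (forall e : R, 0 < e -> exists N, forall m n, (N <= m)%N -> (N <= n)%N ->
       prod_dot (u m - u n) (u m - u n) < e) ->
    exists x, prod_dot (u n - x) (u n - x) @[n --> \oo] --> (0 : R).
Proof.
move=> h.
have [|x hx] := @sh_complete _ X (fst \o u).
  move=> e /h[N hN]; exists N => m n /hN{}hN /hN{}hN.
  by apply: le_lt_trans hN; rewrite lerDl dot_ge0.
have [|y hy] := @sh_complete _ Y (snd \o u).
  move=> e /h[N hN]; exists N => m n /hN{}hN /hN{}hN.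
  by apply: le_lt_trans hN; rewrite lerDr dot_ge0.
exists (x, y); rewrite -[X in _ --> X](addr0 0).
exact: cvgD.
Qed.

Definition prod_sh : semiHilbert R.
Proof.
apply: (@SemiHilbert R (X * Y)%type prod_dot).
- by move=> x y; rewrite /prod_dot dotC (dotC x.2).
- by move=> k x y z; rewrite /prod_dot /= !dotE; ring.
- by move=> x; rewrite addr_ge0 ?dot_ge0.
- exact: prod_complete.
Defined.

End ProductSpace.

(** * Strong measurability *)

Section RealLine.
Context {R : realType}.

Lemma real_complete (u : nat -> R^o) :
  (forall e : R, 0 < e -> exists N, forall m n, (N <= m)%N -> (N <= n)%N ->
    (u m - u n) * (u m - u n) < e) ->
  exists x, (u n - x) * (u n - x) @[n --> \oo] --> (0 : R).
Proof.
move=> h; have /cauchy_cvgP/cvg_ex[x hx] : cauchy (u @ \oo).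
  apply/cauchy_exP => _/posnumP[e].
  have [N hN] := h _ (mulr_gt0 (gt0 e) (gt0 e)).
  exists (u N), N => // n /= Nn; rewrite /ball_ /=.
  have := hN N n (leqnn N) Nn; rewrite /ball/= -expr2 -[X in _ < X]expr2.
  by move=> hlt; rewrite -(@ltr_pXn2r _ 2) ?nnegrE// real_normK ?num_real.
exists x; rewrite -[X in _ --> X](mulr0 0).
by apply: cvgM; rewrite -(subrr x); apply: cvgB => //; exact: cvg_cst.
Qed.

(** With the reals as a semi-Hilbert space, scalar functions are a case of vector functions:
    measurability of norms and scalar products, and the space L2(I), come from the general
    theory. *)
Definition real_sh : semiHilbert R.
Proof.
apply: (@SemiHilbert R (R^o : lmodType R) (fun x y => x * y)).
- by move=> x y; rewrite mulrC.
- by move=> k x y z; rewrite mulrDl -mulrA.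
- by move=> x; rewrite -expr2 sqr_ge0.
- exact: real_complete.
Defined.

Lemma nrm_real (x : real_sh) : nrm x = `|x : R|.
Proof. by rewrite /nrm /dot/= -expr2 sqrtr_sqr. Qed.

Lemma ncvg_real (u : nat -> real_sh) (x : real_sh) : ncvg u x <-> (u n : R) @[n --> \oo] --> (x : R).
Proof.
rewrite ncvgP; split=> [h|/cvgrPdist_lt h e /h[N _ hN]].
  apply/cvgrPdist_lt => e /h[N hN]; exists N => // n /hN.
  by rewrite nrm_real distrC.
by exists N => n /hN; rewrite nrm_real distrC.
Qed.

End RealLine.
Arguments real_sh : clear implicits.

(** The preimage of a set is a countable union over the values of the two indices, so f itself may
    be any map. *)
Lemma measurable_fun_nat2 d (T0 : measurableType d) d' (U : measurableType d')
    (D : set T0) (k l : T0 -> nat) (f : nat -> nat -> U) :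
  measurable_fun D k -> measurable_fun D l -> measurable_fun D (fun t => f (k t) (l t)).
Proof.
move=> mk ml mD B mB.
have -> : D `&` (fun t => f (k t) (l t)) @^-1` B =
    \bigcup_i \bigcup_j (D `&` k @^-1` [set i] `&` (D `&` l @^-1` [set j]) `&` [set _ | B (f i j)]).
  apply/seteqP; split=> [t [Dt Bt]|t [i _ [j _ [[[Dt /= ki] [_ /= lj]] /= Bt]]]].
    by exists (k t) => //; exists (l t).
  by split=> //=; rewrite ki lj.
apply: bigcupT_measurable => i; apply: bigcupT_measurable => j.
have [b|b] := pselect (B (f i j)).
  rewrite (_ : [set _ | _] = setT) ?setIT; first by apply: measurableI; [exact: mk|exact: ml].
  by apply/seteqP; split.
rewrite (_ : [set _ | _] = set0) ?setI0//.
by apply/seteqP; split.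
Qed.

Section StronglyMeasurable.
Context {R : realType} d (T0 : measurableType d) (D : set T0).

(** Pointwise limits of functions with countably many values, all taken from one sequence c.
    Measurability is placed on the index [k n], which avoids a sigma-algebra on X, and the range is
    separable by construction. *)
Definition smeas (X : semiHilbert R) (u : T0 -> X) : Prop :=
  exists (c : nat -> X) (k : nat -> T0 -> nat),
    (forall n, measurable_fun D (k n)) /\
    forall t, D t -> ncvg (fun n => c (k n t)) (u t).

Definition scontinuous2 (X Y Z : semiHilbert R) (g : X -> Y -> Z) : Prop :=
  forall (a : nat -> X) (b : nat -> Y) x y, ncvg a x -> ncvg b y ->
    ncvg (fun n => g (a n) (b n)) (g x y).

Lemma smeas2 (X Y Z : semiHilbert R) (g : X -> Y -> Z) u v :
  scontinuous2 g -> smeas u -> smeas v -> smeas (fun t => g (u t) (v t)).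
Proof.
move=> cg [c [k [mk ck]]] [c' [k' [mk' ck']]].
(* Pairs of values are again enumerated by one index, through the coding of pairs of naturals. *)
exists (fun m => let p := odflt (0, 0)%N (unpickle m) in g (c p.1) (c' p.2)).
exists (fun n t => pickle (k n t, k' n t)); split.
  by move=> n; exact: (@measurable_fun_nat2 _ _ _ _ D _ _ (fun i j => pickle (i, j))).
move=> t Dt; rewrite /=; under eq_fun do rewrite pickleK /=.
by apply: cg; [exact: ck|exact: ck'].
Qed.

Lemma smeas2_measurable (X Y : semiHilbert R) (g : X -> Y -> real_sh R) u v :
  scontinuous2 g -> smeas u -> smeas v -> measurable_fun D (fun t => g (u t) (v t) : R).
Proof.
move=> cg [c [k [mk ck]]] [c' [k' [mk' ck']]].
apply: (@measurable_fun_cvg _ _ _ _ (fun n t => g (c (k n t)) (c' (k' n t)) : R)).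
  by move=> n; exact: (@measurable_fun_nat2 _ _ _ _ D _ _ (fun i j => g (c i) (c' j) : R)).
by move=> t Dt; apply/ncvg_real; apply: cg; [exact: ck|exact: ck'].
Qed.

Section Vector.
Variable X : semiHilbert R.
Implicit Types u v : T0 -> X.

Lemma smeas_cst (x : X) : smeas (fun=> x).
Proof. by exists (fun=> x), (fun=> fun=> 0%N); split=> // t Dt; exact: ncvg_cst. Qed.

Lemma smeas_lin (k : R) u v : smeas u -> smeas v -> smeas (fun t => k *: u t + v t).
Proof. by apply: (smeas2 (g := fun x y : X => k *: x + y)) => a b x y; exact: ncvg_lin. Qed.

Lemma smeasD u v : smeas u -> smeas v -> smeas (fun t => u t + v t).
Proof.
move=> hu hv; have := smeas_lin 1 hu hv.
by under eq_fun do rewrite scale1r.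
Qed.

Lemma smeasZ (k : R) u : smeas u -> smeas (fun t => k *: u t).
Proof.
move=> hu; have := smeas_lin k hu (smeas_cst 0).
by under eq_fun do rewrite addr0.
Qed.

Lemma smeasB u v : smeas u -> smeas v -> smeas (fun t => u t - v t).
Proof.
move=> hu hv; apply: smeasD => //; have := smeasZ (-1) hv.
by under eq_fun do rewrite scaleN1r.
Qed.

Lemma ncvg_dot2 (a b : nat -> X) (x y : X) : ncvg a x -> ncvg b y ->
  dot (a n) (b n) @[n --> \oo] --> dot x y.
Proof.
move=> ha hb; rewrite -[X in _ --> X](addr0 (dot x y)).
have -> : (fun n => dot (a n) (b n)) = (fun n => dot (a n) y + dot (a n) (b n - y)).
  by apply/funext => n; rewrite -dotDr [y + _]addrC subrK.
apply: cvgD; first exact: ncvg_dot.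
apply/norm_cvg0P; apply: (@squeeze_cvgr _ _ _ _ (fun=> 0) (fun n => nrm (a n) * nrm (b n - y))).
- by apply: nearW => n; rewrite normr_ge0 dot_le.
- exact: cvg_cst.
- by rewrite -[X in _ --> X](mulr0 (nrm x)); apply: cvgM => //; exact: ncvg_nrm.
Qed.

Lemma measurable_dot u v : smeas u -> smeas v -> measurable_fun D (fun t => dot (u t) (v t)).
Proof.
apply: (smeas2_measurable (g := fun x y : X => dot x y : real_sh R)) => a b x y ha hb.
by apply/ncvg_real; exact: ncvg_dot2.
Qed.

Lemma measurable_nrm u : smeas u -> measurable_fun D (fun t => nrm (u t)).
Proof.
move=> hu; apply: (smeas2_measurable (g := fun x y : X => nrm x : real_sh R) _ hu hu).
by move=> a b x y ha hb; apply/ncvg_real; exact: ncvg_nrm.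
Qed.

Hypothesis mD : measurable D.

(* [k n t] is the index of a point of [c 0, ..., c n] closest to [u t]. *)
Lemma pettis (u : T0 -> X) (c : nat -> X) :
  (forall x, measurable_fun D (fun t => nrm (u t - x))) ->
  (forall t, D t -> forall e : R, 0 < e -> exists j, nrm (u t - c j) < e) ->
  exists k : nat -> T0 -> nat,
    [/\ forall n, measurable_fun D (k n), forall n t, (k n t <= n)%N,
        forall t, D t -> ncvg (fun n => c (k n t)) (u t) &
        forall n t, nrm (u t - c (k n t)) <= nrm (u t - c 0%N)].
Proof.
move=> mu cu.
pose fix k (n : nat) (t : T0) {struct n} : nat := if n is m.+1 then
  if nrm (u t - c m.+1) < nrm (u t - c (k m t)) then m.+1 else k m t else 0%N.
have kn n t : (k n t <= n)%N.
  by elim: n => //= n ih; case: ifP => // _; exact: leq_trans ih _.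
have mdk n : measurable_fun D (k n) -> measurable_fun D (fun t => nrm (u t - c (k n t))).
  move=> mk _ B mB.
  have -> : D `&` (fun t => nrm (u t - c (k n t))) @^-1` B =
    \bigcup_i ((D `&` k n @^-1` [set i]) `&` (D `&` (fun t => nrm (u t - c i)) @^-1` B)).
    apply/seteqP; split=> [t [Dt Bt]|t [i _ [[Dt /= ki] [_ /= Bt]]]].
      by exists (k n t).
    by split=> //=; rewrite ki.
  by apply: bigcupT_measurable => i; apply: measurableI; [exact: mk|exact: mu].
have mk n : measurable_fun D (k n).
  elim: n => [|n ih] /=; first exact: measurable_cst.
  apply: measurable_fun_if => //.
  - by apply: measurable_fun_ltr => //; exact: mdk.
  - exact: measurable_funS ih.
have kmin n t j : (j <= n)%N -> nrm (u t - c (k n t)) <= nrm (u t - c j).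
  elim: n => [|n ih] /=; first by rewrite leqn0 => /eqP ->.
  rewrite leq_eqVlt ltnS => /orP[/eqP ->|jn]; case: ltP => // hlt.
    exact: le_trans (ltW hlt) (ih jn).
  exact: ih.
exists k; split=> //; last by move=> n t; exact: kmin.
move=> t Dt; apply/ncvgP => e /(cu t Dt)[j hj].
by exists j => n jn; rewrite nrm_sym; apply: le_lt_trans hj; exact: kmin.
Qed.

(** The value 0 is put first in the sequence. The nearest-point approximation then never errs by
    more than the norm of u, which is the domination used in [smeas_approx] and [sL2_approx]. *)
Lemma smeas_dense u : smeas u -> exists c : nat -> X, c 0%N = 0 /\
  forall t, D t -> forall e : R, 0 < e -> exists j, nrm (u t - c j) < e.
Proof.
move=> [c [k [mk ck]]]; exists (fun n => if n is m.+1 then c m else 0); split=> //.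
move=> t Dt e e0; have [N hN] := (ncvgP _ _).1 (ck t Dt) e e0.
by exists (k N t).+1; rewrite nrm_sym; exact: hN.
Qed.

Lemma smeas_approx u : smeas u -> exists (c : nat -> X) (k : nat -> T0 -> nat),
    [/\ forall n, measurable_fun D (k n), forall n t, (k n t <= n)%N,
        forall t, D t -> ncvg (fun n => c (k n t)) (u t) &
        forall n t, nrm (u t - c (k n t)) <= nrm (u t)].
Proof.
move=> su; have [c [c0 cu]] := smeas_dense su.
have [|k [mk kn kc k0]] := pettis _ cu.
  by move=> x; apply: measurable_nrm; apply: smeasB => //; exact: smeas_cst.
by exists c, k; split=> // n t; have := k0 n t; rewrite c0 subr0.
Qed.

(** The union of the countable sets attached to the [v n] is dense in the range of u, and the
    distances of u to fixed points are limits of measurable functions, so [pettis] applies. *)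
Lemma smeas_lim (v : nat -> T0 -> X) u : (forall n, smeas (v n)) ->
  (forall t, D t -> ncvg (v^~ t) (u t)) -> smeas u.
Proof.
move=> sv vu.
have /choice[c hc] n := smeas_dense (sv n).
pose c' m := let p := odflt (0, 0)%N (unpickle m) in c p.1 p.2.
have [x|t Dt e e0|k [mk _ kc _]] := @pettis u c'; last by exists c', k.
- apply: (@measurable_fun_cvg _ _ _ _ (fun n t => nrm (v n t - x))).
    by move=> n; apply: measurable_nrm; apply: smeasB => //; exact: smeas_cst.
  move=> t Dt; apply: ncvg_nrm.
  have := ncvg_lin 1 (vu t Dt) (ncvg_cst (- x)); rewrite scale1r.
  by under eq_fun do rewrite scale1r.
- have [|N hN] := (ncvgP _ _).1 (vu t Dt) (e / 2); first lra.
  have [|j hj] := (hc N).2 t Dt (e / 2); first lra.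
  exists (pickle (N, j)); rewrite /c' pickleK /=.
  apply: le_lt_trans (nrm_dist _ (v N t) _) _.
  by have := hN N (leqnn N); rewrite nrm_sym; lra.
Qed.

Lemma smeas_eq u v : (forall t, D t -> nrm (u t - v t) = 0) -> smeas u -> smeas v.
Proof.
move=> uv su; apply: (smeas_lim (v := fun=> u)) => // t Dt.
by rewrite /ncvg uv//; exact: cvg_cst.
Qed.

End Vector.

Lemma measurable_smeas (f : T0 -> R) : measurable D -> measurable_fun D f -> smeas (f : T0 -> real_sh R).
Proof.
move=> mD mf.
have [x|t Dt e e0|k [mk _ kc _]] := @pettis (real_sh R) mD (f : T0 -> real_sh R)
  (fun n => ratr (odflt 0 (unpickle n)) : R);
  last by exists (fun n => ratr (odflt 0 (unpickle n)) : real_sh R), k.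
- under eq_fun do rewrite nrm_real.
  by apply: measurableT_comp => //; apply: measurable_funB => //; exact: measurable_cst.
- have [|q] := @rat_in_itvoo R (f t - e) (f t + e); first lra.
  rewrite in_itv/= => /andP[q1 q2]; exists (pickle q); rewrite pickleK nrm_real /=.
  by rewrite ltr_norml; apply/andP; split; lra.
Qed.

Lemma smeas_measurable (f : T0 -> R) : smeas (f : T0 -> real_sh R) -> measurable_fun D f.
Proof.
move=> sf; apply: (smeas2_measurable (g := fun x y : real_sh R => x) _ sf sf).
by [].
Qed.

Lemma smeas_scale (X : semiHilbert R) (f : T0 -> R) (u : T0 -> X) : measurable D ->
  measurable_fun D f -> smeas u -> smeas (fun t => f t *: u t).
Proof.
move=> mD mf; apply: (smeas2 (g := fun (x : real_sh R) (y : X) => (x : R) *: y)) => [a b x y|].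
  move=> /ncvg_real ha hb; apply: (@squeeze_cvgr _ _ _ _ (fun=> 0)
     (fun n => `|a n : R| * nrm (b n - y) + `|(a n : R) - x| * nrm y)).
  - apply: nearW => n; rewrite nrm_ge0 /=.
    have -> : (a n : R) *: b n - (x : R) *: y = (a n : R) *: (b n - y) + ((a n : R) - x) *: y.
      by rewrite scalerBr scalerBl addrA subrK.
    by apply: le_trans (nrmD _ _) _; rewrite !nrmZ.
  - exact: cvg_cst.
  - rewrite -[X in _ --> X](addr0 0) -[X in _ --> X + _](mulr0 `|x : R|) -[X in _ --> _ + X](mul0r (nrm y)).
    apply: cvgD; first by apply: cvgM hb; exact: cvg_norm.
    have hx : `|(a n : R) - (x : R)| @[n --> \oo] --> (0 : R).
      by rewrite -[X in _ --> X](@normr0 _ R) -(subrr (x : R)); apply: cvg_norm; apply: cvgB ha _; exact: cvg_cst.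
    by apply: cvgM hx _; exact: cvg_cst.
exact: measurable_smeas.
Qed.

Lemma smeas_comp (X Y : semiHilbert R) (g : X -> Y) (M : R) u :
  (forall x y, nrm (g x - g y) <= M * nrm (x - y)) -> smeas u -> smeas (fun t => g (u t)).
Proof.
move=> gM su; apply: (smeas2 (g := fun (x y : X) => g x) _ su su) => a b x y ha _.
apply: (@squeeze_cvgr _ _ _ _ (fun=> 0) (fun n => M * nrm (a n - x))).
- by apply: nearW => n; rewrite nrm_ge0 gM.
- exact: cvg_cst.
- by rewrite -[X in _ --> X](mulr0 M); apply: cvgM => //; exact: cvg_cst.
Qed.

End StronglyMeasurable.

(** * Square integrable functions *)

Section RealIntegral.
Context {R : realType} d (T0 : measurableType d) (mu : {measure set T0 -> \bar R}).
Variables (D : set T0) (mD : measurable D).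
Implicit Types f g : T0 -> R.

Definition intg f := mu.-integrable D (EFin \o f).

Lemma intg_measurable f : intg f -> measurable_fun D f.
Proof. by move=> /measurable_int/measurable_EFinP. Qed.

Lemma intg_le f g : measurable_fun D f -> intg g ->
  (forall t, D t -> `|f t| <= g t) -> intg f.
Proof.
move=> mf ig fg; apply: (le_integrable mD _ _ ig); first exact/measurable_EFinP.
by move=> t Dt /=; rewrite lee_fin; apply: le_trans (fg t Dt) (ler_norm _).
Qed.

Lemma intgD f g : intg f -> intg g -> intg (fun t => f t + g t).
Proof. by move=> hf hg; exact: (integrableD mD hf hg). Qed.

Lemma intgZ k f : intg f -> intg (fun t => k * f t).
Proof. by move=> hf; exact: (integrableZl mD k hf). Qed.

Lemma intgB f g : intg f -> intg g -> intg (fun t => f t - g t).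
Proof. by move=> hf hg; exact: (integrableB mD hf hg). Qed.

Lemma intg_norm f : intg f -> intg (fun t => `|f t|).
Proof. by move=> hf; exact: (integrable_norm hf). Qed.

Lemma intg_ge0P f : measurable_fun D f -> (forall t, D t -> 0 <= f t) ->
  (\int[mu]_(t in D) (f t)%:E < +oo)%E -> intg f.
Proof.
move=> mf f0 fi; apply/integrableP; split; first exact/measurable_EFinP.
rewrite (eq_integral (fun t => (f t)%:E))// => t /set_mem Dt /=.
by rewrite ger0_norm ?f0.
Qed.

Lemma intg_cst k : (mu D < +oo)%E -> intg (fun=> k).
Proof.
move=> mufin; apply/integrableP; split; first exact/measurable_EFinP/measurable_cst.
by rewrite /= integral_cst// lte_mul_pinfty.
Qed.

Lemma EFin_Rintegral f : intg f -> (\int[mu]_(t in D) (f t)%:E = (\int[mu]_(t in D) f t)%:E)%E.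
Proof. by move=> hf; rewrite /Rintegral fineK//; exact: (integrable_fin_num mD hf). Qed.

Lemma Rintegral_ae f g : measurable_fun D f -> measurable_fun D g ->
  {ae mu, forall t, D t -> f t = g t} -> \int[mu]_(t in D) f t = \int[mu]_(t in D) g t.
Proof.
move=> mf mg fg; congr fine; apply: ae_eq_integral => //; try exact/measurable_EFinP.
by apply: filterS fg => t fg Dt; rewrite fg.
Qed.

Lemma ge0_Rintegral_eq0 f : intg f -> (forall t, D t -> 0 <= f t) ->
  \int[mu]_(t in D) f t <= 0 -> {ae mu, forall t, D t -> f t = 0}.
Proof.
move=> fi f0 If.
have I0 : \int[mu]_(t in D) f t = 0 by apply/eqP; rewrite eq_le If Rintegral_ge0.
have mf : measurable_fun D (EFin \o f) by exact: measurable_int fi.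
have [/(_ _)] := ae_eq_integral_abs mu mD mf.
rewrite (eq_integral (fun t => (f t)%:E)); last first.
  by move=> t /set_mem Dt /=; rewrite ger0_norm ?f0.
rewrite EFin_Rintegral// I0 => /(_ erefl) h _.
by apply: filterS h => t h Dt; have [] := h Dt.
Qed.

Lemma dominated_Rintegral (f_ : nat -> T0 -> R) f g :
  (forall n, measurable_fun D (f_ n)) -> intg g ->
  (forall n t, D t -> `|f_ n t| <= g t) ->
  (forall t, D t -> f_ n t @[n --> \oo] --> f t) ->
  intg f /\ \int[mu]_(t in D) f_ n t @[n --> \oo] --> \int[mu]_(t in D) f t.
Proof.
move=> mf_ ig fg cf.
have mf : measurable_fun D f by exact: measurable_fun_cvg mf_ cf.
have [||||h1 _ h3] := @dominated_convergence _ _ _ mu D mD (fun n t => (f_ n t)%:E)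
    (EFin \o f) (EFin \o g) _ _ _ ig _.
- by move=> n; exact/measurable_EFinP.
- exact/measurable_EFinP.
- by apply: aeW => t Dt; apply: cvg_EFin; [exact: nearW|exact: cf].
- by apply: aeW => t n Dt /=; rewrite lee_fin fg.
split=> //; apply: fine_cvg; rewrite -EFin_Rintegral//.
Qed.

Lemma fatou_Rintegral (f_ : nat -> T0 -> R) f (e : R) :
  (forall n, intg (f_ n)) -> (forall n t, D t -> 0 <= f_ n t) ->
  (forall t, D t -> f_ n t @[n --> \oo] --> f t) ->
  (\forall n \near \oo, \int[mu]_(t in D) f_ n t <= e) ->
  intg f /\ \int[mu]_(t in D) f t <= e.
Proof.
move=> if_ f0 cf Ie.
have mf : measurable_fun D f.
  by apply: measurable_fun_cvg cf => n; exact: intg_measurable.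
have ge0f t : D t -> 0 <= f t.
  move=> Dt; apply: (@le_cvg_seq R (fun=> 0) (fun n => f_ n t)) => [||n].
  - exact: cvg_cst.
  - exact: cf.
  - exact: f0.
have le : (\int[mu]_(t in D) (f t)%:E <= e%:E)%E.
  have := @fatou _ _ _ mu D mD (fun n t => (f_ n t)%:E)
    (fun n => measurable_int mu (if_ n)) (fun n t Dt => f0 n t Dt).
  rewrite (eq_integral (fun t => (f t)%:E)); last first.
    move=> t /set_mem Dt; apply: (cvg_limn_einf_sup _).1.
    by apply: cvg_EFin; [exact: nearW|exact: cf].
  move=> /le_trans; apply.
  apply: le_trans (limn_einf_sup _) _.
  rewrite limn_esup_lim; apply: lime_le; first exact: is_cvg_esups.
  case: Ie => N _ hN; exists N => // n /= Nn.
  apply: ge_ereal_sup => _ [m /= nm <-].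
  by rewrite EFin_Rintegral// lee_fin hN//= (leq_trans Nn).
have fi : intg f by apply: intg_ge0P => //; exact: le_lt_trans le (ltry _).
by split=> //; rewrite -lee_fin -EFin_Rintegral.
Qed.

End RealIntegral.
Arguments intg {R d T0} mu D f.

(** * Completeness of the space of square integrable vector functions *)

Section GeometricSequences.
Context {R : realType}.

Lemma geometric_ncauchy (X : semiHilbert R) (u : nat -> X) (C : R) :
  (forall n, nrm (u n.+1 - u n) <= C * 2^-1 ^+ n) -> ncauchy u.
Proof.
move=> h.
have C0 : 0 <= C by have := h 0%N; rewrite expr0 mulr1; apply: le_trans; exact: nrm_ge0.
(* The factor 1 - 2^-m is the exact partial geometric sum; with the limit 1 in its place the
   induction on m would not close. *)
have tele n m : nrm (u (n + m)%N - u n) <= 2 * C * 2^-1 ^+ n * (1 - 2^-1 ^+ m).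
  elim: m => [|m ih]; first by rewrite addn0 expr0 !subrr nrm0 mulr0.
  rewrite addnS; apply: le_trans (nrm_dist _ (u (n + m)%N) _) _.
  have := h (n + m)%N; rewrite exprD exprS; move: ih.
  move: (2^-1 ^+ n) (2^-1 ^+ m) => a b; nra.
have tail n m : (n <= m)%N -> nrm (u m - u n) <= 2 * C * 2^-1 ^+ n.
  move=> nm; rewrite -(subnKC nm); apply: le_trans (tele _ _) _.
  have p : 0 <= 2^-1 ^+ (m - n) :> R by rewrite exprn_ge0// invr_ge0.
  have q : 0 <= 2 * C * 2^-1 ^+ n by rewrite !mulr_ge0 ?exprn_ge0 ?invr_ge0.
  by rewrite ler_piMr//; lra.
move=> e e0.
have g0 : 2 * C * 2^-1 ^+ n @[n --> \oo] --> 2 * C * 0.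
  by apply: cvg_scale; apply: cvg_expr; rewrite ger0_norm ?invr_ge0// invf_lt1// ltr1n.
rewrite mulr0 in g0; move/cvgrPdist_lt : g0 => /(_ (e / 2)) [|N _ hN]; first lra.
exists N => m n Nm Nn; apply: le_lt_trans (nrm_dist _ (u N) _) _.
rewrite (nrm_sym (u N)).
have := tail _ _ Nm; have := tail _ _ Nn; have := hN N (leqnn N).
rewrite /= sub0r normrN ger0_norm; last first.
  by rewrite mulr_ge0 ?mulr_ge0 ?exprn_ge0 ?invr_ge0.
lra.
Qed.

End GeometricSequences.

Section SquareIntegrable.
Context {R : realType} d (T0 : measurableType d) (mu : {measure set T0 -> \bar R}).
Variables (D : set T0) (mD : measurable D) (X : semiHilbert R).
Implicit Types u v w : T0 -> X.

Definition sL2 u := smeas D u /\ intg mu D (fun t => dot (u t) (u t)).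

Definition L2dot u v : R := \int[mu]_(t in D) dot (u t) (v t).

Lemma sL2_0 : sL2 0.
Proof.
split; first exact: (smeas_cst D (0 : X)).
apply: (@eq_integrable _ _ _ _ _ mD (cst 0%E)); last exact: integrable0.
by move=> t _ /=; rewrite dot0l.
Qed.

Lemma sL2_lin k u v : sL2 u -> sL2 v -> sL2 (k *: u + v).
Proof.
move=> [mu' iu] [mv iv]; have muv : smeas D (k *: u + v) by exact: smeas_lin.
split=> //; apply: (@intg_le _ _ _ mu D mD _ (fun t => (2 * k ^+ 2) * dot (u t) (u t) + 2 * dot (v t) (v t))).
- exact: measurable_dot.
- by apply: intgD => //; apply: intgZ.
- move=> t Dt; rewrite ger0_norm ?dot_ge0//.
  have := sqr_nrmD (k *: u t) (v t); rewrite !dotZl !dotZr /=.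
  by rewrite -/((k *: u + v) t) ; move=> /le_trans; apply; rewrite lerD2r; lra.
Qed.

Definition L2_subspace : subspace (T0 -> X) := Subspace sL2_0 sL2_lin.

Lemma sL2_dot u v : sL2 u -> sL2 v -> intg mu D (fun t => dot (u t) (v t)).
Proof.
move=> [mu' iu] [mv iv].
apply: (@intg_le _ _ _ mu D mD _ (fun t => dot (u t) (u t) + dot (v t) (v t))).
- exact: measurable_dot.
- exact: intgD.
- move=> t Dt; have := dot_ge0 (u t - v t); have := dot_ge0 (u t + v t).
  by rewrite !dotE (dotC (v t)) ler_norml => *; apply/andP; split; lra.
Qed.

Lemma sL2_eq u v : (forall t, D t -> nrm (u t - v t) = 0) -> sL2 u -> sL2 v.
Proof.
move=> uv [su iu]; split; first exact: smeas_eq uv su.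
apply: eq_integrable iu => // t /set_mem Dt /=.
by rewrite -!nrm_sqr (eq_nrm (uv t Dt)).
Qed.

Lemma L2dotC u v : L2dot u v = L2dot v u.
Proof. by apply: eq_Rintegral => t _; rewrite dotC. Qed.

Lemma L2dot_lin k u v w : sL2 u -> sL2 v -> sL2 w ->
  L2dot (k *: u + v) w = k * L2dot u w + L2dot v w.
Proof.
move=> hu hv hw; rewrite /L2dot -RintegralZl//; last exact: sL2_dot.
rewrite -RintegralD//; [|apply: intgZ => //; exact: sL2_dot|exact: sL2_dot].
by apply: eq_Rintegral => t _; rewrite dot_linl.
Qed.

Lemma L2dot_ge0 u : 0 <= L2dot u u.
Proof. by apply: Rintegral_ge0 => t _; exact: dot_ge0. Qed.

Lemma smeas_restrict A u : measurable A -> smeas D u -> smeas D (fun t => \1_A t *: u t).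
Proof.
by move=> mA su; apply: smeas_scale => //; exact: measurable_indic.
Qed.

Lemma sL2_restrict A u : measurable A -> sL2 u -> sL2 (fun t => \1_A t *: u t).
Proof.
move=> mA [su iu]; have sAu := smeas_restrict mA su; split=> //.
apply: (intg_le mD _ iu); first exact: measurable_dot.
move=> t Dt; rewrite ger0_norm ?dot_ge0// !dotE.
by rewrite indicE; case: (_ \in _); rewrite ?mul1r ?mul0r ?dot_ge0.
Qed.

(** The sum of the [g n] has integral at most 2, so it is finite off a null set, and where it is
    finite it bounds every term. *)
Lemma intg_fast_sum (g : nat -> T0 -> R) :
  (forall n, intg mu D (g n)) -> (forall n t, D t -> 0 <= g n t) ->
  (forall n, \int[mu]_(t in D) g n t <= 2^-1 ^+ n) ->
  exists N : set T0, [/\ measurable N, mu N = 0%E &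
    forall t, D t -> ~ N t -> exists M : R, forall n, g n t <= M].
Proof.
move=> ig g0 Ig.
pose G t := (\sum_(0 <= n <oo) (g n t)%:E)%E.
have mG : measurable_fun D G.
  apply: ge0_emeasurable_sum => [n t Dt _|n _]; first by rewrite lee_fin g0.
  exact: measurable_int (ig n).
have IG : (\int[mu]_(t in D) G t < +oo)%E.
  rewrite integral_nneseries//; last by move=> n; exact: measurable_int (ig n).
  apply: (@le_lt_trans _ _ (\sum_(0 <= n <oo) (2^-1 ^+ n : R)%:E)%E).
    apply: lee_nneseries => n _; first by move=> _; apply: integral_ge0 => t Dt; rewrite lee_fin g0.
    by rewrite EFin_Rintegral// lee_fin.
  rewrite (eq_eseriesr (g := fun k => (2 / (2 ^ (k + 1))%:R : R)%:E)) => [|k _].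
    by rewrite (cvg_lim _ (@cvg_geometric_eseries_half R 2 0))// ltry.
  congr EFin; rewrite natrX addn1 exprS exprVn; field.
  by rewrite expf_neq0.
have iG : mu.-integrable D G.
  apply/integrableP; split=> //; rewrite (eq_integral G)// => t /set_mem Dt.
  by rewrite gee0_abs//; apply: nneseries_ge0 => n _ _; rewrite lee_fin g0.
exists (D `&` G @^-1` [set +oo%E]); split.
- exact: mG.
- apply: measure_negligible; first exact: mG.
  apply: negligibleS (integrable_ae mD iG) => t [Dt /= Gt] /(_ Dt).
  by rewrite Gt.
move=> t Dt nN; exists (fine (G t)) => n.
have Gfin : G t \is a fin_num.
  rewrite ge0_fin_numE ?ltey; last by apply: nneseries_ge0 => i _ _; rewrite lee_fin g0.
  by apply/eqP => Gt; apply: nN.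
rewrite -lee_fin fineK//.
apply: le_trans (@nneseries_lim_ge _ (fun n => (g n t)%:E) xpredT 0 n.+1 _); last first.
  by move=> i _ _; rewrite lee_fin g0.
by rewrite big_nat_recr//= leeDr//; apply: sume_ge0 => i _; rewrite lee_fin g0.
Qed.

(* Along a fast subsequence the increments are square summable with the weights
   [4 ^ n], so that the subsequence converges almost everywhere. *)
Theorem sL2_complete (u : nat -> T0 -> X) : (forall n, sL2 (u n)) ->
  (forall e : R, 0 < e -> exists N, forall m n, (N <= m)%N -> (N <= n)%N ->
     L2dot (u m - u n) (u m - u n) < e) ->
  exists2 v, sL2 v & L2dot (u n - v) (u n - v) @[n --> \oo] --> (0 : R).
Proof.
move=> su cu.
have sB m n : sL2 (u m - u n).
  by have := sL2_lin (-1) (su n) (su m); rewrite scaleN1r addrC.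
(* With the weights 4^n the increments then have integrals at most 4^-n, which is below the 2^-n
   required by [intg_fast_sum]. *)
have /choice[N hN] (n : nat) := cu (16^-1 ^+ n) ltac:(by rewrite exprn_gt0// invr_gt0).
pose p := fix p n := if n is m.+1 then maxn (p m).+1 (N m.+1) else N 0%N.
have pN n : (N n <= p n)%N by case: n => //= n; exact: leq_maxr.
have pS n : (p n < p n.+1)%N by exact: leq_maxl.
have np k : (k <= p k)%N by elim: k => // k ih; exact: leq_ltn_trans ih (pS k).
pose g n t : R := 4 ^+ n * dot ((u (p n.+1) - u (p n)) t) ((u (p n.+1) - u (p n)) t).
have [n|n t Dt|n|Z [mZ Z0 hZ]] := @intg_fast_sum g.
- by apply: intgZ => //; case: (sB (p n.+1) (p n)).
- by rewrite mulr_ge0 ?exprn_ge0 ?dot_ge0.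
- rewrite RintegralZl//; last by case: (sB (p n.+1) (p n)).
  have := hN n (p n.+1) (p n) (leq_trans (pN n) (ltnW (pS n))) (pN n).
  have e4 : 0 <= 4 ^+ n :> R by rewrite exprn_ge0.
  move=> /ltW/(ler_wpM2l e4)/le_trans; apply.
  rewrite -exprMn_comm; last exact: mulrC.
  rewrite (_ : 4 * 16^-1 = 2^-1 * 2^-1 :> R); last by field.
  by rewrite exprMn ler_piMr ?exprn_ge0 ?exprn_ile1 ?invr_ge0// invf_le1// ler1n.
have cvgu t : D t -> ~ Z t -> exists x, ncvg (fun n => u (p n) t) x.
  move=> Dt Zt; have [M hM] := hZ t Dt Zt; apply: ncauchy_cvg.
  have M0 : 0 <= M by apply: le_trans (hM 0%N); rewrite mulr_ge0 ?exprn_ge0 ?dot_ge0.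
  apply: (@geometric_ncauchy _ _ _ (Num.sqrt M)) => n.
  rewrite -(@ler_pXn2r _ 2) ?nnegrE ?mulr_ge0 ?sqrtr_ge0 ?exprn_ge0 ?invr_ge0 ?nrm_ge0//.
  rewrite nrm_sqr exprMn sqr_sqrtr// -exprM mulnC exprM.
  rewrite (_ : 2^-1 ^+ 2 = 4^-1 :> R); last by rewrite expr2; field.
  by rewrite exprVn ler_pdivlMr ?exprn_gt0// mulrC; exact: hM.
(* Setting the functions to 0 on the exceptional null set makes them converge at every point of D,
   as [smeas_lim] requires. *)
pose A := ~` Z; have mA : measurable A by exact: measurableC.
have /choice[v hv] t : exists x, D t -> ncvg (fun n => \1_A t *: u (p n) t) x.
  have [Dt|] := pselect (D t); last by exists 0.
  have [Zt|nZt] := pselect (Z t).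
    exists 0 => _; rewrite indicE memNset; last by move/(_ Zt).
    by under eq_fun do rewrite scale0r; exact: ncvg_cst.
  have [x hx] := cvgu t Dt nZt; exists x => _.
  by rewrite indicE mem_set//; under eq_fun do rewrite scale1r.
have sv : smeas D v.
  by apply: (smeas_lim mD (v := fun n t => \1_A t *: u (p n) t)) => // n; apply: smeas_restrict => //; case: (su (p n)).
(* Fatou's lemma along the subsequence turns a Cauchy bound into a bound for the distance to the
   limit; it also shows that the limit is square integrable. *)
have key (e : R) (n : nat) : (forall m, (n <= m)%N -> L2dot (u m - u n) (u m - u n) <= e) ->
   intg mu D (fun t => dot ((v - u n) t) ((v - u n) t)) /\ L2dot (v - u n) (v - u n) <= e.
  move=> hn.
  have sw m : sL2 ((fun t => \1_A t *: u (p m) t) - u n).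
    have := sL2_lin (-1) (su n) (sL2_restrict mA (su (p m))).
    by rewrite scaleN1r addrC.
  apply: (fatou_Rintegral mD (f_ := fun m t => dot (((fun t => \1_A t *: u (p m) t) - u n) t) (((fun t => \1_A t *: u (p m) t) - u n) t))).
  - by move=> m; case: (sw m).
  - by move=> *; exact: dot_ge0.
  - move=> t Dt; have h := ncvg_lin (-1) (ncvg_cst (u n t)) (hv t Dt).
    have e1 w : (w - u n) t = -1 *: u n t + w t by rewrite scaleN1r addrC.
    by rewrite e1; under eq_fun do rewrite e1; exact: ncvg_dot2.
  - exists (n : nat) => // m /= nm.
    have := hn (p m) (leq_trans nm (np m)).
    congr (_ <= _); apply: Rintegral_ae => //.
    + by case: (sB (p m) n) => s _; exact: measurable_dot.
    + by case: (sw m) => s _; exact: measurable_dot.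
    exists Z; split=> // t /= h; apply: contrapT => nZ; apply: h => _.
    by rewrite /= !fctE indicE mem_set// scale1r.
have sLv : sL2 v.
  have [|N0 hN0] := cu 1; first by [].
  have [|i1 _] := key 1 N0 _; first by move=> m Nm; exact: ltW (hN0 _ _ Nm (leqnn _)).
  have s1 : sL2 (v - u N0).
    by split=> //; apply: smeasB => //; case: (su N0).
  by have := sL2_lin 1 s1 (su N0); rewrite scale1r subrK.
exists v => //; apply/cvgrPdist_lt => e e0.
have [|M hM] := cu (e / 2); first lra.
exists M => // n /= Mn; rewrite sub0r normrN ger0_norm ?L2dot_ge0//.
have [_] := key (e / 2) n (fun m nm => ltW (hM m n (leq_trans Mn nm) Mn)).
have -> : L2dot (v - u n) (v - u n) = L2dot (u n - v) (u n - v).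
  by apply: eq_Rintegral => t _; rewrite -!nrm_sqr nrm_sym.
lra.
Qed.

End SquareIntegrable.

Section L2Space.
Context {R : realType} d (T0 : measurableType d) (mu : {measure set T0 -> \bar R}).
Variables (D : set T0) (mD : measurable D) (X : semiHilbert R).

Definition L2_dot_sub (x y : sub_of (L2_subspace mu mD X)) : R :=
  L2dot mu D (sub_val x) (sub_val y).

Lemma sub_L2P (x : sub_of (L2_subspace mu mD X)) : sL2 mu D (sub_val x).
Proof. exact: sub_valP x. Qed.

Definition L2_sh : semiHilbert R.
Proof.
apply: (@SemiHilbert R (sub_of (L2_subspace mu mD X)) L2_dot_sub).
- by move=> x y; exact: L2dotC.
- by move=> k x y z; apply: L2dot_lin => //; exact: sub_L2P.
- by move=> x; exact: L2dot_ge0.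
- move=> u cu.
  have [v sv hv] := sL2_complete mD (fun n => sub_L2P (u n)) cu.
  by exists (sub_mk (P := L2_subspace mu mD X) sv).
Defined.

Definition L2_mk (u : T0 -> X) (su : sL2 mu D u) : L2_sh :=
  sub_mk (P := L2_subspace mu mD X) su.

Lemma L2dot_le (u v : T0 -> X) : sL2 mu D u -> sL2 mu D v ->
  `|L2dot mu D u v| <= Num.sqrt (L2dot mu D u u) * Num.sqrt (L2dot mu D v v).
Proof. by move=> su sv; exact: (dot_le (L2_mk su) (L2_mk sv)). Qed.

Lemma sL2B (u v : T0 -> X) : sL2 mu D u -> sL2 mu D v -> sL2 mu D (u - v).
Proof. by move=> su sv; have := sL2_lin mD (-1) sv su; rewrite scaleN1r addrC. Qed.

Lemma sL2D (u v : T0 -> X) : sL2 mu D u -> sL2 mu D v -> sL2 mu D (u + v).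
Proof. by move=> su sv; have := sL2_lin mD 1 su sv; rewrite scale1r. Qed.

Lemma sL2Z k (u : T0 -> X) : sL2 mu D u -> sL2 mu D (k *: u).
Proof. by move=> su; have := sL2_lin mD k su (sL2_0 mu mD X); rewrite addr0. Qed.

(** The errors are dominated by the norm of u, so dominated convergence applies. The bound
    [k n t <= n] leaves finitely many values, so the approximants can serve as simple functions for
    the Bochner integral. *)
Lemma sL2_approx (u : T0 -> X) : sL2 mu D u ->
  exists (c : nat -> X) (k : nat -> T0 -> nat),
    [/\ forall n, measurable_fun D (k n), forall n t, (k n t <= n)%N,
        forall t, D t -> ncvg (fun n => c (k n t)) (u t),
        forall n, sL2 mu D (c \o k n) &
        L2dot mu D (u - (c \o k n)) (u - (c \o k n)) @[n --> \oo] --> (0 : R)].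
Proof.
move=> su; have [c [k [mk kn ck nk]]] := smeas_approx mD su.1.
have sk n : smeas D (c \o k n).
  by exists c, (fun=> k n); split=> // t Dt; exact: ncvg_cst.
have bound n t : dot ((u - (c \o k n)) t) ((u - (c \o k n)) t) <= dot (u t) (u t).
  by rewrite -!nrm_sqr lerXn2r ?nnegrE ?nrm_ge0//; exact: nk.
have sB n : smeas D (u - (c \o k n)) by apply: smeasB => //; case: su.
have sL2k n : sL2 mu D (c \o k n).
  have h : sL2 mu D (u - (c \o k n)).
    split=> //; apply: (intg_le mD _ su.2); first exact: measurable_dot.
    by move=> t Dt; rewrite ger0_norm ?dot_ge0.
  by have := sL2B su h; rewrite opprB addrC subrK.
exists c, k; split=> //.
have := @dominated_Rintegral _ _ _ mu D mD (fun n t => dot ((u - (c \o k n)) t) ((u - (c \o k n)) t))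
   (cst 0) (fun t => dot (u t) (u t)) _ su.2 _ _.
case=> [n|n t Dt|t Dt|_].
- exact: measurable_dot.
- by rewrite ger0_norm ?dot_ge0.
- have h : ncvg (fun n => -1 *: c (k n t) + u t) (-1 *: u t + u t).
    by apply: ncvg_lin; [exact: ck|exact: ncvg_cst].
  rewrite [X in _ --> X](_ : cst 0 t = dot (-1 *: u t + u t) (-1 *: u t + u t)); last first.
    by rewrite scaleN1r addNr dot0l.
  rewrite (_ : (fun n => _) = (fun n => dot (-1 *: c (k n t) + u t) (-1 *: c (k n t) + u t))).
    exact: ncvg_dot2.
  by apply/funext => n; rewrite scaleN1r addrC.
by rewrite Rintegral_cst// mul0r.
Qed.

End L2Space.

(** * Integrals of vector functions, defined through scalar products *)

Section WeakIntegral.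
Context {R : realType} d (T0 : measurableType d) (mu : {measure set T0 -> \bar R}).
Variable X : semiHilbert R.
Implicit Types (A : set T0) (u : T0 -> X).

Definition wintegrable A u := smeas A u /\ intg mu A (fun t => nrm (u t)).

(* By Riesz' theorem, a vector integral is determined by its scalar products. *)
Definition wint A u : X :=
  xget 0 [set x | forall y, dot x y = \int[mu]_(t in A) dot (u t) y].

Lemma wintegrable_dot A u y : measurable A -> wintegrable A u ->
  intg mu A (fun t => dot (u t) y).
Proof.
move=> mA [su iu]; apply: (@intg_le _ _ _ mu A mA _ (fun t => nrm y * nrm (u t))).
- by apply: measurable_dot => //; exact: smeas_cst.
- exact: intgZ.
- by move=> t At; rewrite mulrC; exact: dot_le.
Qed.

Lemma wintE A u : measurable A -> wintegrable A u ->
  forall y, dot (wint A u) y = \int[mu]_(t in A) dot (u t) y.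
Proof.
move=> mA hu.
have [z hz] : exists z : X, forall y, dot z y = \int[mu]_(t in A) dot (u t) y.
  apply: (@riesz R X _ (\int[mu]_(t in A) nrm (u t))).
  - move=> k x y; rewrite -RintegralZl//; last exact: wintegrable_dot.
    rewrite -RintegralD//; [|by apply: intgZ => //; exact: wintegrable_dot|exact: wintegrable_dot].
    by apply: eq_Rintegral => t _; rewrite !dotE.
  - move=> x; apply: le_trans (le_normr_Rintegral mA (wintegrable_dot x mA hu)) _.
    rewrite -RintegralZr//; last by case: hu.
    apply: le_Rintegral => //.
    + by apply: intg_norm => //; exact: wintegrable_dot.
    + by under eq_fun do rewrite mulrC; apply: intgZ => //; case: hu.
    + by move=> t At; exact: dot_le.
exact: (@xgetPex _ 0 [set x | forall y, dot x y = \int[mu]_(t in A) dot (u t) y] (ex_intro _ z hz)).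
Qed.

(** By Riesz, l is the scalar product with a fixed vector, and with those the integral commutes by
    definition. *)
Lemma wint_functional A u (l : X -> R) (M : R) : measurable A -> wintegrable A u ->
  (forall k x y, l (k *: x + y) = k * l x + l y) -> (forall x, `|l x| <= M * nrm x) ->
  l (wint A u) = \int[mu]_(t in A) l (u t).
Proof.
move=> mA hu ll lM; have [z hz] := riesz ll lM.
by rewrite -hz dotC wintE//; apply: eq_Rintegral => t _; rewrite dotC hz.
Qed.

(** Integrating 2 <u, w> <= s |u|^2 + s^-1 |w|^2 over A, with w the integral itself, gives 2 |w|^2
    <= s I + s^-1 k |w|^2. Take s = k; for k = 0 let s tend to 0. *)
Lemma wint_sqr_le A u (k : R) : measurable A -> wintegrable A u ->
  intg mu A (fun t => dot (u t) (u t)) -> (mu A <= k%:E)%E ->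
  dot (wint A u) (wint A u) <= k * \int[mu]_(t in A) dot (u t) (u t).
Proof.
move=> mA hu iu muk.
set w := wint A u; set I := \int[mu]_(t in A) dot (u t) (u t).
have mufin : (mu A < +oo)%E by exact: le_lt_trans muk (ltry _).
have muf : mu A \is a fin_num by rewrite ge0_fin_numE.
have k0 : 0 <= k by rewrite -lee_fin (le_trans _ muk).
have I0 : 0 <= I by apply: Rintegral_ge0 => t _; exact: dot_ge0.
have fk : fine (mu A) <= k by rewrite -lee_fin fineK.
have f0 : 0 <= fine (mu A) by exact: fine_ge0.
have key (s : R) : 0 < s -> 2 * dot w w <= s * I + s^-1 * dot w w * k.
  move=> s0; apply: (@le_trans _ _ (s * I + s^-1 * dot w w * fine (mu A))); last first.
    by rewrite lerD2l ler_wpM2l// mulr_ge0 ?invr_ge0 ?dot_ge0// ltW.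
  have icst r : intg mu A (fun=> r) by exact: intg_cst.
  set q := s^-1 * dot w w.
  have -> : 2 * dot w w = \int[mu]_(t in A) (2 * dot (u t) w).
    by rewrite {1}/w wintE// RintegralZl//; exact: wintegrable_dot.
  have -> : s * I + q * fine (mu A) = \int[mu]_(t in A) (s * dot (u t) (u t) + q).
    rewrite RintegralD//; [|exact: intgZ|exact: icst].
    by rewrite RintegralZl// Rintegral_cst.
  apply: le_Rintegral => //.
  + by apply: intgZ => //; exact: wintegrable_dot.
  + by apply: intgD => //; exact: intgZ.
  move=> t At; have := dot_ge0 (s *: u t - w).
  rewrite !dotE (dotC w) => h; rewrite -(ler_pM2l s0) /q mulrDr !mulrA.
  rewrite divff ?gt_eqF// mul1r; lra.
have [ki|ki] := eqVneq k 0.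
  rewrite ki mul0r; have h s : 0 < s -> 2 * dot w w <= s * I.
    by move=> s0; have := key s s0; rewrite ki mulr0 addr0.
  suff h2 (e : R) : 0 < e -> dot w w <= 0 + e by apply/ler_addgt0Pr.
  move=> e0; have I1 : 0 < I + 1 by lra.
  have := h _ (divr_gt0 e0 I1); have : e / (I + 1) * I <= e.
    by rewrite mulrAC ler_pdivrMr//; nra.
  have := dot_ge0 w; lra.
have kp : 0 < k by rewrite lt_neqAle eq_sym ki.
by have := key k kp; rewrite mulrAC mulVf// mul1r; lra.
Qed.

Lemma nrm_wint_le A u : measurable A -> wintegrable A u ->
  nrm (wint A u) <= \int[mu]_(t in A) nrm (u t).
Proof.
move=> mA hu; set w := wint A u.
have I0 : 0 <= \int[mu]_(t in A) nrm (u t) by apply: Rintegral_ge0 => t _; exact: nrm_ge0.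
have [w0|w0] := eqVneq (nrm w) 0; first by rewrite w0.
have wp : 0 < nrm w by rewrite lt_neqAle eq_sym w0 nrm_ge0.
rewrite -(ler_pM2r wp) -expr2 nrm_sqr {1}/w wintE// -RintegralZr//; last by case: hu.
apply: le_Rintegral => //.
- exact: wintegrable_dot.
- by under eq_fun do rewrite mulrC; apply: intgZ => //; case: hu.
- by move=> t At; exact: dot_le_nrm.
Qed.

End WeakIntegral.
Arguments wint {R d T0} mu {X} A u.
Opaque wint.
Arguments wintegrable {R d T0} mu {X} A u.

(** * Primitives *)

Section HolderConstant.
Context {R : realType}.

(** Cut [0, t] into n + 1 equal parts: the increments of m add up, and the common factor sqrt(t / (n
    + 1)) tends to 0. This takes the place of differentiation almost everywhere in
    [product_rule]. *)
Lemma holder_constant (T C : R) (F m : R -> R) : 0 <= C ->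
  (forall s t, 0 <= s -> s <= t -> t <= T -> `|F t - F s| <= C * Num.sqrt (t - s) * (m t - m s)) ->
  forall t, 0 <= t <= T -> F t = F 0.
Proof.
move=> C0 h t /andP[t0 tT].
have bound (n : nat) : `|F t - F 0| <= C * Num.sqrt (t / n.+1%:R) * (m t - m 0).
  have n0 : 0 < n.+1%:R :> R by rewrite ltr0n.
  have step (i : nat) : (i <= n.+1)%N -> `|F (i%:R * (t / n.+1%:R)) - F 0| <= C * Num.sqrt (t / n.+1%:R) * (m (i%:R * (t / n.+1%:R)) - m 0).
    elim: i => [_|i ih iln]; first by rewrite mul0r !subrr normr0 mulr0.
    have tn0 : 0 <= t / n.+1%:R by rewrite divr_ge0// ltW.
    have a0 : 0 <= i%:R * (t / n.+1%:R) by rewrite mulr_ge0.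
    have ab : i%:R * (t / n.+1%:R) <= i.+1%:R * (t / n.+1%:R) by rewrite ler_wpM2r// ler_nat.
    have bT : i.+1%:R * (t / n.+1%:R) <= T.
      apply: le_trans tT; rewrite mulrA ler_pdivrMr// mulrC ler_wpM2l// ler_nat//.
    have := h _ _ a0 ab bT.
    rewrite -mulrBl -natrB ?leqnSn// subSnn mul1r => h1.
    apply: le_trans (ler_distD (F (i%:R * (t / n.+1%:R))) _ _) _.
    apply: le_trans (lerD h1 (ih (ltnW iln))) _.
    by rewrite -mulrDr subrKA.
  have := step n.+1 (leqnn _).
  by rewrite mulrCA divff ?mulr1// pnatr_eq0.
apply/eqP; rewrite -subr_eq0 -normr_le0 -(@ler_pXn2r _ 2) ?nnegrE// expr0n/=.
set K := C ^+ 2 * t * (m t - m 0) ^+ 2.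
apply: (@le_cvg_seq R (fun=> `|F t - F 0| ^+ 2) (fun n => K * n.+1%:R^-1)).
- exact: cvg_cst.
- by rewrite -[X in _ --> X](mulr0 K); apply: cvg_scale; exact: cvg_harmonic.
- move=> n; have := bound n => hb.
  apply: (@le_trans _ _ ((C * Num.sqrt (t / n.+1%:R) * (m t - m 0)) ^+ 2)).
    by rewrite lerXn2r ?nnegrE// (le_trans _ hb).
  rewrite !exprMn sqr_sqrtr ?divr_ge0// /K; move: (n.+1%:R^-1) => a.
  by rewrite le_eqVlt; apply/orP; left; apply/eqP; ring.
Qed.

End HolderConstant.

Section Subsets.
Context {R : realType} d (T0 : measurableType d) (mu : {measure set T0 -> \bar R}).
Variables (D A : set T0) (mD : measurable D) (mA : measurable A) (AD : A `<=` D).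

Lemma smeasS (X : semiHilbert R) (u : T0 -> X) : smeas D u -> smeas A u.
Proof.
move=> [c [k [mk ck]]]; exists c, k; split=> [n|t /AD/ck//].
exact: measurable_funS (mk n).
Qed.

Lemma intgS (f : T0 -> R) : intg mu D f -> intg mu A f.
Proof. by move=> h; exact: integrableS h. Qed.

Lemma sL2S (X : semiHilbert R) (u : T0 -> X) : sL2 mu D u -> sL2 mu A u.
Proof. by move=> [su iu]; split; [exact: smeasS|exact: intgS]. Qed.

Lemma sL2_wintegrable (X : semiHilbert R) (u : T0 -> X) : (mu D < +oo)%E ->
  sL2 mu D u -> wintegrable mu A u.
Proof.
move=> fD [su iu]; split; first exact: smeasS.
apply: intgS; apply: (intg_le mD (g := fun t => 1 + dot (u t) (u t))).
- exact: measurable_nrm.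
- by apply: intgD => //; exact: intg_cst.
- move=> t Dt; rewrite ger0_norm ?nrm_ge0// -nrm_sqr.
  by have := sqr_ge0 (nrm (u t) - 1); rewrite sqrrB expr1n; have := nrm_ge0 (u t); lra.
Qed.

Lemma sL2_bounded (X : semiHilbert R) (u : T0 -> X) (C : R) : (mu D < +oo)%E ->
  smeas D u -> (forall t, D t -> dot (u t) (u t) <= C) -> sL2 mu D u.
Proof.
move=> fD su uC; split=> //; apply: (intg_le mD (g := fun=> C)).
- exact: measurable_dot.
- exact: intg_cst.
- by move=> t Dt; rewrite ger0_norm ?dot_ge0 ?uC.
Qed.

End Subsets.

Section Primitive.
Context {R : realType} (T : R).
Local Notation mu := (@lebesgue_measure R).
Local Notation TR := (measurableTypeR R).
Local Notation J := (`[0, T]%classic : set TR).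

Lemma measurable_itvR (i : interval R) : measurable ([set` i] : set TR).
Proof. exact: measurable_itv. Qed.

Lemma lebesgue_itv_fin (a b : R) (x y : bool) : (mu [set` Interval (BSide x a) (BSide y b)] < +oo)%E.
Proof.
by rewrite lebesgue_measure_itv/=; case: ifP => _; rewrite ?ltry// -EFinB ltry.
Qed.

Lemma lebesgue_itv_le (s t : R) (x y : bool) : s <= t ->
  (mu ([set` Interval (BSide x s) (BSide y t)] : set TR) <= (t - s)%:E)%E.
Proof.
move=> st; apply: (@eq_ind _ _ (fun z => (z <= (t - s)%:E)%E) _ _ (esym (lebesgue_measure_itv _))).
by rewrite /= lte_fin; case: ifP => _; rewrite -?EFinB ?lee_fin ?subr_ge0.
Qed.

Lemma J_fin : (mu J < +oo)%E. Proof. exact: lebesgue_itv_fin. Qed.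

Lemma sub_J0 (t : R) : t <= T -> (`[0, t]%classic : set TR) `<=` J.
Proof. by move=> tT; apply: subset_itvl; rewrite bnd_simp. Qed.

Lemma sub_J (s t : R) : 0 <= s -> t <= T -> (`]s, t]%classic : set TR) `<=` J.
Proof.
move=> s0 tT x /=; rewrite !in_itv/= => /andP[sx xt].
by rewrite (le_trans s0 (ltW sx)) (le_trans xt tT).
Qed.

Lemma Rintegral_JB (f : R -> R) (s t : R) : 0 <= s -> s <= t -> t <= T -> intg mu J f ->
  \int[mu]_(r in `[0, t]) f r - \int[mu]_(r in `[0, s]) f r = \int[mu]_(r in `]s, t]) f r.
Proof.
move=> s0 st tT hf; apply: Rintegral_itvB; rewrite ?bnd_simp//.
exact: (intgS (measurable_itvR _) (measurable_itvR _) (sub_J0 tT) hf).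
Qed.

Definition ucont (X : semiHilbert R) (u : R -> X) : Prop :=
  forall e : R, 0 < e -> exists2 d : R, 0 < d &
    forall s t, J s -> J t -> `|s - t| < d -> nrm (u s - u t) < e.

Lemma holder_ucont (X : semiHilbert R) (u : R -> X) (C : R) : 0 <= C ->
  (forall s t, 0 <= s -> s <= t -> t <= T -> dot (u t - u s) (u t - u s) <= (t - s) * C) ->
  ucont u.
Proof.
move=> C0 h e e0; have C1 : 0 < C + 1 by lra.
have e2 : 0 < e ^+ 2 by rewrite exprn_gt0.
exists (e ^+ 2 / (C + 1)); first by rewrite divr_gt0.
suff hh s t : s <= t -> J s -> J t -> `|s - t| < e ^+ 2 / (C + 1) -> nrm (u t - u s) < e.
  move=> s t Js Jt; have [st|/ltW ts] := leP s t; first by rewrite nrm_sym; exact: hh.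
  by rewrite distrC; exact: hh.
move=> st; rewrite /= !in_itv/= => /andP[s0 _] /andP[_ tT].
rewrite distrC ger0_norm ?subr_ge0// => hd.
rewrite -(@ltr_pXn2r _ 2) ?nnegrE ?nrm_ge0 ?(ltW e0)// nrm_sqr.
apply: le_lt_trans (h s t s0 st tT) _.
move: hd; rewrite ltr_pdivlMr//; apply: le_lt_trans.
by rewrite ler_wpM2l ?subr_ge0//; lra.
Qed.

Lemma ucont_cvg (X : semiHilbert R) (u : R -> X) : ucont u ->
  forall t, J t -> nrm (u s - u t) @[s --> within J (nbhs t)] --> (0 : R).
Proof.
move=> hu t Jt; apply/cvgrPdist_lt => e /hu[d d0 hd].
rewrite near_withinE; exists d => //= s /= st Js.
by rewrite sub0r normrN ger0_norm ?nrm_ge0//; apply: hd => //; rewrite distrC.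
Qed.

Lemma smeas_ucont (X : semiHilbert R) (u : R -> X) : ucont u -> smeas J u.
Proof.
move=> hu.
(* The countable dense set consists of values at rationals. Clipping moves a rational near an
   endpoint back into [0, T] without increasing its distance to points of the interval. *)
pose clip (x : R) : R := Num.min (Num.max x 0) T.
pose c n := u (clip (ratr (odflt 0 (unpickle n)))).
have dense (t : R) : J t -> forall e : R, 0 < e -> exists j, nrm (u t - c j) < e.
  move=> Jt e e0; have [d d0 hd] := hu e e0.
  have [|q] := @rat_in_itvoo R (t - d) (t + d); first lra.
  rewrite in_itv/= => /andP[q1 q2]; exists (pickle q); rewrite /c pickleK /=.
  move: (Jt); rewrite /= in_itv/= => /andP[t0 tT].
  apply: hd => //.
    rewrite /= in_itv/= /clip le_min ge_min le_max lexx orbT/= lexx orbT andbT.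
    exact: le_trans t0 tT.
  rewrite /clip ltr_norml maxEle; case: (leP (ratr q) 0) => h1; rewrite minEle.
    by case: (leP 0 T) => h2; apply/andP; split; lra.
  by case: (leP (ratr q) T) => h2; apply/andP; split; lra.
have [x||k [mk _ kc _]] := @pettis R _ _ J X (measurable_itvR _) u c.
- apply: subspace_continuous_measurable_fun => //.
  apply/subspace_continuousP => t Jt.
  apply/cvgrPdist_lt => e e0; have [d d0 hd] := hu e e0.
  rewrite near_withinE; exists d => //= s /= st Js.
  apply: le_lt_trans (nrm_distl _ _) _; rewrite opprB addrA subrK.
  exact: hd.
- exact: dense.
- by exists c, k.
Qed.

End Primitive.

Section PrimitiveL2.
Context {R : realType} (T : R).
Local Notation mu := (@lebesgue_measure R).
Local Notation TR := (measurableTypeR R).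
Local Notation J := (`[0, T]%classic : set TR).
Local Notation "J[ s , t ]" := (`]s, t]%classic : set TR) (at level 0, format "J[ s ,  t ]").
Local Notation "J[ t ]" := (`[0, t]%classic : set TR) (at level 0, format "J[ t ]").

Definition prim (X : semiHilbert R) (u : R -> X) (t : R) : X := wint mu J[t] u.

Section OneSpace.
Context (X : semiHilbert R).
Implicit Types u v : R -> X.

Lemma sL2_wint (A : set TR) u : measurable A -> A `<=` J -> sL2 mu J u -> wintegrable mu A u.
Proof. by move=> mA AJ; apply: sL2_wintegrable => //; exact: J_fin. Qed.

Lemma intg_dotr (A : set TR) u y : measurable A -> A `<=` J -> sL2 mu J u -> intg mu A (fun t => dot (u t) y).
Proof. by move=> mA AJ su; apply: wintegrable_dot => //; exact: sL2_wint. Qed.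

Lemma prim_dot u y t : t <= T -> sL2 mu J u -> dot (prim u t) y = \int[mu]_(r in `[0, t]) dot (u r) y.
Proof. by move=> tT su; apply: wintE => //; apply: sL2_wint => //; exact: sub_J0. Qed.

Lemma primB u s t : 0 <= s -> s <= t -> t <= T -> sL2 mu J u ->
  nrm (prim u t - prim u s - wint mu J[s, t] u) = 0.
Proof.
move=> s0 st tT su; apply/nrm_eq0P.
(* A vector orthogonal to every vector, itself included, has norm zero. Equality of vectors is
   proved in this way throughout. *)
suff h y : dot (prim u t - prim u s - wint mu J[s, t] u) y = 0 by exact: h.
rewrite dotBl dotBl (prim_dot y tT su) (prim_dot y (le_trans st tT) su).
rewrite wintE//; last by apply: sL2_wint => //; exact: sub_J.
rewrite (Rintegral_JB s0 st tT) ?subrr//.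
exact: intg_dotr.
Qed.

Lemma prim_sqr_le u s t : 0 <= s -> s <= t -> t <= T -> sL2 mu J u ->
  dot (prim u t - prim u s) (prim u t - prim u s) <=
  (t - s) * \int[mu]_(r in `]s, t]) dot (u r) (u r).
Proof.
move=> s0 st tT su.
have := primB s0 st tT su => /eq_nrm h.
rewrite -nrm_sqr h nrm_sqr; apply: wint_sqr_le => //.
- by apply: sL2_wint => //; exact: sub_J.
- by apply: (intgS (measurable_itvR _) _ (sub_J s0 tT)) => //; case: su.
- exact: lebesgue_itv_le.
Qed.

Lemma prim0 u : 0 <= T -> sL2 mu J u -> nrm (prim u 0) = 0.
Proof.
move=> T0 su; apply/nrm_eq0P; rewrite prim_dot//.
by rewrite set_itv1 Rintegral_set1.
Qed.

Lemma L2J_ge (f : R -> R) (A : set TR) : measurable A -> A `<=` J -> intg mu J f -> (forall t, J t -> 0 <= f t) ->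
  \int[mu]_(r in A) f r <= \int[mu]_(r in J) f r.
Proof.
move=> mA AJ hf f0; rewrite -(setIidr AJ) Rintegral_mkcondr.
apply: le_Rintegral => //.
  have := intgS (measurable_itvR _) mA AJ hf.
  rewrite /intg (integrable_mkcond _ mA) => h.
  have h2 : mu.-integrable J ((EFin \o f) \_ A) by exact: integrableS h.
  by apply: eq_integrable h2 => // x _; rewrite restrict_EFin.
move=> x Jx; rewrite patchE; case: ifP => // _; exact: f0.
Qed.

Lemma prim_sqr_leT u s t : 0 <= s -> s <= t -> t <= T -> sL2 mu J u ->
  dot (prim u t - prim u s) (prim u t - prim u s) <= (t - s) * L2dot mu J u u.
Proof.
move=> s0 st tT su; apply: le_trans (prim_sqr_le s0 st tT su) _.
rewrite ler_wpM2l ?subr_ge0//; apply: L2J_ge => //; first exact: sub_J.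
- by case: su.
- by move=> r _; exact: dot_ge0.
Qed.

Lemma prim_ucont u x0 : sL2 mu J u -> ucont T (fun t => x0 + prim u t).
Proof.
move=> su; apply: (holder_ucont (C := L2dot mu J u u)); first exact: L2dot_ge0.
by move=> s t s0 st tT; rewrite opprD addrACA subrr add0r; exact: prim_sqr_leT.
Qed.

Lemma prim_bound u t : 0 <= t -> t <= T -> sL2 mu J u ->
  dot (prim u t) (prim u t) <= t * \int[mu]_(r in `[0, t]) dot (u r) (u r).
Proof.
move=> t0 tT su; rewrite /prim; apply: wint_sqr_le => //.
- by apply: sL2_wint => //; exact: sub_J0.
- by apply: (intgS (measurable_itvR _) _ (sub_J0 tT)) => //; case: su.
- by rewrite -[t in X in (_ <= X)%E]subr0; exact: lebesgue_itv_le.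
Qed.

Lemma prim_boundT u t : 0 <= t -> t <= T -> sL2 mu J u ->
  dot (prim u t) (prim u t) <= T * L2dot mu J u u.
Proof.
move=> t0 tT su; apply: le_trans (prim_bound t0 tT su) _.
apply: ler_pM => //; first by apply: Rintegral_ge0 => r _; exact: dot_ge0.
apply: L2J_ge => //; first exact: sub_J0.
- by case: su.
- by move=> r _; exact: dot_ge0.
Qed.

Lemma prim_sL2 u x0 : sL2 mu J u -> sL2 mu J (fun t => x0 + prim u t).
Proof.
move=> su; apply: (@sL2_bounded _ _ _ mu J _ _ _ (2 * dot x0 x0 + 2 * (T * L2dot mu J u u))) => //.
- exact: J_fin.
- by apply: smeas_ucont; exact: prim_ucont.
- move=> t; rewrite /= in_itv/= => /andP[t0 tT].
  apply: le_trans (sqr_nrmD _ _) _; rewrite lerD2l ler_wpM2l//.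
  exact: prim_boundT.
Qed.

End OneSpace.
Opaque prim.

(** * The product rule for primitives *)

Definition bounded_bilinear (X Y : semiHilbert R) (B : X -> Y -> R) (M : R) : Prop :=
  [/\ forall k x x' y, B (k *: x + x') y = k * B x y + B x' y,
      forall k x y y', B x (k *: y + y') = k * B x y + B x y' &
      forall x y, `|B x y| <= M * nrm x * nrm y].

Section ProductRule.
Context (X Y : semiHilbert R) (B : X -> Y -> R) (M : R).
Hypothesis bB : bounded_bilinear B M.
Hypothesis M0 : 0 <= M.

Lemma bilinBl x x' y : B (x - x') y = B x y - B x' y.
Proof. by case: bB => h _ _; rewrite addrC -scaleN1r h mulN1r addrC. Qed.

Lemma bilinBr x y y' : B x (y - y') = B x y - B x y'.
Proof. by case: bB => _ h _; rewrite addrC -scaleN1r h mulN1r addrC. Qed.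

Lemma bilin_eql x x' y : nrm (x - x') = 0 -> B x y = B x' y.
Proof.
move=> h; apply/eqP; rewrite -subr_eq0 -bilinBl -normr_le0.
by case: bB => _ _ /(_ (x - x') y) hb; apply: le_trans hb _; rewrite h mulr0 mul0r.
Qed.

Lemma bilin_eqr x y y' : nrm (y - y') = 0 -> B x y = B x y'.
Proof.
move=> h; apply/eqP; rewrite -subr_eq0 -bilinBr -normr_le0.
by case: bB => _ _ /(_ x (y - y')) hb; apply: le_trans hb _; rewrite h mulr0.
Qed.

Lemma bilin_scontinuous : scontinuous2 (B : X -> Y -> real_sh R).
Proof.
move=> a b x y ha hb; apply/ncvg_real.
have h n : `|B (a n) (b n) - B x y| <= M * nrm (a n) * nrm (b n - y) + M * nrm (a n - x) * nrm y.
  have -> : B (a n) (b n) - B x y = B (a n) (b n - y) + B (a n - x) y.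
    by rewrite bilinBr bilinBl addrA subrK.
  case: bB => _ _ hB; apply: le_trans (ler_normD _ _) _; exact: lerD.
apply/subr_cvg0; apply/norm_cvg0P.
apply: (@squeeze_cvgr _ _ _ _ (fun=> 0) (fun n => M * nrm (a n) * nrm (b n - y) + M * nrm (a n - x) * nrm y)).
- by apply: nearW => n; rewrite normr_ge0 h.
- exact: cvg_cst.
- rewrite -[X in _ --> X](addr0 0) -[X in _ --> X + _](mulr0 (M * nrm x)) -[X in _ --> _ + X](mul0r (nrm y)).
  apply: cvgD; first by apply: cvgM hb; apply: cvg_scale; exact: ncvg_nrm.
  apply: cvgM; last exact: cvg_cst.
  by rewrite -[X in _ --> X](mulr0 M); exact: cvg_scale.
Qed.

Lemma intg_bilin (D : set TR) (u : R -> X) (v : R -> Y) : measurable D ->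
  sL2 mu D u -> sL2 mu D v -> intg mu D (fun t => B (u t) (v t)).
Proof.
move=> mD [su iu] [sv iv]; apply: (@intg_le _ _ _ mu D mD _ (fun t => M * (dot (u t) (u t) + dot (v t) (v t)))).
- exact: smeas2_measurable bilin_scontinuous su sv.
- by apply: intgZ => //; exact: intgD.
- move=> t Dt; case: bB => _ _ /(_ (u t) (v t)) h; apply: le_trans h _.
  rewrite -mulrA ler_wpM2l// -!nrm_sqr; have := nrm_ge0 (u t); have := nrm_ge0 (v t); nra.
Qed.

(** The difference F of the two sides changes over [s, r] by the integral of B(u p, y r - y p) + B(x
    s - x p, v p). Primitives of square integrable functions are Hölder continuous of exponent 1/2,
    so this is at most a constant times sqrt(r - s) times the integral of |u| + |v|, and
    [holder_constant] applies. *)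
Theorem product_rule (x0 : X) (y0 : Y) (u : R -> X) (v : R -> Y) :
  sL2 mu J u -> sL2 mu J v -> forall t, 0 <= t <= T ->
  B (x0 + prim u t) (y0 + prim v t) = B x0 y0 +
    \int[mu]_(r in `[0, t]) (B (u r) (y0 + prim v r) + B (x0 + prim u r) (v r)).
Proof.
move=> su sv t t0T.
have T0 : 0 <= T by case/andP: t0T => /le_trans; exact.
pose x r := x0 + prim u r; pose y r := y0 + prim v r.
have sx : sL2 mu J x by exact: prim_sL2.
have sy : sL2 mu J y by exact: prim_sL2.
pose g r := B (u r) (y r) + B (x r) (v r).
have ig : intg mu J g by apply: intgD => //; exact: intg_bilin.
pose N r := nrm (u r) + nrm (v r).
have inu : intg mu J (fun r => nrm (u r)) by case: (sL2_wint (measurable_itvR _) (@subset_refl _ J) su).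
have inv : intg mu J (fun r => nrm (v r)) by case: (sL2_wint (measurable_itvR _) (@subset_refl _ J) sv).
have iN : intg mu J N by exact: intgD.
pose F r := B (x r) (y r) - \int[mu]_(s in `[0, r]) g s.
pose m r := \int[mu]_(s in `[0, r]) N s.
set cu := Num.sqrt (L2dot mu J u u); set cv := Num.sqrt (L2dot mu J v v).
have cu0 : 0 <= cu by exact: sqrtr_ge0.
have cv0 : 0 <= cv by exact: sqrtr_ge0.
suff : F t = F 0.
  rewrite /F set_itv1 Rintegral_set1 subr0 => /eqP; rewrite subr_eq => /eqP ->.
  congr (_ + _); have hx : nrm (x 0 - x0) = 0 by rewrite /x addrC addKr prim0.
  have hy : nrm (y 0 - y0) = 0 by rewrite /y addrC addKr prim0.
  by rewrite (bilin_eql _ hx) (bilin_eqr _ hy).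
apply: (@holder_constant _ T (M * (cu + cv)) F m) t0T.
  by rewrite mulr_ge0// addr_ge0.
move=> s r s0 sr rT; have mI : measurable J[s, r] by [].
have IJ := sub_J s0 rT.
have lin1 z : B (prim u r - prim u s) z = \int[mu]_(p in `]s, r]) B (u p) z.
  rewrite (bilin_eql z (primB s0 sr rT su)).
  apply: (wint_functional (l := fun x => B x z) (M := M * nrm z)) => //.
  - exact: sL2_wint.
  - by move=> k a b; case: bB.
  - by move=> a; case: bB => _ _ h; rewrite mulrAC.
have lin2 z : B z (prim v r - prim v s) = \int[mu]_(p in `]s, r]) B z (v p).
  rewrite (bilin_eqr z (primB s0 sr rT sv)).
  apply: (wint_functional (l := fun y => B z y) (M := M * nrm z)) => //.
  - exact: sL2_wint.
  - by move=> k a b; case: bB.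
  - by move=> a; case: bB.
have cst_sL2 (Z : semiHilbert R) (z : Z) : sL2 mu J[s, r] (fun=> z).
  apply: (@sL2_bounded _ _ _ mu _ _ _ _ (dot z z)) => //; last exact: smeas_cst.
  exact: lebesgue_itv_fin.
have su' := sL2S (measurable_itvR _) mI IJ su.
have sv' := sL2S (measurable_itvR _) mI IJ sv.
have sx' := sL2S (measurable_itvR _) mI IJ sx.
have sy' := sL2S (measurable_itvR _) mI IJ sy.
have dF : F r - F s = \int[mu]_(p in `]s, r]) (B (u p) (y r - y p) + B (x s - x p) (v p)).
  have -> : F r - F s = (B (x r) (y r) - B (x s) (y s)) -
      (\int[mu]_(s in `[0, r]) g s - \int[mu]_(p in `[0, s]) g p) by rewrite /F; ring.
  rewrite (Rintegral_JB s0 sr rT ig).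
  have -> : B (x r) (y r) - B (x s) (y s) = B (prim u r - prim u s) (y r) + B (x s) (prim v r - prim v s).
    have -> : prim u r - prim u s = x r - x s by rewrite /x opprD addrACA subrr add0r.
    have -> : prim v r - prim v s = y r - y s by rewrite /y opprD addrACA subrr add0r.
    by rewrite bilinBl bilinBr addrA subrK.
  have i1 : intg mu J[s, r] (fun p => B (u p) (y r)) by exact: intg_bilin mI su' (cst_sL2 Y (y r)).
  have i2 : intg mu J[s, r] (fun p => B (x s) (v p)) by exact: intg_bilin mI (cst_sL2 X (x s)) sv'.
  have i3 : intg mu J[s, r] g by exact: (intgS (measurable_itvR _) mI IJ ig).
  rewrite (lin1 (y r)) (lin2 (x s)) -(RintegralD mI i1 i2) -(RintegralB mI (intgD mI i1 i2) i3).
  by apply: eq_Rintegral => p _; rewrite /g bilinBl bilinBr opprD addrACA.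
rewrite dF.
have iin : intg mu J[s, r] (fun p => B (u p) (y r - y p) + B (x s - x p) (v p)).
  apply: (intgD mI).
    exact: intg_bilin mI su' (sL2B mI (cst_sL2 Y (y r)) sy').
  exact: intg_bilin mI (sL2B mI (cst_sL2 X (x s)) sx') sv'.
apply: le_trans (le_normr_Rintegral mI iin) _.
have iN' : intg mu J[s, r] N by exact: (intgS (measurable_itvR _) mI IJ iN).
rewrite /m (Rintegral_JB s0 sr rT iN) -(RintegralZl _ mI iN').
apply: (le_Rintegral mI (intg_norm iin) (intgZ mI _ iN')).
move=> p; rewrite /= in_itv/= => /andP[sp pr].
have p0 : 0 <= p by exact: le_trans s0 (ltW sp).
have pT : p <= T by exact: le_trans pr rT.
set q := Num.sqrt (r - s); have q0 : 0 <= q by exact: sqrtr_ge0.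
have hx : nrm (x s - x p) <= q * cu.
  rewrite nrm_sym /x opprD addrACA subrr add0r.
  rewrite -(@ler_pXn2r _ 2) ?nnegrE ?nrm_ge0 ?mulr_ge0// nrm_sqr exprMn !sqr_sqrtr ?L2dot_ge0 ?subr_ge0//.
  apply: le_trans (prim_sqr_leT s0 (ltW sp) pT su) _.
  by rewrite ler_wpM2r ?L2dot_ge0// lerD2r.
have hy : nrm (y r - y p) <= q * cv.
  rewrite /y opprD addrACA subrr add0r.
  rewrite -(@ler_pXn2r _ 2) ?nnegrE ?nrm_ge0 ?mulr_ge0// nrm_sqr exprMn !sqr_sqrtr ?L2dot_ge0 ?subr_ge0//.
  apply: le_trans (prim_sqr_leT p0 pr rT sv) _.
  by rewrite ler_wpM2r ?L2dot_ge0// lerB// ltW.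
apply: le_trans (ler_normD _ _) _; case: bB => _ _ hB.
apply: le_trans (lerD (hB _ _) (hB _ _)) _.
have nu := nrm_ge0 (u p); have nv := nrm_ge0 (v p).
have h1 : nrm (u p) * nrm (y r - y p) <= nrm (u p) * (q * cv) by rewrite ler_wpM2l.
have h2 : nrm (x s - x p) * nrm (v p) <= (q * cu) * nrm (v p) by rewrite ler_wpM2r.
rewrite -!mulrA -mulrDr ler_wpM2l//.
apply: le_trans (lerD h1 h2) _; rewrite /N.
have : 0 <= q * (cu * nrm (u p)) by rewrite !mulr_ge0.
have : 0 <= q * (cv * nrm (v p)) by rewrite !mulr_ge0.
lra.
Qed.

End ProductRule.
End PrimitiveL2.
Opaque prim.

(** * The linear parabolic problem *)

Section L2Convergence.
Context {R : realType} d (T0 : measurableType d) (mu : {measure set T0 -> \bar R}).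
Variables (D : set T0) (mD : measurable D) (X : semiHilbert R).
Implicit Types u v : T0 -> X.

Definition L2cvg (u_ : nat -> T0 -> X) u :=
  L2dot mu D (u_ n - u) (u_ n - u) @[n --> \oo] --> (0 : R).

Lemma L2dot_cvg (u_ v_ : nat -> T0 -> X) u v :
  (forall n, sL2 mu D (u_ n)) -> (forall n, sL2 mu D (v_ n)) -> sL2 mu D u -> sL2 mu D v ->
  L2cvg u_ u -> L2cvg v_ v ->
  L2dot mu D (u_ n) (v_ n) @[n --> \oo] --> L2dot mu D u v.
Proof.
move=> su_ sv_ su sv cu cv.
have ncv (w_ : nat -> T0 -> X) w (sw_ : forall n, sL2 mu D (w_ n)) (sw : sL2 mu D w) :
   L2cvg w_ w -> ncvg (fun n => L2_mk mD (sw_ n)) (L2_mk mD sw).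
  by move=> h; apply/ncvg_sqr; exact: h.
exact: (ncvg_dot2 (ncv u_ u su_ su cu) (ncv v_ v sv_ sv cv)).
Qed.

Lemma L2cvg_cst u : L2cvg (fun=> u) u.
Proof.
rewrite /L2cvg subrr; have -> : L2dot mu D (0 : T0 -> X) (0 : T0 -> X) = 0.
  by rewrite /L2dot; under eq_Rintegral do rewrite dot0l; rewrite Rintegral_cst// mul0r.
exact: cvg_cst.
Qed.

Lemma L2dot_eq0 u : sL2 mu D u -> L2dot mu D u u <= 0 -> {ae mu, forall t, D t -> nrm (u t) = 0}.
Proof.
move=> su u0; have := ge0_Rintegral_eq0 mD su.2 (fun t _ => dot_ge0 (u t)) u0.
by apply: filterS => t h Dt; apply/nrm_eq0P; exact: h.
Qed.

Lemma ae_L2dot_eq0 u v : {ae mu, forall t, D t -> nrm (u t) = 0} -> sL2 mu D u -> sL2 mu D v ->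
  L2dot mu D u v = 0.
Proof.
move=> u0 su sv.
have -> : L2dot mu D u v = \int[mu]_(t in D) 0; last by rewrite Rintegral_cst// mul0r.
apply: (Rintegral_ae mD).
- exact: (intg_measurable (sL2_dot mD su sv)).
- exact: measurable_cst.
- by apply: filterS u0 => t h Dt; rewrite dot0_nrm ?h.
Qed.

End L2Convergence.
Arguments L2cvg {R d T0} mu D {X} u_ u.

Section TimeL2.
Context {R : realType} (T : R).
Local Notation mu := (@lebesgue_measure R).
Local Notation TR := (measurableTypeR R).
Local Notation J := (`[0, T]%classic : set TR).
Local Notation "J[ t ]" := (`[0, t]%classic : set TR) (at level 0, format "J[ t ]").
Context (X : semiHilbert R).
Implicit Types u v : R -> X.

Lemma L2dot_J_le (A : set TR) u : measurable A -> A `<=` J -> sL2 mu J u ->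
  L2dot mu A u u <= L2dot mu J u u.
Proof.
by move=> mA AJ su; apply: L2J_ge => //; [case: su|move=> t _; exact: dot_ge0].
Qed.

Lemma L2cvgS (A : set TR) (u_ : nat -> R -> X) u : measurable A -> A `<=` J ->
  (forall n, sL2 mu J (u_ n)) -> sL2 mu J u -> L2cvg mu J u_ u -> L2cvg mu A u_ u.
Proof.
move=> mA AJ su_ su cu; rewrite /L2cvg.
apply: (@squeeze_cvgr _ _ _ _ (fun=> 0) (fun n => L2dot mu J (u_ n - u) (u_ n - u))) => //.
- apply: nearW => n; rewrite L2dot_ge0/=; apply: L2dot_J_le => //.
  exact: (sL2B (measurable_itvR _)).
- exact: cvg_cst.
Qed.

Lemma sL2_csts (x : X) : sL2 mu J (fun=> x).
Proof.
apply: (@sL2_bounded _ _ _ mu J (measurable_itvR _) _ _ (dot x x)) => //.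
- exact: J_fin.
- exact: smeas_cst.
Qed.

Lemma L2cvg_weak (t : R) (u_ : nat -> R -> X) u y : t <= T ->
  (forall n, sL2 mu J (u_ n)) -> sL2 mu J u -> L2cvg mu J u_ u ->
  \int[mu]_(r in J[t]) dot (u_ n r) y @[n --> \oo] --> \int[mu]_(r in J[t]) dot (u r) y.
Proof.
move=> tT su_ su cu; have mJ := measurable_itvR (Interval (BLeft (0:R)) (BRight T)).
have mt := measurable_itvR (Interval (BLeft (0:R)) (BRight t)).
have sub := sub_J0 tT.
apply: (@L2dot_cvg _ _ _ mu J[t] mt X u_ (fun=> fun=> y) u (fun=> y)).
- by move=> n; exact: (sL2S mJ mt sub (su_ n)).
- by move=> _; exact: (sL2S mJ mt sub (sL2_csts y)).
- exact: (sL2S mJ mt sub su).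
- exact: (sL2S mJ mt sub (sL2_csts y)).
- exact: L2cvgS mt sub su_ su cu.
- exact: L2cvg_cst.
Qed.

Lemma prim_lin k u v t y : t <= T -> sL2 mu J u -> sL2 mu J v ->
  dot (prim (k *: u + v) t) y = k * dot (prim u t) y + dot (prim v t) y.
Proof.
move=> tT su sv.
have suv : sL2 mu J (k *: u + v) by exact: (sL2_lin (measurable_itvR _)).
rewrite (prim_dot y tT suv) (prim_dot y tT su) (prim_dot y tT sv).
have mt := measurable_itvR (Interval (BLeft (0:R)) (BRight t)).
have iu := intg_dotr y mt (sub_J0 tT) su; have iv := intg_dotr y mt (sub_J0 tT) sv.
rewrite -(RintegralZl _ mt iu) -(RintegralD mt (intgZ mt _ iu) iv).
by apply: eq_Rintegral => r _; rewrite dot_linl.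
Qed.

Lemma L2dot_split_le t u : t <= T -> sL2 mu J u ->
  L2dot mu J[t] u u <= L2dot mu J u u.
Proof. by move=> tT su; apply: L2dot_J_le => //; exact: sub_J0. Qed.

End TimeL2.

(** * The equation v' + lam A v = h: strong solutions, density of their data, existence and
    uniqueness *)

Section Parabolic.
Context {R : realType} (T lam M : R) (V H : semiHilbert R) (j : V -> H).
Hypothesis T0 : 0 <= T.
Hypothesis lam0 : 0 < lam.
Hypothesis M0 : 0 <= M.
Hypothesis j_lin : forall k x y, j (k *: x + y) = k *: j x + j y.
Hypothesis j_le : forall x, nrm (j x) <= M * nrm x.
Hypothesis j_inj : forall x, nrm (j x) = 0 -> nrm x = 0.
Hypothesis j_dense : forall q, (forall w, dot q (j w) = 0) -> nrm q = 0.
Local Notation mu := (@lebesgue_measure R).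
Local Notation TR := (measurableTypeR R).
Local Notation J := (`[0, T]%classic : set TR).
Local Notation "J[ t ]" := (`[0, t]%classic : set TR) (at level 0, format "J[ t ]").

Let mJ : measurable J := measurable_itvR _.
Let mt t : measurable J[t] := measurable_itvR _.

Definition jdot (x y : V) : R := dot (j x) (j y).

Lemma jdot_bilinear : bounded_bilinear jdot (M ^+ 2).
Proof.
split=> [k x x' y|k x y y'|x y]; rewrite /jdot ?j_lin ?dotE//.
apply: le_trans (dot_le _ _) _; rewrite expr2.
have -> : M * M * nrm x * nrm y = (M * nrm x) * (M * nrm y) by ring.
by apply: ler_pM; rewrite ?nrm_ge0.
Qed.

Lemma jdot_pos : 0 <= M ^+ 2. Proof. exact: sqr_ge0. Qed.

Lemma jB x y : j (x - y) = j x - j y.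
Proof. by have := j_lin (-1) y x; rewrite !scaleN1r addrC => ->; rewrite addrC. Qed.

Lemma jinv_ex : exists G : V -> V, forall w x, dot (G w) x = jdot w x.
Proof.
have /choice[G hG] : forall w, exists z, forall x, dot z x = jdot w x; last by exists G.
move=> w; apply: (@riesz R V (jdot w) (M ^+ 2 * nrm w)).
- by move=> k x y; case: jdot_bilinear.
- by move=> x; case: jdot_bilinear.
Qed.

(* The inverse [G] of the operator of the scalar product of V, composed with
   the embedding of V into its dual. *)
Definition jinv : V -> V := projT1 (cid jinv_ex).

Lemma jinvE w x : dot (jinv w) x = jdot w x.
Proof. by rewrite /jinv; case: cid. Qed.

Lemma jinv_lip x y : nrm (jinv x - jinv y) <= M ^+ 2 * nrm (x - y).
Proof.
have h0 := nrm_ge0 (jinv x - jinv y).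
have [->|h] := eqVneq (nrm (jinv x - jinv y)) 0.
  by rewrite mulr_ge0 ?nrm_ge0 ?sqr_ge0.
have hp : 0 < nrm (jinv x - jinv y) by rewrite lt_neqAle eq_sym h.
rewrite -(ler_pM2r hp) -expr2 nrm_sqr {1}dotBl !jinvE -/(jdot _ _).
have [hl _ hb] := jdot_bilinear.
rewrite -(bilinBl jdot_bilinear); apply: le_trans (ler_norm _) _; exact: hb.
Qed.

Lemma jinv_sL2 th : sL2 mu J th -> sL2 mu J (fun t => jinv (th t)).
Proof.
move=> sth.
have sm : smeas J (fun t => jinv (th t)) by apply: (smeas_comp jinv_lip); case: sth.
split=> //; apply: (@intg_le _ _ _ mu J mJ _ (fun t => (M ^+ 2) ^+ 2 * dot (th t) (th t))).
- exact: measurable_dot.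
- by apply: intgZ => //; case: sth.
- move=> t _; rewrite ger0_norm ?dot_ge0// -!nrm_sqr -exprMn lerXn2r ?nnegrE ?nrm_ge0//.
    by rewrite mulr_ge0 ?nrm_ge0 ?sqr_ge0.
  have h0 : nrm (jinv 0) = 0.
    by apply/nrm_eq0P; rewrite jinvE /jdot -[X in dot (j X) _](subrr 0) jB subrr dot0l.
  have := jinv_lip (th t) 0; rewrite subr0 => /(le_trans _); apply.
  by have := nrm_dist (jinv (th t)) (jinv 0) 0; rewrite !subr0 h0 addr0.
Qed.

(* [th] is v', and the last clause is j^* j v' + lam A v = h at every time. *)
Definition strong (w0 : V) (th h v : R -> V) : Prop :=
  [/\ sL2 mu J th, sL2 mu J h, sL2 mu J v,
      forall t, J t -> forall x, dot (v t) x = dot (w0 + prim th t) x &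
      forall t, J t -> forall x, dot (h t) x = jdot (th t) x + lam * dot (v t) x].

(** Nothing has to be solved here: v' = th is arbitrary and the right-hand side is defined by the
    equation, read in V through [jinv]. *)
Lemma strong_ex w0 th : sL2 mu J th -> strong w0 th
  (fun t => jinv (th t) + lam *: (w0 + prim th t)) (fun t => w0 + prim th t).
Proof.
move=> sth; have sv := prim_sL2 w0 sth.
have sG := jinv_sL2 sth.
split=> //; first by apply: (sL2D mJ sG); exact: sL2Z.
by move=> t _ x; rewrite !dotE jinvE.
Qed.

Lemma strong_lin k w0 w0' th th' h h' v v' :
  strong w0 th h v -> strong w0' th' h' v' ->
  strong (k *: w0 + w0') (k *: th + th') (k *: h + h') (k *: v + v').
Proof.
move=> [s1 s2 s3 e1 e2] [s1' s2' s3' e1' e2']; split; try exact: sL2_lin.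
  move=> t Jt x; have tT : t <= T by move: Jt; rewrite /= in_itv/= => /andP[].
  rewrite dotDl (prim_lin k x tT s1 s1') !dotE e1// e1'// !dotE; ring.
move=> t Jt x; rewrite !dotE e2// e2'// /jdot j_lin !dotE; ring.
Qed.

Lemma strongB w0 w0' th th' h h' v v' :
  strong w0 th h v -> strong w0' th' h' v' -> strong (w0 - w0') (th - th') (h - h') (v - v').
Proof.
move=> s s'; have := strong_lin (-1) s' s.
by rewrite !scaleN1r !(addrC (- _)).
Qed.

Lemma strong_nrm w0 th h v t : strong w0 th h v -> J t -> nrm (v t - (w0 + prim th t)) = 0.
Proof.
move=> [_ _ _ e1 _] Jt; apply/nrm_eq0P; rewrite dotBl e1// subrr//.
Qed.

(** The product rule for |j v|^2 gives the integrand 2 <h, v> - 2 lam |v|^2, and |h - lam v|^2 >= 0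
    bounds 2 <h, v> by lam |v|^2 + lam^-1 |h|^2. *)
Lemma strong_energy w0 th h v : strong w0 th h v -> forall t, J t ->
  jdot (v t) (v t) + lam * L2dot mu J[t] v v <= jdot w0 w0 + lam^-1 * L2dot mu J[t] h h.
Proof.
move=> hs t Jt; have [sth sh sv e1 e2] := hs.
have t0T : 0 <= t <= T by move: Jt; rewrite /= in_itv.
have tT : t <= T by case/andP: t0T.
have sub := sub_J0 tT.
have := product_rule jdot_bilinear jdot_pos w0 w0 sth sth t0T.
have jeq s : J s -> forall x, jdot (v s) x = jdot (w0 + prim th s) x.
  by move=> Js x; exact: (bilin_eql jdot_bilinear _ (strong_nrm hs Js)).
have jC x y : jdot x y = jdot y x by exact: dotC.
rewrite -jeq// (jC (v t)) -jeq// => ->.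
have st := sL2S mJ (mt t) sub sth; have svt := sL2S mJ (mt t) sub sv.
have sht := sL2S mJ (mt t) sub sh.
have ivv := sL2_dot (mt t) svt svt; have ihh := sL2_dot (mt t) sht sht.
have ihv := sL2_dot (mt t) sht svt.
have -> : \int[mu]_(r in J[t]) (jdot (th r) (w0 + prim th r) + jdot (w0 + prim th r) (th r)) =
    \int[mu]_(r in J[t]) (2 * dot (h r) (v r) - (2 * lam) * dot (v r) (v r)).
  apply: eq_Rintegral => r /set_mem/sub Jr; rewrite e2//.
  by rewrite (jC (w0 + _)) (jC (th r) (w0 + _)) -(jeq r Jr) (jC (th r)); ring.
rewrite /L2dot -addrA lerD2l -(RintegralZl _ (mt t) ivv) -(RintegralZl _ (mt t) ihh).
have i1 := intgB (mt t) (intgZ (mt t) 2 ihv) (intgZ (mt t) (2 * lam) ivv).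
rewrite -(RintegralD (mt t) i1 (intgZ (mt t) lam ivv)).
apply: (le_Rintegral (mt t) (intgD (mt t) i1 (intgZ (mt t) lam ivv)) (intgZ (mt t) lam^-1 ihh)).
move=> r _; have := dot_ge0 (h r - lam *: v r); rewrite !dotE (dotC (v r)) => h1.
rewrite -(ler_pM2l lam0) mulrA divff ?gt_eqF// mul1r; lra.
Qed.

(** In this form the derivative of v has disappeared, so the identity survives limits in which only
    v and h converge. *)
Lemma strong_weak w0 th h v w : strong w0 th h v -> forall t, J t ->
  jdot (v t) w = jdot w0 w + (\int[mu]_(r in J[t]) dot (h r) w - lam * \int[mu]_(r in J[t]) dot (v r) w).
Proof.
move=> hs t Jt; have [sth sh sv e1 e2] := hs.
have t0T : 0 <= t <= T by move: Jt; rewrite /= in_itv.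
have tT : t <= T by case/andP: t0T.
have sub := sub_J0 tT.
have jC x y : jdot x y = jdot y x by exact: dotC.
rewrite jC -jinvE dotC e1// dotDl dotC jinvE jC; congr (_ + _).
have ih := intg_dotr w (mt t) sub sh; have iv := intg_dotr w (mt t) sub sv.
rewrite (prim_dot _ tT sth) -(RintegralZl _ (mt t) iv) -(RintegralB (mt t) ih (intgZ (mt t) _ iv)).
apply: eq_Rintegral => r /set_mem/sub Jr; rewrite e2// addrK.
by rewrite dotC jinvE jC.
Qed.

(** By the product rule twice the integral is |int_0^T r|^2. It gives the sign needed both for the
    density of data and for uniqueness. *)
Lemma prim_self_ge0 (r : R -> V) : sL2 mu J r -> 0 <= \int[mu]_(t in J) dot (prim r t) (r t).
Proof.
move=> sr.
have bd : bounded_bilinear (fun x y : V => dot x y) 1.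
  by split=> [k x x' y|k x y y'|x y]; rewrite ?dotE// mul1r dot_le.
have TT : 0 <= T <= T by rewrite T0 lexx.
have := product_rule bd ler01 0 0 sr sr TT.
rewrite dot0l !add0r => e.
have sp := prim_sL2 0 sr.
have ip : intg mu J (fun t => dot (prim r t) (r t)).
  by apply: (sL2_dot mJ _ sr); apply: sL2_eq sp => // t _; rewrite add0r subrr nrm0.
have : 0 <= 2 * \int[mu]_(t in J) dot (prim r t) (r t).
  rewrite -(RintegralZl _ mJ ip).
  have -> : \int[mu]_(t in J) (2 * dot (prim r t) (r t)) = dot (prim r T) (prim r T).
    by rewrite e; apply: eq_Rintegral => t _; rewrite !add0r (dotC (r t)); ring.
  exact: dot_ge0.
by rewrite pmulr_rge0.
Qed.

Local Notation Z := (prod_sh H (L2_sh mu mJ V)).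

Definition strong_data (z : Z) : Prop :=
  exists w0 th v, z.1 = j w0 /\ strong w0 th (sub_val z.2) v.

Lemma strong_data0 : strong_data 0.
Proof.
exists 0, 0, 0; split.
  by have := jB 0 0; rewrite subrr subrr.
have s0 := sL2_0 mu mJ V; split=> //.
  move=> t Jt x; have tT : t <= T by move: Jt; rewrite /= in_itv/= => /andP[].
  rewrite dotDl (prim_dot x tT s0) !dot0l add0r.
  by rewrite (@eq_Rintegral _ _ _ mu J[t] (fun=> 0)) ?Rintegral_cst ?mul0r// => r _; rewrite dot0l.
by move=> t Jt x; rewrite /jdot !dot0l -[X in dot (j X) _](subrr 0) jB subrr dot0l mulr0 addr0.
Qed.

Lemma strong_data_lin k z z' : strong_data z -> strong_data z' -> strong_data (k *: z + z').
Proof.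
move=> [w0 [th [v [e s]]]] [w0' [th' [v' [e' s']]]].
exists (k *: w0 + w0'), (k *: th + th'), (k *: v + v'); split.
  by rewrite j_lin -e -e'.
exact: strong_lin.
Qed.

Definition strong_subspace : subspace Z := Subspace strong_data0 strong_data_lin.

(* Testing an orthogonal pair [(q, r)] against the data of [t |-> int_0^t r]
   gives [int |j r|^2 + lam / 2 |int_0^T r|^2 = 0]. *)
Lemma strong_data_dense (z : Z) : exists s : nat -> Z, (forall k, strong_data (s k)) /\ ncvg s z.
Proof.
apply: (@dense_of_orthogonal _ Z strong_subspace) => -[q r] hq.
have sr : sL2 mu J (sub_val r) by exact: sub_L2P.
pose rr : R -> V := sub_val r.
have orth w0 th : sL2 mu J th ->
   dot q (j w0) + L2dot mu J rr (fun t => jinv (th t) + lam *: (w0 + prim th t)) = 0.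
  move=> sth; have hs := strong_ex w0 sth; have [_ sh _ _ _] := hs.
  apply: (hq (j w0, L2_mk mJ sh)).
  by exists w0, th, (fun t => w0 + prim th t).
have r0 : {ae mu, forall t, J t -> nrm (rr t) = 0}.
  have ij : intg mu J (fun t => jdot (rr t) (rr t)) by exact: (intg_bilin jdot_bilinear jdot_pos mJ sr sr).
  have ae0 : {ae mu, forall t, J t -> jdot (rr t) (rr t) = 0}.
    apply: (ge0_Rintegral_eq0 mJ ij); first by move=> t _; exact: dot_ge0.
    have := orth 0 rr sr; have -> : j 0 = 0 by have := jB 0 0; rewrite !subrr.
    rewrite dot0r add0r => e.
    have ip : intg mu J (fun t => dot (prim rr t) (rr t)).
      apply: (sL2_dot mJ _ sr); apply: sL2_eq (prim_sL2 0 sr) => // t _.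
      by rewrite add0r subrr nrm0.
    have e2 : \int[mu]_(t in J) jdot (rr t) (rr t) + lam * \int[mu]_(t in J) dot (prim rr t) (rr t) = 0.
      rewrite -[RHS]e -(RintegralZl _ mJ ip) -(RintegralD mJ ij (intgZ mJ _ ip)).
      by apply: eq_Rintegral => t _; rewrite !dotE add0r (dotC (rr t) (jinv _)) jinvE (dotC (rr t) (prim _ _)).
    have := prim_self_ge0 sr; rewrite -(pmulr_rge0 _ lam0); lra.
  by apply: filterS ae0 => t h Jt; apply: j_inj; apply/nrm_eq0P; exact: h.
(* Once r vanishes almost everywhere, the solutions with v' = 0 show that q is orthogonal to the
   range of j. *)
have q0 : nrm q = 0.
  apply: j_dense => w; have := orth w 0 (sL2_0 mu mJ V).
  have [_ sh _ _ _] := strong_ex w (sL2_0 mu mJ V).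
  by rewrite (ae_L2dot_eq0 mJ r0 sr sh) addr0.
apply/nrm_eq0P; rewrite /dot/= /prod_dot/=.
rewrite -nrm_sqr q0 expr0n/= add0r.
exact: (ae_L2dot_eq0 mJ r0 sr sr).
Qed.

(** The equation integrated in time and tested with w: it involves no derivative of v and includes
    the initial value, and it can only be asked for almost every t since v matters up to null
    sets. *)
Definition parabolic_solution (v0 : H) (h v : R -> V) : Prop :=
  sL2 mu J v /\ {ae mu, forall t, J t -> forall w,
    jdot (v t) w = dot v0 (j w) + (\int[mu]_(r in J[t]) dot (h r) w - lam * \int[mu]_(r in J[t]) dot (v r) w)}.

(** The energy inequality for differences of strong solutions makes [v n] Cauchy in square mean with
    values in V, and [j (v n)] uniformly Cauchy on [0, T] with values in H. The limits [vv] and [v_]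
    agree almost everywhere; [v_] is the continuous representative in H. *)
Theorem parabolic_existence (v0 : H) (h : R -> V) : sL2 mu J h ->
  exists (v : R -> V) (v_ : R -> H),
    [/\ parabolic_solution v0 h v,
        ucont T v_ /\ {ae mu, forall t, J t -> nrm (j (v t) - v_ t) = 0},
        forall t, J t -> forall w, dot (v_ t) (j w) =
          dot v0 (j w) + (\int[mu]_(r in J[t]) dot (h r) w - lam * \int[mu]_(r in J[t]) dot (v r) w) &
        forall t, J t -> dot (v_ t) (v_ t) + lam * L2dot mu J[t] v v <=
           dot v0 v0 + lam^-1 * L2dot mu J[t] h h].
Proof.
move=> sh.
have [z [zs zc]] := strong_data_dense (v0, L2_mk mJ sh).
have /choice[W hW] (n : nat) : exists p : V * (R -> V) * (R -> V),
    (z n).1 = j p.1.1 /\ strong p.1.1 p.1.2 (sub_val (z n).2) p.2.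
  by have [w0 [th [v hv]]] := zs n; exists (w0, th, v).
pose w_ n := (W n).1.1; pose v n := (W n).2; pose h_ n : R -> V := sub_val (z n).2.
have sw n : strong (w_ n) (W n).1.2 (h_ n) (v n) by case: (hW n).
have sv n : sL2 mu J (v n) by case: (sw n).
have shn n : sL2 mu J (h_ n) by case: (sw n).
have zsq := (ncvg_sqr _ _).1 zc.
have zE n : dot (z n - (v0, L2_mk mJ sh)) (z n - (v0, L2_mk mJ sh)) =
    dot ((z n).1 - v0) ((z n).1 - v0) + L2dot mu J (h_ n - h) (h_ n - h) by [].
have cw : ncvg (fun n => j (w_ n)) v0.
  apply/ncvg_sqr; apply: (cvg0_le _ zsq) => n.
  have -> : j (w_ n) = (z n).1 by case: (hW n).
  by rewrite zE dot_ge0/= lerDl L2dot_ge0.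
have ch : L2cvg mu J h_ h.
  by apply: (cvg0_le _ zsq) => n; rewrite zE L2dot_ge0/= lerDr dot_ge0.
have zC : forall e : R, 0 < e -> exists N, forall m n, (N <= m)%N -> (N <= n)%N ->
    jdot (w_ m - w_ n) (w_ m - w_ n) + lam^-1 * L2dot mu J (h_ m - h_ n) (h_ m - h_ n) < e.
  move=> e e0.
  have [|N1 hN1] := ncvg_sqr_cauchy cw (e := e / 2); first lra.
  have lz : 0 < lam * (e / 2) by rewrite mulr_gt0//; lra.
  have ncz : ncvg (fun n => (z n).2) (L2_mk mJ sh) by apply/ncvg_sqr; exact: ch.
  have [N2 hN2] := ncvg_sqr_cauchy ncz lz.
  exists (maxn N1 N2) => m n; rewrite !geq_max => /andP[m1 m2] /andP[n1 n2].
  rewrite [ltRHS](_ : _ = e / 2 + e / 2); last by field.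
  apply: ltrD; first by rewrite /jdot jB; exact: hN1.
  by rewrite mulrC ltr_pdivrMr// mulrC; exact: hN2.
have En m n t : J t ->
    jdot (v m t - v n t) (v m t - v n t) + lam * L2dot mu J[t] (v m - v n) (v m - v n) <=
    jdot (w_ m - w_ n) (w_ m - w_ n) + lam^-1 * L2dot mu J (h_ m - h_ n) (h_ m - h_ n).
  move=> Jt; apply: le_trans (strong_energy (strongB (sw m) (sw n)) Jt) _.
  rewrite lerD2l ler_wpM2l ?invr_ge0 ?(ltW lam0)//; apply: L2dot_split_le.
    by move: Jt; rewrite /= in_itv/= => /andP[].
  exact: (sL2B mJ).
have JT : J T by rewrite /= in_itv/= T0 lexx.
have [vv svv cv] : exists2 vv, sL2 mu J vv & L2cvg mu J v vv.
  apply: (sL2_complete mJ sv) => e e0.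
  have [N hN] := zC _ (mulr_gt0 lam0 e0); exists N => m n Nm Nn.
  rewrite -(ltr_pM2l lam0); apply: le_lt_trans (hN m n Nm Nn).
  apply: le_trans (En m n T JT); rewrite lerDr; exact: dot_ge0.
have /choice[v_ hv_] t : exists x, J t -> ncvg (fun n => j (v n t)) x.
  have [Jt|nJ] := pselect (J t); last by exists 0.
  have [|x hx] := @ncauchy_cvg _ _ (fun n => j (v n t)); last by exists x.
  move=> e e0; have [|N hN] := zC (e ^+ 2); first exact: exprn_gt0.
  exists N => m n Nm Nn; rewrite -(@ltr_pXn2r _ 2) ?nnegrE ?nrm_ge0 ?(ltW e0)//.
  rewrite nrm_sqr -jB; apply: le_lt_trans (hN m n Nm Nn).
  by apply: le_trans (En m n t Jt); rewrite lerDl mulr_ge0 ?L2dot_ge0// ltW.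
have unif (e : R) : 0 < e -> exists N, forall n t, (N <= n)%N -> J t -> nrm (j (v n t) - v_ t) <= e.
  move=> e0; have [|N hN] := zC (e ^+ 2); first exact: exprn_gt0.
  exists N => n t Nn Jt.
  apply: (@cvg_le_near _ (fun m => nrm (j (v n t) - j (v m t))) _ _ N) => [|m Nm].
    by apply: ncvg_nrm; apply: ncvg_subr; exact: hv_.
  rewrite -(@ler_pXn2r _ 2) ?nnegrE ?nrm_ge0 ?(ltW e0)//.
  rewrite nrm_sqr -jB; apply: le_trans (ltW (hN n m Nn Nm)).
  by apply: le_trans (En _ _ t Jt); rewrite lerDl mulr_ge0 ?L2dot_ge0// ltW.
(* Each [v n] is, up to norm zero, a primitive and hence uniformly continuous; uniform convergence
   passes this on to [v_]. *)
have juc n : ucont T (fun t => j (v n t)).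
  have [sth _ _ _ _] := sw n; move=> e e0.
  have M1 : 0 < M + 1 by rewrite ltr_wpDl.
  have [d d0 hd] := prim_ucont (w_ n) sth (divr_gt0 e0 M1).
  exists d => // s t Js Jt st; rewrite -jB.
  apply: le_lt_trans (j_le _) _.
  have := hd s t Js Jt st; rewrite ltr_pdivlMr//; apply: le_lt_trans.
  have e1 x r : J r -> nrm (v n r - x) = nrm (w_ n + prim (W n).1.2 r - x).
    move=> Jr; apply: eq_nrm; rewrite opprB addrA subrK; exact: strong_nrm (sw n) Jr.
  rewrite (e1 _ s Js) nrm_sym (e1 _ t Jt) nrm_sym mulrC ler_wpM2l ?nrm_ge0//; lra.
have uv : ucont T v_.
  move=> e e0; have [|N hN] := unif (e / 3); first lra.
  have [|d d0 hd] := juc N (e / 3); first lra.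
  exists d => // s t Js Jt st.
  have h1 := hN N s (leqnn N) Js; have h2 := hN N t (leqnn N) Jt; have h3 := hd s t Js Jt st.
  apply: le_lt_trans (nrm_dist _ (j (v N s)) _) _.
  have := nrm_dist (j (v N s)) (j (v N t)) (v_ t); rewrite (nrm_sym (v_ s)); lra.
have weak t : J t -> forall w, dot (v_ t) (j w) =
    dot v0 (j w) + (\int[mu]_(r in J[t]) dot (h r) w - lam * \int[mu]_(r in J[t]) dot (vv r) w).
  move=> Jt w; have tT : t <= T by move: Jt; rewrite /= in_itv/= => /andP[].
  have c1 := ncvg_dot (y := j w) (hv_ t Jt); have c2 := ncvg_dot (y := j w) cw.
  have c3 := L2cvg_weak (y := w) tT shn sh ch; have c4 := L2cvg_weak (y := w) tT sv svv cv.
  apply: (cvg_uniq _ c1 (cvgD c2 (cvgB c3 (cvg_scale (k := lam) c4)))) => n.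
  exact: (strong_weak w (sw n) Jt).
have energy t : J t -> dot (v_ t) (v_ t) + lam * L2dot mu J[t] vv vv <=
           dot v0 v0 + lam^-1 * L2dot mu J[t] h h.
  move=> Jt; have tT : t <= T by move: Jt; rewrite /= in_itv/= => /andP[].
  have sub := sub_J0 tT.
  have cvt : L2dot mu J[t] (v n) (v n) @[n --> \oo] --> L2dot mu J[t] vv vv.
    by apply: (L2dot_cvg (mt t)) => [n|n||||]; try exact: (sL2S mJ (mt t) sub); exact: (L2cvgS (mt t) sub sv svv cv).
  have cht : L2dot mu J[t] (h_ n) (h_ n) @[n --> \oo] --> L2dot mu J[t] h h.
    by apply: (L2dot_cvg (mt t)) => [n|n||||]; try exact: (sL2S mJ (mt t) sub); exact: (L2cvgS (mt t) sub shn sh ch).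
  apply: (@le_cvg_seq R (fun n => dot (j (v n t)) (j (v n t)) + lam * L2dot mu J[t] (v n) (v n))
      (fun n => dot (j (w_ n)) (j (w_ n)) + lam^-1 * L2dot mu J[t] (h_ n) (h_ n))).
  - by apply: cvgD; [exact: (ncvg_dot2 (hv_ t Jt) (hv_ t Jt))|exact: cvg_scale].
  - by apply: cvgD; [exact: (ncvg_dot2 cw cw)|exact: cvg_scale].
  - by move=> n; exact: (strong_energy (sw n) Jt).
(* Both limits are compared in square mean with values in H, with [j (v n)] in between. *)
have aev : {ae mu, forall t, J t -> nrm (j (vv t) - v_ t) = 0}.
  have sjv u : sL2 mu J u -> sL2 mu J (fun t => j (u t)).
    move=> [su iu]; split; first by apply: (smeas_comp (M := M) _ su) => x y; rewrite -jB; exact: j_le.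
    exact: (intg_bilin jdot_bilinear jdot_pos mJ (conj su iu) (conj su iu)).

  have suv : smeas J v_ by exact: smeas_ucont.
  have sv_ : sL2 mu J v_.
    have [N hN] := unif 1 ltr01.
    split=> //; apply: (@intg_le _ _ _ mu J mJ _ (fun t => 2 * dot (j (v N t)) (j (v N t)) + 2)).
    + exact: measurable_dot.
    + apply: (intgD mJ); first by apply: (intgZ mJ); case: (sjv _ (sv N)).
      exact: (intg_cst mJ _ (J_fin T)).
    + move=> t Jt; rewrite ger0_norm ?dot_ge0//.
      have := sqr_nrmB (j (v N t)) (j (v N t) - v_ t); rewrite opprB addrCA subrr addr0.
      have := hN N t (leqnn N) Jt; rewrite -(nrm_sqr (_ - v_ t)) => hle.
      have : nrm (j (v N t) - v_ t) ^+ 2 <= 1 by rewrite exprn_ile1// nrm_ge0.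
      lra.
  have sd : sL2 mu J ((fun t => j (vv t)) - v_) by apply: (sL2B mJ) => //; exact: sjv.
  apply: (L2dot_eq0 mJ sd).
  suff hh (e : R) : 0 < e -> L2dot mu J ((fun t => j (vv t)) - v_) ((fun t => j (vv t)) - v_) <= 0 + e.
    by apply/ler_addgt0Pr.
  move=> e0.
  (* The squared distance of the two limits will be at most (2 M^2 + 2 T) e / D; the added 1 keeps D
     positive. *)
  pose D : R := 2 * M ^+ 2 + 2 * T + 1.
  have D0 : 0 < D by rewrite ltr_wpDl// addr_ge0// mulr_ge0// sqr_ge0.
  (* A distance below both 1 and e / D has its square below e / D. *)
  have [N1 hN1] := unif (Num.min 1 (e / D)) ltac:(by rewrite lt_min ltr01 divr_gt0).
  have [N2 hN2] := cvg0_lt cv (divr_gt0 e0 D0).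
  pose n := maxn N1 N2.
  have b1 := hN1 n _ (leq_maxl N1 N2); have b2 := hN2 n (leq_maxr N1 N2).
  have sdn := sL2B mJ (sv n) svv.
  have iF : intg mu J (fun t => (2 * M ^+ 2) * dot ((v n - vv) t) ((v n - vv) t) + 2 * (e / D)).
    by apply: (intgD mJ); [apply: (intgZ mJ); case: sdn|exact: (intg_cst mJ _ (J_fin T))].
  apply: (@le_trans _ _ (\int[mu]_(t in J) ((2 * M ^+ 2) * dot ((v n - vv) t) ((v n - vv) t) + 2 * (e / D)))).
    apply: (le_Rintegral mJ sd.2 iF) => t Jt.
    have -> : ((fun t => j (vv t)) - v_) t = (j (v n t) - v_ t) - (j (v n t - vv t)).
      have idn (a b c : H) : b - c = (a - c) - (a - b) by rewrite opprB [RHS]addrC addrA subrK.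
      by rewrite jB; exact: idn.
    apply: le_trans (sqr_nrmB _ _) _; rewrite addrC -!nrm_sqr; apply: lerD.
      rewrite -mulrA ler_wpM2l// -exprMn.
      have jn : nrm (j (v n t - vv t)) <= M * nrm ((v n - vv) t) by exact: (j_le (v n t - vv t)).
      by rewrite lerXn2r ?nnegrE ?nrm_ge0// mulr_ge0 ?nrm_ge0.
    rewrite ler_wpM2l//; have := b1 t Jt; rewrite le_min => /andP[c1 c2].
    by rewrite expr2; apply: le_trans c2; rewrite ler_piMr// nrm_ge0.
  have icst : intg mu J (fun=> 2 * (e / D)) by exact: (intg_cst mJ _ (J_fin T)).
  rewrite (RintegralD mJ (intgZ mJ _ sdn.2) icst) (RintegralZl _ mJ sdn.2) (Rintegral_cst mu mJ) add0r.
  have muT : fine (mu J) <= T.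
    rewrite -lee_fin fineK; last by rewrite ge0_fin_numE// J_fin.
    by rewrite -[T in leRHS]subr0; exact: lebesgue_itv_le.
  have eD : 0 <= e / D by rewrite divr_ge0 ?ltW.
  rewrite -[leRHS](divfK (lt0r_neq0 D0)).
  rewrite -/(L2dot mu J (v n - vv) (v n - vv)).
  have h1 : 2 * M ^+ 2 * L2dot mu J (v n - vv) (v n - vv) <= 2 * M ^+ 2 * (e / D).
    by rewrite ler_wpM2l ?mulr_ge0 ?sqr_ge0// ltW.
  have h2 : 2 * (e / D) * fine (mu J) <= 2 * (e / D) * T by rewrite ler_wpM2l// mulr_ge0.
  have -> : e / D * D = 2 * M ^+ 2 * (e / D) + 2 * (e / D) * T + e / D.
    by move: (e / D) => q; rewrite /D; ring.
  by apply: le_trans (lerD h1 h2) _; rewrite lerDl.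
exists vv, v_; split=> //.
split=> //; apply: filterS aev => t ht Jt w.
rewrite -weak//; apply/eqP; rewrite -subr_eq0 -dotBl.
by rewrite dot0_nrm// ht.
Qed.

(** Testing with w = v t gives |j v|^2 = - lam <int_0^t v, v>, whose integral over [0, T] is
    nonpositive by [prim_self_ge0]; j is injective up to norm zero. *)
Lemma parabolic_unique v : parabolic_solution 0 (fun=> 0) v -> {ae mu, forall t, J t -> nrm (v t) = 0}.
Proof.
move=> [sv hv].
have ij : intg mu J (fun t => jdot (v t) (v t)) by exact: (intg_bilin jdot_bilinear jdot_pos mJ sv sv).
have ip : intg mu J (fun t => dot (prim v t) (v t)).
  apply: (sL2_dot mJ _ sv); apply: sL2_eq (prim_sL2 0 sv) => // t _.
  by rewrite add0r subrr nrm0.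
have ae0 : {ae mu, forall t, J t -> jdot (v t) (v t) = 0}.
  apply: (ge0_Rintegral_eq0 mJ ij); first by move=> t _; exact: dot_ge0.
  have -> : \int[mu]_(t in J) jdot (v t) (v t) = \int[mu]_(t in J) (- lam * dot (prim v t) (v t)).
    apply: (Rintegral_ae mJ (intg_measurable ij) (intg_measurable (intgZ mJ _ ip))).
    apply: filterS hv => t ht Jt; rewrite ht// dot0l add0r.
    have tT : t <= T by move: Jt; rewrite /= in_itv/= => /andP[].
    rewrite (prim_dot _ tT sv) (@eq_Rintegral _ _ _ mu J[t] (fun=> 0)); last by move=> r _; rewrite dot0l.
    by rewrite Rintegral_cst ?mul0r ?sub0r ?mulNr//; exact: mt.
  rewrite (RintegralZl _ mJ ip) mulNr oppr_le0 mulr_ge0 ?(ltW lam0)//.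
  exact: prim_self_ge0.
by apply: filterS ae0 => t h Jt; apply: j_inj; apply/nrm_eq0P; exact: h.
Qed.

Lemma parabolicB v0 h v v0' h' v' : sL2 mu J h -> sL2 mu J h' ->
  parabolic_solution v0 h v -> parabolic_solution v0' h' v' ->
  parabolic_solution (v0 - v0') (h - h') (v - v').
Proof.
move=> sh sh' [sv hv] [sv' hv']; split; first exact: (sL2B mJ).
apply: filterS2 hv hv' => t ht ht' Jt w.
have tT : t <= T by move: Jt; rewrite /= in_itv/= => /andP[].
have sub := sub_J0 tT.
have -> : jdot ((v - v') t) w = jdot (v t) w - jdot (v' t) w by exact: (bilinBl jdot_bilinear).
rewrite ht// ht'// dotBl.
have d u u' : sL2 mu J u -> sL2 mu J u' -> \int[mu]_(r in J[t]) dot ((u - u') r) w =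
    \int[mu]_(r in J[t]) dot (u r) w - \int[mu]_(r in J[t]) dot (u' r) w.
  move=> su su'; rewrite -(RintegralB (mt t) (intg_dotr w (mt t) sub su) (intg_dotr w (mt t) sub su')).
  by apply: eq_Rintegral => r _; rewrite dotBl.
rewrite d// d//; ring.
Qed.

(** By uniqueness any solution agrees almost everywhere with the constructed one and inherits its
    energy bound. *)
Lemma parabolic_sqr_le v0 h v : sL2 mu J h -> parabolic_solution v0 h v ->
  forall t, J t -> lam * L2dot mu J[t] v v <= dot v0 v0 + lam^-1 * L2dot mu J[t] h h.
Proof.
move=> sh pv t Jt; have [v' [v_ [pv' _ _ E]]] := parabolic_existence v0 sh.
have tT : t <= T by move: Jt; rewrite /= in_itv/= => /andP[].
have sub := sub_J0 tT.
have := parabolicB sh sh pv pv'; rewrite !subrr => /parabolic_unique ae0.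
have -> : L2dot mu J[t] v v = L2dot mu J[t] v' v'.
  have [sv _] := pv; have [sv' _] := pv'.
  apply: (Rintegral_ae (mt t)).
  - exact: (intg_measurable (sL2S mJ (mt t) sub sv).2).
  - exact: (intg_measurable (sL2S mJ (mt t) sub sv').2).
  apply: filterS ae0 => r hr /sub Jr; rewrite -!nrm_sqr.
  by congr (_ ^+ 2); apply: eq_nrm; exact: hr.
by apply: le_trans (E t Jt); rewrite lerDr dot_ge0.
Qed.

End Parabolic.

(** * Picard iteration *)

Section ExponentialWeight.
Context {R : realType}.
Local Notation mu := (@lebesgue_measure R).
Local Notation TR := (measurableTypeR R).

Lemma is_derive_expM (g x : R) : is_derive x 1 (fun s : R => g^-1 * expR (g * s)) (g^-1 * (g * expR (g * x))).
Proof.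
have h1 : is_derive x (1 : R) (fun s : R => g * s) g.
  have := @is_deriveZ R R R id g x 1 1 _; rewrite /GRing.scale/= mulr1; exact.
have := is_deriveZ (g^-1) (is_derive1_comp (is_derive_expR (g * x)) h1).
by rewrite /GRing.scale/= (mulrC (expR _)).
Qed.

Lemma continuous_expM (g x : R) : {for x, continuous (fun s : R => expR (g * s))}.
Proof.
apply: continuous_comp; last exact: continuous_expR.
by apply: cvgM; [exact: cvg_cst|exact: cvg_id].
Qed.

Lemma intg_expM (g t : R) : intg mu (`[0, t]%classic : set TR) (fun s => expR (g * s)).
Proof.
apply: continuous_compact_integrable; first exact: segment_compact.
by apply: continuous_subspaceT => x; exact: continuous_expM.
Qed.

(** The factor [g^-1] is the gain of the exponential weight: each integration in time makes the
    constant smaller when g is large. *)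
Lemma Rintegral_expM_le (g t : R) : 0 < g -> 0 <= t ->
  \int[mu]_(s in `[0, t]) expR (g * s) <= g^-1 * expR (g * t).
Proof.
move=> g0; rewrite le_eqVlt => /predU1P[<-|t0].
  by rewrite set_itv1 Rintegral_set1 mulr_ge0 ?invr_ge0 ?expR_ge0// ltW.
rewrite /Rintegral (continuous_FTC2 (F := fun s : R => g^-1 * expR (g * s)) t0).
- by rewrite -EFinB /= lerBlDr lerDl mulr_ge0 ?invr_ge0 ?expR_ge0// ltW.
- by apply: continuous_subspaceT => x; exact: continuous_expM.
- have dF (x : R) : derivable (fun s : R => g^-1 * expR (g * s)) x 1.
    by have [] := is_derive_expM g x.
  have cF (x : R) : {for x, continuous (fun s : R => g^-1 * expR (g * s))}.
    by apply: differentiable_continuous; exact/derivable1_diffP.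
  split=> [x _||]; first exact: dF.
    by apply: cvg_at_right_filter; exact: cF.
  by apply: cvg_at_left_filter; exact: cF.
- move=> x _; rewrite derive1E (@derive_val _ _ _ _ _ _ _ (is_derive_expM g x)).
  by rewrite mulrA mulVf ?mul1r// gt_eqF.
Qed.

End ExponentialWeight.

Section Picard.
Context {R : realType} (T lam M K2 : R) (V H : semiHilbert R) (j : V -> H).
Hypothesis T0 : 0 <= T.
Hypothesis lam0 : 0 < lam.
Hypothesis M0 : 0 <= M.
Hypothesis K0 : 0 <= K2.
Hypothesis j_lin : forall k x y, j (k *: x + y) = k *: j x + j y.
Hypothesis j_le : forall x, nrm (j x) <= M * nrm x.
Hypothesis j_inj : forall x, nrm (j x) = 0 -> nrm x = 0.
Hypothesis j_dense : forall q, (forall w, dot q (j w) = 0) -> nrm q = 0.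
Local Notation mu := (@lebesgue_measure R).
Local Notation TR := (measurableTypeR R).
Local Notation J := (`[0, T]%classic : set TR).
Local Notation "J[ t ]" := (`[0, t]%classic : set TR) (at level 0, format "J[ t ]").

Variable Phi : (R -> V) -> (R -> V).
Hypothesis Phi_L2 : forall w, sL2 mu J w -> sL2 mu J (Phi w).
Hypothesis Phi_lip : forall w1 w2, sL2 mu J w1 -> sL2 mu J w2 -> forall t, J t ->
  L2dot mu J[t] (Phi w1 - Phi w2) (Phi w1 - Phi w2) <= K2 * L2dot mu J[t] (w1 - w2) (w1 - w2).
Variables (u0 : V) (v0 : H).

Let mJ : measurable J := measurable_itvR _.
Let mt t : measurable J[t] := measurable_itvR _.
Let Jle t : J t -> t <= T. Proof. by rewrite /= in_itv/= => /andP[]. Qed.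
Let Jge t : J t -> 0 <= t. Proof. by rewrite /= in_itv/= => /andP[]. Qed.

Definition primitive_from (v : R -> V) : R -> V := fun t => u0 + prim v t.
(* With v = eta', the problem reads v' + lam A v = f(eta) - A eta. *)
Definition rhs (v : R -> V) : R -> V := Phi (primitive_from v) - primitive_from v.

Lemma sL2_primitive v : sL2 mu J v -> sL2 mu J (primitive_from v).
Proof. exact: prim_sL2. Qed.

Lemma sL2_rhs v : sL2 mu J v -> sL2 mu J (rhs v).
Proof. by move=> sv; apply: (sL2B mJ); [apply: Phi_L2|]; exact: sL2_primitive. Qed.

Lemma L2dot_lin_le (A : set TR) (X Y Z : semiHilbert R) (a b : R) (u : R -> X) (v : R -> Y) (w : R -> Z) :
  measurable A -> sL2 mu A u -> sL2 mu A v -> sL2 mu A w ->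
  (forall t, A t -> dot (u t) (u t) <= a * dot (v t) (v t) + b * dot (w t) (w t)) ->
  L2dot mu A u u <= a * L2dot mu A v v + b * L2dot mu A w w.
Proof.
move=> mA su sv sw h; rewrite /L2dot -(RintegralZl _ mA sv.2) -(RintegralZl _ mA sw.2).
rewrite -(RintegralD mA (intgZ mA _ sv.2) (intgZ mA _ sw.2)).
exact: (le_Rintegral mA su.2 (intgD mA (intgZ mA _ sv.2) (intgZ mA _ sw.2))).
Qed.

Lemma L2dot_le_exp (t g B : R) (u : R -> V) : J t -> 0 < g -> 0 <= B -> sL2 mu J u ->
  (forall s, J s -> s <= t -> dot (u s) (u s) <= B * expR (g * s)) ->
  L2dot mu J[t] u u <= B * (g^-1 * expR (g * t)).
Proof.
move=> Jt g0 B0 su h; have su' := sL2S mJ (mt t) (sub_J0 (Jle Jt)) su.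
apply: (@le_trans _ _ (\int[mu]_(s in J[t]) (B * expR (g * s)))).
  apply: (le_Rintegral (mt t) su'.2 (intgZ (mt t) _ (intg_expM g t))) => s Js.
  apply: h; first exact: sub_J0 (Jle Jt) _ Js.
  by move: Js; rewrite /= in_itv/= => /andP[].
by rewrite (RintegralZl _ (mt t) (intg_expM g t)) ler_wpM2l// Rintegral_expM_le// Jge.
Qed.

Lemma prim_diff_sqr v1 v2 s : J s -> sL2 mu J v1 -> sL2 mu J v2 ->
  dot ((primitive_from v1 - primitive_from v2) s) ((primitive_from v1 - primitive_from v2) s) <=
  T * L2dot mu J[s] (v1 - v2) (v1 - v2).
Proof.
move=> Js sv1 sv2; have sB := sL2B mJ sv1 sv2.
have e : nrm ((primitive_from v1 - primitive_from v2) s - prim (v1 - v2) s) = 0.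
  apply/nrm_eq0P; set z := _ - prim _ _.
  suff h y : dot ((primitive_from v1 - primitive_from v2) s - prim (v1 - v2) s) y = 0 by exact: h.
  have e0 : v1 - v2 = -1 *: v2 + v1 by rewrite scaleN1r addrC.
  rewrite e0 dotBl (prim_lin (-1) y (Jle Js) sv2 sv1).
  have -> : (primitive_from v1 - primitive_from v2) s = prim v1 s - prim v2 s.
    have -> : (primitive_from v1 - primitive_from v2) s = (u0 + prim v1 s) - (u0 + prim v2 s) by [].
    by rewrite opprD addrACA subrr add0r.
  by rewrite dotBl; ring.
rewrite -nrm_sqr (eq_nrm e) nrm_sqr.
apply: le_trans (prim_bound (Jge Js) (Jle Js) sB) _.
by rewrite ler_wpM2r ?L2dot_ge0// Jle.
Qed.

Lemma rhs_diff t v1 v2 : J t -> sL2 mu J v1 -> sL2 mu J v2 ->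
  L2dot mu J[t] (rhs v1 - rhs v2) (rhs v1 - rhs v2) <=
  2 * (K2 + 1) * L2dot mu J[t] (primitive_from v1 - primitive_from v2) (primitive_from v1 - primitive_from v2).
Proof.
move=> Jt sv1 sv2; have sub := sub_J0 (Jle Jt).
have s1 := sL2_primitive sv1; have s2 := sL2_primitive sv2.
have h := Phi_lip s1 s2 Jt.
have sP := sL2S mJ (mt t) sub (sL2B mJ (Phi_L2 s1) (Phi_L2 s2)).
have sE := sL2S mJ (mt t) sub (sL2B mJ s1 s2).
have sR := sL2S mJ (mt t) sub (sL2B mJ (sL2_rhs sv1) (sL2_rhs sv2)).
apply: (@le_trans _ _ (2 * L2dot mu J[t] (Phi (primitive_from v1) - Phi (primitive_from v2)) (Phi (primitive_from v1) - Phi (primitive_from v2)) + 2 * L2dot mu J[t] (primitive_from v1 - primitive_from v2) (primitive_from v1 - primitive_from v2))).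
  apply: (L2dot_lin_le (mt t) sR sP sE) => s _.
  have -> : (rhs v1 - rhs v2) s = (Phi (primitive_from v1) - Phi (primitive_from v2)) s - (primitive_from v1 - primitive_from v2) s.
    have e (a b c d : V) : (a - b) - (c - d) = (a - c) - (b - d).
      by rewrite !opprB addrACA [RHS]addrACA (addrC (- b)).
    exact: e.
  exact: sqr_nrmB.
rewrite [leRHS](_ : forall b, 2 * (K2 + 1) * b = 2 * (K2 * b) + 2 * b) => [|b]; last by ring.
by rewrite lerD2r ler_wpM2l.
Qed.

(** Chosen so that lam^-2 (K2 + 1) T / rate <= 1/16. The contraction uses twice this quantity and
    needs at most 1/4; Gronwall's argument uses six times it and needs at most 1/2. The summand 1 in
    [T + 1] keeps the rate positive for T = 0. *)
Definition rate : R := 16 * (K2 + 1) * (T + 1) * lam^-1 * lam^-1.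

Lemma rate_gt0 : 0 < rate.
Proof. by rewrite /rate !mulr_gt0 ?invr_gt0// ltr_wpDl. Qed.

Lemma lam2_rate : lam^-1 * lam^-1 * ((K2 + 1) * T * rate^-1) <= 16^-1.
Proof.
have T1 : 0 < T + 1 by rewrite ltr_wpDl.
have K1 : 0 < K2 + 1 by rewrite ltr_wpDl.
have -> : lam^-1 * lam^-1 * ((K2 + 1) * T * rate^-1) = 16^-1 * (T / (T + 1)).
  by rewrite /rate; field; rewrite !gt_eqF.
by rewrite ler_piMr// ler_pdivrMr// mul1r lerDl.
Qed.

(** The least admissible B is the square of the weighted norm of v1 - v2, the supremum of exp(- rate
    s) times the integral of |v1 - v2|^2 over [0, s]. One step costs the Lipschitz constant and two
    factors lam^-1; integrating the primitives gains T / rate. *)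
Lemma picard_contraction (B : R) v1 v2 w1 w2 : 0 <= B -> sL2 mu J v1 -> sL2 mu J v2 ->
  parabolic_solution T lam j v0 (rhs v1) w1 -> parabolic_solution T lam j v0 (rhs v2) w2 ->
  (forall s, J s -> L2dot mu J[s] (v1 - v2) (v1 - v2) <= B * expR (rate * s)) ->
  forall t, J t -> L2dot mu J[t] (w1 - w2) (w1 - w2) <= B / 4 * expR (rate * t).
Proof.
move=> B0 sv1 sv2 p1 p2 hB t Jt.
have p := parabolicB j_lin j_le (sL2_rhs sv1) (sL2_rhs sv2) p1 p2.
have := parabolic_sqr_le T0 lam0 M0 j_lin j_le j_inj j_dense (sL2B mJ (sL2_rhs sv1) (sL2_rhs sv2)) p Jt.
rewrite subrr dot0l add0r => h1.
have h2 := rhs_diff Jt sv1 sv2.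
have sE := sL2B mJ (sL2_primitive sv1) (sL2_primitive sv2).
have h3 : L2dot mu J[t] (primitive_from v1 - primitive_from v2) (primitive_from v1 - primitive_from v2) <= (T * B) * (rate^-1 * expR (rate * t)).
  apply: (L2dot_le_exp Jt rate_gt0 _ sE); first exact: mulr_ge0.
  move=> s Js _; apply: le_trans (prim_diff_sqr Js sv1 sv2) _.
  by rewrite -mulrA ler_wpM2l// hB.
rewrite -(ler_pM2l lam0); apply: le_trans h1 _.
rewrite -(ler_pM2l (_ : 0 < lam^-1)) ?invr_gt0// [leRHS]mulrA mulVf ?gt_eqF// mul1r.
have ll : 0 <= lam^-1 * lam^-1 by rewrite mulr_ge0// invr_ge0 ltW.
have K1 : 0 <= 2 * (K2 + 1) by rewrite mulr_ge0// addr_ge0.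
rewrite mulrA; apply: le_trans (ler_wpM2l ll (le_trans h2 (ler_wpM2l K1 h3))) _.
have -> : lam^-1 * lam^-1 * (2 * (K2 + 1) * (T * B * (rate^-1 * expR (rate * t)))) =
   (lam^-1 * lam^-1 * ((K2 + 1) * T * rate^-1)) * (2 * (B * expR (rate * t))) by ring.
have BE : 0 <= B * expR (rate * t) by rewrite mulr_ge0 ?expR_ge0.
apply: le_trans (ler_wpM2r (mulr_ge0 _ BE) lam2_rate) _ => //.
rewrite [leRHS]mulrAC; move: BE; move: (B * expR _) => X; lra.
Qed.

Lemma expR_rate_ge1 s : J s -> 1 <= expR (rate * s).
Proof. by move=> Js; rewrite -expR0 ler_expR mulr_ge0 ?(ltW rate_gt0)// Jge. Qed.

Lemma L2dot_J_exp (u : R -> V) s : sL2 mu J u -> J s ->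
  L2dot mu J[s] u u <= L2dot mu J u u * expR (rate * s).
Proof.
move=> su Js; apply: le_trans (L2dot_split_le (Jle Js) su) _.
by rewrite ler_peMr ?L2dot_ge0// expR_rate_ge1.
Qed.

Lemma picard_unique v1 v2 : parabolic_solution T lam j v0 (rhs v1) v1 ->
  parabolic_solution T lam j v0 (rhs v2) v2 -> {ae mu, forall t, J t -> nrm (v1 t - v2 t) = 0}.
Proof.
move=> p1 p2; have sv1 := p1.1; have sv2 := p2.1.
have sB := sL2B mJ sv1 sv2.
pose B := L2dot mu J (v1 - v2) (v1 - v2).
have B0 : 0 <= B by exact: L2dot_ge0.
have it (n : nat) : forall t, J t -> L2dot mu J[t] (v1 - v2) (v1 - v2) <= (B * 4^-1 ^+ n) * expR (rate * t).
  elim: n => [|n ih]; first by move=> t Jt; rewrite expr0 mulr1; exact: L2dot_J_exp.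
  have Bn : 0 <= B * 4^-1 ^+ n by rewrite mulr_ge0 ?exprn_ge0 ?invr_ge0.
  move=> t Jt; have := picard_contraction Bn sv1 sv2 p1 p2 ih Jt.
  by rewrite exprSr mulrA.
apply: (L2dot_eq0 mJ sB).
have JT : J T by rewrite /= in_itv/= T0 lexx.
apply: (@le_cvg_seq R (fun=> L2dot mu J (v1 - v2) (v1 - v2)) (fun n => (B * expR (rate * T)) * 4^-1 ^+ n)).
- exact: cvg_cst.
- rewrite -[X in _ --> X](mulr0 (B * expR (rate * T))); apply: cvg_scale.
  by apply: cvg_expr; rewrite ger0_norm ?invr_ge0// invf_lt1// ltr1n.
- by move=> n; rewrite mulrAC; exact: it.
Qed.

Theorem picard_existence : exists (v : R -> V) (v_ : R -> H),
  [/\ sL2 mu J v,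
      ucont T v_ /\ {ae mu, forall t, J t -> nrm (j (v t) - v_ t) = 0},
      forall t, J t -> forall w, dot (v_ t) (j w) =
          dot v0 (j w) + (\int[mu]_(r in J[t]) dot (rhs v r) w - lam * \int[mu]_(r in J[t]) dot (v r) w) &
      forall t, J t -> dot (v_ t) (v_ t) + lam * L2dot mu J[t] v v <=
           dot v0 v0 + lam^-1 * L2dot mu J[t] (rhs v) (rhs v)].
Proof.
have solve h : sL2 mu J h -> exists v, parabolic_solution T lam j v0 h v.
  move=> sh; have [v [v_ [p _ _ _]]] := parabolic_existence T0 lam0 M0 j_lin j_le j_inj j_dense v0 sh.
  by exists v.
(* The solution operator is a choice and satisfies the equation only on square integrable inputs,
   where all iterates stay. *)
have /choice[S hS] (v : R -> V) : exists w, sL2 mu J v -> parabolic_solution T lam j v0 (rhs v) w.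
  have [sv|] := pselect (sL2 mu J v); last by exists v.
  by have [w hw] := solve _ (sL2_rhs sv); exists w.
pose x n := iter n S (0 : R -> V).
have sx n : sL2 mu J (x n).
  elim: n => [|n ih]; first exact: (sL2_0 mu mJ V).
  by case: (hS _ ih).
pose B := L2dot mu J (x 1%N - x 0%N) (x 1%N - x 0%N).
have B0 : 0 <= B by exact: L2dot_ge0.
have JT : J T by rewrite /= in_itv/= T0 lexx.
have it (n : nat) : forall t, J t -> L2dot mu J[t] (x n.+1 - x n) (x n.+1 - x n) <= (B * 4^-1 ^+ n) * expR (rate * t).
  elim: n => [|n ih]; first by move=> t Jt; rewrite expr0 mulr1; apply: L2dot_J_exp => //; exact: (sL2B mJ).
  have Bn : 0 <= B * 4^-1 ^+ n by rewrite mulr_ge0 ?exprn_ge0 ?invr_ge0.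
  move=> t Jt; have := picard_contraction Bn (sx n.+1) (sx n) (hS _ (sx n.+1)) (hS _ (sx n)) ih Jt.
  by rewrite exprSr mulrA.
pose C := Num.sqrt (B * expR (rate * T)).
have cx : ncauchy (fun n => L2_mk mJ (sx n)).
  apply: (@geometric_ncauchy _ _ _ C) => n.
  have BT : 0 <= B * expR (rate * T) by rewrite mulr_ge0 ?expR_ge0.
  rewrite -(@ler_pXn2r _ 2) ?nnegrE ?mulr_ge0 ?sqrtr_ge0 ?exprn_ge0 ?invr_ge0 ?nrm_ge0//.
  rewrite nrm_sqr exprMn sqr_sqrtr// -exprM mulnC exprM.
  rewrite (_ : 2^-1 ^+ 2 = 4^-1 :> R); last by rewrite expr2; field.
  by rewrite mulrAC; exact: (it n T JT).
have [y hy] := ncauchy_cvg cx.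
pose v : R -> V := sub_val y.
have sv : sL2 mu J v by exact: sub_L2P.
have cv : L2cvg mu J x v by exact: (ncvg_sqr _ _).1 hy.
(* The linear problem is solved once more, for the right-hand side of the limit v. The iterates
   converge to both v and w, so these agree almost everywhere, and the continuous representative and
   the energy bound of w serve for v. *)
have [w [w_ [pw [uw aew] weak energy]]] := parabolic_existence T0 lam0 M0 j_lin j_le j_inj j_dense v0 (sL2_rhs sv).
have sw := pw.1.
have key n : L2dot mu J (x n.+1 - w) (x n.+1 - w) <= L2dot mu J (x n - v) (x n - v) / 4 * expR (rate * T).
  apply: (picard_contraction _ (sx n) sv (hS _ (sx n)) pw _ JT); first exact: L2dot_ge0.
  by move=> s Js; apply: L2dot_J_exp => //; exact: (sL2B mJ).
have cw : ncvg (fun n => L2_mk mJ (sx n.+1)) (L2_mk mJ sw).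
  apply/ncvg_sqr; apply: (@cvg0_le _ _ (fun n => (4^-1 * expR (rate * T)) * L2dot mu J (x n - v) (x n - v))).
    move=> n; rewrite dot_ge0/=; apply: le_trans (key n) _.
    by rewrite mulrC mulrA (mulrC (expR _)) mulrC mulrA mulrAC.
  by rewrite -[X in _ --> X](mulr0 (4^-1 * expR (rate * T))); exact: cvg_scale.
have cv1 : ncvg (fun n => L2_mk mJ (sx n.+1)) y.
  apply/ncvgP => e /((ncvgP _ _).1 hy e)[N hN]; exists N => n Nn.
  exact: (hN n.+1 (leqW Nn)).
have ewv : nrm (y - L2_mk mJ sw) = 0 := ncvg_unique cv1 cw.
have aewv : {ae mu, forall t, J t -> nrm ((v - w) t) = 0}.
  by apply: (L2dot_eq0 mJ (sL2B mJ sv sw)); rewrite -[leLHS](nrm_sqr (y - L2_mk mJ sw)) ewv expr0n.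
have vw_dot t z : J t -> \int[mu]_(r in J[t]) dot (w r) z = \int[mu]_(r in J[t]) dot (v r) z.
  move=> Jt; have sub := sub_J0 (Jle Jt).
  apply: (Rintegral_ae (mt t)).
  - exact: (intg_measurable (intg_dotr z (mt t) sub sw)).
  - exact: (intg_measurable (intg_dotr z (mt t) sub sv)).
  apply: filterS aewv => r hr /sub Jr; apply/esym/eqP; rewrite -subr_eq0 -dotBl.
  by rewrite dot0_nrm//; exact: hr.
exists v, w_; split=> //.
- split=> //; apply: filterS2 aewv aew => t h1 h2 Jt.
  apply: nrm_sub0_trans (h2 Jt); apply/eqP; rewrite eq_le nrm_ge0 andbT.
  rewrite -(jB j_lin); apply: le_trans (j_le _) _.
  by have -> := h1 Jt; rewrite mulr0.
- by move=> t Jt z; rewrite weak// vw_dot.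
- move=> t Jt; have -> : L2dot mu J[t] v v = L2dot mu J[t] w w; last exact: energy.
  have sub := sub_J0 (Jle Jt).
  apply: (Rintegral_ae (mt t)).
  - exact: (intg_measurable (sL2S mJ (mt t) sub sv).2).
  - exact: (intg_measurable (sL2S mJ (mt t) sub sw).2).
  by apply: filterS aewv => r hr /sub Jr; rewrite -!nrm_sqr (eq_nrm (hr Jr)).
Qed.

End Picard.

(** * The a priori estimate *)

Section PicardEnergy.
Context {R : realType} (T lam K2 : R) (V H : semiHilbert R).
Hypothesis T0 : 0 <= T.
Hypothesis lam0 : 0 < lam.
Hypothesis K0 : 0 <= K2.
Local Notation mu := (@lebesgue_measure R).
Local Notation TR := (measurableTypeR R).
Local Notation J := (`[0, T]%classic : set TR).
Local Notation "J[ t ]" := (`[0, t]%classic : set TR) (at level 0, format "J[ t ]").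

Variable Phi : (R -> V) -> (R -> V).
Hypothesis Phi_L2 : forall w, sL2 mu J w -> sL2 mu J (Phi w).
Hypothesis Phi_lip : forall w1 w2, sL2 mu J w1 -> sL2 mu J w2 -> forall t, J t ->
  L2dot mu J[t] (Phi w1 - Phi w2) (Phi w1 - Phi w2) <= K2 * L2dot mu J[t] (w1 - w2) (w1 - w2).
Variables (u0 : V) (v0 : H).

Let mJ : measurable J := measurable_itvR _.
Let mt t : measurable J[t] := measurable_itvR _.
Let Jle t : J t -> t <= T. Proof. by rewrite /= in_itv/= => /andP[]. Qed.
Let Jge t : J t -> 0 <= t. Proof. by rewrite /= in_itv/= => /andP[]. Qed.

Let eta (v : R -> V) := primitive_from u0 v.
Let phi0 : R -> V := Phi 0.
Let rate := rate T lam K2.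

Definition data_sqr : R := dot u0 u0 + dot v0 v0 + L2dot mu J phi0 phi0.

Lemma eta_sqr v s : J s -> sL2 mu J v ->
  dot (eta v s) (eta v s) <= 2 * dot u0 u0 + 2 * (T * L2dot mu J[s] v v).
Proof.
move=> Js sv; apply: le_trans (sqr_nrmD _ _) _; rewrite lerD2l ler_wpM2l//.
apply: le_trans (prim_bound (Jge Js) (Jle Js) sv) _.
by rewrite ler_wpM2r ?L2dot_ge0// Jle.
Qed.

Lemma rhs_sqr v t : J t -> sL2 mu J v ->
  L2dot mu J[t] (rhs Phi u0 v) (rhs Phi u0 v) <=
  3 * L2dot mu J phi0 phi0 + 3 * (K2 + 1) * L2dot mu J[t] (eta v) (eta v).
Proof.
move=> Jt sv; have sub := sub_J0 (Jle Jt).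
have s0 := sL2_0 mu mJ V.
have se : sL2 mu J (eta v) by exact: sL2_primitive.
have h := Phi_lip se s0 Jt; rewrite subr0 in h.
have sP := sL2S mJ (mt t) sub (sL2B mJ (Phi_L2 se) (Phi_L2 s0)).
have sp0 := sL2S mJ (mt t) sub (Phi_L2 s0).
have se' := sL2S mJ (mt t) sub se.
have sR := sL2S mJ (mt t) sub (sL2_rhs Phi_L2 u0 sv).
have sPe : sL2 mu J[t] (Phi (eta v) - Phi 0 - eta v) := sL2B (mt t) sP se'.
(* The weights come from |a + b|^2 <= 3 |a|^2 + (3/2) |b|^2, that is |2 a - b|^2 >= 0; doubling for
   the two parts of b then gives 3 in front of all three terms. *)
have h1 : L2dot mu J[t] (rhs Phi u0 v) (rhs Phi u0 v) <=
   3 * L2dot mu J[t] phi0 phi0 + (3 / 2) * L2dot mu J[t] (Phi (eta v) - Phi 0 - eta v) (Phi (eta v) - Phi 0 - eta v).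
  apply: (L2dot_lin_le (mt t) sR sp0 sPe) => s _.
  have -> : rhs Phi u0 v s = phi0 s + (Phi (eta v) - Phi 0 - eta v) s.
    have e (a b c : V) : a - b = c + (a - c - b) by rewrite addrA [c + _]addrC subrK.
    exact: e.
  rewrite -/phi0; move: (phi0 s) ((Phi (eta v) - Phi 0 - eta v) s) => a b.
  have := dot_ge0 (2 *: a - b); rewrite !dotE (dotC b a).
  move: (dot a a) (dot a b) (dot b b) => x y z; lra.
have h2 : L2dot mu J[t] (Phi (eta v) - Phi 0 - eta v) (Phi (eta v) - Phi 0 - eta v) <=
   2 * L2dot mu J[t] (Phi (eta v) - Phi 0) (Phi (eta v) - Phi 0) + 2 * L2dot mu J[t] (eta v) (eta v).
  by apply: (L2dot_lin_le (mt t) sPe sP se') => s _; exact: sqr_nrmB.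
have h3 := L2dot_split_le (Jle Jt) (Phi_L2 s0).
move: h h1 h2 h3.
move: (L2dot mu J[t] (rhs Phi u0 v) _) (L2dot mu J[t] phi0 _) (L2dot mu J phi0 _)
  (L2dot mu J[t] (Phi (eta v) - Phi 0 - eta v) _) (L2dot mu J[t] (Phi (eta v) - Phi 0) _)
  (L2dot mu J[t] (eta v) (eta v)) => *; lra.
Qed.

Lemma L2dot_const_le (t A B g : R) (u : R -> V) : J t -> 0 < g -> 0 <= A -> 0 <= B -> sL2 mu J u ->
  (forall s, J s -> s <= t -> dot (u s) (u s) <= A + B * expR (g * s)) ->
  L2dot mu J[t] u u <= A * T + B * (g^-1 * expR (g * t)).
Proof.
move=> Jt g0 A0 B0 su h; have su' := sL2S mJ (mt t) (sub_J0 (Jle Jt)) su.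
have icst : intg mu J[t] (fun=> A).
  by apply: (intg_cst (mt t)); exact: lebesgue_itv_fin.
have ie := intgZ (mt t) B (intg_expM g t).
apply: (@le_trans _ _ (\int[mu]_(s in J[t]) (A + B * expR (g * s)))).
  apply: (le_Rintegral (mt t) su'.2 (intgD (mt t) icst ie)) => s Js.
  apply: h; first exact: sub_J0 (Jle Jt) _ Js.
  by move: Js; rewrite /= in_itv/= => /andP[].
rewrite (RintegralD (mt t) icst ie) (RintegralZl _ (mt t) (intg_expM g t)) (Rintegral_cst mu (mt t)).
apply: lerD; last by rewrite ler_wpM2l// Rintegral_expM_le// Jge.
rewrite ler_wpM2l// -lee_fin fineK; last by rewrite ge0_fin_numE// lebesgue_itv_fin.
apply: le_trans (lebesgue_itv_le _ _ (Jge Jt)) _.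
by rewrite subr0 lee_fin Jle.
Qed.

(** Twice the constant [c1] of [picard_gronwall], since 2 c1 D is the fixed point of B |-> c1 D + B
    / 2; the exponential is the weight at time T. *)
Definition gronwall_const : R :=
  2 * (lam^-1 + lam^-1 * lam^-1 * (3 + 6 * (K2 + 1) * T)) * expR (rate * T).

(** If the squared norm over [0, t] is at most B exp(rate t), the energy inequality improves B to c1
    D + B / 2, where D is the size of the data. Starting from the finite norm over [0, T], the
    iteration drives B down to 2 c1 D. *)
Lemma picard_gronwall v :
  sL2 mu J v ->
  (forall t, J t -> lam * L2dot mu J[t] v v <= dot v0 v0 + lam^-1 * L2dot mu J[t] (rhs Phi u0 v) (rhs Phi u0 v)) ->
  forall t, J t -> L2dot mu J[t] v v <= gronwall_const * data_sqr.
Proof.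
move=> sv hE.
pose c1 := lam^-1 + lam^-1 * lam^-1 * (3 + 6 * (K2 + 1) * T).
have l0 : 0 <= lam^-1 by rewrite invr_ge0 ltW.
have ll : 0 <= lam^-1 * lam^-1 by rewrite mulr_ge0.
have K1 : 0 <= K2 + 1 by rewrite addr_ge0.
have c10 : 0 <= c1 by rewrite /c1 !(addr_ge0, mulr_ge0).
have uu := dot_ge0 u0; have vv := dot_ge0 v0.
have pp : 0 <= L2dot mu J phi0 phi0 by exact: L2dot_ge0.
have d0 : 0 <= data_sqr by rewrite /data_sqr !addr_ge0.
have rg : 0 < rate by exact: rate_gt0.
have step (B : R) : 0 <= B -> (forall s, J s -> L2dot mu J[s] v v <= B * expR (rate * s)) ->
    forall t, J t -> L2dot mu J[t] v v <= (c1 * data_sqr + B / 2) * expR (rate * t).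
  move=> B0 hB t Jt.
  have se : sL2 mu J (eta v) by exact: sL2_primitive.
  have h1 : L2dot mu J[t] (eta v) (eta v) <= 2 * dot u0 u0 * T + 2 * (T * B) * (rate^-1 * expR (rate * t)).
    apply: (L2dot_const_le Jt rg) => //; rewrite ?mulr_ge0// => s Js _.
    apply: le_trans (eta_sqr Js sv) _; rewrite lerD2l -[leRHS](mulrA 2 (T * B)) -(mulrA T B).
    by rewrite ler_wpM2l// ler_wpM2l// hB.
  have h2 := rhs_sqr Jt sv.
  have h3 := hE t Jt.
  have E1 : 1 <= expR (rate * t) by exact: expR_rate_ge1.
  have h4 : L2dot mu J[t] v v <= lam^-1 * dot v0 v0 + lam^-1 * lam^-1 *
      (3 * L2dot mu J phi0 phi0 + 3 * (K2 + 1) * (2 * dot u0 u0 * T + 2 * (T * B) * (rate^-1 * expR (rate * t)))).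
    rewrite -(ler_pM2l lam0); apply: le_trans h3 _.
    rewrite [leRHS]mulrDr !mulrA mulfV ?gt_eqF// !mul1r -!mulrA lerD2l ler_wpM2l//.
    apply: le_trans h2 _; rewrite lerD2l -mulrA ler_wpM2l// ler_wpM2l//.
    by apply: le_trans h1 _; rewrite -!mulrA.
  apply: le_trans h4 _.
  have h5 : lam^-1 * dot v0 v0 + lam^-1 * lam^-1 * (3 * L2dot mu J phi0 phi0 + 3 * (K2 + 1) * (2 * dot u0 u0 * T)) <= c1 * data_sqr.
    rewrite /c1 /data_sqr.
    have a1 : 0 <= lam^-1 * dot u0 u0 by exact: mulr_ge0.
    have a2 : 0 <= lam^-1 * L2dot mu J phi0 phi0 by exact: mulr_ge0.
    have a3 : 0 <= lam^-1 * lam^-1 * ((3 + 6 * (K2 + 1) * T) * dot v0 v0).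
      by rewrite mulr_ge0// mulr_ge0// addr_ge0// !mulr_ge0.
    have a4 : 0 <= lam^-1 * lam^-1 * (3 * dot u0 u0) by rewrite !mulr_ge0.
    have a5 : 0 <= lam^-1 * lam^-1 * (6 * (K2 + 1) * T * L2dot mu J phi0 phi0) by rewrite !mulr_ge0.
    rewrite -subr_ge0.
    apply: le_trans (addr_ge0 a1 (addr_ge0 a2 (addr_ge0 a3 (addr_ge0 a4 a5)))) _.
    by rewrite le_eqVlt; apply/orP; left; apply/eqP; ring.
  have h6 := lam2_rate T0 lam0 K0.
  have BE : 0 <= B * expR (rate * t) by rewrite mulr_ge0 ?expR_ge0.
  have h7 : lam^-1 * lam^-1 * (3 * (K2 + 1) * (2 * (T * B) * (rate^-1 * expR (rate * t)))) <= B / 2 * expR (rate * t).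
    have -> : lam^-1 * lam^-1 * (3 * (K2 + 1) * (2 * (T * B) * (rate^-1 * expR (rate * t)))) =
       (lam^-1 * lam^-1 * ((K2 + 1) * T * rate^-1)) * (6 * (B * expR (rate * t))) by ring.
    apply: le_trans (ler_wpM2r (mulr_ge0 _ BE) h6) _ => //.
    by rewrite [leRHS]mulrAC; move: BE; move: (B * expR _) => X; lra.
  have h8 : c1 * data_sqr <= c1 * data_sqr * expR (rate * t) by rewrite ler_peMr// mulr_ge0.
  rewrite (mulrDl (c1 * data_sqr)); apply: le_trans _ (lerD (le_trans h5 h8) h7).
  by rewrite le_eqVlt; apply/orP; left; apply/eqP; ring.
pose G := L2dot mu J v v.
have G0 : 0 <= G by exact: L2dot_ge0.
have it (n : nat) : forall t, J t -> L2dot mu J[t] v v <= (2 * c1 * data_sqr + G * 2^-1 ^+ n) * expR (rate * t).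
  have D0 : 0 <= 2 * c1 * data_sqr by rewrite !mulr_ge0.
  elim: n => [|n ih] t Jt.
    apply: le_trans (L2dot_J_exp T0 lam0 K0 sv Jt) _.
    by rewrite expr0 mulr1 ler_wpM2r ?expR_ge0// lerDr.
  have Bn : 0 <= 2 * c1 * data_sqr + G * 2^-1 ^+ n by rewrite addr_ge0// mulr_ge0 ?exprn_ge0 ?invr_ge0.
  apply: le_trans (step _ Bn ih t Jt) _.
  rewrite ler_wpM2r ?expR_ge0// exprSr; move: (2^-1 ^+ n) => q.
  by rewrite le_eqVlt; apply/orP; left; apply/eqP; field.
move=> t Jt.
have lim : L2dot mu J[t] v v <= (2 * c1 * data_sqr) * expR (rate * t).
  apply: (@le_cvg_seq R (fun=> L2dot mu J[t] v v) (fun n => 2 * c1 * data_sqr * expR (rate * t) + (G * expR (rate * t)) * 2^-1 ^+ n)).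
  - exact: cvg_cst.
  - rewrite -[X in _ --> X]addr0; apply: cvg_shift.
    rewrite -[X in _ --> X](mulr0 (G * expR (rate * t))); apply: cvg_scale.
    by apply: cvg_expr; rewrite ger0_norm ?invr_ge0// invf_lt1// ltr1n.
  - by move=> n; apply: le_trans (it n t Jt) _; rewrite (mulrDl (2 * c1 * data_sqr)) (mulrAC G).
apply: le_trans lim _; rewrite /gronwall_const -/c1 mulrAC ler_wpM2r//.
by rewrite ler_wpM2l ?mulr_ge0// ler_expR ler_wpM2l ?(ltW rg)// Jle.
Qed.

(** The sum of three bounds: 1 + lam^-1 (...) for |eta'|^2, from the energy inequality; 2 + 2 T G
    for |eta|^2; and G for the integral of |eta'|^2, with G the Gronwall constant. *)
Definition energy_const : R :=
  1 + lam^-1 * (3 + 6 * (K2 + 1) * T * (1 + T * gronwall_const)) + 2 + (2 * T + 1) * gronwall_const.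

Lemma energy_const_ge0 : 0 <= energy_const.
Proof.
have l0 : 0 <= lam^-1 by rewrite invr_ge0 ltW.
have g0 : 0 <= gronwall_const by rewrite /gronwall_const !(addr_ge0, mulr_ge0, expR_ge0).
by rewrite /energy_const !(addr_ge0, mulr_ge0).
Qed.

Lemma picard_energy v (v_ : R -> H) :
  sL2 mu J v ->
  (forall t, J t -> dot (v_ t) (v_ t) + lam * L2dot mu J[t] v v <=
           dot v0 v0 + lam^-1 * L2dot mu J[t] (rhs Phi u0 v) (rhs Phi u0 v)) ->
  forall t, J t -> dot (v_ t) (v_ t) + dot (eta v t) (eta v t) + L2dot mu J[t] v v <= energy_const * data_sqr.
Proof.
move=> sv hE t Jt.
have hG : forall t, J t -> L2dot mu J[t] v v <= gronwall_const * data_sqr.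
  apply: picard_gronwall => // s Js; apply: le_trans (hE s Js); rewrite lerDr; exact: dot_ge0.
have l0 : 0 <= lam^-1 by rewrite invr_ge0 ltW.
have K1 : 0 <= K2 + 1 by rewrite addr_ge0.
have uu := dot_ge0 u0; have vv := dot_ge0 v0.
have pp : 0 <= L2dot mu J phi0 phi0 by exact: L2dot_ge0.
have u1 : dot u0 u0 <= data_sqr by rewrite /data_sqr -addrA lerDl addr_ge0.
have v1 : dot v0 v0 <= data_sqr by rewrite /data_sqr -addrA addrCA lerDl addr_ge0.
have p1 : L2dot mu J phi0 phi0 <= data_sqr by rewrite /data_sqr lerDr addr_ge0.
have se : sL2 mu J (eta v) by exact: sL2_primitive.
have eb s : J s -> dot (eta v s) (eta v s) <= 2 * data_sqr + 2 * (T * (gronwall_const * data_sqr)).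
  move=> Js; apply: le_trans (eta_sqr Js sv) _; apply: lerD; first by rewrite ler_wpM2l.
  by rewrite ler_wpM2l// ler_wpM2l// hG.
have g0 : 0 <= gronwall_const * data_sqr by apply: le_trans (hG t Jt); exact: L2dot_ge0.
have h1 : L2dot mu J[t] (eta v) (eta v) <= (2 * data_sqr + 2 * (T * (gronwall_const * data_sqr))) * T.
  have d0 : 0 <= data_sqr by exact: le_trans uu u1.
  have B0 : 0 <= 2 * data_sqr + 2 * (T * (gronwall_const * data_sqr)).
    by rewrite addr_ge0 ?(mulr_ge0 _ d0) ?(mulr_ge0 _ (mulr_ge0 T0 g0)).
  (* With B = 0 the exponential term disappears and only the constant bound is integrated. *)
  have := @L2dot_const_le t _ 0 1 (eta v) Jt ltr01 B0 (lexx _) se.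
  rewrite mul0r addr0; apply.
  by move=> s Js _; rewrite mul0r addr0; exact: eb.
have h2 : dot (v_ t) (v_ t) <= data_sqr + lam^-1 * (3 * data_sqr + 3 * (K2 + 1) * ((2 * data_sqr + 2 * (T * (gronwall_const * data_sqr))) * T)).
  have hv : dot (v_ t) (v_ t) <= dot v0 v0 + lam^-1 * L2dot mu J[t] (rhs Phi u0 v) (rhs Phi u0 v).
    by apply: le_trans (hE t Jt); rewrite lerDl mulr_ge0 ?L2dot_ge0// ltW.
  apply: le_trans hv _; apply: lerD => //; rewrite ler_wpM2l//.
  apply: le_trans (rhs_sqr Jt sv) _; apply: lerD; first by rewrite ler_wpM2l.
  by rewrite ler_wpM2l ?mulr_ge0.
apply: le_trans (lerD (lerD h2 (eb t Jt)) (hG t Jt)) _.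
by rewrite le_eqVlt; apply/orP; left; apply/eqP; rewrite /energy_const; ring.
Qed.

End PicardEnergy.

(** * Test functions *)

Section Smooth.
Context {R : realType}.
Implicit Types (f g : R -> R) (n k : nat).

(** [Ck n] means n times differentiable. Naming the derivative in the recursion lets the closure
    rules go through by induction on n. *)
Fixpoint Ck n f : Prop := if n is m.+1 then
  exists2 g : R -> R, (forall x, is_derive (x : R) (1 : R) f (g x)) & Ck m g else True.

Definition smooth f := forall n, Ck n f.

Lemma is_derive_derive1 f (x d : R) : is_derive x (1 : R) f d -> derive1 f x = d.
Proof. by move=> h; rewrite derive1E derive_val. Qed.

Lemma is_derive_derive1_fun f g : (forall x, is_derive (x : R) (1 : R) f (g x)) -> derive1 f = g.
Proof. by move=> h; apply/funext => x; exact: is_derive_derive1. Qed.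

Lemma derivable_is_derive f x : derivable f x 1 -> is_derive x (1 : R) f (derive1 f x).
Proof. by move=> h; split; rewrite ?derive1E. Qed.

Lemma smoothP f : smooth f <-> forall n (x : R), derivable (derive1n n f) x 1.
Proof.
split=> [sf n x|].
  elim: n f {sf} (sf n.+1) => [|n ih] f [g fg Cg]; first exact: ex_derive.
  by rewrite derive1Sn (is_derive_derive1_fun fg); exact: ih.
move=> h n; elim: n f h => [//|n ih] f h /=.
exists (derive1 f); first by move=> x; exact: derivable_is_derive (h 0%N x).
by apply: ih => k x; rewrite -derive1Sn.
Qed.

Lemma smooth_deriv f : smooth f -> forall x, is_derive (x : R) (1 : R) f (derive1 f x).
Proof. by move=> /smoothP h x; exact: derivable_is_derive (h 0%N x). Qed.

Lemma smooth_derive1 f : smooth f -> smooth (derive1 f).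
Proof. by move=> /smoothP h; apply/smoothP => n x; rewrite -derive1Sn. Qed.

Lemma smooth_antideriv f g : (forall x, is_derive (x : R) (1 : R) f (g x)) -> smooth g -> smooth f.
Proof. by move=> fg sg [|n] //; exists g. Qed.

Lemma CkS n f : Ck n.+1 f -> Ck n f.
Proof. by elim: n f => [//|n ih] f [g fg /ih Cg]; exists g. Qed.

Lemma CkD n f g : Ck n f -> Ck n g -> Ck n (fun x => f x + g x).
Proof.
elim: n f g => [//|n ih] f g [f' ff Cf] [g' gg Cg].
exists (fun x => f' x + g' x); last exact: ih.
by move=> x; exact: is_deriveD.
Qed.

Lemma Ck_cst n (c : R) : Ck n (fun=> c).
Proof.
elim: n c => [//|n ih] c; exists (fun=> 0); last exact: ih.
by move=> x; exact: is_derive_cst.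
Qed.

Lemma CkM n f g : Ck n f -> Ck n g -> Ck n (fun x => f x * g x).
Proof.
elim: n f g => [//|n ih] f g hf hg; have := hf; have := hg.
move=> [g' gg Cg] [f' ff Cf].
exists (fun x => f x * g' x + g x * f' x).
  by move=> x; exact: is_deriveM.
by apply: CkD; apply: ih => //; exact: CkS.
Qed.

Lemma CkZ n (c : R) f : Ck n f -> Ck n (fun x => c * f x).
Proof. by move=> Cf; apply: CkM => //; exact: Ck_cst. Qed.

Lemma Ck_affine n (a b : R) f : Ck n f -> Ck n (fun x => f (a * x + b)).
Proof.
elim: n f => [//|n ih] f [f' ff Cf].
exists (fun x => a * f' (a * x + b)); last by apply: CkZ; exact: ih.
move=> x; have da : is_derive (x : R) (1 : R) (fun x : R => a * x + b) a.
  by apply: (is_derive_eq (is_deriveD (is_deriveZ a (is_derive_id x 1)) (is_derive_cst b x 1))); rewrite addr0; exact: mulr1.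
have := @is_derive1_comp _ f (fun x : R => a * x + b) x (f' (a * x + b)) a (ff _) da.
by rewrite mulrC.
Qed.

(* The functions [x ^- k * exp (- 1 / x)] are closed under differentiation:
   [flat k' = - k flat (k + 1) + flat (k + 2)]. *)
Definition flat k (x : R) : R := if 0 < x then x ^- k * expR (- x^-1) else 0.

Lemma flat_ge0 k x : 0 <= flat k x.
Proof.
by rewrite /flat; case: ifP => // x0; rewrite mulr_ge0 ?expR_ge0// invr_ge0 exprn_ge0// ltW.
Qed.

Lemma flat0_le1 x : flat 0 x <= 1.
Proof.
rewrite /flat; case: ifP => // x0; rewrite expr0 invr1 mul1r -expR0 ler_expR oppr_le0.
by rewrite invr_ge0 ltW.
Qed.

(** The term of order k + 1 of the exponential series at 1 / x bounds exp(1 / x) from below. *)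
Lemma flat_le k x : 0 < x -> flat k x <= k.+1`!%:R * x.
Proof.
move=> x0; rewrite /flat x0 expRN ler_pdivrMr ?expR_gt0//.
have h := expR_ge1Dxn k (ltW (_ : 0 < x^-1)); rewrite invr_gt0 in h.
have {}h : x^-1 ^+ k.+1 / k.+1`!%:R <= expR x^-1.
  by apply: le_trans (h x0); rewrite lerDr.
have f0 : 0 < k.+1`!%:R * x by rewrite mulr_gt0// ltr0n fact_gt0.
apply: le_trans (ler_wpM2l (ltW f0) h).
rewrite exprSr exprVn le_eqVlt; apply/orP; left; apply/eqP.
have fn : k.+1`!%:R != 0 :> R by rewrite pnatr_eq0 -lt0n fact_gt0.
move: (k.+1`!%:R) (x ^+ k) (gt_eqF x0) fn => c y xn cn.
by rewrite -(mulrA _ x^-1) -invfM mulrC (mulrC c) mulfVK// mulf_neq0// xn.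
Qed.

Lemma quadratic_is_derive f (C : R) : f 0 = 0 -> 0 <= C ->
  (forall x : R, `|f x| <= C * x ^+ 2) -> is_derive (0 : R) (1 : R) f 0.
Proof.
move=> f0 C0 fC.
suff h : h^-1 *: ((f \o shift (0 : R)) (h *: (1 : R)) - f 0) @[h --> (0:R)^'] --> (0 : R).
  by split; [apply/cvg_ex; exists 0 | rewrite /derive; apply: (cvg_lim _ h)].
apply/cvgrPdist_lt => e e0.
have C1 : 0 < C + 1 by rewrite ltr_wpDl.
near=> h.
have hn : h != 0 by near: h; exact: nbhs_dnbhs_neq.
rewrite sub0r normrN f0 subr0 /= addr0 [h *: 1]mulr1.
rewrite normrZ normfV ltr_pdivrMl ?normr_gt0//.
apply: le_lt_trans (fC h) _.
rewrite -(real_normK (num_real h)) expr2 mulrCA ltr_pM2l ?normr_gt0//.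
apply: (@le_lt_trans _ _ ((C + 1) * `|h|)); first by rewrite ler_wpM2r// lerDl.
rewrite -ltr_pdivlMl//; near: h; apply: nbhs_dnbhs.
by apply: (@nbhs0_lt _ R^o); rewrite mulr_gt0 ?invr_gt0.
Unshelve. all: by end_near.
Qed.

Lemma is_derive_flat k x : is_derive x (1 : R) (flat k) (- k%:R * flat k.+1 x + flat k.+2 x).
Proof.
have [x0|x0|->] := ltgtP x 0.
- have -> : - k%:R * flat k.+1 x + flat k.+2 x = 0 by rewrite /flat (lt_gtF x0) mulr0 addr0.
  apply: (@near_eq_is_derive _ _ _ (cst 0)).
  near=> y; rewrite /flat lt_gtF//; near: y.
  exact: lt_nbhsl.
(* For positive x, [flat k] is u^k exp(- u) composed with u = 1 / x. *)
- pose g : R -> R := (id ^+ k * (fun u : R => expR (- u))) \o (fun y : R => y^-1).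
  apply: (@near_eq_is_derive _ _ _ g).
    near=> y; have y0 : 0 < y by near: y; exact: lt_nbhsr.
    by rewrite /flat y0 /g !fctE/= exprVn.
  have dN (u : R) : is_derive u (1 : R) (fun u : R => expR (- u)) (- expR (- u)).
    have := @is_derive1_comp _ expR (fun u : R => - u) u _ _ (is_derive_expR _) (is_deriveN (is_derive_id u 1)).
    by rewrite mulrN1.
  have xn : x != 0 by rewrite gt_eqF.
  have dF (u : R) := is_deriveM (is_deriveX k (is_derive_id u (1 : R))) (dN u).
  have dV := @is_deriveV _ id x 1 1 xn (is_derive_id x 1).
  apply: (is_derive_eq (@is_derive1_comp _ _ (fun y : R => y^-1) x _ _ (dF x^-1) dV)).
  rewrite /flat x0 -!exprVn fctE/=; move: (expR _) => E; clear; case: k => [|n].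
    rewrite !mulr0n; set w := x^-1; rewrite /GRing.scale /=; ring.
  have sc (a b : R) : a *: (b : R^o) = a * b by [].
  rewrite !sc -[n.+1.-1]/n; move: (x^-1) => w.
  rewrite -(mulrN1 (1 *+ n.+1)); move: (1 *+ n.+1) => c; rewrite !exprS; ring.
(* For x > 0, flat k x = x flat (k + 1) x <= (k + 2)! x^2, so the derivative at 0 vanishes. *)
- apply: (is_derive_eq (quadratic_is_derive (C := (k.+2)`!%:R) _ _ _)); rewrite ?ler0n//; last 2 first.
  + move=> {}x; rewrite ger0_norm ?flat_ge0//.
    have [x0|x0] := ltP 0 x; last by rewrite /flat ltNge x0/= mulr_ge0 ?ler0n ?sqr_ge0.
    have -> : flat k x = x * flat k.+1 x.
      by rewrite /flat x0 mulrA exprSr invfM mulrCA mulfV ?gt_eqF// mulr1.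
    by rewrite expr2 mulrCA ler_pM2l// flat_le.
  + by rewrite /flat ltxx mulr0 addr0.
  by rewrite /flat ltxx.
Unshelve. all: by end_near.
Qed.

Lemma Ck_flat n k : Ck n (flat k).
Proof.
elim: n k => [//|n ih] k; exists (fun x => - k%:R * flat k.+1 x + flat k.+2 x).
  exact: is_derive_flat.
by apply: CkD => //; exact: CkZ.
Qed.

(* As n grows, the bumps increase to the indicator of the open interval. *)
Definition bump (a b : R) n (x : R) : R :=
  flat 0 (n.+1%:R * (x - a)) * flat 0 (n.+1%:R * (b - x)).

Lemma smooth_bump a b n : smooth (bump a b n).
Proof.
move=> m; apply: CkM.
  have -> : (fun x => flat 0 (n.+1%:R * (x - a))) = (fun x => flat 0 (n.+1%:R * x + - (n.+1%:R * a))).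
    by apply/funext => x; rewrite mulrBr.
  by apply: Ck_affine; exact: Ck_flat.
have -> : (fun x => flat 0 (n.+1%:R * (b - x))) = (fun x => flat 0 (- n.+1%:R * x + n.+1%:R * b)).
  by apply/funext => x; rewrite mulrBr addrC mulNr.
by apply: Ck_affine; exact: Ck_flat.
Qed.

Lemma bump_ge0 a b n x : 0 <= bump a b n x.
Proof. by rewrite mulr_ge0 ?flat_ge0. Qed.

Lemma bump_le1 a b n x : bump a b n x <= 1.
Proof. by rewrite mulr_ile1 ?flat_ge0 ?flat0_le1. Qed.

Lemma bump_out a b n x : ~ (`]a, b[%classic : set R) x -> bump a b n x = 0.
Proof.
move=> h; rewrite /bump.
have [ax|xa] := ltP a x; last first.
  by rewrite {1}/flat ltNge pmulr_rle0 ?ltr0n// subr_le0 xa mul0r.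
have [xb|bx] := ltP x b; first by exfalso; apply: h; rewrite /= in_itv/= ax xb.
by rewrite [flat 0 (_ * (b - x))]/flat ltNge pmulr_rle0 ?ltr0n// subr_le0 bx mulr0.
Qed.

Lemma flat_cvg1 (y : R) : 0 < y -> flat 0 (n.+1%:R * y) @[n --> \oo] --> (1 : R).
Proof.
move=> y0; have -> : (fun n => flat 0 (n.+1%:R * y)) = (fun n => expR (- (y^-1 * n.+1%:R^-1))).
  apply/funext => n; rewrite /flat mulr_gt0 ?ltr0n// expr0 invr1 mul1r invfM.
  by rewrite [_^-1 * y^-1]mulrC.
have h : - (y^-1 * n.+1%:R^-1) @[n --> \oo] --> (0 : R).
  rewrite -oppr0; apply: cvgN; rewrite -[X in _ --> X](mulr0 y^-1); apply: cvg_scale.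
  exact: cvg_harmonic.
rewrite -[X in _ --> X]expR0; exact: (@continuous_cvg _ _ _ _ _ _ (@expR R) _ (@continuous_expR R 0) h).
Qed.

Lemma bump_cvg a b x : (`]a, b[%classic : set R) x -> bump a b n x @[n --> \oo] --> (1 : R).
Proof.
rewrite /= in_itv/= => /andP[ax xb].
by rewrite -[X in _ --> X]mulr1; apply: cvgM; apply: flat_cvg1; rewrite subr_gt0.
Qed.

Lemma smooth_continuous f : smooth f -> continuous f.
Proof.
move=> sf x; apply: differentiable_continuous; apply/derivable1_diffP.
exact: @ex_derive _ _ _ _ _ _ _ (smooth_deriv sf x).
Qed.

Lemma smoothD f g : smooth f -> smooth g -> smooth (fun x => f x + g x).
Proof. by move=> sf sg n; exact: CkD. Qed.

Lemma smoothZ c f : smooth f -> smooth (fun x => c * f x).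
Proof. by move=> sf n; exact: CkZ. Qed.

End Smooth.

(** * Test functions on an open interval *)

Section TestFunctions.
Context {R : realType}.
Local Notation mu := (@lebesgue_measure R).
Local Notation TR := (measurableTypeR R).
Variable D : set R.
Hypothesis D_open : open D.
Hypothesis D_itv : is_interval D.
Hypothesis D_ne : D !=set0.
Implicit Types (f g w phi : R -> R) (a b c d : R).

Let mD : measurable (D : set TR).
Proof. exact: open_measurable. Qed.

Lemma segment_in_open c : D c -> exists a b, [/\ a < c, c < b & `[a, b]%classic `<=` D].
Proof.
move=> Dc; have /nbhs_ballP[e /= e0 he] := open_nbhs_nbhs (conj D_open Dc).
exists (c - e / 2), (c + e / 2); split; [lra|lra|].
by move=> x /=; rewrite in_itv/= => /andP[h1 h2]; apply: he; rewrite /ball/= ltr_norml; apply/andP; split; lra.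
Qed.

(** The compact support lies between its least and its greatest point, and openness leaves room on
    both sides. Vanishing at a and b themselves is what removes boundary terms later. *)
Lemma test_function_support phi : test_function D phi ->
  exists a b, [/\ a < b, `[a, b]%classic `<=` D & forall x, ~ (`]a, b[%classic : set R) x -> phi x = 0].
Proof.
move=> [_ [A [cA AD] A0]].
have [[x Ax]|Ae] := pselect (A !=set0); last first.
  (* An empty support set means phi = 0; any segment inside D will do. *)
  have [c /segment_in_open[a [b [ac cb sD]]]] := D_ne.
  exists a, b; split=> // [|x _]; first exact: lt_trans ac cb.
  by apply: A0 => Ax; apply: Ae; exists x.
have An : A !=set0 by exists x.
have ci : {within A, continuous (@id R)} by apply: continuous_subspaceT => y; exact: cvg_id.
have [c /set_mem Ac hc] := compact_EVT_min An cA ci.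
have [d /set_mem Ad hd] := compact_EVT_max An cA ci.
have [a [a' [ac ca' sc]]] := segment_in_open (AD _ Ac).
have [d' [b [dd' db sd]]] := segment_in_open (AD _ Ad).
have cd : c <= d by apply: hc; exact: mem_set.
exists a, b; split.
- by apply: lt_trans ac (le_lt_trans cd db).
- move=> y /=; rewrite in_itv/= => /andP[ay yb]; apply: (D_itv (x := a) (y := b)).
  + by apply: sc; rewrite /= in_itv/= lexx/= (ltW (lt_trans ac ca')).
  + by apply: sd; rewrite /= in_itv/= lexx/= andbT (ltW (lt_trans dd' db)).
  + by rewrite ay yb.
- move=> y hy; apply: A0 => Ay; apply: hy; rewrite /= in_itv/=.
  by rewrite (lt_le_trans ac (hc _ (mem_set Ay))) (le_lt_trans (hd _ (mem_set Ay)) db).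
Qed.

Lemma test_functionP phi a b : smooth phi -> `[a, b]%classic `<=` D ->
  (forall x, ~ (`]a, b[%classic : set R) x -> phi x = 0) -> test_function D phi.
Proof.
move=> /smoothP sp abD h; split=> //; exists `[a, b]%classic; first by split=> //; exact: segment_compact.
by move=> x hx; apply: h => hx'; apply: hx; apply: subset_itv_oo_cc hx'.
Qed.

Lemma test_smooth phi : test_function D phi -> smooth phi.
Proof. by move=> [h _]; apply/smoothP. Qed.

Lemma test_continuous phi : test_function D phi -> continuous phi.
Proof. by move/test_smooth; exact: smooth_continuous. Qed.

Lemma derive1_support phi a b : smooth phi ->
  (forall x, ~ (`]a, b[%classic : set R) x -> phi x = 0) ->
  forall x, ~ (`]a, b[%classic : set R) x -> derive1 phi x = 0.
Proof.
move=> sp h; have sd := smooth_derive1 sp; have cd := smooth_continuous sd.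
have h1 x : x < a \/ b < x -> derive1 phi x = 0.
  move=> hx; apply: is_derive_derive1; apply: (@near_eq_is_derive _ _ _ (cst 0)).
  case: hx => hx; near=> y; rewrite h//= in_itv/=.
    have : y < a by near: y; exact: lt_nbhsl.
    by move=> ya; rewrite (lt_gtF ya).
  have : b < y by near: y; exact: lt_nbhsr.
  by move=> ya; rewrite (lt_gtF ya) andbF.
move=> x hx; have [xa|ax] := ltP x a; first by apply: h1; left.
have [bx|xb] := ltP b x; first by apply: h1; right.
(* At an endpoint the derivative vanishes by continuity from outside the interval. *)
have [xa|xb'] : x = a \/ x = b.
  have [ax'|] := ltP a x; last by move=> xa; left; apply/eqP; rewrite eq_le xa.
  have [xb'|bx'] := ltP x b; last by right; apply/eqP; rewrite eq_le xb.
  by case: hx; rewrite /= in_itv/= ax' xb'.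
- subst x; have hl : derive1 phi x @[x --> a^'-] --> derive1 phi a.
    by apply: cvg_at_left_filter; exact: cd.
  have hl0 : derive1 phi x @[x --> a^'-] --> (0 : R).
    apply: cvg_near_cst; near=> y; apply: h1; left.
    by near: y; exact: nbhs_left_lt.
  exact: (cvg_unique _ hl hl0).
- subst x; have hl : derive1 phi x @[x --> b^'+] --> derive1 phi b.
    by apply: cvg_at_right_filter; exact: cd.
  have hl0 : derive1 phi x @[x --> b^'+] --> (0 : R).
    apply: cvg_near_cst; near=> y; apply: h1; right.
    by near: y; exact: nbhs_right_gt.
  exact: (cvg_unique _ hl hl0).
Unshelve. all: by end_near.
Qed.

Lemma test_derive1 phi : test_function D phi -> test_function D (derive1 phi).
Proof.
move=> tp; have sp := test_smooth tp; have [a [b [_ abD h]]] := test_function_support tp.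
apply: (test_functionP (smooth_derive1 sp) abD); exact: derive1_support.
Qed.

Lemma test_bounded phi : test_function D phi -> exists M, forall x, `|phi x| <= M.
Proof.
move=> tp; have [a [b [ab abD h]]] := test_function_support tp.
have cn : continuous (fun x => `|phi x|).
  by move=> x; apply: cvg_norm; exact: test_continuous.
have [c _ hc] := @EVT_max _ (fun x => `|phi x|) a b (ltW ab) (continuous_subspaceT cn).
exists `|phi c| => x; have [hx|hx] := pselect ((`]a, b[%classic : set R) x).
  by apply: hc; exact: subset_itv_oo_cc hx.
by rewrite h// normr0.
Qed.

Lemma test_lin k phi psi : test_function D phi -> test_function D psi ->
  test_function D (k *: (phi : R -> R^o) + psi).
Proof.
move=> tp tq; have [_ [A [cA AD] A0]] := tp; have [_ [B [cB BD] B0]] := tq.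
split.
  apply/smoothP; apply: smoothD; last exact: test_smooth.
  by apply: smoothZ; exact: test_smooth.
exists (A `|` B); first by split; [exact: compactU|move=> x [/AD|/BD]].
move=> x h; rewrite (_ : (_ + _) x = k * phi x + psi x)// A0 ?B0 ?mulr0 ?addr0// => ?; apply: h; [right|left]; done.
Qed.

Lemma test_cst0 : test_function D (0 : R -> R).
Proof.
split; first by apply/smoothP => n; exact: (Ck_cst n 0).
by exists set0 => //; split=> //; exact: compact0.
Qed.

Lemma test_bump a b n : `[a, b]%classic `<=` D -> test_function D (bump a b n).
Proof.
move=> abD; apply: (test_functionP (a := a) (b := b)) => //; first exact: smooth_bump.
by move=> x hx; exact: bump_out.
Qed.

Lemma measurable_test phi (A : set TR) : test_function D phi -> measurable A -> measurable_fun A (phi : TR -> R).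
Proof.
move=> /test_continuous cp mA; apply: measurable_funTS.
exact: (continuous_measurable_fun cp).
Qed.

Lemma Rintegral_support (A B : set TR) (f : TR -> R) : A `<=` B ->
  (forall x, B x -> ~ A x -> f x = 0) -> \int[mu]_(x in B) f x = \int[mu]_(x in A) f x.
Proof.
move=> AB f0; rewrite -(setIidr AB) [RHS]Rintegral_mkcondr; apply: eq_Rintegral => x /set_mem Bx.
by rewrite patchE; case: ifPn => // /negP h; rewrite f0// => Ax; apply: h; exact: mem_set.
Qed.

Lemma bump_Rintegral_cvg a b w : `[a, b]%classic `<=` D ->
  intg mu (`]a, b[%classic : set TR) w ->
  \int[mu]_(x in (D : set TR)) (w x * bump a b n x) @[n --> \oo] -->
  \int[mu]_(x in (`]a, b[%classic : set TR)) w x.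
Proof.
move=> abD iw.
have abo : (`]a, b[%classic : set TR) `<=` (D : set TR) by move=> x hx; apply: abD; exact: subset_itv_oo_cc.
have e : (fun n => \int[mu]_(x in (D : set TR)) (w x * bump a b n x)) =
         (fun n => \int[mu]_(x in (`]a, b[%classic : set TR)) (w x * bump a b n x)).
  by apply/funext => n; apply: Rintegral_support => // x _ hx; rewrite bump_out ?mulr0.
rewrite e; have mab : measurable (`]a, b[%classic : set TR) by exact: measurable_itvR.
have [] // := @dominated_Rintegral _ _ _ mu _ mab (fun n x => w x * bump a b n x) w (fun x => `|w x|).
- move=> n; apply: measurable_funM; first exact: intg_measurable iw.
  exact: (measurable_test (test_bump n abD) mab).
- exact: intg_norm.
- by move=> n x _; rewrite normrM ler_piMr// ger0_norm ?bump_ge0 ?bump_le1.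
- move=> x hx; rewrite -[X in _ --> X]mulr1; apply: cvg_scale; exact: bump_cvg.
Qed.

End TestFunctions.

(** * The fundamental lemma of the calculus of variations and du Bois-Reymond's lemma *)

Section FundamentalLemma.
Context {R : realType}.
Local Notation mu := (@lebesgue_measure R).
Local Notation TR := (measurableTypeR R).
Variable D : set R.
Hypothesis D_open : open D.
Hypothesis D_itv : is_interval D.
Hypothesis D_ne : D !=set0.
Implicit Types (f g w phi : R -> R) (a b c d : R).

Let mD : measurable (D : set TR).
Proof. exact: open_measurable. Qed.

Lemma fine_lebesgue_oo (s t : R) : s < t -> fine (mu (`]s, t[%classic : set TR)) = t - s.
Proof.
move=> st; apply: (congr1 fine (y := (t - s)%:E)); apply: etrans (lebesgue_measure_itv _) _.
by rewrite /= lte_fin st EFinB.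
Qed.

Definition locally_intg w := forall a b, `[a, b]%classic `<=` D -> intg mu (`[a, b]%classic : set TR) w.

Lemma intg_oo a b w : intg mu (`[a, b]%classic : set TR) w -> intg mu (`]a, b[%classic : set TR) w.
Proof. exact: (intgS (measurable_itvR _) (measurable_itvR _) (@subset_itv_oo_cc _ _ a b)). Qed.

Lemma Rintegral_oo_cc a b w : intg mu (`[a, b]%classic : set TR) w ->
  \int[mu]_(x in `[a, b]) w x = \int[mu]_(x in `]a, b[) w x.
Proof.
move=> iw; rewrite -Rintegral_itv_obnd_cbnd; last first.
  by apply: (intgS (measurable_itvR _) (measurable_itvR _) _ iw); apply: subset_itvr; rewrite bnd_simp.
by rewrite -Rintegral_itv_bndo_bndc//; exact: intg_oo.
Qed.

(** The primitive of w from p is constant on the interval, and by Lebesgue's theorem its derivative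
    is w almost everywhere. *)
Lemma zero_Rintegral_ae_itv p q w : intg mu (`[p, q]%classic : set TR) w ->
  (forall y, p < y -> y < q -> \int[mu]_(x in `]p, y[) w x = 0) ->
  {ae mu, forall x, (`]p, q[%classic : set TR) x -> w x = 0}.
Proof.
move=> iw h; pose f : R -> R := w \_ (`[p, q]%classic : set R).
have mpq : measurable (`[p, q]%classic : set TR) by exact: measurable_itvR.
have fT : mu.-integrable setT (EFin \o f).
  by have := (integrable_mkcond _ mpq).1 iw; rewrite /f restrict_EFin.
have ae := @FTC1 R f (BLeft p) (fun y => integrableS measurableT (measurable_itvR _) (@subsetT _ _) fT)
  (integrable_locally mpq iw).
case: ae => A [mA A0 hA]; exists A; split=> // x /= nx; apply: hA => /= hx; apply: nx => xpq.
have := xpq; rewrite /= in_itv/= => /andP[px xq].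
case: hx => [|_ e]; first by rewrite lte_fin.
have fx : f x = w x by rewrite /f patchE mem_set//=; exact: subset_itv_oo_cc xpq.
rewrite -fx -e; apply: is_derive_derive1; apply: (@near_eq_is_derive _ _ _ (cst 0)).
near=> y; have py : p < y by near: y; exact: lt_nbhsr.
have yq : y < q by near: y; exact: lt_nbhsl.
have sub : (`[p, y]%classic : set TR) `<=` (`[p, q]%classic : set TR).
  by apply: subset_itvl; rewrite bnd_simp ltW.
have -> : \int[mu]_(t in `[p, y]) f t = \int[mu]_(t in `[p, y]) w t.
  by apply: eq_Rintegral => t /set_mem ht; rewrite /f patchE mem_set//; exact: sub.
rewrite Rintegral_oo_cc ?h//.
exact: (intgS mpq (measurable_itvR _) sub iw).
Unshelve. all: by end_near.
Qed.

(** Every point of D lies in an interval with rational ends whose closure is inside D, and there are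
    only countably many exceptional null sets for these. *)
Lemma zero_Rintegral_ae w : locally_intg w ->
  (forall a b, a < b -> `[a, b]%classic `<=` D -> \int[mu]_(x in `]a, b[) w x = 0) ->
  {ae mu, forall x, D x -> w x = 0}.
Proof.
move=> lw h.
have ae n : {ae mu, forall x : TR, forall p q : rat, unpickle n = Some (p, q) ->
    `[ratr p, ratr q]%classic `<=` D -> (`]ratr p, ratr q[%classic : set R) x -> w x = 0}.
  case: (unpickle n) => [[p q]|]; last by apply: aeW.
  have [sub|nsub] := pselect ((`[ratr p, ratr q]%classic : set R) `<=` D); last first.
    by apply: aeW => x p' q' [<- <-] /nsub.
  have := @zero_Rintegral_ae_itv (ratr p) (ratr q) w (lw _ _ sub).
  move=> /(_ _)[|A [mA A0 hA]].
    move=> y py yq; apply: h => // x; rewrite /= in_itv/= => /andP[px xy]; apply: sub.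
    by rewrite /= in_itv/= px (le_trans xy (ltW yq)).
  by exists A; split=> // x /= hx; apply: hA => /= hx'; apply: hx => p' q' [<- <-] _; exact: hx'.
have := ae_foralln ae; apply: filterS => x hx Dx.
have [a [b [ax xb sab]]] := segment_in_open D_open Dx.
have [p] := rat_in_itvoo ax; rewrite in_itv/= => /andP[ap px].
have [q] := rat_in_itvoo xb; rewrite in_itv/= => /andP[xq qb].
apply: (hx (pickle (p, q)) p q); first exact: pickleK.
  move=> y; rewrite /= in_itv/= => /andP[py yq]; apply: sab; rewrite /= in_itv/=.
  by rewrite (le_trans (ltW ap) py) (le_trans yq (ltW qb)).
by rewrite /= in_itv/= px xq.
Qed.

Lemma test_Rintegral_ae w : locally_intg w ->
  (forall phi, test_function D phi -> \int[mu]_(x in (D : set TR)) (w x * phi x) = 0) ->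
  {ae mu, forall x, D x -> w x = 0}.
Proof.
move=> lw h; apply: zero_Rintegral_ae => // a b ab sub.
have := bump_Rintegral_cvg (D := D) sub (intg_oo (lw _ _ sub)).
move=> hc; apply: (cvg_uniq _ hc (cvg_cst 0)) => n.
by apply: h; exact: test_bump.
Qed.

Lemma intg_support (A B : set TR) (f : TR -> R) : measurable A -> measurable B -> A `<=` B ->
  (forall x, B x -> ~ A x -> f x = 0) -> intg mu A f -> intg mu B f.
Proof.
move=> mA mB AB f0 iA.
have iB := integrableS measurableT mB (@subsetT _ _) ((integrable_mkcond _ mA).1 iA).
apply: eq_integrable iB => // x /set_mem Bx; rewrite patchE; case: ifPn => // /negP h /=.
by rewrite f0// => Ax; apply: h; exact: mem_set.
Qed.

Lemma intg_test w phi : locally_intg w -> test_function D phi ->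
  intg mu (D : set TR) (fun x => w x * phi x).
Proof.
move=> lw tp; have [a [b [ab sub h]]] := test_function_support D_open D_itv D_ne tp.
have mab : measurable (`[a, b]%classic : set TR) by exact: measurable_itvR.
apply: (intg_support mab mD sub).
  by move=> x _ hx; rewrite h ?mulr0// => hx'; apply: hx; exact: subset_itv_oo_cc.
have [M hM] := test_bounded D_open D_itv D_ne tp.
apply: (intg_le mab (g := fun x => M * `|w x|)).
- apply: measurable_funM; first exact: intg_measurable (lw _ _ sub).
  exact: (measurable_test tp mab).
- by apply: intgZ => //; apply: intg_norm => //; exact: lw.
- by move=> x _; rewrite normrM mulrC ler_wpM2r.
Qed.

(** Mean zero is exactly what makes the primitive vanish again to the right of the support. *)
Lemma test_antiderivative psi a b : smooth psi -> a < b -> `[a, b]%classic `<=` D ->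
  (forall x, ~ (`]a, b[%classic : set R) x -> psi x = 0) ->
  \int[mu]_(x in (D : set TR)) psi x = 0 ->
  exists2 phi, test_function D phi & derive1 phi = psi.
Proof.
move=> sp ab sub h I0; have cp := smooth_continuous sp.
have ip (c d : R) : intg mu (`[c, d]%classic : set TR) psi.
  by apply: continuous_compact_integrable; [exact: segment_compact|exact: continuous_subspaceT].
(* The integration starts to the left of a, so that points x >= a lie strictly above the lower limit
   and the fundamental theorem applies there. *)
pose phi x : R := \int[mu]_(t in `[a - 1, x]) psi t.
have dphi x : is_derive (x : R) (1 : R) phi (psi x).
  have [xa|ax] := ltP x a.
    rewrite h; last by rewrite /= in_itv/= ltNge (ltW xa).
    apply: (@near_eq_is_derive _ _ _ (cst 0)).
    near=> y; have ya : y < a by near: y; exact: lt_nbhsl.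
    have -> : phi y = \int[mu]_(t in `[a - 1, y]) 0.
      apply: eq_Rintegral => t /set_mem; rewrite /= in_itv/= => /andP[_ ty].
      by rewrite h//= in_itv/= ltNge (ltW (le_lt_trans ty ya)).
    by rewrite Rintegral_cst ?mul0r//; exact: measurable_itvR.
  have xx1 : x < x + 1 by rewrite ltrDl.
  have a1x : a - 1 < x by lra.
  have [d <-] := continuous_FTC1_closed xx1 (ip (a - 1) (x + 1)) a1x (cp x).
  exact: derivable_is_derive.
have sphi : smooth phi by exact: smooth_antideriv dphi sp.
exists phi; last exact: is_derive_derive1_fun.
apply: (test_functionP (a := a) (b := b)) => // x hx.
have mo (i : interval R) : measurable ([set` i] : set TR) by exact: measurable_itvR.
have [bx|xb] := leP b x.
  rewrite -I0 /phi.
  have s1 : (`]a, b[%classic : set TR) `<=` (`[a - 1, x]%classic : set TR).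
    by apply: subset_itvW => //; lra.
  have s2 : (`]a, b[%classic : set TR) `<=` (D : set TR).
    by move=> t ht; apply: sub; exact: subset_itv_oo_cc.
  by rewrite (Rintegral_support s1) ?(Rintegral_support s2)// => t _; exact: h.
have xa : x <= a by rewrite leNgt; apply/negP => ax; apply: hx; rewrite /= in_itv/= ax.
have -> : phi x = \int[mu]_(t in `[a - 1, x]) 0.
  apply: eq_Rintegral => t /set_mem; rewrite /= in_itv/= => /andP[_ tx].
  by rewrite h//= in_itv/= ltNge (le_trans tx xa).
by rewrite Rintegral_cst ?mul0r.
Unshelve. all: by end_near.
Qed.

(* The test functions [(int bump') bump - (int bump) bump'] have integral zero,
   so they are derivatives of test functions; in the limit, [w] has the same mean
   over all intervals. *)
Lemma du_bois_reymond w : locally_intg w ->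
  (forall phi, test_function D phi -> \int[mu]_(x in (D : set TR)) (w x * derive1 phi x) = 0) ->
  exists c, {ae mu, forall x, D x -> w x = c}.
Proof.
move=> lw h.
have mean a b c d : a < b -> c < d -> `[a, b]%classic `<=` D -> `[c, d]%classic `<=` D ->
    (d - c) * \int[mu]_(x in `]a, b[) w x = (b - a) * \int[mu]_(x in `]c, d[) w x.
  move=> ab cd sab scd.
  have i1 s t : intg mu (`]s, t[%classic : set TR) (fun=> 1 : R).
    by apply: intg_cst; [exact: measurable_itvR|exact: lebesgue_itv_fin].
  have one s t : s < t -> \int[mu]_(x in `]s, t[) (1 : R) = t - s.
    move=> st; rewrite Rintegral_cst ?mul1r; last exact: measurable_itvR.
    exact: fine_lebesgue_oo.
  have lim s t f : `[s, t]%classic `<=` D -> intg mu (`]s, t[%classic : set TR) f ->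
     \int[mu]_(x in (D : set TR)) (f x * bump s t n x) @[n --> \oo] --> \int[mu]_(x in `]s, t[) f x.
    by move=> sst; exact: bump_Rintegral_cvg.
  have l1 := lim _ _ _ sab (intg_oo (lw _ _ sab)).
  have l2 := lim _ _ _ scd (intg_oo (lw _ _ scd)).
  have m1 := lim _ _ _ sab (i1 a b); rewrite (one _ _ ab) in m1.
  have m2 := lim _ _ _ scd (i1 c d); rewrite (one _ _ cd) in m2.
  have e n : (\int[mu]_(x in (D : set TR)) (1 * bump c d n x)) * (\int[mu]_(x in (D : set TR)) (w x * bump a b n x)) =
     (\int[mu]_(x in (D : set TR)) (1 * bump a b n x)) * (\int[mu]_(x in (D : set TR)) (w x * bump c d n x)).
    pose p := bump a b n; pose q := bump c d n.
    have tp : test_function D p by exact: test_bump.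
    have tq : test_function D q by exact: test_bump.
    have l0 : locally_intg (fun=> 1).
      by move=> s t _; apply: intg_cst; [exact: measurable_itvR|exact: lebesgue_itv_fin].
    have [P hP] : exists P, \int[mu]_(x in (D : set TR)) (1 * p x) = P by exists (\int[mu]_(x in (D : set TR)) (1 * p x)).
    have [Q hQ] : exists Q, \int[mu]_(x in (D : set TR)) (1 * q x) = Q by exists (\int[mu]_(x in (D : set TR)) (1 * q x)).
    rewrite -/p -/q hP hQ.
    pose psi : R -> R := (- P) *: (q : R -> R^o) + (Q *: (p : R -> R^o) + 0).
    have tpsi : test_function D psi by apply: test_lin => //; apply: test_lin => //; exact: test_cst0.
    have psiE x : psi x = Q * p x - P * q x.
      by rewrite /psi addrC addr0 (_ : (_ + _) x = Q * p x + (- P) * q x)// mulNr.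
    have split f : locally_intg f -> \int[mu]_(x in (D : set TR)) (f x * psi x) =
       Q * (\int[mu]_(x in (D : set TR)) (f x * p x)) - P * (\int[mu]_(x in (D : set TR)) (f x * q x)).
      move=> lf; have ip := intg_test lf tp; have iq := intg_test lf tq.
      rewrite -(RintegralZl Q mD ip) -(RintegralZl P mD iq) -(RintegralB mD (intgZ mD Q ip) (intgZ mD P iq)).
      by apply: eq_Rintegral => x _; rewrite psiE mulrBr !(mulrCA (f x)).
    have [a' [b' [ab' sub' h']]] := test_function_support D_open D_itv D_ne tpsi.
    have := @test_antiderivative psi a' b' (test_smooth tpsi) ab' sub' h'.
    have -> : \int[mu]_(x in (D : set TR)) psi x = \int[mu]_(x in (D : set TR)) (1 * psi x).
      by apply: eq_Rintegral => x _; rewrite mul1r.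
    rewrite (split _ l0) hP hQ mulrC subrr => /(_ erefl)[phi tphi dphi].
    have := h _ tphi; rewrite dphi (split _ lw) => /eqP.
    by rewrite subr_eq0 => /eqP.
  by apply: (cvg_uniq e); [exact: cvgM m2 l1|exact: cvgM m1 l2].
have [x0 Dx0] := D_ne; have [c [d [cx xd scd]]] := segment_in_open D_open Dx0.
have cd := lt_trans cx xd.
exists ((d - c)^-1 * \int[mu]_(x in `]c, d[) w x); set m := _ * _.
have lc : locally_intg (fun=> m).
  by move=> a b _; apply: intg_cst; [exact: measurable_itvR|exact: lebesgue_itv_fin].
have := @zero_Rintegral_ae (fun x => w x - m).
move=> /(_ _ _)[||A [mA A0 hA]].
- by move=> a b sub; apply: intgB; [exact: measurable_itvR|exact: lw|exact: lc].
- move=> a b ab sub; rewrite RintegralB; [|exact: measurable_itvR|exact: intg_oo (lw _ _ sub)|exact: intg_oo (lc _ _ sub)].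
  rewrite Rintegral_cst; last exact: measurable_itvR.
  rewrite fine_lebesgue_oo// /m -mulrA [_ * (b - a)]mulrC -(mean _ _ _ _ ab cd sub scd).
  by rewrite mulrA mulVf ?mul1r ?subrr// subr_eq0 gt_eqF.
- by exists A; split=> // x /= hx; apply: hA => /= hx'; apply: hx => /hx' /subr0_eq.
Qed.

End FundamentalLemma.

Section LebesgueAe.
Context {R : realType}.
Local Notation mu := (@lebesgue_measure R).

Lemma ae_mono (P Q : R -> Prop) : (forall x, P x -> Q x) ->
  {ae mu, forall x, P x} -> {ae mu, forall x, Q x}.
Proof. by move=> PQ [A [mA A0 hA]]; exists A; split=> // x /= nQ; apply: hA => /= /PQ. Qed.

Lemma ae_conj (P Q : R -> Prop) : {ae mu, forall x, P x} -> {ae mu, forall x, Q x} ->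
  {ae mu, forall x, P x /\ Q x}.
Proof.
move=> [A [mA A0 hA]] [B [mB B0 hB]]; exists (A `|` B); split; first exact: measurableU.
  exact: null_set_setU.
move=> x /= nPQ; have [Px|/hA] := pselect (P x); last by left.
by right; apply: hB => /= Qx; apply: nPQ.
Qed.

End LebesgueAe.

(** * Distributional derivatives in time *)

Section TimeTest.
Context {R : realType} (T : R).
Hypothesis T0 : 0 < T.
Local Notation mu := (@lebesgue_measure R).
Local Notation TR := (measurableTypeR R).
Local Notation J := (`[0, T]%classic : set TR).
Local Notation Jo := (`]0, T[%classic : set R).
Local Notation "J[ t ]" := (`[0, t]%classic : set TR) (at level 0, format "J[ t ]").

Let mJ : measurable J := measurable_itvR _.
Let Jo_ne : Jo !=set0.
Proof. by exists (T / 2); rewrite /= in_itv/=; rewrite divr_gt0//= ltr_pdivrMr// ltr_pMr// ltr1n. Qed.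
Let Jo_open : open Jo. Proof. exact: interval_open. Qed.

Lemma test_derive1_itv phi : test_function Jo phi -> test_function Jo (derive1 phi).
Proof. exact: (test_derive1 Jo_open (@interval_is_interval _ _) Jo_ne). Qed.

Lemma test_bounded_itv phi : test_function Jo phi -> exists M, forall x, `|phi x| <= M.
Proof. exact: (test_bounded Jo_open (@interval_is_interval _ _) Jo_ne). Qed.

Lemma test_sL2 phi : test_function Jo phi -> sL2 mu J (phi : TR -> real_sh R).
Proof.
move=> tp; have [M hM] := test_bounded_itv tp.
apply: (@sL2_bounded _ _ _ mu J mJ (real_sh R) phi (M ^+ 2)); first exact: J_fin.
  by apply: (measurable_smeas mJ); exact: (measurable_test tp mJ).
move=> t _; rewrite [dot _ _](_ : _ = phi t ^+ 2)// -real_normK ?num_real//.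
by rewrite lerXn2r// nnegrE// (le_trans _ (hM t)).
Qed.

(** Written as the primitive of its derivative, a test function can enter [product_rule] as the
    scalar factor. *)
Lemma test_primitive phi t : test_function Jo phi -> J t ->
  nrm ((phi t : real_sh R) - prim (derive1 phi : TR -> real_sh R) t) = 0.
Proof.
rewrite /= in_itv/= => tp /andP[t0 tT].
have td := test_derive1_itv tp.
have p0 : phi 0 = 0.
  have [_ [A [_ AJ] hA]] := tp; apply: hA => /AJ; by rewrite /= in_itv/= ltxx.
have e : prim (derive1 phi : TR -> real_sh R) t = phi t :> R.
  have := prim_dot (1 : real_sh R) tT (test_sL2 td).
  rewrite [dot _ _](_ : _ = prim (derive1 phi : TR -> real_sh R) t :> R); last exact: mulr1.
  move=> ->.
  have -> : \int[mu]_(r in `[0, t]) dot (derive1 phi r : real_sh R) (1 : real_sh R) = \int[mu]_(r in `[0, t]) derive1 phi r.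
    by apply: eq_Rintegral => r _; exact: mulr1.
  have [t0'|t0'] := ltP 0 t; last first.
    have -> : t = 0 by apply/eqP; rewrite eq_le t0' t0.
    by rewrite set_itv1 Rintegral_set1 p0.
  rewrite /Rintegral (@continuous_FTC2 _ (derive1 phi) phi)//; first by rewrite -EFinB/= p0 subr0.
  - exact: continuous_subspaceT (test_continuous td).
  - have cp := test_continuous tp; split.
    + by move=> x _; apply: ex_derive; exact: smooth_deriv (test_smooth tp) x.
    + by apply: cvg_at_right_filter; exact: cp.
    + by apply: cvg_at_left_filter; exact: cp.
by rewrite nrm_real e subrr normr0.
Qed.

(** This is [product_rule] for the bilinear form (a, x) |-> a <x, y>; both boundary terms vanish
    with phi. *)
Lemma test_by_parts (X : semiHilbert R) (x0 : X) (u : R -> X) phi y :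
  test_function Jo phi -> sL2 mu J u ->
  \int[mu]_(t in J) (derive1 phi t * dot (x0 + prim u t) y) = - \int[mu]_(t in J) (phi t * dot (u t) y).
Proof.
move=> tp su; have td := test_derive1_itv tp.
pose B (a : real_sh R) (x : X) : R := (a : R) * dot x y.
have bB : bounded_bilinear B (nrm y).
  split.
  - by move=> k a a' x; rewrite /B; have -> : (k *: a + a' : real_sh R) = k * (a : R) + (a' : R) :> R by []; ring.
  - by move=> k a x x'; rewrite /B !dotE; ring.
  - move=> a x; rewrite /B normrM nrm_real [nrm y * _]mulrC -mulrA ler_wpM2l// mulrC; exact: dot_le.
have JT : 0 <= T <= T by rewrite lexx andbT ltW.
have := product_rule bB (nrm_ge0 y) (0 : real_sh R) x0 (test_sL2 td) su JT.
have ep t : J t -> B (0 + prim (derive1 phi : TR -> real_sh R) t) =1 B (phi t).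
  move=> Jt x; apply: (bilin_eql bB); rewrite add0r nrm_sym; exact: test_primitive.
have pT : phi T = 0.
  have [_ [A [_ AJ] hA]] := tp; apply: hA => /AJ; by rewrite /= in_itv/= ltxx andbF.
rewrite ep; last by rewrite /= in_itv.
rewrite /B pT !mul0r add0r => /esym.
have -> : \int[mu]_(r in `[0, T]) ((derive1 phi r : real_sh R) * dot (x0 + prim u r) y +
     (0 + prim (derive1 phi : TR -> real_sh R) r) * dot (u r) y) =
   \int[mu]_(r in J) (derive1 phi r * dot (x0 + prim u r) y + phi r * dot (u r) y).
  apply: eq_Rintegral => r /set_mem Jr; congr (_ + _); exact: (ep r Jr (u r)).
rewrite RintegralD//; first by move=> /eqP; rewrite addr_eq0 => /eqP.
  exact: (intg_bilin bB (nrm_ge0 y) mJ (test_sL2 td) (prim_sL2 x0 su)).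
exact: (intg_bilin bB (nrm_ge0 y) mJ (test_sL2 tp) su).
Qed.

(** By [test_by_parts] the primitive of u satisfies the same identity, so the difference has
    distributional derivative zero and du Bois-Reymond's lemma makes it constant. *)
Lemma weak_time_derivative (X : semiHilbert R) (u : R -> X) (g : R -> R) y :
  sL2 mu J u -> intg mu J g ->
  (forall phi, test_function Jo phi ->
     \int[mu]_(t in J) (derive1 phi t * g t) = - \int[mu]_(t in J) (phi t * dot (u t) y)) ->
  exists c, {ae mu, forall t, Jo t -> g t = c + dot (prim u t) y}.
Proof.
move=> su ig h.
have ip : intg mu J (fun t => dot (prim u t) y).
  have s0 := prim_sL2 0 su; have := intg_dotr y mJ (@subset_refl _ J) s0.
  by apply: eq_integrable => // t _ /=; rewrite add0r.
have lw : locally_intg Jo (fun t => g t - dot (prim u t) y).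
  move=> a b sub; apply: (intgS mJ (measurable_itvR _) _ (intgB mJ ig ip)).
  by move=> t /sub; exact: subset_itv_oo_cc.
have [|c hc] := du_bois_reymond Jo_open (@interval_is_interval _ _) Jo_ne lw; last first.
  by exists c; apply: ae_mono hc => t ht Jt; rewrite -(ht Jt) subrK.
move=> phi tp; have td := test_derive1_itv tp.
have tdd (f : R -> R) : intg mu J f -> intg mu J (fun t => derive1 phi t * f t).
  move=> jf; have [M hM] := test_bounded_itv td.
  apply: (intg_le mJ (g := fun x => M * `|f x|)).
  - by apply: measurable_funM; [exact: (measurable_test td mJ)|exact: intg_measurable jf].
  - by apply: intgZ => //; exact: intg_norm.
  - by move=> x _; rewrite normrM ler_wpM2r.
have -> : \int[mu]_(x in (Jo : set TR)) ((g x - dot (prim u x) y) * derive1 phi x) =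
   \int[mu]_(x in J) (derive1 phi x * (g x - dot (prim u x) y)).
  rewrite (Rintegral_oo_cc (tdd _ (intgB mJ ig ip))); apply: eq_Rintegral => t _; exact: mulrC.
have -> : \int[mu]_(x in J) (derive1 phi x * (g x - dot (prim u x) y)) =
  \int[mu]_(x in J) (derive1 phi x * g x) - \int[mu]_(x in J) (derive1 phi x * dot (prim u x) y).
  rewrite -(RintegralB mJ (tdd _ ig) (tdd _ ip)); apply: eq_Rintegral => t _; exact: mulrBr.
rewrite (h _ tp); have := test_by_parts 0 y tp su.
by under eq_Rintegral do rewrite add0r; move=> ->; rewrite subrr.
Qed.

(** A point with another value would have, by continuity, a whole interval of such points, and this
    has positive measure. *)
Lemma ae_cst_continuous (g : R -> R) c :
  (forall t, J t -> g s @[s --> within (`[0, T]%classic : set R) (nbhs t)] --> g t) ->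
  {ae mu, forall t, Jo t -> g t = c} -> forall t, J t -> g t = c.
Proof.
move=> gc [A [mA A0 hA]] t Jt; apply/eqP; apply/negPn/negP => gt.
have e0 : 0 < `|g t - c| by rewrite normr_gt0 subr_eq0.
have /cvgrPdist_lt/(_ _ e0) := gc t Jt; rewrite near_withinE => -[d /= d0 hd].
move: Jt; rewrite /= in_itv/= => /andP[t0 tT].
(* Cutting at 0 and T leaves a nonempty open interval also when t is an endpoint. *)
pose a := Num.max 0 (t - d); pose b := Num.min T (t + d).
have ab : a < b.
  rewrite /a /b gt_max !lt_min T0/= (ltr_pwDr d0 t0)/= ltrBlDr (le_lt_trans tT (_ : T < T + d)) ?ltrDl//=.
  by rewrite (lt_trans (_ : t - d < t)) ?ltrDl// ltrBlDr ltrDl.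
have sub : (`]a, b[%classic : set TR) `<=` A.
  move=> s; rewrite /= in_itv/= /a /b gt_max lt_min => /andP[/andP[s0 sd] /andP[sT std]].
  apply: hA => /= h; have Js : Jo s by rewrite /= in_itv/= s0.
  have := hd s; rewrite (h Js) => /(_ _ _); rewrite ltxx => hf; apply: notF; apply: hf.
    by rewrite /ball_/= ltr_norml; apply/andP; split; lra.
  exact: subset_itv_oo_cc Js.
have h0 : (mu (`]a, b[%classic : set TR) <= 0)%E.
  by rewrite -A0; exact: (le_measure mu (mem_set (measurable_itvR `]a, b[)) (mem_set mA) sub).
have := fine_lebesgue_oo ab.
have -> : mu (`]a, b[%classic : set TR) = 0%E by apply/eqP; rewrite eq_le h0 measure_ge0.
by move=> /= /eqP; rewrite eq_sym subr_eq0 gt_eqF.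
Qed.

End TimeTest.

(** * Sobolev spaces *)

Section L2Functions.
Context {R : realType}.
Local Notation mu := (@lebesgue_measure R).
Local Notation TR := (measurableTypeR R).
Local Notation fct u := (u : TR -> real_sh R) (only parsing).
Implicit Types (u v w : R -> R).

(** Both sides say that u is measurable on D with integrable square; this connects the library's
    Lebesgue space with the vector theory at X = R. *)
Lemma Lfun_sL2 (D : set TR) u : measurable D ->
  ((u \_ D : R -> R) \in Lfun mu 2%:E) <-> sL2 mu D (fct u).
Proof.
move=> mD.
have e : (fun x => ((u \_ D) x ^+ 2)%:E) = (fun x => (u x ^+ 2)%:E) \_ D.
  by apply/funext => x; rewrite !patchE; case: ifP => //; rewrite expr0n.
have mr := measurable_restrict u mD measurableT; rewrite setTI in mr.
split=> [h|[su iu]].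
  have /andP[mu1 _] := h; rewrite inE/= in mu1.
  have mu2 : measurable_fun D u by exact/mr.
  split; first exact: measurable_smeas.
  have h2 : mu.-integrable setT ((fun x => (u x ^+ 2)%:E) \_ D) by rewrite -e; exact: Lfun2_integrable_sqr h.
  exact: (integrable_mkcond _ mD).2 h2.
have mu2 : measurable_fun D u by exact: smeas_measurable su.
have mu1 : measurable_fun setT (u \_ D) by exact/mr.
have /integrableP[_ fin] := (integrable_mkcond _ mD).1 iu.
rewrite inE; apply/andP; split; first by rewrite inE.
rewrite inE/= /finite_norm unlock /Lnorm; apply: poweR_lty; apply: le_lt_trans fin.
rewrite le_eqVlt; apply/orP; left; apply/eqP; apply: eq_integral => x _.
rewrite /= !patchE; case: ifP => _ /=; last by rewrite ?normr0 ?abse0 ?powR0 ?pnatr_eq0.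
by congr EFin; rewrite powR_mulrn// real_normK ?num_real// expr2 ger0_norm// -expr2 sqr_ge0.
Qed.

Lemma I_cases (L : \bar R) :
  [\/ exists2 r : R, L = r%:E & I_ L = `]- r, r[%classic, L = +oo%E /\ I_ L = setT | L = -oo%E /\ I_ L = set0].
Proof.
case: L => [r| |].
- by apply: Or31; exists r => //; apply/seteqP; split=> x; rewrite /I_/= in_itv/= -EFinN !lte_fin.
- by apply: Or32; split=> //; apply/seteqP; split=> x // _; rewrite /I_/= ltNyr ltry.
- by apply: Or33; split=> //; apply/seteqP; split=> x //; rewrite /I_/= ltNge leey.
Qed.

Lemma open_I (L : \bar R) : open (I_ L).
Proof.
by have [[r _ ->]|[_ ->]|[_ ->]] := I_cases L; [exact: interval_open|exact: openT|exact: open0].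
Qed.

Lemma is_interval_I (L : \bar R) : is_interval (I_ L).
Proof.
by have [[r _ ->]|[_ ->]|[_ ->]] := I_cases L; [exact: interval_is_interval| |].
Qed.

Lemma I_ne (L : \bar R) : (0 < L)%E -> I_ L !=set0.
Proof. by move=> L0; exists 0; rewrite /I_/= L0 andbT oppe_lt0. Qed.

Lemma measurable_I (L : \bar R) : measurable (I_ L : set TR).
Proof. by apply: open_measurable; exact: open_I. Qed.

Variable L : \bar R.
Local Notation I := (I_ L : set TR).
Local Notation mI := (measurable_I L).

Definition L2s : semiHilbert R := L2_sh mu mI (real_sh R).

Lemma L2P u : L2 L u <-> sL2 mu I (fct u).
Proof. exact: (Lfun_sL2 u mI). Qed.

Lemma L2_ss0 : L2 L (0 : R -> R^o).
Proof. by apply/L2P; exact: (sL2_0 mu mI (real_sh R)). Qed.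

Lemma L2_lin k u v : L2 L u -> L2 L v -> L2 L (k *: (u : R -> R^o) + v).
Proof. by move=> /L2P hu /L2P hv; apply/L2P; exact: (sL2_lin mI k hu hv). Qed.

Lemma L2_dotC u v : L2_dot L u v = L2_dot L v u.
Proof. by apply: eq_Rintegral => x _; rewrite mulrC. Qed.

Lemma L2_dot_lin k u v w : L2 L u -> L2 L v -> L2 L w ->
  L2_dot L (k *: (u : R -> R^o) + v) w = k * L2_dot L u w + L2_dot L v w.
Proof. by move=> /L2P hu /L2P hv /L2P hw; exact: (L2dot_lin mI k hu hv hw). Qed.

Lemma L2_dot_ge0 u : 0 <= L2_dot L u u.
Proof. exact: (L2dot_ge0 mu I (fct u)). Qed.

Lemma L2_measurable u : L2 L u -> measurable_fun I (u : TR -> R).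
Proof. by move=> /L2P[su _]; exact: smeas_measurable su. Qed.

Lemma L2_dot_ae u u' v : L2 L u -> L2 L u' -> L2 L v ->
  {ae mu, forall x, I_ L x -> u x = u' x} -> L2_dot L u v = L2_dot L u' v.
Proof.
move=> hu hu' hv uu; apply: (Rintegral_ae mI).
- exact: measurable_funM (L2_measurable hu) (L2_measurable hv).
- exact: measurable_funM (L2_measurable hu') (L2_measurable hv).
- by apply: ae_mono uu => x h /h ->.
Qed.

Lemma L2_dot0_ae u : L2 L u -> L2_dot L u u <= 0 -> {ae mu, forall x, I_ L x -> u x = 0}.
Proof.
move=> /L2P hu u0; have := L2dot_eq0 mI hu u0.
by apply: ae_mono => x h /h; rewrite nrm_real => /normr0_eq0.
Qed.

Lemma L2_locally_intg u : L2 L u -> locally_intg (I_ L) u.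
Proof.
move=> /L2P hu a b sub.
have mab : measurable (`[a, b]%classic : set TR) by exact: measurable_itvR.
have hu' := sL2S mI mab sub hu.
have h1 : sL2 mu (`[a, b]%classic : set TR) (fct (fun=> 1)).
  apply: (@sL2_bounded _ _ _ mu _ mab (real_sh R) _ 1); [exact: lebesgue_itv_fin|exact: smeas_cst|].
  by move=> t _; rewrite [dot _ _](_ : _ = 1 * 1)// mulr1.
by apply: eq_integrable (sL2_dot mab hu' h1) => // x _ /=; congr EFin; exact: mulr1.
Qed.

Lemma L2_test phi : (0 < L)%E -> test_function (I_ L) phi -> L2 L phi.
Proof.
move=> L0 tp; apply/L2P; split.
  by apply: (measurable_smeas mI); exact: (measurable_test tp mI).
have lp : locally_intg (I_ L) phi.
  move=> a b _; apply: continuous_compact_integrable; first exact: segment_compact.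
  by apply: continuous_subspaceT; exact: test_continuous tp.
have h := intg_test (@open_I L) (@is_interval_I L) (I_ne L0) lp tp; exact h.
Qed.

End L2Functions.

(** * Weak derivatives, H1 and its closed subspaces *)

Section Sobolev.
Context {R : realType} (L : \bar R).
Hypothesis L0 : (0 < L)%E.
Local Notation mu := (@lebesgue_measure R).
Local Notation TR := (measurableTypeR R).
Local Notation I := (I_ L : set TR).
Implicit Types (u v w : R -> R).

Let Io : open (I_ L) := @open_I R L.
Let Ii : is_interval (I_ L) := @is_interval_I R L.
Let In : I_ L !=set0 := I_ne L0.

Lemma test_L2 phi : test_function (I_ L) phi -> L2 L phi /\ L2 L (derive1 phi).
Proof.
move=> tp; split; first exact: L2_test.
by apply: L2_test => //; exact: test_derive1.
Qed.

Lemma weak_derivative_lin k u v u' v' : L2 L u -> L2 L v -> L2 L u' -> L2 L v' ->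
  weak_derivative L u u' -> weak_derivative L v v' ->
  weak_derivative L (k *: (u : R -> R^o) + v) (k *: (u' : R -> R^o) + v').
Proof.
move=> hu hv hu' hv' wu wv phi tp; have [l1 l2] := test_L2 tp.
have a1 := L2_dot_lin k hu hv l2; have a2 := L2_dot_lin k hu' hv' l1.
apply: etrans a1 _; apply: etrans (congr1 -%R (esym a2)).
by rewrite opprD -mulrN; congr (_ * _ + _); [exact: wu|exact: wv].
Qed.

Lemma weak_derivative_unique u w w' : L2 L w -> L2 L w' ->
  weak_derivative L u w -> weak_derivative L u w' -> {ae mu, forall x, I_ L x -> w x = w' x}.
Proof.
move=> hw hw' ww ww'.
have hB : L2 L ((-1) *: (w' : R -> R^o) + w) by exact: L2_lin.
have h0 phi : test_function (I_ L) phi ->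
    \int[mu]_(x in I) (((-1) *: (w' : R -> R^o) + w) x * phi x) = 0.
  move=> tp; have [l1 _] := test_L2 tp.
  apply: etrans (L2_dot_lin (-1) hw' hw l1) _.
  rewrite mulN1r; have e1 := ww phi tp; have e2 := ww' phi tp.
  have -> : L2_dot L w phi = L2_dot L w' phi by apply: oppr_inj; rewrite -[LHS]e1 -[RHS]e2.
  by rewrite addrC subrr.
have h := test_Rintegral_ae Io (L2_locally_intg hB) h0.
apply: ae_mono h => x h /h /eqP; rewrite (_ : (_ + _) x = (-1) * w' x + w x)//.
by rewrite mulN1r addrC subr_eq0 => /eqP.
Qed.

Lemma dxP u : H1 L u -> [/\ L2 L u, L2 L (dx L u) & weak_derivative L u (dx L u)].
Proof.
move=> [hu [w lw ww]]; split=> //;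
by have [] := @xgetPex _ (cst 0 : R -> R) [set w | L2 L w /\ weak_derivative L u w] (ex_intro _ w (conj lw ww)).
Qed.

Lemma dx_ae u w : H1 L u -> L2 L w -> weak_derivative L u w ->
  {ae mu, forall x, I_ L x -> dx L u x = w x}.
Proof. by move=> /dxP[_ l d] lw ww; exact: weak_derivative_unique d ww. Qed.

(** [dx] chooses a function in a class, so it is linear only almost everywhere. Its properties are
    therefore stated inside scalar products, where the choice is invisible. *)
Lemma dx_dot u w v : H1 L u -> L2 L w -> weak_derivative L u w -> L2 L v ->
  L2_dot L (dx L u) v = L2_dot L w v.
Proof.
move=> hu lw ww lv; have [_ l _] := dxP hu.
by apply: L2_dot_ae => //; exact: dx_ae.
Qed.

Lemma H1_lin k u v : H1 L u -> H1 L v -> H1 L (k *: (u : R -> R^o) + v).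
Proof.
move=> /dxP[lu ldu du] /dxP[lv ldv dv]; split; first exact: L2_lin.
by exists (k *: (dx L u : R -> R^o) + dx L v); [exact: L2_lin|exact: weak_derivative_lin].
Qed.

Lemma weak_derivative0 : weak_derivative L (0 : R -> R^o) (0 : R -> R^o).
Proof.
move=> phi _; have e f : \int[mu]_(x in I) ((0 : R -> R^o) x * f x) = 0.
  have -> : \int[mu]_(x in I) ((0 : R -> R^o) x * f x) = \int[mu]_(x in I) 0.
    by apply: eq_Rintegral => x _; exact: mul0r.
  by rewrite Rintegral_cst ?mul0r//; exact: measurable_I.
by rewrite !e oppr0.
Qed.

Lemma H1_0fun : H1 L (0 : R -> R^o).
Proof.
split; first exact: L2_ss0.
by exists 0; [exact: L2_ss0|exact: weak_derivative0].
Qed.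

Definition H1_subspace : subspace (R -> R^o) := Subspace H1_0fun H1_lin.

Lemma dx_lin k u v w : H1 L u -> H1 L v -> L2 L w ->
  L2_dot L (dx L (k *: (u : R -> R^o) + v)) w = k * L2_dot L (dx L u) w + L2_dot L (dx L v) w.
Proof.
move=> hu hv lw; have [lu ldu du] := dxP hu; have [lv ldv dv] := dxP hv.
apply: etrans (dx_dot (H1_lin k hu hv) (L2_lin k ldu ldv) (weak_derivative_lin k lu lv ldu ldv du dv) lw) _.
exact: (L2_dot_lin k ldu ldv lw).
Qed.

Lemma form_aC kappa u v : form_a L kappa u v = form_a L kappa v u.
Proof. by rewrite /form_a (L2_dotC L (dx L u)) (L2_dotC L u). Qed.

Lemma form_a_lin kappa k u v w : H1 L u -> H1 L v -> H1 L w ->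
  form_a L kappa (k *: (u : R -> R^o) + v) w = k * form_a L kappa u w + form_a L kappa v w.
Proof.
move=> hu hv hw; have [lu _ _] := dxP hu; have [lv _ _] := dxP hv; have [lw ldw _] := dxP hw.
apply: etrans (congr2 (fun a b => a + kappa * b) (dx_lin k hu hv ldw) (L2_dot_lin k lu lv lw)) _.
have r (A B C D : R) : k * A + B + kappa * (k * C + D) = k * (A + kappa * C) + (B + kappa * D) by ring.
exact: r.
Qed.

(** The Sobolev scalar product is the form with regularization 1, so symmetry and linearity are
    proved for both at once. *)
Lemma H1_dotE u v : H1_dot L u v = form_a L 1 u v.
Proof. by rewrite /H1_dot /form_a mul1r addrC. Qed.

Lemma L2_complete (u : nat -> R -> R) : (forall n, L2 L (u n)) ->
  (forall e : R, 0 < e -> exists N, forall m n, (N <= m)%N -> (N <= n)%N ->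
     L2_dot L (u m - u n) (u m - u n) < e) ->
  exists2 v, L2 L v & L2_dot L (u n - v) (u n - v) @[n --> \oo] --> (0 : R).
Proof.
move=> lu cu.
have su n : sL2 mu I (u n : TR -> real_sh R) by apply/L2P.
have [v sv hv] := sL2_complete (measurable_I L) su cu.
by exists v => //; apply/L2P.
Qed.

Lemma L2_dot_cvg (u : nat -> R -> R) v w : (forall n, L2 L (u n)) -> L2 L v -> L2 L w ->
  L2_dot L (u n - v) (u n - v) @[n --> \oo] --> (0 : R) ->
  L2_dot L (u n) w @[n --> \oo] --> L2_dot L v w.
Proof.
move=> /(_ _)/L2P su /L2P sv /L2P sw h.
apply: (@L2dot_cvg _ _ _ mu I (measurable_I L) (real_sh R) u (fun=> w) v w) => //.
exact: (L2cvg_cst mu (measurable_I L) (w : TR -> real_sh R)).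
Qed.

(** The functions and their derivatives converge separately in L2; testing passes to the limit, so
    the second limit is the weak derivative of the first. *)
Lemma H1_complete (u : nat -> R -> R) : (forall n, H1 L (u n)) ->
  (forall e : R, 0 < e -> exists N, forall m n, (N <= m)%N -> (N <= n)%N ->
     H1_dot L (u m - u n) (u m - u n) < e) ->
  exists2 v, H1 L v & H1_dot L (u n - v) (u n - v) @[n --> \oo] --> (0 : R).
Proof.
move=> hu cu.
have hB m n : H1 L (u m - u n).
  by have := H1_lin (-1) (hu n) (hu m); rewrite scaleN1r addrC.
have lu n : L2 L (u n) by have [] := dxP (hu n).
have ld n : L2 L (dx L (u n)) by have [] := dxP (hu n).
have [v lv cv] : exists2 v, L2 L v & L2_dot L (u n - v) (u n - v) @[n --> \oo] --> (0 : R).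
  apply: L2_complete => // e /cu[N hN]; exists N => m n Nm Nn.
  by apply: le_lt_trans (hN m n Nm Nn); rewrite /H1_dot lerDl L2_dot_ge0.
have LB (f g : R -> R) : L2 L f -> L2 L g -> L2 L ((f : R -> R^o) - g).
  by move=> lf lg; have := L2_lin (-1) lg lf; rewrite scaleN1r addrC.
have dxB (f g : R -> R) w : H1 L f -> L2 L g -> weak_derivative L w g -> H1 L w ->
   L2_dot L (dx L ((f : R -> R^o) - w)) (dx L ((f : R -> R^o) - w)) = L2_dot L ((dx L f : R -> R^o) - g) ((dx L f : R -> R^o) - g).
  move=> hf lg dg hw; have [lf ldf df] := dxP hf; have [lw _ _] := dxP hw.
  have hfw : H1 L ((f : R -> R^o) - w) by have := H1_lin (-1) hw hf; rewrite scaleN1r addrC.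
  have [lfw ldfw _] := dxP hfw.
  have wd : weak_derivative L ((f : R -> R^o) - w) ((dx L f : R -> R^o) - g).
    by have := weak_derivative_lin (-1) lw lf lg ldf dg df; rewrite !scaleN1r ![- _ + _]addrC.
  have lB := LB _ _ ldf lg.
  by rewrite (dx_dot hfw lB wd ldfw) L2_dotC (dx_dot hfw lB wd lB).
have [g lg cg] : exists2 v, L2 L v & L2_dot L (dx L (u n) - v) (dx L (u n) - v) @[n --> \oo] --> (0 : R).
  apply: L2_complete => // e /cu[N hN]; exists N => m n Nm Nn.
  have [_ _ dn] := dxP (hu n).
  rewrite -(dxB _ _ (u n) (hu m) (ld n) dn (hu n)).
  by apply: le_lt_trans (hN m n Nm Nn); rewrite /H1_dot lerDr L2_dot_ge0.
have wv : weak_derivative L v g.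
  move=> phi tp; have [l1 l2] := test_L2 tp.
  apply: (@cvg_uniq _ (fun n => L2_dot L (u n) (derive1 phi)) (fun n => - L2_dot L (dx L (u n)) phi)).
  - by move=> n; have [_ _ d] := dxP (hu n); exact: d.
  - exact: L2_dot_cvg.
  - by apply: cvgN; exact: L2_dot_cvg.
have hv : H1 L v by split=> //; exists g.
exists v => //; rewrite /H1_dot -[X in _ --> X]addr0; apply: cvgD => //.
have -> // : (fun n => L2_dot L (dx L (u n - v)) (dx L (u n - v))) = (fun n => L2_dot L (dx L (u n) - g) (dx L (u n) - g)).
by apply/funext => n; rewrite -(dxB _ _ v (hu n) lg wv hv).
Qed.

Definition H1_sh : semiHilbert R.
Proof.
apply: (@SemiHilbert R (sub_of H1_subspace) (fun x y => H1_dot L (sub_val x) (sub_val y))).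
- by move=> x y; rewrite !H1_dotE form_aC.
- by move=> k x y z; rewrite !H1_dotE; exact: (form_a_lin 1 k (sub_valP x) (sub_valP y) (sub_valP z)).
- by move=> x; rewrite /H1_dot addr_ge0// L2_dot_ge0.
- move=> u hu; have [v hv cv] := H1_complete (fun n => sub_valP (u n)) hu.
  by exists (@sub_mk _ _ H1_subspace v hv).
Defined.

Let mkH u (hu : H1 L u) : H1_sh := @sub_mk _ _ H1_subspace u hu.

Lemma H1_normE u (hu : H1 L u) : H1_norm L u = nrm (mkH hu).
Proof. by []. Qed.

Lemma H1_norm_lin k u v : H1 L u -> H1 L v ->
  H1_norm L (k *: (u : R -> R^o) + v) <= `|k| * H1_norm L u + H1_norm L v.
Proof.
move=> hu hv; rewrite !H1_normE; first exact: H1_lin.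
move=> h; have := nrmD (k *: mkH hu) (mkH hv); rewrite nrmZ; apply: le_trans.
by rewrite le_eqVlt; apply/orP; left; apply/eqP.
Qed.

Lemma H1_closure_lin (S : set (R -> R)) : S `<=` H1 L ->
  (forall k u v, S u -> S v -> S (k *: (u : R -> R^o) + v)) ->
  forall k u v, H1_closure L S u -> H1_closure L S v -> H1_closure L S (k *: (u : R -> R^o) + v).
Proof.
move=> SH Sl k u v [hu cu] [hv cv]; split; first exact: H1_lin.
move=> e e0; have k1 : 0 < `|k| + 1 by rewrite ltr_wpDl.
have [u' Su' du] := cu (e / 2 / (`|k| + 1)) (divr_gt0 (divr_gt0 e0 (ltr0n _ 2)) k1).
have [v' Sv' dv] := cv (e / 2) (divr_gt0 e0 (ltr0n _ 2)).
exists (k *: (u' : R -> R^o) + v'); first exact: Sl.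
have B (f g : R -> R) : H1 L f -> H1 L g -> H1 L ((f : R -> R^o) - g).
  by move=> lf lg; have := H1_lin (-1) lg lf; rewrite scaleN1r addrC.
have -> : (k *: (u : R -> R^o) + v - (k *: (u' : R -> R^o) + v') : R -> R^o) =
   k *: ((u : R -> R^o) - u') + ((v : R -> R^o) - v').
  by rewrite scalerBr opprD addrACA.
apply: le_lt_trans (H1_norm_lin k (B _ _ hu (SH _ Su')) (B _ _ hv (SH _ Sv'))) _.
rewrite [ltRHS](splitr e) ler_ltD//.
apply: le_trans (ler_wpM2l (normr_ge0 k) (ltW du)) _.
rewrite mulrCA ler_piMr ?divr_ge0 ?(ltW e0)//.
by rewrite ler_pdivrMr// mul1r lerDl.
Qed.

Lemma H1_norm0 : H1_norm L (0 : R -> R^o) = 0.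
Proof. by rewrite (H1_normE H1_0fun); exact: (@nrm0 _ H1_sh). Qed.

Lemma sub_H1_closure (S : set (R -> R)) u : H1 L u -> S u -> H1_closure L S u.
Proof.
move=> hu Su; split=> // e e0; exists u => //.
by rewrite (_ : (u - u) = (0 : R -> R^o)) ?H1_norm0//; exact: (@subrr (R -> R^o)).
Qed.

Lemma H1_closure_limit (S : set (R -> R)) (u : nat -> R -> R) v : S `<=` H1 L ->
  (forall n, H1_closure L S (u n)) -> H1 L v ->
  H1_dot L (u n - v) (u n - v) @[n --> \oo] --> (0 : R) -> H1_closure L S v.
Proof.
move=> SH cu hv cv; split=> // e e0.
have B (f g : R -> R) : H1 L f -> H1 L g -> H1 L ((f : R -> R^o) - g).
  by move=> lf lg; have := H1_lin (-1) lg lf; rewrite scaleN1r addrC.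
have [N hN] := cvg0_lt cv (exprn_gt0 2 (divr_gt0 e0 (ltr0n _ 2))).
have [hu hS] := cu N; have [w Sw dw] := hS (e / 2) (divr_gt0 e0 (ltr0n _ 2)).
exists w => //; have hw := SH _ Sw.
have -> : ((v : R -> R^o) - w : R -> R^o) = (-1) *: ((u N : R -> R^o) - v) + ((u N : R -> R^o) - w).
  by rewrite scaleN1r opprB addrA subrK.
apply: le_lt_trans (H1_norm_lin (-1) (B _ _ hu hv) (B _ _ hu hw)) _.
rewrite normrN1 mul1r [ltRHS](splitr e); apply: ltrD; last exact: dw.
have d0 : 0 <= H1_dot L (u N - v) (u N - v) by rewrite /H1_dot addr_ge0// L2_dot_ge0.
have sq (d x : R) : 0 <= d -> 0 < x -> d < x ^+ 2 -> Num.sqrt d < x.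
  by move=> d1 x0 dx; rewrite -(ltr_pXn2r (n := 2)) ?nnegrE ?sqrtr_ge0 ?(ltW x0)// sqr_sqrtr.
exact: (sq _ _ d0 (divr_gt0 e0 (ltr0n _ 2)) (hN N (leqnn N))).
Qed.

Lemma weak_derivative_test phi : test_function (I_ L) phi -> weak_derivative L phi (derive1 phi).
Proof.
move=> tp psi tq.
have mu_ab f a b : `[a, b]%classic `<=` I_ L -> (forall x, ~ (`]a, b[%classic : set R) x -> f x = 0) ->
    \int[mu]_(x in I) f x = \int[mu]_(x in `[a, b]) f x.
  move=> sub h; apply: Rintegral_support => // x _ hx; apply: h => hx'; apply: hx.
  exact: subset_itv_oo_cc hx'.
have [a [b [ab sub h]]] := test_function_support Io Ii In tp.
rewrite (mu_ab _ a b sub); last by move=> x /h ->; rewrite mul0r.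
rewrite (mu_ab _ a b sub); last by move=> x /(derive1_support (test_smooth tp) h) ->; rewrite mul0r.
have dd f : test_function (I_ L) f -> derivable_oo_LRcontinuous f a b.
  move=> tf; have cf := test_continuous tf; split.
  - by move=> x _; apply: ex_derive; exact: smooth_deriv (test_smooth tf) x.
  - by apply: cvg_at_right_filter; exact: cf.
  - by apply: cvg_at_left_filter; exact: cf.
have cd f : test_function (I_ L) f -> {within `[a, b], continuous (derive1 f)}.
  move=> tf; apply: continuous_subspaceT; apply: test_continuous.
  exact: (test_derive1 Io Ii In tf).
rewrite (Rintegration_by_parts ab (cd _ tp) (dd _ tp) (fun _ _ => erefl) (cd _ tq) (dd _ tq) (fun _ _ => erefl)).
rewrite !h ?mul0r ?subrr ?sub0r// /= in_itv/= ltxx ?andbF//.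
Qed.

Lemma test_H1 phi : test_function (I_ L) phi -> H1 L phi.
Proof.
move=> tp; have [l1 l2] := test_L2 tp; split=> //.
by exists (derive1 phi) => //; exact: weak_derivative_test.
Qed.

Lemma vanishes_at_ends_lin k u v : vanishes_at_ends L u -> vanishes_at_ends L v ->
  vanishes_at_ends L (k *: (u : R -> R^o) + v).
Proof.
have c F (FF : Filter F) : u x @[x --> F] --> (0 : R) -> v x @[x --> F] --> (0 : R) ->
    (k *: (u : R -> R^o) + v) x @[x --> F] --> (0 : R).
  move=> hu hv; rewrite -[X in _ --> X]addr0 -[X in _ --> X + _](mulr0 k).
  by apply: cvgD => //; apply: cvgMr.
by rewrite /vanishes_at_ends; case: (L) => [r| |] // [u1 u2] [v1 v2]; split; exact: c.
Qed.

Lemma vanishes_at_ends_test phi : test_function (I_ L) phi -> vanishes_at_ends L phi.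
Proof.
move=> tp; have [a [b [ab sub h]]] := test_function_support Io Ii In tp.
have aI : I_ L a by apply: sub; rewrite /= in_itv/= lexx ltW.
have bI : I_ L b by apply: sub; rewrite /= in_itv/= lexx ltW.
have h1 x : x < a -> phi x = 0 by move=> xa; rewrite h//= in_itv/= (lt_gtF xa).
have h2 x : b < x -> phi x = 0 by move=> xa; rewrite h//= in_itv/= (lt_gtF xa) andbF.
move: aI bI; rewrite /vanishes_at_ends /I_; case: (L) => [r| |] //= /andP[a1 a2] /andP[b1 b2]; split;
  apply: cvg_near_cst; near=> x.
- by apply: h2; near: x; apply: nbhs_left_gt; rewrite -lte_fin.
- by apply: h1; near: x; apply: nbhs_right_lt; rewrite -lte_fin.
- by apply: h2; near: x; apply: nbhs_pinfty_gt; exact: num_real.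
- by apply: h1; near: x; apply: nbhs_ninfty_lt; exact: num_real.
Unshelve. all: by end_near.
Qed.

(** Both choices of V are closures of such a core, which allows one treatment of the two boundary
    conditions. *)
Definition V_base (bc : boundary_condition) : set (R -> R) :=
  match bc with
  | Dirichlet => test_function (I_ L)
  | Neumann => [set u | H1 L u /\ exists w, [/\ L2 L w, weak_derivative L u w & vanishes_at_ends L w]]
  end.

Lemma V_memE bc : V_mem L bc = H1_closure L (V_base bc).
Proof. by case: bc. Qed.

Lemma V_base_H1 bc : V_base bc `<=` H1 L.
Proof. by case: bc => u; [exact: test_H1|case]. Qed.

Lemma V_base_lin bc k u v : V_base bc u -> V_base bc v -> V_base bc (k *: (u : R -> R^o) + v).
Proof.
case: bc => /=; first exact: test_lin.
move=> [hu [u' [lu' du vu]]] [hv [v' [lv' dv vv]]]; split; first exact: H1_lin.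
have [lu _ _] := dxP hu; have [lv _ _] := dxP hv.
exists (k *: (u' : R -> R^o) + v'); split; [exact: L2_lin|exact: weak_derivative_lin|].
exact: vanishes_at_ends_lin.
Qed.

(** Test functions satisfy the Neumann condition too, since their derivatives vanish near the ends.
    This provides density of V in H in both cases. *)
Lemma test_V bc phi : test_function (I_ L) phi -> V_mem L bc phi.
Proof.
move=> tp; rewrite V_memE; apply: sub_H1_closure; first exact: test_H1.
case: bc => //=; split; first exact: test_H1.
exists (derive1 phi); split; [by have [] := test_L2 tp|exact: weak_derivative_test|].
by apply: vanishes_at_ends_test; exact: test_derive1.
Qed.

Lemma V_H1 bc u : V_mem L bc u -> H1 L u.
Proof. by rewrite V_memE => -[]. Qed.

Lemma V_mem_lin bc k u v : V_mem L bc u -> V_mem L bc v -> V_mem L bc (k *: (u : R -> R^o) + v).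
Proof. by rewrite V_memE; apply: H1_closure_lin; [exact: V_base_H1|exact: V_base_lin]. Qed.

Lemma V_mem0 bc : V_mem L bc (0 : R -> R^o).
Proof. by apply: test_V; exact: test_cst0. Qed.

Definition V_subspace bc : subspace (R -> R^o) := Subspace (V_mem0 bc) (@V_mem_lin bc).

End Sobolev.

(** * V with the scalar product a, and its embedding into H *)

Section EnergySpace.
Context {R : realType} (L : \bar R) (bc : boundary_condition).
Context (ip : (R -> R) -> (R -> R) -> R) (kappa c0 : R).
Hypothesis L0 : (0 < L)%E.
Hypothesis ipV : V_inner_product L bc ip.
Hypothesis a_bounded : form_bounded L bc ip kappa.
Hypothesis c0_gt0 : 0 < c0.
Hypothesis a_coercive : form_coercive L bc ip kappa c0.
Local Notation mu := (@lebesgue_measure R).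
Local Notation TR := (measurableTypeR R).
Local Notation I := (I_ L : set TR).
Implicit Types (u v w : R -> R).
Local Notation a := (form_a L kappa).

Lemma ip_ge0 u : V_mem L bc u -> 0 <= ip u u.
Proof.
move=> Vu; have [_ _ [m [M [m0 M0 h]]]] := ipV; have /andP[+ _] := h u Vu; apply: le_trans.
by rewrite mulr_ge0 ?(ltW m0)// /H1_dot addr_ge0// L2_dot_ge0.
Qed.

Lemma V_norm_sqr u : V_mem L bc u -> V_norm ip u ^+ 2 = ip u u.
Proof. by move=> Vu; rewrite /V_norm sqr_sqrtr// ip_ge0. Qed.

Lemma form_le_ip u : V_mem L bc u -> a u u <= ip u u.
Proof.
move=> Vu; apply: le_trans (ler_norm _) _; apply: le_trans (a_bounded Vu Vu) _.
by rewrite -expr2 V_norm_sqr.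
Qed.

Lemma ip_le_form u : V_mem L bc u -> c0 * ip u u <= a u u.
Proof. by move=> Vu; rewrite -V_norm_sqr//; exact: a_coercive. Qed.

Lemma form_ge0 u : V_mem L bc u -> 0 <= a u u.
Proof. by move=> Vu; apply: le_trans (ip_le_form Vu); rewrite mulr_ge0 ?(ltW c0_gt0)// ip_ge0. Qed.

Lemma form_H1 : exists2 k, 0 < k & forall u, V_mem L bc u -> H1_dot L u u <= k * a u u.
Proof.
have [_ _ [m [M [m0 M0 h]]]] := ipV.
exists (m^-1 * c0^-1); first by rewrite mulr_gt0 ?invr_gt0.
move=> u Vu; rewrite -mulrA; have /andP[h1 _] := h u Vu.
rewrite ler_pdivlMl//; apply: le_trans h1 _.
by rewrite ler_pdivlMl// ip_le_form.
Qed.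

Local Notation VS := (V_subspace L0 bc).

(** Completeness: coercivity turns Cauchy sequences for a into Cauchy sequences of H1, where V is
    closed, and boundedness of a turns H1 convergence back into convergence for a. *)
Definition V_sh : semiHilbert R.
Proof.
apply: (@SemiHilbert R (sub_of VS) (fun x y => a (sub_val x) (sub_val y))).
- by move=> x y; exact: form_aC.
- move=> k x y z.
  exact: (form_a_lin L0 kappa k (V_H1 (sub_valP x)) (V_H1 (sub_valP y)) (V_H1 (sub_valP z))).
- by move=> x; exact: form_ge0 (sub_valP x).
- move=> u hu; have [k k0 hk] := form_H1.
  have [|v hv cv] := @H1_complete _ L L0 (fun n => sub_val (u n)) (fun n => V_H1 (sub_valP (u n))).
    move=> e e0; have ki : 0 < k^-1 by rewrite invr_gt0.
    have [N hN] := hu (k^-1 * e) (mulr_gt0 ki e0).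
    exists N => m n Nm Nn; apply: le_lt_trans (hk _ (sub_valP (u m - u n))) _.
    by rewrite -ltr_pdivlMl//; exact: hN.
  have Vv : V_mem L bc v.
    rewrite V_memE; apply: (H1_closure_limit L0 (@V_base_H1 _ _ L0 bc) _ hv cv).
    by move=> n; rewrite -V_memE; exact: sub_valP (u n).
  exists (@sub_mk _ _ VS v Vv).
  have [_ _ [m [M [m0 M0 h]]]] := ipV.
  apply: (@squeeze_cvgr _ _ _ _ (fun=> 0) (fun n => M * H1_dot L (sub_val (u n) - v) (sub_val (u n) - v))).
  + near=> n; pose x := u n - @sub_mk _ _ VS v Vv.
    apply/andP; split; first exact: form_ge0 (sub_valP x).
    apply: le_trans (form_le_ip (sub_valP x)) _.
    by have /andP[_] := h _ (sub_valP x).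
  + exact: cvg_cst.
  + by rewrite -[X in _ --> X](mulr0 M); apply: cvg_scale.
Unshelve. all: by end_near.
Defined.

Definition V_inj (x : V_sh) : L2s L :=
  @L2_mk _ _ _ mu I (measurable_I L) (real_sh R) (sub_val x)
    ((L2P L _).1 (let: And3 h _ _ := dxP (V_H1 (sub_valP x)) in h)).

Lemma V_inj_dot (x y : V_sh) : dot (V_inj x) (V_inj y) = L2_dot L (sub_val x) (sub_val y).
Proof. by []. Qed.

Lemma V_inj_lin k (x y : V_sh) : V_inj (k *: x + y) = k *: V_inj x + V_inj y.
Proof. by apply: val_inj. Qed.

Lemma V_inj_le : exists2 M, 0 <= M & forall x : V_sh, nrm (V_inj x) <= M * nrm x.
Proof.
have [k k0 hk] := form_H1; exists (Num.sqrt k); first exact: sqrtr_ge0.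
move=> x; rewrite /nrm -sqrtrM ?(ltW k0)// ler_wsqrtr//.
apply: le_trans (hk _ (sub_valP x)).
by rewrite V_inj_dot /H1_dot lerDl L2_dot_ge0.
Qed.

(** A function that vanishes almost everywhere has 0 as a weak derivative, so both terms of a(x, x)
    vanish. *)
Lemma V_inj_inj (x : V_sh) : nrm (V_inj x) = 0 -> nrm x = 0.
Proof.
move=> /nrm_eq0P; rewrite V_inj_dot => h.
have hx := V_H1 (sub_valP x); have [lx ldx dx_] := dxP hx.
have x0 := L2_dot0_ae lx (eq_ind_r (fun z => z <= 0) (lexx 0) h).
have l0 := L2_ss0 L.
have wd : weak_derivative L (sub_val x) (0 : R -> R^o).
  move=> phi tp; have [l1 l2] := test_L2 L0 tp.
  exact: (etrans (L2_dot_ae lx l0 l2 x0) (weak_derivative0 tp)).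
have d0 : L2_dot L (dx L (sub_val x)) (dx L (sub_val x)) = 0.
  rewrite (dx_dot L0 hx l0 wd ldx) /L2_dot.
  have -> : \int[mu]_(y in I) ((0 : R -> R^o) y * dx L (sub_val x) y) = \int[mu]_(y in I) 0.
    by apply: eq_Rintegral => y _; exact: mul0r.
  by rewrite Rintegral_cst ?mul0r//; exact: measurable_I.
by apply/nrm_eq0P; rewrite [dot x x](_ : _ = a (sub_val x) (sub_val x))// /form_a d0 h mulr0 addr0.
Qed.

(** V contains the test functions, so the fundamental lemma applies to q. *)
Lemma V_inj_dense (q : L2s L) : (forall x : V_sh, dot q (V_inj x) = 0) -> nrm q = 0.
Proof.
move=> h; have lq : L2 L (sub_val q) by apply/L2P; exact: sub_L2P.
have q0 := test_Rintegral_ae (@open_I _ L) (L2_locally_intg lq) (fun phi tp =>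
   h (@sub_mk _ _ VS phi (test_V L0 bc tp))).
apply/nrm_eq0P; rewrite [dot q q](_ : _ = L2_dot L (sub_val q) (sub_val q))//.
rewrite (L2_dot_ae lq (L2_ss0 L) lq q0) /L2_dot.
have -> : \int[mu]_(y in I) ((0 : R -> R^o) y * sub_val q y) = \int[mu]_(y in I) 0.
  by apply: eq_Rintegral => y _; exact: mul0r.
by rewrite Rintegral_cst ?mul0r//; exact: measurable_I.
Qed.

End EnergySpace.

(** * Bochner spaces over prenormed spaces *)

Section LowerIntegral.
Import HBNNSimple.
Context {R : realType} d (T0 : measurableType d) (mu : {measure set T0 -> \bar R}).

(* No measurability is required: the integral of a nonnegative function is a
   supremum over the simple functions below it. *)
Lemma ae_le_integral (D : set T0) (f g : T0 -> \bar R) :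
  (forall t, (0 <= f t)%E) -> (forall t, (0 <= g t)%E) ->
  {ae mu, forall t, D t -> (f t <= g t)%E} ->
  (\int[mu]_(t in D) f t <= \int[mu]_(t in D) g t)%E.
Proof.
move=> f0 g0 [N [mN N0 hN]].
rewrite (ge0_integralE mu (fun x _ => f0 x)) (ge0_integralE mu (fun x _ => g0 x)).
apply: ge_ereal_sup => _ /= [h hf <-].
have mC : measurable (~` N) by exact: measurableC.
(* The simple function is set to 0 on the null set: its integral is unchanged, and it now lies below
   g everywhere. *)
pose h1 := mul_nnsfun h (indic_nnsfun R mC).
have hle : (sintegral mu h <= sintegral mu h1)%E.
  rewrite -!integralT_nnsfun le_eqVlt; apply/orP; left; apply/eqP.
  apply: ae_eq_integral => //; try by apply/measurable_EFinP.
  exists N; split=> // x /= hx; apply: contrapT => Nx; apply: hx => _.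
  by rewrite mindicE mem_set ?mulr1.
apply: (le_trans hle).
apply: ereal_sup_ubound; exists h1 => // x /=.
  have [Nx|Nx] := pselect (N x).
    rewrite mindicE memNset ?mulr0; last by move=> h'; exact: h'.
    by rewrite patchE; case: ifP.
  rewrite mindicE mem_set ?mulr1//; apply: le_trans (hf x) _.
  rewrite !patchE; case: ifPn => // /set_mem Dx.
  by apply: contrapT => hx; apply: Nx; apply: hN => /= /(_ Dx).
Qed.

End LowerIntegral.

Section Realization.
Context {R : realType} (X : prenormed R) (Y : semiHilbert R).

(* A prenormed space is identified with a semi-Hilbert space through maps in both
   directions which are inverse to each other up to vectors of norm zero. *)
Record realization (rho : X -> Y) (sigma : Y -> X) (A B : R) : Prop := Realization {
  rz_A : 0 < A;
  rz_B : 0 < B;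
  rz_ge0 : forall x : X, 0 <= pn_norm x;
  rz_mem0 : pn_mem (0 : X);
  rz_mem : forall k (x y : X), pn_mem x -> pn_mem y -> pn_mem (k *: x + y);
  rz_lin : forall k (x y : X), pn_mem x -> pn_mem y -> nrm (rho (k *: x + y) - (k *: rho x + rho y)) = 0;
  rz_leA : forall x : X, pn_mem x -> nrm (rho x) <= A * pn_norm x;
  rz_leB : forall x : X, pn_mem x -> pn_norm x <= B * nrm (rho x);
  rz_inv : forall y, pn_mem (sigma y) /\ nrm (rho (sigma y) - y) = 0 }.

End Realization.

Section Transfer.
Context {R : realType} (T : R) (X : prenormed R) (Y : semiHilbert R).
Context (rho : X -> Y) (sigma : Y -> X) (A B : R).
Hypothesis T0 : 0 < T.
Hypothesis rz : realization rho sigma A B.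
Local Notation mu := (@lebesgue_measure R).
Local Notation TR := (measurableTypeR R).
Local Notation J := (`[0, T]%classic : set TR).
Local Notation Jo := (`]0, T[%classic : set TR).
Implicit Types (u : R -> X) (v : R -> Y) (x : X) (y : Y).

Let mJ : measurable J := measurable_itvR _.
Let mo : measurable Jo := measurable_itvR _.
Let oJ : Jo `<=` J := @subset_itv_oo_cc _ _ _ _.
Let A0 : 0 < A := rz_A rz.
Let B0 : 0 < B := rz_B rz.

Definition represents u v : Prop :=
  {ae mu, forall t, t \in `]0, T[ -> pn_mem (u t) /\ nrm (rho (u t) - v t) = 0}.

Lemma rz_memB x x' : pn_mem x -> pn_mem x' -> pn_mem (x - x').
Proof. by move=> hx hx'; have := rz_mem rz (-1) hx' hx; rewrite scaleN1r addrC. Qed.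

Lemma rz_linB x x' : pn_mem x -> pn_mem x' -> nrm (rho (x - x') - (rho x - rho x')) = 0.
Proof.
move=> hx hx'; have := rz_lin rz (-1) hx' hx.
by rewrite !scaleN1r [- x' + x]addrC [- rho x' + _]addrC.
Qed.

Lemma rz_distA x x' : pn_mem x -> pn_mem x' -> nrm (rho x - rho x') <= A * pn_norm (x - x').
Proof.
move=> hx hx'; rewrite -(eq_nrm (rz_linB hx hx')).
by apply: (rz_leA rz); exact: rz_memB.
Qed.

Lemma rz_distB x x' : pn_mem x -> pn_mem x' -> pn_norm (x - x') <= B * nrm (rho x - rho x').
Proof.
move=> hx hx'; rewrite -(eq_nrm (rz_linB hx hx')).
by apply: (rz_leB rz); exact: rz_memB.
Qed.

Lemma rz_sum n (k : 'I_n -> R) (x : 'I_n -> X) : (forall i, pn_mem (x i)) ->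
  pn_mem (\sum_(i < n) k i *: x i) /\
  nrm (rho (\sum_(i < n) k i *: x i) - \sum_(i < n) k i *: rho (x i)) = 0.
Proof.
elim: n k x => [|n ih] k x hx.
  rewrite !big_ord0; split; first exact: rz_mem0 rz.
  by have := rz_linB (rz_mem0 rz) (rz_mem0 rz); rewrite !subrr subr0.
have [m h] := ih (fun i => k (widen_ord (leqnSn n) i)) (fun i => x (widen_ord (leqnSn n) i)) (fun i => hx _).
rewrite !big_ord_recr /= addrC; split; first exact: (rz_mem rz).
apply: (nrm_sub0_trans (rz_lin rz _ (hx _) m)).
by rewrite [_ + k ord_max *: _]addrC opprD addrACA subrr add0r.
Qed.

Lemma sum_indic_sL2 n (D : 'I_n -> set TR) (c : 'I_n -> Y) : (forall i, measurable (D i)) ->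
  sL2 mu J (fun t => \sum_(i < n) (\1_(D i) t : R) *: c i).
Proof.
elim: n D c => [|n ih] D c mD.
  have -> : (fun t : TR => \sum_(i < 0) (\1_(D i) t : R) *: c i) = 0.
    by apply/funext => t; rewrite big_ord0.
  exact: sL2_0.
have s1 := ih (fun i => D (widen_ord (leqnSn n) i)) (fun i => c (widen_ord (leqnSn n) i)) (fun i => mD _).
have s2 := sL2_restrict mJ (mD ord_max) (sL2_csts T (c ord_max)).
have := sL2D mJ s1 s2; congr (sL2 mu J _).
by apply/funext => t; rewrite big_ord_recr.
Qed.

Lemma sum_indic_wint n (D : 'I_n -> set TR) (c : 'I_n -> Y) : (forall i, measurable (D i)) ->
  (forall i, D i `<=` Jo) ->
  nrm (wint mu J (fun t => \sum_(i < n) (\1_(D i) t : R) *: c i) -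
       \sum_(i < n) fine (mu (D i)) *: c i) = 0.
Proof.
move=> mD sD; apply/nrm_eq0P.
suff h y : dot (wint mu J (fun t => \sum_(i < n) (\1_(D i) t : R) *: c i) -
       \sum_(i < n) fine (mu (D i)) *: c i) y = 0 by exact: h.
have sw (f : R -> Y) : sL2 mu J f -> forall y, dot (wint mu J f) y = \int[mu]_(t in J) dot (f t) y.
  by move=> sf; apply: (wintE mJ); exact: (sL2_wint mJ (@subset_refl _ J) sf).
rewrite dotBl sw; last exact: sum_indic_sL2.
apply/eqP; rewrite subr_eq0; apply/eqP.
elim: n D c mD sD => [|n ih] D c mD sD.
  rewrite big_ord0 dot0l.
  have -> : \int[mu]_(t in J) dot (\sum_(i < 0) (\1_(D i) t : R) *: c i) y = \int[mu]_(t in J) 0.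
    by apply: eq_Rintegral => t _; rewrite big_ord0 dot0l.
  by rewrite Rintegral_cst// mul0r.
have s1 := @sum_indic_sL2 n (fun i => D (widen_ord (leqnSn n) i)) (fun i => c (widen_ord (leqnSn n) i)) (fun i => mD _).
have s2 := sL2_restrict mJ (mD ord_max) (sL2_csts T (c ord_max)).
have i1 := intg_dotr y mJ (@subset_refl _ J) s1.
have i2 := intg_dotr y mJ (@subset_refl _ J) s2.
have -> : \int[mu]_(t in J) dot (\sum_(i < n.+1) (\1_(D i) t : R) *: c i) y =
   \int[mu]_(t in J) (dot (\sum_(i < n) (\1_(D (widen_ord (leqnSn n) i)) t : R) *: c (widen_ord (leqnSn n) i)) y
     + dot ((\1_(D ord_max) t : R) *: c ord_max) y).
  by apply: eq_Rintegral => t _; rewrite big_ord_recr dotDl.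
rewrite (RintegralD mJ i1 i2) (ih (fun i => D (widen_ord (leqnSn n) i)) (fun i => c (widen_ord (leqnSn n) i)) (fun i => mD _) (fun i => sD _)).
rewrite big_ord_recr dotDl /=; congr (_ + _).
have ii : intg mu J (\1_(D ord_max) : TR -> R).
  apply: (intg_le mJ (g := fun=> 1)); first exact: measurable_indic.
    by apply: intg_cst => //; exact: J_fin.
  by move=> t _; rewrite indicE; case: (_ \in _); rewrite ?normr1 ?normr0.
have -> : \int[mu]_(t in J) dot ((\1_(D ord_max) t : R) *: c ord_max) y =
   \int[mu]_(t in J) (dot (c ord_max) y * \1_(D ord_max) t).
  by apply: eq_Rintegral => t _; rewrite dotZl mulrC.
rewrite (RintegralZl _ mJ ii) dotZl mulrC; congr (_ * _).
rewrite /Rintegral integral_indic//; congr (fine (mu _)).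
by apply/setIidl => t ht; apply: oJ; exact: sD ht.
Qed.

Lemma represents_memP u v : represents u v -> {ae mu, forall t, t \in `]0, T[ -> pn_mem (u t)}.
Proof. by apply: ae_mono => t h /h[]. Qed.

Lemma sf_eval_rho (s : simple_function X T) t :
  pn_mem (sf_eval s t) /\
  nrm (rho (sf_eval s t) - \sum_(i < sf_size s) (\1_(sf_dom i) t : R) *: rho (sf_val i)) = 0.
Proof. by apply: rz_sum => i; exact: sf_mem. Qed.

Lemma sf_integral_rho (s : simple_function X T) :
  pn_mem (sf_integral s) /\
  nrm (rho (sf_integral s) - wint mu J (fun t => \sum_(i < sf_size s) (\1_(sf_dom i) t : R) *: rho (sf_val i))) = 0.
Proof.
have [m h] := @rz_sum (sf_size s) (fun i => fine (mu (sf_dom i))) (@sf_val _ _ _ s) (@sf_mem _ _ _ s).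
split=> //; apply: (nrm_sub0_trans h); rewrite nrm_sym.
by apply: sum_indic_wint => i; [exact: sf_measurable|exact: sf_sub].
Qed.

Lemma strongly_measurable_smeas u : strongly_measurable T u -> exists2 v, smeas J v & represents u v.
Proof.
move=> [mem [s hs]].
have [N [mN N0 hN]] := ae_conj mem hs.
(* On G membership and convergence hold at every point. Putting the representative equal to 0
   elsewhere makes the approximations converge on all of [0, T]. *)
pose G : set TR := Jo `\` N; have mG : measurable G by exact: measurableD.
have gG t : G t -> Jo t /\ (pn_mem (u t) /\ (pn_norm (u t - sf_eval (s n) t) @[n --> \oo] --> (0 : R))).
  move=> [Jt Nt]; split=> //; apply: contrapT => h; apply: Nt; apply: hN => /= -[h1 h2].
  by apply: h; split; [exact: h1|exact: h2].
exists (fun t => (\1_G t : R) *: rho (u t)).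
  apply: (smeas_lim mJ (v := fun n t => (\1_G t : R) *: (\sum_(i < sf_size (s n)) (\1_(sf_dom i) t : R) *: rho (sf_val i)))).
    move=> n; apply: smeas_restrict => //.
    by have [] := @sum_indic_sL2 _ (@sf_dom _ _ _ (s n)) (fun i => rho (sf_val i)) (@sf_measurable _ _ _ (s n)).
  move=> t Jt; rewrite indicE; case: (boolP (t \in G)) => [/set_mem/gG[_ [mt ct]]|_] /=; last first.
    by under eq_fun do rewrite scale0r; rewrite scale0r; exact: ncvg_cst.
  rewrite scale1r; under eq_fun do rewrite scale1r.
  apply: (cvg0_le (v := fun n => A * pn_norm (u t - sf_eval (s n) t))).
  - move=> n; have [m h] := sf_eval_rho (s n) t; rewrite nrm_ge0/= nrm_sym.
    apply: le_trans (rz_distA mt m).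
    by apply: le_trans (nrm_dist _ (rho (sf_eval (s n) t)) _) _; rewrite h addr0.
  - by rewrite -[X in _ --> X](mulr0 A); apply: cvg_scale.
exists N; split=> // t /= nt; apply: contrapT => Nt; apply: nt => Jt.
have Gt : G t by split.
have [_ [mt _]] := gG _ Gt; split=> //.
by rewrite indicE mem_set// scale1r subrr nrm0.
Qed.

Section Approximation.
Variables (c : nat -> Y) (k : TR -> nat) (n : nat).
Hypothesis mk : measurable_fun J k.
Hypothesis kn : forall t, (k t <= n)%N.

Let dom (i : 'I_n.+1) : set R := Jo `&` k @^-1` [set nat_of_ord i].

Let dom_measurable i : measurable (dom i).
Proof.
have -> : dom i = Jo `&` (J `&` k @^-1` [set nat_of_ord i]).
  by apply/seteqP; split=> t [h1] => [h2|[_ h2]]; split=> //; split=> //; exact: oJ.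
by apply: measurableI => //; exact: mk.
Qed.

Let dom_sub i : dom i `<=` `]0, T[.
Proof. by move=> t []. Qed.

(** The values of the approximant are carried back to X by [sigma], one for each level set of the
    index; the bound by n makes them finitely many. *)
Definition approx_sf : simple_function X T :=
  @SimpleFunction R X T n.+1 dom (fun i => sigma (c i)) dom_measurable dom_sub
    (fun i => (rz_inv rz (c i)).1).

Lemma approx_sf_eval t : t \in `]0, T[ -> sf_eval approx_sf t = sigma (c (k t)).
Proof.
move=> Jt; have kt : (k t < n.+1)%N by rewrite ltnS.
rewrite /sf_eval (bigD1 (Ordinal kt))//= indicE mem_set; last by split.
rewrite scale1r big1 ?addr0// => i ik; rewrite indicE memNset ?scale0r// => -[_ /= e].
by move/eqP: ik; apply; apply: val_inj.
Qed.

Lemma approx_sf_integral : sL2 mu J (c \o k) ->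
  nrm (rho (sf_integral approx_sf) - wint mu J (c \o k)) = 0.
Proof.
move=> sc; have [m h] := sf_integral_rho approx_sf.
apply: (nrm_sub0_trans h); apply/nrm_eq0P; set z := _ - _.
have e y : dot z y = 0.
  rewrite /z dotBl.
  have ss := @sum_indic_sL2 _ (@sf_dom _ _ _ approx_sf) (fun i => rho (sf_val i)) (@sf_measurable _ _ _ approx_sf).
  rewrite (wintE mJ (sL2_wint mJ (@subset_refl _ J) ss)) (wintE mJ (sL2_wint mJ (@subset_refl _ J) sc)).
  rewrite (Rintegral_oo_cc (intg_dotr y mJ (@subset_refl _ J) ss)) (Rintegral_oo_cc (intg_dotr y mJ (@subset_refl _ J) sc)).
  apply/eqP; rewrite subr_eq0; apply/eqP; apply: eq_Rintegral => t /set_mem Jt.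
  apply/eqP; rewrite -subr_eq0 -dotBl; apply/eqP; apply: dot0_nrm.
  have [_ h1] := sf_eval_rho approx_sf t; rewrite approx_sf_eval// in h1.
  by apply: (nrm_sub0_trans (y := rho (sigma (c (k t))))); [rewrite nrm_sym|exact: (rz_inv rz _).2].
exact: e.
Qed.

End Approximation.

End Transfer.

(** * Square integrability and Bochner integrals under a realization *)

Section TransferL2.
Context {R : realType} (T : R) (X : prenormed R) (Y : semiHilbert R).
Context (rho : X -> Y) (sigma : Y -> X) (A B : R).
Hypothesis T0 : 0 < T.
Hypothesis rz : realization rho sigma A B.
Local Notation mu := (@lebesgue_measure R).
Local Notation TR := (measurableTypeR R).
Local Notation J := (`[0, T]%classic : set TR).
Local Notation Jo := (`]0, T[%classic : set TR).
Local Notation represents := (represents T rho).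
Implicit Types (u : R -> X) (v : R -> Y) (x : X) (y : Y).

Let mJ : measurable J := measurable_itvR _.
Let mo : measurable Jo := measurable_itvR _.
Let oJ : Jo `<=` J := @subset_itv_oo_cc _ _ _ _.
Let A0 : 0 < A := rz_A rz.
Let B0 : 0 < B := rz_B rz.

Lemma smeas_strongly_measurable u v : smeas J v -> represents u v -> strongly_measurable T u.
Proof.
move=> sv uv; split; first exact: represents_memP uv.
have [c [k [mk kn ck _]]] := smeas_approx mJ sv.
exists (fun n => approx_sf rz c n (mk n)).
apply: ae_mono uv => t h Jt; have [mt ut] := h Jt.
apply: (cvg0_le (v := fun n => B * nrm (c (k n t) - v t))).
  move=> n; rewrite (rz_ge0 rz)/= (approx_sf_eval rz c (mk n) (kn n) Jt).
  have [ms hs] := rz_inv rz (c (k n t)).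
  apply: le_trans (rz_distB rz mt ms) _; rewrite ler_wpM2l ?(ltW B0)// nrm_sym.
  apply: le_trans (nrm_dist _ (c (k n t)) _) _; rewrite hs add0r.
  by apply: le_trans (nrm_dist _ (v t) _) _; rewrite [nrm (v t - _)]nrm_sym ut addr0.
by rewrite -[X in _ --> X](mulr0 B); apply: cvg_scale; apply: ck; exact: oJ.
Qed.

Lemma L2_time_sL2 u : L2_time T u -> exists2 v, sL2 mu J v & represents u v.
Proof.
move=> [su fu]; have [v0 sv0 uv0] := strongly_measurable_smeas rz su.
pose v t := (\1_Jo t : R) *: v0 t.
have uv : represents u v.
  apply: ae_mono uv0 => t h Jt; have [m e] := h Jt; split=> //.
  by rewrite /v indicE mem_set// scale1r.
exists v => //; have sv : smeas J v by exact: smeas_restrict.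
split=> //; have Ai : 0 < A ^- 2 by rewrite invr_gt0 exprn_gt0.
have d0 t : 0 <= A ^- 2 * dot (v t) (v t) by rewrite mulr_ge0 ?(ltW Ai) ?dot_ge0.
have le t : pn_mem (u t) -> nrm (rho (u t) - v t) = 0 -> A ^- 2 * dot (v t) (v t) <= pn_norm (u t) ^+ 2.
  move=> m e; rewrite ler_pdivrMl ?exprn_gt0// -nrm_sqr -(eq_nrm e) -exprMn.
  rewrite lerXn2r ?nnegrE ?nrm_ge0 ?mulr_ge0 ?(ltW A0) ?(rz_ge0 rz)//.
  exact: (rz_leA rz m).
have : intg mu J (fun t => A ^+ 2 * (A ^- 2 * dot (v t) (v t))).
  apply: (intgZ mJ (A ^+ 2) (f := fun t => A ^- 2 * dot (v t) (v t))).
  apply: intg_ge0P; last 2 first.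
  - by move=> t _; exact: d0.
  - apply: (le_lt_trans _ fu).
    apply: (@le_trans _ _ (\int[mu]_(t in J) (((fun t => (pn_norm (u t) ^+ 2)%:E) \_ Jo) t))%E).
      apply: ae_le_integral => [t|t|]; first by rewrite lee_fin.
        by rewrite patchE; case: ifP => // _; rewrite lee_fin sqr_ge0.
      apply: ae_mono uv => t h Jt; rewrite patchE; case: ifPn => Jot.
        by rewrite lee_fin; have [m e] := h (set_mem Jot); exact: le.
      by rewrite lee_fin /v indicE (negbTE Jot) scale0r dot0l mulr0.
    by rewrite -integral_mkcondr setIidr.
  - by apply: measurable_funM; [exact: measurable_cst|exact: measurable_dot].
apply: eq_integrable => // t _ /=; rewrite mulrA mulfV ?mul1r//.
by rewrite expf_neq0// gt_eqF.
Qed.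

Lemma L2dot_oo v w : sL2 mu J v -> sL2 mu J w -> L2dot mu J v w = L2dot mu Jo v w.
Proof. by move=> sv sw; rewrite /L2dot (Rintegral_oo_cc (sL2_dot mJ sv sw)). Qed.

Lemma integral_pn_sqr_le u v : represents u v -> sL2 mu J v ->
  (\int[mu]_(t in `]0%R, T[) ((pn_norm (u t)) ^+ 2)%:E <= (B ^+ 2 * L2dot mu J v v)%:E)%E.
Proof.
move=> uv sv; have sv' := sL2S mJ mo oJ sv.
rewrite (L2dot_oo sv sv) /L2dot -(RintegralZl _ mo sv'.2) -(EFin_Rintegral mo (intgZ mo (B ^+ 2) sv'.2)).
apply: ae_le_integral => [t|t|]; first by rewrite lee_fin sqr_ge0.
  by rewrite lee_fin mulr_ge0 ?sqr_ge0 ?dot_ge0.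
apply: ae_mono uv => t h Jt; have [m e] := h Jt.
rewrite lee_fin -nrm_sqr -exprMn lerXn2r ?nnegrE ?(rz_ge0 rz) ?mulr_ge0 ?(ltW B0) ?nrm_ge0//.
by rewrite -(eq_nrm e); exact: (rz_leB rz m).
Qed.

Lemma le_integral_pn_sqr u v : represents u v -> sL2 mu J v ->
  ((A ^- 2 * L2dot mu J v v)%:E <= \int[mu]_(t in `]0%R, T[) ((pn_norm (u t)) ^+ 2)%:E)%E.
Proof.
move=> uv sv; have sv' := sL2S mJ mo oJ sv.
rewrite (L2dot_oo sv sv) /L2dot -(RintegralZl _ mo sv'.2) -(EFin_Rintegral mo (intgZ mo (A ^- 2) sv'.2)).
have Ai : 0 < A ^- 2 by rewrite invr_gt0 exprn_gt0.
apply: ae_le_integral => [t|t|]; first by rewrite lee_fin mulr_ge0 ?(ltW Ai) ?dot_ge0.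
  by rewrite lee_fin sqr_ge0.
apply: ae_mono uv => t h Jt; have [m e] := h Jt.
rewrite lee_fin ler_pdivrMl ?exprn_gt0// -nrm_sqr -(eq_nrm e) -exprMn.
rewrite lerXn2r ?nnegrE ?nrm_ge0 ?mulr_ge0 ?(ltW A0) ?(rz_ge0 rz)//.
exact: (rz_leA rz m).
Qed.

Lemma sL2_L2_time u v : represents u v -> sL2 mu J v -> L2_time T u.
Proof.
move=> uv sv; split; first exact: smeas_strongly_measurable sv.1 uv.
exact: le_lt_trans (integral_pn_sqr_le uv sv) (ltry _).
Qed.

Lemma L2_time_norm_sqr u v : represents u v -> sL2 mu J v ->
  (L2_time_norm T u ^+ 2 <= B ^+ 2 * L2dot mu J v v) /\
  (L2dot mu J v v <= A ^+ 2 * L2_time_norm T u ^+ 2).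
Proof.
move=> uv sv; have h1 := integral_pn_sqr_le uv sv; have h2 := le_integral_pn_sqr uv sv.
have i0 : (0 <= \int[mu]_(t in `]0%R, T[) ((pn_norm (u t)) ^+ 2)%:E)%E.
  by apply: integral_ge0 => t _; rewrite lee_fin sqr_ge0.
have fi : (\int[mu]_(t in `]0%R, T[) ((pn_norm (u t)) ^+ 2)%:E)%E \is a fin_num.
  by rewrite ge0_fin_numE// (le_lt_trans h1) ?ltry.
rewrite /L2_time_norm sqr_sqrtr; last by apply: Rintegral_ge0 => t _; exact: sqr_ge0.
rewrite /Rintegral; split; first by rewrite -lee_fin fineK.
by rewrite -ler_pdivrMl ?exprn_gt0// -lee_fin fineK.
Qed.

Lemma Rintegral_nrm_le v : sL2 mu J v ->
  \int[mu]_(t in J) nrm (v t) <= Num.sqrt (L2dot mu J v v) * Num.sqrt T.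
Proof.
move=> sv.
have sn : sL2 mu J (fun t => nrm (v t) : real_sh R).
  split; first by apply: (measurable_smeas mJ); exact: measurable_nrm sv.1.
  by apply: eq_integrable sv.2 => // t _ /=; rewrite -nrm_sqr expr2.
have := L2dot_le mJ sn (sL2_csts T (1 : real_sh R)).
have -> : L2dot mu J (fun t => nrm (v t) : real_sh R) (fun=> 1 : real_sh R) = \int[mu]_(t in J) nrm (v t).
  by apply: eq_Rintegral => t _; exact: mulr1.
have -> : L2dot mu J (fun t => nrm (v t) : real_sh R) (fun t => nrm (v t) : real_sh R) = L2dot mu J v v.
  by apply: eq_Rintegral => t _; rewrite -[RHS]nrm_sqr.
move=> h; apply: le_trans (ler_norm _) _; apply: le_trans h _.
rewrite ler_wpM2l ?sqrtr_ge0// ler_wsqrtr//.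
rewrite /L2dot (Rintegral_cst mu mJ) [dot _ _](_ : _ = 1 * 1)// !mul1r.
rewrite -lee_fin fineK; last by rewrite ge0_fin_numE// lebesgue_itv_fin.
by apply: le_trans (lebesgue_itv_le _ _ (ltW T0)) _; rewrite subr0.
Qed.

(** The simple approximations of v converge in square mean, hence in the mean on the bounded
    interval. Carried back to X they approximate u, and their integrals differ from that of v by at
    most the mean error. *)
Lemma bochner_integral_represents u v x : represents u v -> sL2 mu J v ->
  pn_mem x -> nrm (rho x - wint mu J v) = 0 -> bochner_integral T u x.
Proof.
move=> uv sv mx hx; split=> //; first exact: smeas_strongly_measurable sv.1 uv.
have [c [k [mk kn ck sc cv]]] := sL2_approx mJ sv.
exists (fun n => approx_sf rz c n (mk n)).
have sB n : sL2 mu J (v - (c \o k n)) by exact: sL2B.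
pose e n := B * (Num.sqrt (L2dot mu J (v - (c \o k n)) (v - (c \o k n))) * Num.sqrt T).
have e0 : e n @[n --> \oo] --> (0 : R).
  rewrite -[X in _ --> X](mulr0 B); apply: cvg_scale.
  rewrite -[X in _ --> X](mul0r (Num.sqrt T)); apply: cvgMl => //.
  rewrite -[X in _ --> X](@sqrtr0 R); apply: (cvg_comp _ _ cv); exact: sqrt_continuous.
have le n : B * \int[mu]_(t in J) nrm ((v - (c \o k n)) t) <= e n.
  by rewrite ler_wpM2l ?(ltW B0)// Rintegral_nrm_le.
have inrm n : intg mu J (fun t => nrm ((v - (c \o k n)) t)).
  by have [] := sL2_wint mJ (@subset_refl _ J) (sB n).
split.
  apply: (@squeeze_cvge _ _ _ R (fun=> 0%E) _ (fun n => (e n)%:E)).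
  - near=> n; apply/andP; split; first by apply: integral_ge0 => t _; rewrite lee_fin (rz_ge0 rz).
    apply: (@le_trans _ _ (B * \int[mu]_(t in J) nrm ((v - (c \o k n)) t))%:E); last by rewrite lee_fin.
    have io := intgS mJ mo oJ (inrm n).
    rewrite (Rintegral_oo_cc (inrm n)) -(RintegralZl _ mo io) -(EFin_Rintegral mo (intgZ mo B io)).
    apply: ae_le_integral => [t|t|]; first by rewrite lee_fin (rz_ge0 rz).
      by rewrite lee_fin mulr_ge0 ?nrm_ge0 ?(ltW B0).
    apply: ae_mono uv => t h Jt; have [m ut] := h Jt.
    rewrite lee_fin (approx_sf_eval rz c (mk n) (kn n) Jt); have [ms hs] := rz_inv rz (c (k n t)).
    apply: le_trans (rz_distB rz m ms) _; rewrite ler_wpM2l ?(ltW B0)//.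
    apply: le_trans (nrm_dist _ (v t) _) _; rewrite ut add0r.
    by apply: le_trans (nrm_dist _ (c (k n t)) _) _; rewrite [X in _ + X]nrm_sym hs addr0.
  - exact: cvg_cst.
  - by apply: cvg_EFin => //; exact: nearW.
apply: (cvg0_le (v := e)) => // n; rewrite (rz_ge0 rz)/=.
have [mi _] := sf_integral_rho rz (approx_sf rz c n (mk n)).
apply: le_trans (rz_distB rz mi mx) _; apply: le_trans (le n); rewrite ler_wpM2l ?(ltW B0)//.
apply: le_trans (nrm_dist _ (wint mu J (c \o k n)) _) _.
rewrite (approx_sf_integral rz (mk n) (kn n) (sc n)) add0r.
apply: le_trans (nrm_dist _ (wint mu J v) _) _; rewrite [X in _ + X]nrm_sym hx addr0 nrm_sym.
have w1 := sL2_wint mJ (@subset_refl _ J) sv; have w2 := sL2_wint mJ (@subset_refl _ J) (sc n).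
have w3 := sL2_wint mJ (@subset_refl _ J) (sB n).
apply: le_trans (nrm_wint_le mJ w3).
suff h : nrm (wint mu J v - wint mu J (c \o k n) - wint mu J (v - (c \o k n))) = 0 by rewrite (eq_nrm h).
apply/nrm_eq0P; set z := _ - _; have hz y : dot z y = 0; last exact: hz.
rewrite /z dotBl dotBl (wintE mJ w1) (wintE mJ w2) (wintE mJ w3).
rewrite -(RintegralB mJ (intg_dotr y mJ (@subset_refl _ J) sv) (intg_dotr y mJ (@subset_refl _ J) (sc n))).
apply/eqP; rewrite subr_eq0; apply/eqP; apply: eq_Rintegral => t _.
by rewrite -dotBl.
Unshelve. all: by end_near.
Qed.

(** Conversely, simple functions approximating u in the mean are carried forward by [rho], and the
    same error bound identifies the integral, which is thus determined by v. *)
Lemma bochner_integral_wint u v x : bochner_integral T u x -> represents u v -> sL2 mu J v ->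
  nrm (rho x - wint mu J v) = 0.
Proof.
move=> [_ mx [s [hs hi]]] uv sv.
pose w n (t : R) := \sum_(i < sf_size (s n)) (\1_(sf_dom i) t : R) *: rho (sf_val i).
have sw n : sL2 mu J (w n) by apply: sum_indic_sL2 => i; exact: sf_measurable.
have sB n : sL2 mu J (v - w n) by exact: sL2B.
have inrm n : intg mu J (fun t => nrm ((v - w n) t)).
  by have [] := sL2_wint mJ (@subset_refl _ J) (sB n).
have c1 : \int[mu]_(t in J) nrm ((v - w n) t) @[n --> \oo] --> (0 : R).
  have h n : ((A^-1 * \int[mu]_(t in J) nrm ((v - w n) t))%:E <=
      \int[mu]_(t in `]0%R, T[) (pn_norm (u t - sf_eval (s n) t))%:E)%E.
    have io := intgS mJ mo oJ (inrm n).
    rewrite (Rintegral_oo_cc (inrm n)) -(RintegralZl _ mo io) -(EFin_Rintegral mo (intgZ mo A^-1 io)).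
    apply: ae_le_integral => [t|t|]; first by rewrite lee_fin mulr_ge0 ?nrm_ge0// invr_ge0 ltW.
      by rewrite lee_fin (rz_ge0 rz).
    apply: ae_mono uv => t h Jt; have [m ut] := h Jt.
    have [ms hs'] := sf_eval_rho rz (s n) t.
    rewrite lee_fin ler_pdivrMl//; apply: le_trans (rz_distA rz m ms).
    apply: le_trans (nrm_dist _ (rho (u t)) _) _; rewrite nrm_sym ut add0r.
    by apply: le_trans (nrm_dist _ (rho (sf_eval (s n) t)) _) _; rewrite hs' addr0.
  have c2 : (A^-1 * \int[mu]_(t in J) nrm ((v - w n) t))%:E @[n --> \oo] --> (0%:E : \bar R).
    apply: (@squeeze_cvge _ _ _ R (fun=> 0%E) _ (fun n => \int[mu]_(t in `]0%R, T[) (pn_norm (u t - sf_eval (s n) t))%:E)%E).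
    - near=> m; rewrite h andbT lee_fin mulr_ge0 ?invr_ge0 ?(ltW A0)//.
      by apply: Rintegral_ge0 => t _; exact: nrm_ge0.
    - exact: cvg_cst.
    - exact: hs.
  have c3 : A^-1 * \int[mu]_(t in J) nrm ((v - w n) t) @[n --> \oo] --> (0 : R).
    exact: (fine_cvg c2).
  have -> : (fun n => \int[mu]_(t in J) nrm ((v - w n) t)) = (fun n => A * (A^-1 * \int[mu]_(t in J) nrm ((v - w n) t))).
    by apply/funext => n; rewrite mulrA mulfV ?mul1r// gt_eqF.
  by rewrite -[X in _ --> X](mulr0 A); apply: cvg_scale.
have lim : nrm (rho x - wint mu J v) <= 0; last by apply/eqP; rewrite eq_le lim nrm_ge0.
apply: (@le_cvg_seq R (fun=> nrm (rho x - wint mu J v)) (fun n => A * pn_norm (sf_integral (s n) - x) + \int[mu]_(t in J) nrm ((v - w n) t))).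
- exact: cvg_cst.
- rewrite -[X in _ --> X]addr0; apply: cvgD => //.
  by rewrite -[X in _ --> X](mulr0 A); apply: cvg_scale.
move=> n; have [mi hn] := sf_integral_rho rz (s n).
apply: le_trans (nrm_dist _ (rho (sf_integral (s n))) _) _; apply: lerD.
  by rewrite nrm_sym; exact: (rz_distA rz mi mx).
apply: le_trans (nrm_dist _ (wint mu J (w n)) _) _; rewrite hn add0r nrm_sym.
have w1 := sL2_wint mJ (@subset_refl _ J) sv; have w2 := sL2_wint mJ (@subset_refl _ J) (sw n).
have w3 := sL2_wint mJ (@subset_refl _ J) (sB n).
apply: le_trans (nrm_wint_le mJ w3).
suff h : nrm (wint mu J v - wint mu J (w n) - wint mu J (v - w n)) = 0 by rewrite (eq_nrm h).
apply/nrm_eq0P; set z := _ - _; have hz y : dot z y = 0; last exact: hz.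
rewrite /z dotBl dotBl (wintE mJ w1) (wintE mJ w2) (wintE mJ w3).
rewrite -(RintegralB mJ (intg_dotr y mJ (@subset_refl _ J) sv) (intg_dotr y mJ (@subset_refl _ J) (sw n))).
apply/eqP; rewrite subr_eq0; apply/eqP; apply: eq_Rintegral => t _.
by rewrite -dotBl.
Unshelve. all: by end_near.
Qed.

End TransferL2.

(** * Time derivatives, continuity and initial values under a realization *)

Section TransferTime.
Context {R : realType} (T : R) (X : prenormed R) (Y : semiHilbert R).
Context (rho : X -> Y) (sigma : Y -> X) (A B : R).
Hypothesis T0 : 0 < T.
Hypothesis rz : realization rho sigma A B.
Local Notation mu := (@lebesgue_measure R).
Local Notation TR := (measurableTypeR R).
Local Notation J := (`[0, T]%classic : set TR).
Local Notation Jo := (`]0, T[%classic : set TR).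
Local Notation represents := (represents T rho).
Implicit Types (u : R -> X) (v : R -> Y) (x : X) (y : Y).

Let mJ : measurable J := measurable_itvR _.
Let oJ : Jo `<=` J := @subset_itv_oo_cc _ _ _ _.
Let Jle t : J t -> t <= T. Proof. by rewrite /= in_itv/= => /andP[]. Qed.

Lemma rz_linZ k x : pn_mem x -> pn_mem (k *: x) /\ nrm (rho (k *: x) - k *: rho x) = 0.
Proof.
move=> hx; have := rz_mem rz k hx (rz_mem0 rz); rewrite addr0 => m; split=> //.
have := rz_lin rz k hx (rz_mem0 rz); rewrite addr0 => h; apply: (nrm_sub0_trans h).
rewrite addrAC subrr add0r.
by have := rz_linB rz (rz_mem0 rz) (rz_mem0 rz); rewrite !subrr subr0.
Qed.

Lemma rz_linN x : pn_mem x -> pn_mem (- x) /\ nrm (rho (- x) + rho x) = 0.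
Proof. by move=> /(rz_linZ (-1)); rewrite !scaleN1r opprK. Qed.

Lemma representsB u u' v v' : represents u v -> represents u' v' -> represents (u - u') (v - v').
Proof.
move=> h h'; apply: ae_mono (ae_conj h h') => t [h1 h2] Jt.
have [m1 e1] := h1 Jt; have [m2 e2] := h2 Jt; split; first exact: (rz_memB rz).
apply: (nrm_sub0_trans (rz_linB rz m1 m2)).
have e (a b c d : Y) : a - b - (c - d) = (a - c) - (b - d).
  by rewrite !opprB addrACA [- b - c]addrC addrACA.
rewrite [X in nrm X](_ : _ = rho (u t) - v t - (rho (u' t) - v' t)); last exact: e.
apply/eqP; rewrite eq_le nrm_ge0 andbT; apply: le_trans (nrmB _ _) _.
by rewrite e1 e2 addr0.
Qed.

Lemma representsZ (k : R -> R) u v : represents u v -> represents (fun t => k t *: u t) (fun t => k t *: v t).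
Proof.
move=> h; apply: ae_mono h => t h Jt; have [m e] := h Jt; have [mk ek] := rz_linZ (k t) m.
by split=> //; apply: (nrm_sub0_trans ek); rewrite -scalerBr nrmZ e mulr0.
Qed.

Lemma represents_eq u v v' : represents u v -> {ae mu, forall t, Jo t -> nrm (v t - v' t) = 0} ->
  represents u v'.
Proof.
move=> h h'; apply: ae_mono (ae_conj h h') => t [h1 h2] Jt.
by have [m e] := h1 Jt; split=> //; exact: (nrm_sub0_trans e (h2 Jt)).
Qed.

Lemma represents_ae u u' v v' : represents u v -> represents u' v' ->
  {ae mu, forall t, Jo t -> nrm (v t - v' t) = 0} -> ae_equal T u u'.
Proof.
move=> h h' hv; apply: ae_mono (ae_conj h (ae_conj h' hv)) => t [h1 [h2 h3]] Jt.
have [m1 e1] := h1 Jt; have [m2 e2] := h2 Jt.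
apply/eqP; rewrite eq_le (rz_ge0 rz) andbT; apply: le_trans (rz_distB rz m1 m2) _.
rewrite (nrm_sub0_trans e1 (nrm_sub0_trans (h3 Jt) _)) ?mulr0//.
by rewrite nrm_sym.
Qed.

Lemma sL2_test phi v : test_function (`]0, T[ : set R) phi -> sL2 mu J v ->
  sL2 mu J (fun t => phi t *: v t).
Proof.
move=> tp sv.
have [M hM] := test_bounded_itv T0 tp.
have sm : smeas J (fun t => phi t *: v t).
  by apply: smeas_scale => //; [exact: (measurable_test tp mJ)|exact: sv.1].
split=> //; apply: (intg_le mJ (g := fun t => M ^+ 2 * dot (v t) (v t))).
- exact: measurable_dot.
- exact: (intgZ mJ _ sv.2).
move=> t _; rewrite ger0_norm ?dot_ge0// !dotE mulrA -expr2 ler_wpM2r ?dot_ge0//.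
rewrite -real_normK ?num_real// lerXn2r// nnegrE//.
by apply: le_trans (hM t).
Qed.

(** The vector identity between Bochner integrals reduces to scalar identities for each y; the
    common value is carried back from Y by [sigma]. *)
Lemma time_derivative_represents u u1 v v1 : represents u v -> represents u1 v1 ->
  sL2 mu J v -> sL2 mu J v1 ->
  (forall phi y, test_function (`]0, T[ : set R) phi ->
    \int[mu]_(t in J) (derive1 phi t * dot (v t) y) = - \int[mu]_(t in J) (phi t * dot (v1 t) y)) ->
  time_derivative T u u1.
Proof.
move=> uv uv1 sv sv1 h phi tp; have td : test_function (`]0, T[ : set R) (derive1 phi) by exact: (test_derive1_itv T0 tp).
have s := sL2_test td sv; have s1 := sL2_test tp sv1.
pose w := wint mu J (fun t => derive1 phi t *: v t).
have [mw ew] := rz_inv rz w; exists (sigma w).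
  exact: (bochner_integral_represents T0 rz (representsZ (derive1 phi) uv) s mw ew).
have [mn en] := rz_linN mw.
apply: (bochner_integral_represents T0 rz (representsZ phi uv1) s1 mn).
apply/nrm_eq0P; set z := _ - _; have hz y : dot z y = 0; last exact: hz.
have e1 : dot (rho (- sigma w)) y = - dot (rho (sigma w)) y.
  by apply/eqP; rewrite -addr_eq0 -dotDl; apply/eqP; exact: dot0_nrm.
have e2 : dot (rho (sigma w)) y = dot w y.
  by apply/eqP; rewrite -subr_eq0 -dotBl; apply/eqP; exact: dot0_nrm.
rewrite /z dotBl e1 e2 /w (wintE mJ (sL2_wint mJ (@subset_refl _ J) s)) (wintE mJ (sL2_wint mJ (@subset_refl _ J) s1)).
have -> : \int[mu]_(t in J) dot (derive1 phi t *: v t) y = \int[mu]_(t in J) (derive1 phi t * dot (v t) y).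
  by apply: eq_Rintegral => t _; rewrite dotZl.
have -> : \int[mu]_(t in J) dot (phi t *: v1 t) y = \int[mu]_(t in J) (phi t * dot (v1 t) y).
  by apply: eq_Rintegral => t _; rewrite dotZl.
by rewrite h// opprK subrr.
Qed.

Lemma time_derivative_weak u u1 v v1 : represents u v -> represents u1 v1 ->
  sL2 mu J v -> sL2 mu J v1 -> time_derivative T u u1 ->
  forall phi y, test_function (`]0, T[ : set R) phi ->
    \int[mu]_(t in J) (derive1 phi t * dot (v t) y) = - \int[mu]_(t in J) (phi t * dot (v1 t) y).
Proof.
move=> uv uv1 sv sv1 h phi y tp; have td : test_function (`]0, T[ : set R) (derive1 phi) by exact: (test_derive1_itv T0 tp).
have s := sL2_test td sv; have s1 := sL2_test tp sv1.
have [x hx hx'] := h phi tp; have [_ mx _] := hx.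
have b1 := bochner_integral_wint rz hx (representsZ (derive1 phi) uv) s.
have b2 := bochner_integral_wint rz hx' (representsZ phi uv1) s1.
have [mn en] := rz_linN mx.
have e1 : dot (rho (- x)) y = - dot (rho x) y.
  by apply/eqP; rewrite -addr_eq0 -dotDl; apply/eqP; exact: dot0_nrm.
have e2 : dot (rho x) y = dot (wint mu J (fun t => derive1 phi t *: v t)) y.
  by apply/eqP; rewrite -subr_eq0 -dotBl; apply/eqP; exact: dot0_nrm.
have e3 : dot (rho (- x)) y = dot (wint mu J (fun t => phi t *: v1 t)) y.
  by apply/eqP; rewrite -subr_eq0 -dotBl; apply/eqP; exact: dot0_nrm.
have -> : \int[mu]_(t in J) (derive1 phi t * dot (v t) y) = \int[mu]_(t in J) dot (derive1 phi t *: v t) y.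
  by apply: eq_Rintegral => t _; rewrite dotZl.
have -> : \int[mu]_(t in J) (phi t * dot (v1 t) y) = \int[mu]_(t in J) dot (phi t *: v1 t) y.
  by apply: eq_Rintegral => t _; rewrite dotZl.
rewrite -(wintE mJ (sL2_wint mJ (@subset_refl _ J) s)) -(wintE mJ (sL2_wint mJ (@subset_refl _ J) s1)).
by rewrite -e2 -e3 e1 opprK.
Qed.

Lemma continuous_time_ucont u v : ucont T v ->
  (forall t, J t -> pn_mem (u t) /\ nrm (rho (u t) - v t) = 0) -> continuous_time T u.
Proof.
move=> cv h; split=> [t /h[]//|t Jt]; have [mt et] := h t Jt.
have hc := ucont_cvg cv Jt.
apply: (@squeeze_cvgr _ _ _ _ (fun=> 0) (fun s => B * nrm (v s - v t))).
- rewrite near_withinE; near=> s => Js; have [ms es] := h s Js.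
  rewrite (rz_ge0 rz)/=; apply: le_trans (rz_distB rz ms mt) _.
  rewrite ler_wpM2l ?(ltW (rz_B rz))//.
  apply: le_trans (nrm_dist _ (v s) _) _; rewrite es add0r.
  by apply: le_trans (nrm_dist _ (v t) _) _; rewrite [X in _ + X]nrm_sym et addr0.
- exact: cvg_cst.
- by rewrite -[X in _ --> X](mulr0 B); apply: cvgMr.
Unshelve. all: by end_near.
Qed.

(** The difference <rho (w t), q> - g t is continuous and almost everywhere constant, hence
    constant; its value at 0 eliminates the unknown c. *)
Lemma continuous_time_affine (w : R -> X) (g : R -> R) (q : Y) (c : R) : continuous_time T w ->
  (forall t, J t -> g s @[s --> within (`[0, T]%classic : set R) (nbhs t)] --> g t) -> g 0 = 0 ->
  {ae mu, forall t, Jo t -> dot (rho (w t)) q = c + g t} ->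
  forall t, J t -> dot (rho (w t)) q = dot (rho (w 0)) q + g t.
Proof.
move=> [mw cw] cg g0 h.
have cF t : J t -> (dot (rho (w s)) q - g s) @[s --> within (`[0, T]%classic : set R) (nbhs t)] --> dot (rho (w t)) q - g t.
  move=> Jt; apply: cvgB; last exact: cg.
  apply/cvgrPdist_le => e e0; have k0 : 0 < A * nrm q + 1.
    by rewrite ltr_wpDl// mulr_ge0 ?nrm_ge0 ?(ltW (rz_A rz)).
  have /cvgrPdist_le/(_ _ (divr_gt0 e0 k0)) := cw t Jt.
  rewrite !near_withinE; apply: filterS => s hs Js; have := hs Js.
  rewrite sub0r normrN ger0_norm ?(rz_ge0 rz)// ler_pdivlMr// => hs'.
  rewrite -dotBl; apply: le_trans (dot_le _ _) _; apply: le_trans hs'.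
  rewrite nrm_sym; apply: le_trans (ler_wpM2r (nrm_ge0 q) (rz_distA rz (mw s Js) (mw t Jt))) _.
  by rewrite mulrDr mulr1 (mulrC A) -mulrA lerDl (rz_ge0 rz).
have hF : {ae mu, forall t, Jo t -> dot (rho (w t)) q - g t = c}.
  by apply: ae_mono h => t h Jt; rewrite h// addrK.
have cst := ae_cst_continuous T0 cF hF.
have J0 : J 0 by rewrite /= in_itv/= lexx ltW.
move=> t Jt; apply/eqP; rewrite -subr_eq; apply/eqP.
by rewrite (cst t Jt) -(cst 0 J0) g0 subr0.
Qed.

Lemma dot_prim_continuous v y t : sL2 mu J v -> J t ->
  dot (prim v s) y @[s --> within (`[0, T]%classic : set R) (nbhs t)] --> dot (prim v t) y.
Proof.
move=> sv Jt; have hc := ucont_cvg (prim_ucont 0 sv) Jt.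
apply/cvgrPdist_le => e e0; have k0 : 0 < nrm y + 1 by rewrite ltr_wpDl// nrm_ge0.
have /cvgrPdist_le/(_ _ (divr_gt0 e0 k0)) := hc; apply: filterS => s.
rewrite sub0r normrN ger0_norm ?nrm_ge0// !add0r ler_pdivlMr// => hs.
rewrite -dotBl; apply: le_trans (dot_le _ _) _; apply: le_trans hs.
by rewrite nrm_sym mulrDr mulr1 lerDl nrm_ge0.
Qed.

(* The continuous representative determines the constant of integration. *)
Lemma time_derivative_primitive u u1 v1 x0 : L2_time T u -> represents u1 v1 -> sL2 mu J v1 ->
  time_derivative T u u1 -> pn_mem x0 -> initial_value T u x0 ->
  represents u (primitive_from (rho x0) v1).
Proof.
move=> lu uv1 sv1 du mx0 [w [cw wu w0]].
have [v sv uv] := L2_time_sL2 rz lu.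
have J0 : J 0 by rewrite /= in_itv/= lexx ltW.
have hw : {ae mu, forall t, Jo t -> nrm (rho (w t) - v t) = 0}.
  apply: ae_mono (ae_conj wu uv) => t [h1 h2] Jt; have [m e] := h2 Jt.
  apply: (nrm_sub0_trans _ e); apply/eqP; rewrite eq_le nrm_ge0 andbT.
  by apply: le_trans (rz_distA rz (cw.1 t (oJ Jt)) m) _; rewrite h1// mulr0.
have e0 : nrm (rho (w 0) - rho x0) = 0.
  apply/eqP; rewrite eq_le nrm_ge0 andbT.
  by apply: le_trans (rz_distA rz (cw.1 0 J0) mx0) _; rewrite w0 mulr0.
have key t : J t -> nrm (rho (w t) - primitive_from (rho x0) v1 t) = 0.
  move=> Jt; apply/nrm_eq0P; set z := _ - _; have hz y : dot z y = 0; last exact: hz.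
  have [c hc] := @weak_time_derivative _ _ T0 _ v1 (fun t => dot (v t) y) y sv1 (intg_dotr y mJ (@subset_refl _ J) sv)
    (fun phi tp => time_derivative_weak uv uv1 sv sv1 du y tp).
  have hwc : {ae mu, forall t, Jo t -> dot (rho (w t)) y = c + dot (prim v1 t) y}.
    apply: ae_mono (ae_conj hw hc) => s [h1 h2] Js; rewrite -(h2 Js).
    by apply/eqP; rewrite -subr_eq0 -dotBl; apply/eqP; apply: dot0_nrm; exact: h1.
  have g0 : dot (prim v1 0) y = 0 by apply: dot0_nrm; exact: (prim0 (ltW T0) sv1).
  have := continuous_time_affine cw (fun t Jt => dot_prim_continuous (y := y) sv1 Jt) g0 hwc Jt.
  rewrite /z dotBl => ->; rewrite /primitive_from dotDl.
  have -> : dot (rho (w 0)) y = dot (rho x0) y.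
    by apply/eqP; rewrite -subr_eq0 -dotBl; apply/eqP; exact: dot0_nrm.
  by rewrite subrr.
apply: (represents_eq uv); apply: ae_mono hw => t h Jt.
by apply: (nrm_sub0_trans (y := rho (w t))); [rewrite nrm_sym h|exact: key (oJ Jt)].
Qed.

End TransferTime.

Lemma ae_segment {R : realType} (T : R) (P : R -> Prop) :
  {ae lebesgue_measure, forall t : R, t \in `]0, T[ -> P t} ->
  {ae lebesgue_measure, forall t : R, t \in `[0, T] -> P t}.
Proof.
move=> [A [mA A0 hA]]; exists (A `|` ([set 0] `|` [set T])); split.
- by apply: measurableU => //; apply: measurableU; exact: measurable_set1.
- apply: null_set_setU => //; first by apply: measurableU; exact: measurable_set1.
  by apply: null_set_setU; [exact: measurable_set1|exact: measurable_set1|exact: lebesgue_measure_set1|exact: lebesgue_measure_set1].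
move=> t /= nPt; have [t0|t0] := eqVneq t 0; first by right; left.
have [tT|tT] := eqVneq t T; first by right; right.
left; apply: hA => /= h; apply: nPt => Jt; apply: h; move: Jt; rewrite in_itv/= => /andP[t0' tT'].
by rewrite in_itv/= !lt_neqAle t0' tT' tT eq_sym t0.
Qed.

(** * The Lipschitz bound on initial segments of time *)

Section Localization.
Context {R : realType} (T k : R) (X : semiHilbert R).
Hypothesis k0 : 0 <= k.
Local Notation mu := (@lebesgue_measure R).
Local Notation TR := (measurableTypeR R).
Local Notation J := (`[0, T]%classic : set TR).
Local Notation "J[ t ]" := (`[0, t]%classic : set TR) (at level 0, format "J[ t ]").
Variable F : (R -> X) -> (R -> X).
Hypothesis F_L2 : forall w, sL2 mu J w -> sL2 mu J (F w).
Hypothesis F_lip : forall w1 w2, sL2 mu J w1 -> sL2 mu J w2 ->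
  L2dot mu J (F w1 - F w2) (F w1 - F w2) <= k * L2dot mu J (w1 - w2) (w1 - w2).
Hypothesis F_local : forall w1 w2 (A : set TR), sL2 mu J w1 -> sL2 mu J w2 ->
  (forall s, A s -> w1 s = w2 s) -> {ae mu, forall s, J s -> A s -> nrm (F w1 s - F w2 s) = 0}.

Let mJ : measurable J := measurable_itvR _.
Let mt t : measurable J[t] := measurable_itvR _.

(* Replacing [w1] by [w2] after time t reduces the estimate to the whole interval. *)
Lemma lipschitz_initial_segment w1 w2 : sL2 mu J w1 -> sL2 mu J w2 -> forall t, J t ->
  L2dot mu J[t] (F w1 - F w2) (F w1 - F w2) <= k * L2dot mu J[t] (w1 - w2) (w1 - w2).
Proof.
move=> s1 s2 t Jt; have tT : t <= T by move: Jt; rewrite /= in_itv/= => /andP[].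
have sub := sub_J0 tT; have sB := sL2B mJ s1 s2.
pose w : R -> X := w2 + (fun s => (\1_(J[t]) s : R) *: (w1 - w2) s).
have sw : sL2 mu J w := sL2D mJ s2 (sL2_restrict mJ (mt t) sB).
have wE s : w s = w2 s + (\1_(J[t]) s : R) *: (w1 s - w2 s) by [].
have w1E s : J[t] s -> w s = w1 s.
  by move=> Js; rewrite wE indicE mem_set// scale1r addrC subrK.
have sp := F_L2 sw; have sp1 := F_L2 s1; have sp2 := F_L2 s2.
have e1 : L2dot mu J[t] (F w1 - F w2) (F w1 - F w2) = L2dot mu J[t] (F w - F w2) (F w - F w2).
  have sa := sL2S mJ (mt t) sub (sL2B mJ sp1 sp2); have sb := sL2S mJ (mt t) sub (sL2B mJ sp sp2).
  apply: (Rintegral_ae (mt t)); [exact: (measurable_dot sa.1 sa.1)|exact: (measurable_dot sb.1 sb.1)|].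
  apply: ae_mono (F_local sw s1 w1E) => s h Js; have {}h := h (sub _ Js) Js.
  rewrite -!nrm_sqr; congr (_ ^+ 2); apply: eq_nrm.
  rewrite (_ : (F w1 - F w2) s - (F w - F w2) s = F w1 s - F w2 s - (F w s - F w2 s))//.
  by rewrite opprB addrA subrK nrm_sym.
rewrite e1; apply: le_trans (L2dot_J_le (mt t) sub (sL2B mJ sp sp2)) _.
apply: le_trans (F_lip sw s2) _; rewrite ler_wpM2l//.
rewrite le_eqVlt; apply/orP; left; apply/eqP; rewrite /L2dot (Rintegral_support sub).
  apply: eq_Rintegral => s /set_mem Js.
  by rewrite (_ : (w - w2) s = (w1 - w2) s)// (_ : (w - w2) s = w s - w2 s)// w1E.
move=> s Js nJs; rewrite (_ : (w - w2) s = w s - w2 s)// wE indicE memNset// scale0r addr0 subrr.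
exact: dot0l.
Qed.

End Localization.

(** * Weak solutions *)

Section Realizations.
Context {R : realType} (L : \bar R) (bc : boundary_condition).
Context (ip : (R -> R) -> (R -> R) -> R) (kappa c0 : R).
Hypothesis L0 : (0 < L)%E.
Hypothesis ipV : V_inner_product L bc ip.
Hypothesis a_bounded : form_bounded L bc ip kappa.
Hypothesis c0_gt0 : 0 < c0.
Hypothesis a_coercive : form_coercive L bc ip kappa c0.
Implicit Types (u v w : R -> R).
Local Notation a := (form_a L kappa).
Local Notation Vs := (V_sh L0 ipV a_bounded c0_gt0 a_coercive).
Local Notation VX := (V L bc ip).
Local Notation VX' := (Vstar L bc ip).
Local Notation b := (Num.sqrt c0^-1).

Definition V_mk u (hu : V_mem L bc u) : Vs := @sub_mk _ _ (V_subspace L0 bc) u hu.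
Definition V_val (x : Vs) : R -> R := sub_val x.

Lemma V_valP (x : Vs) : V_mem L bc (V_val x). Proof. exact: sub_valP. Qed.

Lemma b_gt0 : 0 < b. Proof. by rewrite sqrtr_gt0 invr_gt0. Qed.

Lemma V_norm_ge0 u : 0 <= V_norm ip u. Proof. exact: sqrtr_ge0. Qed.

Lemma nrm_le_V_norm (x : Vs) : nrm x <= V_norm ip (V_val x).
Proof. by rewrite ler_wsqrtr//; exact: form_le_ip ipV a_bounded _ (V_valP x). Qed.

Lemma V_norm_le_nrm (x : Vs) : V_norm ip (V_val x) <= b * nrm x.
Proof.
rewrite /nrm /V_norm -sqrtrM ?invr_ge0 ?(ltW c0_gt0)// ler_wsqrtr//.
by rewrite ler_pdivlMl//; exact: (ip_le_form ipV a_coercive (V_valP x)).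
Qed.

Lemma V_normZ k u : V_mem L bc u -> V_norm ip (k *: (u : R -> R^o)) = `|k| * V_norm ip u.
Proof.
move=> Vu; have [sy li _] := ipV; have V0 : V_mem L bc (0 : R -> R^o) := V_mem0 L0 bc.
have Vk : V_mem L bc (k *: (u : R -> R^o)) by have := V_mem_lin L0 k Vu V0; rewrite addr0.
have i0 w : V_mem L bc w -> ip (0 : R -> R^o) w = 0.
  move=> Vw; have := li 1 _ _ _ V0 V0 Vw.
  rewrite (_ : 1 \*: (0 : R -> R^o) + 0 = (0 : R -> R^o)); last by rewrite addr0; apply/funext => x; exact: mulr0.
  by rewrite mul1r => /eqP; rewrite -subr_eq0 opprD addNKr oppr_eq0 => /eqP.
have iz w : V_mem L bc w -> ip (k *: (u : R -> R^o)) w = k * ip u w.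
  by move=> Vw; have := li k _ _ _ Vu V0 Vw; rewrite addr0 i0// addr0.
rewrite /V_norm iz// sy// iz// mulrA -expr2 sqrtrM ?sqr_ge0// sqrtr_sqr.
by [].
Qed.

Definition V_rho (u : VX) : Vs :=
  if pselect (V_mem L bc u) is left h then V_mk h else 0.

Lemma V_rhoE u (hu : V_mem L bc u) : V_rho u = V_mk hu.
Proof.
rewrite /V_rho; case: pselect => // h; apply: val_inj; by [].
Qed.

(** The constants 1 and b = sqrt(1 / c0) express a(u, u) <= ip u u <= c0^-1 a(u, u): boundedness of
    the form on one side, coercivity on the other. *)
Lemma V_realization : realization V_rho (V_val : Vs -> VX) 1 b.
Proof.
split.
- exact: ltr01.
- exact: b_gt0.
- exact: V_norm_ge0.
- exact: (V_mem0 L0 bc).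
- exact: (@V_mem_lin _ _ L0 bc).
- move=> k x y hx hy; have hxy := V_mem_lin L0 k hx hy.
  rewrite (V_rhoE hx) (V_rhoE hy) (V_rhoE hxy).
  rewrite (_ : V_mk hxy = k *: V_mk hx + V_mk hy) ?subrr ?nrm0//.
  exact: val_inj.
- by move=> x hx; rewrite mul1r (V_rhoE hx); exact: nrm_le_V_norm.
- by move=> x hx; rewrite (V_rhoE hx); exact: (V_norm_le_nrm (V_mk hx)).
- move=> y; split; first exact: V_valP.
  by rewrite (V_rhoE (V_valP y)) (_ : V_mk _ = y) ?subrr ?nrm0//; exact: val_inj.
Qed.

(** For nonzero norm, normalize u and use the definition of the dual norm; on vectors of norm zero a
    bounded functional vanishes. *)
Lemma dual_le (l : VX') u : pn_mem l -> V_mem L bc u -> `|l u| <= dual_norm l * V_norm ip u.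
Proof.
move=> [ll [M lM]] Vu; have V0 : V_mem L bc (0 : R -> R^o) := V_mem0 L0 bc.
have [e|ne] := eqVneq (V_norm ip u) 0.
  by rewrite e mulr0; apply: le_trans (lM u Vu) _; rewrite [pn_norm _]e mulr0.
have u0 : 0 < V_norm ip u by rewrite lt_neqAle eq_sym ne V_norm_ge0.
pose w : VX := (V_norm ip u)^-1 *: (u : R -> R^o).
have Vw : V_mem L bc w by have := V_mem_lin L0 (V_norm ip u)^-1 Vu V0; rewrite addr0.
have l0 : l (0 : R -> R^o) = 0.
  have := ll 1 _ _ V0 V0; rewrite addr0 scale1r mul1r => /eqP.
  by rewrite -subr_eq0 opprD addNKr oppr_eq0 => /eqP.
have lw : l w = (V_norm ip u)^-1 * l u.
  by have := ll (V_norm ip u)^-1 _ _ Vu V0; rewrite addr0 l0 addr0.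
have nw : V_norm ip w <= 1.
  by rewrite /w V_normZ// ger0_norm ?invr_ge0 ?V_norm_ge0// mulVf.
have : `|l w| <= dual_norm l.
  apply: ub_le_sup; last by exists w.
  exists `|M| => _ [x [Vx nx] ->]; apply: le_trans (lM x Vx) _.
  apply: le_trans (ler_wpM2r (V_norm_ge0 _) (ler_norm M)) _.
  by rewrite ler_piMr.
by rewrite lw normrM ger0_norm ?invr_ge0 ?V_norm_ge0// ler_pdivrMl// mulrC.
Qed.

Lemma dual_norm_ge0 (l : VX') : 0 <= dual_norm l.
Proof.
have V0 : V_mem L bc (0 : R -> R^o) := V_mem0 L0 bc.
have n0 : V_norm ip (0 : R -> R^o) <= 1.
  by rewrite -(scaler0 _ 0) V_normZ// normr0 mul0r.
rewrite /dual_norm; set S := [set _ | _].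
have S0 : S `|l (0 : R -> R^o)| by exists (0 : R -> R^o).
(* For a functional that is unbounded on the unit ball the supremum takes its default value 0. *)
have [hS|hS] := pselect (has_sup S); last by rewrite sup_out.
by apply: le_trans (ub_le_sup hS.2 S0).
Qed.

Lemma dual_norm_le (l : VX') C : (forall u, V_mem L bc u -> V_norm ip u <= 1 -> `|l u| <= C) ->
  dual_norm l <= C.
Proof.
move=> h; apply: ge_sup; last by move=> _ [x [Vx nx] ->]; exact: h.
exists `|l (0 : R -> R^o)|, (0 : R -> R^o) => //; split; first exact: (V_mem0 L0 bc).
by rewrite /= -(scaler0 _ 0) V_normZ ?normr0 ?mul0r//; exact: (V_mem0 L0 bc).
Qed.

Definition S_rho (l : VX') : Vs := xget 0 [set z : Vs | forall x : Vs, dot z x = l (V_val x)].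

Definition S_val (y : Vs) : VX' := fun v => a (V_val y) v.

Lemma S_rhoE (l : VX') : pn_mem l -> forall x : Vs, dot (S_rho l) x = l (V_val x).
Proof.
move=> hl; have [ll _] := hl.
have [z hz] : exists z : Vs, forall x, dot z x = l (V_val x).
  apply: (@riesz R Vs (fun x => l (V_val x)) (dual_norm l * b)).
  - by move=> k x y; exact: (ll k _ _ (V_valP x) (V_valP y)).
  - move=> x; apply: le_trans (dual_le hl (V_valP x)) _.
    by rewrite -mulrA ler_wpM2l ?dual_norm_ge0// V_norm_le_nrm.
exact: (@xgetPex _ 0 [set z : Vs | forall x : Vs, dot z x = l (V_val x)] (ex_intro _ z hz)).
Qed.

Lemma S_rho_unique (l : VX') (z : Vs) : pn_mem l ->
  (forall x : Vs, dot z x = l (V_val x)) -> nrm (S_rho l - z) = 0.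
Proof.
move=> hl hz; apply/nrm_eq0P; rewrite dotBl hz S_rhoE// subrr.
by [].
Qed.

Lemma S_val_mem (y : Vs) : pn_mem (S_val y).
Proof.
split=> [k u v Vu Vv|].
  rewrite /S_val form_aC (form_aC _ _ (V_val y) u) (form_aC _ _ (V_val y) v).
  exact: (form_a_lin L0 kappa k (V_H1 Vu) (V_H1 Vv) (V_H1 (V_valP y))).
by exists (V_norm ip (V_val y)) => u Vu; exact: a_bounded (V_valP y) Vu.
Qed.

(** Riesz representation uses a while the dual norm uses the given norm of V, so the two constants
    of [V_realization] reappear exchanged. *)
Lemma S_realization : realization S_rho (S_val : Vs -> VX') b 1.
Proof.
have mem0 : pn_mem (0 : VX').
  split=> [k x y _ _|]; first by rewrite /= mulr0 addr0.
  by exists 0 => x _; rewrite normr0 mul0r.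
have memL k (x y : VX') : pn_mem x -> pn_mem y -> pn_mem (k *: x + y).
  move=> [lx [M hM]] [ly [N hN]]; split=> [r u v Vu Vv|].
    have e w : (k *: x + y) w = k * x w + y w by [].
    by rewrite !e lx// ly//; ring.
  exists (`|k| * M + N) => u Vu; apply: le_trans (ler_normD _ _) _; rewrite normrM mulrDl -mulrA.
  by apply: lerD; [rewrite ler_wpM2l// hM|exact: hN].
split=> //.
- exact: b_gt0.
- exact: dual_norm_ge0.
- move=> k x y hx hy; apply: S_rho_unique; first exact: memL.
  by move=> z; rewrite !dotE !S_rhoE.
- move=> l hl; have [e|ne] := eqVneq (nrm (S_rho l)) 0.
    by rewrite e mulr_ge0 ?(ltW b_gt0)// dual_norm_ge0.
  have n0 : 0 < nrm (S_rho l) by rewrite lt_neqAle eq_sym ne nrm_ge0.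
  rewrite -(ler_pM2r n0) -expr2 nrm_sqr S_rhoE//.
  apply: le_trans (ler_norm _) _; apply: le_trans (dual_le hl (V_valP _)) _.
  by rewrite [b * _]mulrC -mulrA ler_wpM2l ?dual_norm_ge0// V_norm_le_nrm.
- move=> l hl; rewrite mul1r; apply: dual_norm_le => u Vu nu.
  have -> : l u = dot (S_rho l) (V_mk Vu) by rewrite S_rhoE.
  apply: le_trans (dot_le _ _) _; rewrite ler_piMr ?nrm_ge0//.
  by apply: le_trans nu; exact: (nrm_le_V_norm (V_mk Vu)).
- move=> y; split; first exact: S_val_mem.
  by apply: S_rho_unique; first exact: S_val_mem.
Qed.

End Realizations.

Section SquareIntegrableFunctions.
Context {R : realType} (L : \bar R).
Local Notation HX := (@H R L).

Definition H_mk u (hu : L2 L u) : L2s L := L2_mk (measurable_I L) ((L2P L u).1 hu).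
Definition H_val (x : L2s L) : R -> R := sub_val x.

Lemma H_valP (x : L2s L) : L2 L (H_val x). Proof. by apply/L2P; exact: sub_L2P. Qed.

Definition H_rho (u : HX) : L2s L := if pselect (L2 L u) is left h then H_mk h else 0.

Lemma H_rhoE u (hu : L2 L u) : H_rho u = H_mk hu.
Proof. by rewrite /H_rho; case: pselect => // h; exact: val_inj. Qed.

Lemma H_normE u (hu : L2 L u) : L2_norm L u = nrm (H_mk hu). Proof. by []. Qed.

Lemma H_realization : realization H_rho (H_val : L2s L -> HX) 1 1.
Proof.
split.
- exact: ltr01.
- exact: ltr01.
- by move=> x; exact: sqrtr_ge0.
- exact: L2_ss0.
- by move=> k x y hx hy; exact: L2_lin.
- move=> k x y hx hy; have hxy := L2_lin k hx hy.
  rewrite (H_rhoE hx) (H_rhoE hy) (H_rhoE hxy).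
  rewrite (_ : H_mk hxy = k *: H_mk hx + H_mk hy) ?subrr ?nrm0//.
  exact: val_inj.
- by move=> x hx; rewrite mul1r (H_rhoE hx).
- by move=> x hx; rewrite mul1r (H_rhoE hx).
- move=> y; split; first exact: H_valP.
  by rewrite (H_rhoE (H_valP y)) (_ : H_mk _ = y) ?subrr ?nrm0//; exact: val_inj.
Qed.

End SquareIntegrableFunctions.

Section EnergyEmbedding.
Context {R : realType} (L : \bar R) (bc : boundary_condition).
Context (ip : (R -> R) -> (R -> R) -> R) (kappa c0 : R).
Context (L0 : (0 < L)%E) (ipV : V_inner_product L bc ip) (a_bounded : form_bounded L bc ip kappa).
Context (c0_gt0 : 0 < c0) (a_coercive : form_coercive L bc ip kappa c0).
Local Notation Vs := (V_sh L0 ipV a_bounded c0_gt0 a_coercive).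
Local Notation VX := (V L bc ip).
Local Notation VX' := (Vstar L bc ip).
Local Notation rV := (V_rho L0 ipV a_bounded c0_gt0 a_coercive).
Local Notation rS := (S_rho L0 ipV a_bounded c0_gt0 a_coercive).
Implicit Types (u v : VX).

Lemma S_rho_dot (l : VX') v : pn_mem l -> pn_mem v -> l v = dot (rS l) (rV v).
Proof. by move=> hl hv; rewrite (S_rhoE hl) (V_rhoE _ _ _ _ _ hv). Qed.

Lemma op_A_rho_dot u v : pn_mem u -> pn_mem v -> op_A kappa u v = dot (rV u) (rV v).
Proof. by move=> hu hv; rewrite (V_rhoE _ _ _ _ _ hu) (V_rhoE _ _ _ _ _ hv). Qed.

Lemma V_mem_L2 u : pn_mem u -> L2 L u.
Proof. by move=> hu; have [] := dxP (V_H1 hu). Qed.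

Lemma H_to_Vstar_rho_dot u v : pn_mem u -> pn_mem v ->
  (H_to_Vstar u : VX') v = dot (V_inj (rV u)) (V_inj (rV v)).
Proof. by move=> hu hv; rewrite (V_rhoE _ _ _ _ _ hu) (V_rhoE _ _ _ _ _ hv). Qed.

Lemma H_rho_V_rho u : pn_mem u -> nrm (H_rho (u : H L) - V_inj (rV u)) = 0.
Proof.
move=> hu; rewrite (V_rhoE _ _ _ _ _ hu) (H_rhoE (V_mem_L2 hu)).
by rewrite (_ : H_mk _ = V_inj (V_mk L0 ipV a_bounded c0_gt0 a_coercive hu)) ?subrr ?nrm0//; exact: val_inj.
Qed.

Lemma H_rho_norm (u : H L) : L2 L u -> L2_norm L u = nrm (H_rho u).
Proof. by move=> hu; rewrite (H_rhoE hu) H_normE. Qed.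

Lemma H_to_Vstar_mem u : pn_mem u -> pn_mem (H_to_Vstar u : VX').
Proof.
move=> hu; have [M M0 hM] := V_inj_le L0 ipV a_bounded c0_gt0 a_coercive.
split=> [k w v Vw Vv|].
  rewrite /H_to_Vstar L2_dotC (L2_dotC L u w) (L2_dotC L u v).
  exact: (L2_dot_lin k (V_mem_L2 Vw) (V_mem_L2 Vv) (V_mem_L2 hu)).
exists (M * nrm (rV u) * M) => v Vv; rewrite (H_to_Vstar_rho_dot hu Vv).
apply: le_trans (dot_le _ _) _; rewrite -(mulrA (M * nrm _)).
apply: ler_pM; [exact: nrm_ge0|exact: nrm_ge0|exact: hM|].
apply: le_trans (hM _) (ler_wpM2l M0 _); rewrite (V_rhoE _ _ _ _ _ Vv).
exact: (nrm_le_V_norm (V_mk L0 ipV a_bounded c0_gt0 a_coercive Vv)).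
Qed.

End EnergyEmbedding.

(* Unification must not unfold the concrete spaces. *)
#[global] Opaque V_sh L2s V_val V_mk H_val H_mk V_inj.

(** * The nonlinear problem in the abstract spaces: existence, estimate, uniqueness *)

Section Solution.
Context {R : realType} (L : \bar R) (bc : boundary_condition).
Context (ip : (R -> R) -> (R -> R) -> R) (kappa T lam K b M : R).
Local Notation mu := (@lebesgue_measure R).
Local Notation TR := (measurableTypeR R).
Local Notation J := (`[0, T]%classic : set TR).
Local Notation Jo := (`]0, T[%classic : set TR).
Local Notation "J[ t ]" := (`[0, t]%classic : set TR) (at level 0, format "J[ t ]").
Local Notation VX := (V L bc ip).
Local Notation VX' := (Vstar L bc ip).
Local Notation HX := (@H R L).
Hypothesis T0 : 0 < T.
Hypothesis lam0 : 0 < lam.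
Hypothesis K0 : 0 <= K.
Hypothesis M0 : 0 <= M.

(* [Vs] and [Hs] stand for V and H, and V* is identified with [Vs] by the Riesz
   representation with respect to the form a. *)
Variables (Vs Hs : semiHilbert R) (j : Vs -> Hs).
Variables (rV : VX -> Vs) (vV : Vs -> VX) (rS : VX' -> Vs) (vS : Vs -> VX') (rH : HX -> Hs) (vH : Hs -> HX).
Hypothesis zV : realization rV vV 1 b.
Hypothesis zS : realization rS vS b 1.
Hypothesis zH : realization rH vH 1 1.
Hypothesis j_lin : forall k x y, j (k *: x + y) = k *: j x + j y.
Hypothesis j_le : forall x, nrm (j x) <= M * nrm x.
Hypothesis j_inj : forall x, nrm (j x) = 0 -> nrm x = 0.
Hypothesis j_dense : forall q, (forall w, dot q (j w) = 0) -> nrm q = 0.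
Hypothesis rS_dot : forall (l : VX') (v : VX), pn_mem l -> pn_mem v -> l v = dot (rS l) (rV v).
Hypothesis op_A_dot : forall u v : VX, pn_mem u -> pn_mem v -> op_A kappa u v = dot (rV u) (rV v).
Hypothesis H_to_Vstar_mem : forall u : VX, pn_mem u -> pn_mem (H_to_Vstar u : VX').
Hypothesis H_to_Vstar_dot : forall u v : VX, pn_mem u -> pn_mem v ->
  (H_to_Vstar u : VX') v = dot (j (rV u)) (j (rV v)).
Hypothesis V_L2 : forall u : VX, pn_mem u -> L2 L u.
Hypothesis rH_rV : forall u : VX, pn_mem u -> nrm (rH u - j (rV u)) = 0.
Hypothesis L2_normE : forall u : HX, L2 L u -> L2_norm L u = nrm (rH u).

Variable f : R -> VX -> VX'.
Hypothesis f_lip : lipschitz_rhs T f K.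

Let mJ : measurable J := measurable_itvR _.
Let mt t : measurable J[t] := measurable_itvR _.
Let Jle t : J t -> t <= T. Proof. by rewrite /= in_itv/= => /andP[]. Qed.
Let oJ : Jo `<=` J := @subset_itv_oo_cc _ _ _ _.
Let J0 : J 0. Proof. by rewrite /= in_itv/= lexx ltW. Qed.
Let b0 : 0 < b := rz_A zS.

Lemma V_represents (w : R -> Vs) : represents T rV (fun t => vV (w t)) w.
Proof. by apply: aeW => t _; exact: rz_inv zV (w t). Qed.

Lemma S_represents (w : R -> Vs) : represents T rS (fun t => vS (w t)) w.
Proof. by apply: aeW => t _; exact: rz_inv zS (w t). Qed.

Lemma rhs_represents_ex (w : R -> Vs) : sL2 mu J w ->
  exists v : R -> Vs, sL2 mu J v /\ represents T rS (fun t => f t (vV (w t))) v.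
Proof.
move=> sw; have [_ h _] := f_lip.
have [v sv uv] := L2_time_sL2 zS (h _ (sL2_L2_time zV (V_represents w) sw)).
by exists v.
Qed.

(** The map w |-> f(t, w(t)) read in [Vs]: a choice of a square integrable representative,
    determined up to null sets. *)
Definition Phi (w : R -> Vs) : R -> Vs :=
  xget 0 [set v : R -> Vs | sL2 mu J v /\ represents T rS (fun t => f t (vV (w t))) v].

Lemma PhiP w : sL2 mu J w -> sL2 mu J (Phi w) /\ represents T rS (fun t => f t (vV (w t))) (Phi w).
Proof.
move=> /rhs_represents_ex h.
exact: (@xgetPex _ 0 [set v : R -> Vs | sL2 mu J v /\ represents T rS (fun t => f t (vV (w t))) v] h).
Qed.

Lemma Phi_L2 w : sL2 mu J w -> sL2 mu J (Phi w). Proof. by move=> /PhiP[]. Qed.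

Local Notation K2 := ((K * b ^+ 2) ^+ 2).

(** One factor b comes from the representation of the dual and one from comparing the norms on V,
    whence K b^2 as Lipschitz constant and its square for squared norms. *)
Lemma Phi_lipschitz w1 w2 : sL2 mu J w1 -> sL2 mu J w2 ->
  L2dot mu J (Phi w1 - Phi w2) (Phi w1 - Phi w2) <= K2 * L2dot mu J (w1 - w2) (w1 - w2).
Proof.
move=> s1 s2; have [_ hL2 hlip] := f_lip.
have [sp1 r1] := PhiP s1; have [sp2 r2] := PhiP s2.
have [_ le1] := L2_time_norm_sqr zS (representsB zS r1 r2) (sL2B mJ sp1 sp2).
have [le2 _] := L2_time_norm_sqr zV (representsB zV (V_represents w1) (V_represents w2)) (sL2B mJ s1 s2).
have le3 := hlip _ _ (sL2_L2_time zV (V_represents w1) s1) (sL2_L2_time zV (V_represents w2) s2).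
have n0 (X : prenormed R) (u : R -> X) : 0 <= L2_time_norm T u by exact: sqrtr_ge0.
apply: le_trans le1 _.
have le4 : L2_time_norm T (fun t => f t (vV (w1 t)) - f t (vV (w2 t))) ^+ 2 <=
   K ^+ 2 * (b ^+ 2 * L2dot mu J (w1 - w2) (w1 - w2)).
  apply: le_trans (ler_wpM2l (sqr_ge0 K) le2); rewrite -exprMn.
  by rewrite lerXn2r ?nnegrE ?mulr_ge0 ?n0.
apply: le_trans (ler_wpM2l (sqr_ge0 b) le4) _.
by rewrite le_eqVlt; apply/orP; left; apply/eqP; ring.
Qed.

(** At a time where w1 and w2 agree, both choices represent the same value of f. *)
Lemma Phi_local w1 w2 (A : set TR) : sL2 mu J w1 -> sL2 mu J w2 ->
  (forall s, A s -> w1 s = w2 s) -> {ae mu, forall s, J s -> A s -> nrm (Phi w1 s - Phi w2 s) = 0}.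
Proof.
move=> s1 s2 hA; have [_ r1] := PhiP s1; have [_ r2] := PhiP s2.
apply: ae_segment; apply: ae_mono (ae_conj r1 r2) => s [h1 h2] Js As.
have [_ e1] := h1 Js; have [_ e2] := h2 Js; rewrite (hA s As) in e1.
by apply: (nrm_sub0_trans _ e2); rewrite nrm_sym.
Qed.

Lemma Phi_lip w1 w2 : sL2 mu J w1 -> sL2 mu J w2 -> forall t, J t ->
  L2dot mu J[t] (Phi w1 - Phi w2) (Phi w1 - Phi w2) <= K2 * L2dot mu J[t] (w1 - w2) (w1 - w2).
Proof.
exact: (lipschitz_initial_segment (sqr_ge0 (K * b ^+ 2)) Phi_L2 Phi_lipschitz Phi_local).
Qed.

Local Notation jj := (jinv j_lin j_le).

(** In the identification of the dual with V, the embedding of V into H and then into the dual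
    becomes [jinv]. *)
Lemma H_to_Vstar_represents u (p : R -> Vs) : represents T rV u p ->
  represents T rS (fun t => H_to_Vstar (u t) : VX') (fun t => jj (p t)).
Proof.
apply: ae_mono => t h Jt; have [m e] := h Jt; have mem := H_to_Vstar_mem m.
split=> //; apply/nrm_eq0P; set z := _ - _; have hz y : dot z y = 0; last exact: hz.
have [my ey] := rz_inv zV y.
have e1 : dot (rS (H_to_Vstar (u t))) y = dot (j (rV (u t))) (j y).
  have := rS_dot mem my; rewrite (H_to_Vstar_dot m my) => h1.
  have h2 : dot (rS (H_to_Vstar (u t))) y = dot (rS (H_to_Vstar (u t))) (rV (vV y)).
    by apply/eqP; rewrite -subr_eq0 -dotBr dotC; apply/eqP; apply: dot0_nrm; rewrite nrm_sym.
  by rewrite h2 -h1; exact: (bilin_eqr (jdot_bilinear j_lin j_le) (rV (u t)) ey).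
rewrite /z dotBl e1 jinvE; apply/eqP; rewrite subr_eq0; apply/eqP.
exact: (bilin_eql (jdot_bilinear j_lin j_le) y e).
Qed.

Lemma rS_ext (l l' : VX') : pn_mem l -> pn_mem l' -> (forall w : VX, pn_mem w -> l w = l' w) ->
  nrm (rS l - rS l') = 0.
Proof.
move=> m m' h; apply/nrm_eq0P; set z := _ - _; have hz y : dot z y = 0; last exact: hz.
have [my ey] := rz_inv zV y.
have e (l1 : VX') : pn_mem l1 -> dot (rS l1) y = l1 (vV y).
  move=> m1; rewrite (rS_dot m1 my); apply/eqP; rewrite -subr_eq0 -dotBr dotC; apply/eqP.
  by apply: dot0_nrm; rewrite nrm_sym.
by rewrite /z dotBl (e _ m) (e _ m') h// subrr.
Qed.

(** The functions [u t] and [vV (p t)] are at distance zero in V without being equal, so the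
    independence of [f t] from representatives enters here. *)
Lemma f_represents u (p : R -> Vs) : represents T rV u p -> sL2 mu J p ->
  represents T rS (fun t => f t (u t)) (Phi p).
Proof.
move=> up sp; have [hf _ _] := f_lip; have [_ rp] := PhiP sp.
apply: ae_mono (ae_conj hf (ae_conj up rp)) => t [h1 [h2 h3]] Jt.
have [hm hx] := h1 Jt; have [m e] := h2 Jt; have [m' e'] := h3 Jt.
have [mp ep] := rz_inv zV (p t).
split; first exact: hm.
apply: (nrm_sub0_trans _ e'); apply: rS_ext; [exact: hm|exact: m'|].
apply: hx => //; apply/eqP; rewrite eq_le (rz_ge0 zV (u t - vV (p t)))/= andbT.
apply: le_trans (rz_distB zV m mp) _.
by rewrite (nrm_sub0_trans e (etrans (nrm_sym _ _) ep)) mulr0.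
Qed.

Variables (u0 v0 : R -> R).
Hypothesis Vu0 : pn_mem (u0 : VX).
Hypothesis Hv0 : L2 L v0.
Local Notation U0 := (rV u0).
Local Notation W0 := (rH v0).

Section Existence.
Variables (v : R -> Vs) (v_ : R -> Hs).
Hypothesis sv : sL2 mu J v.
Hypothesis cv_ : ucont T v_.
Hypothesis vv_ : {ae mu, forall t, J t -> nrm (j (v t) - v_ t) = 0}.
Hypothesis hv : forall t, J t -> forall w, dot (v_ t) (j w) = dot W0 (j w) +
  (\int[mu]_(r in J[t]) dot (rhs Phi U0 v r) w - lam * \int[mu]_(r in J[t]) dot (v r) w).

Let y := primitive_from U0 v.
(** The second derivative read off from the equation: eta'' = f(eta) - A eta - lam A eta'. *)
Let q : R -> Vs := rhs Phi U0 v - lam *: v.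
Definition eta (t : R) : VX := vV (y t).
(* For every t this is a representative of [v_ t] in H, and it lies in V whenever
   [v t] does represent [v_ t], which is the case for almost every t. *)
Definition eta1 (t : R) : VX := if nrm (j (v t) - v_ t) == 0 then vV (v t) else vH (v_ t).
Definition eta2 (t : R) : VX' := vS (q t).

Let sy : sL2 mu J y. Proof. exact: prim_sL2. Qed.
Let srhs : sL2 mu J (rhs Phi U0 v). Proof. exact: (sL2_rhs Phi_L2). Qed.
Let sq : sL2 mu J q. Proof. by apply: (sL2B mJ srhs); exact: sL2Z. Qed.

Lemma eta_represents : represents T rV eta y.
Proof. exact: V_represents. Qed.

Lemma eta1_represents : represents T rV eta1 v.
Proof.
apply: ae_mono vv_ => t h Jt; rewrite /eta1 h ?eqxx; last exact: oJ.
exact: rz_inv zV (v t).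
Qed.

Lemma eta2_represents : represents T rS eta2 q.
Proof. exact: S_represents. Qed.

Lemma prim_q_dot t w : J t -> dot (prim q t) w =
  \int[mu]_(r in J[t]) dot (rhs Phi U0 v r) w - lam * \int[mu]_(r in J[t]) dot (v r) w.
Proof.
move=> Jt; have tT := Jle Jt.
rewrite (prim_dot w tT sq) -(RintegralZl lam (mt t) (intg_dotr w (mt t) (sub_J0 tT) sv)).
rewrite -(RintegralB (mt t) (intg_dotr w (mt t) (sub_J0 tT) srhs) (intgZ (mt t) lam (intg_dotr w (mt t) (sub_J0 tT) sv))).
apply: eq_Rintegral => r _; rewrite (_ : q r = rhs Phi U0 v r - lam *: v r)// dotBl dotZl.
by [].
Qed.

Lemma eta_time_derivative : time_derivative T eta eta1.
Proof.
apply: (time_derivative_represents T0 zV eta_represents eta1_represents sy sv) => phi w tp.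
exact: test_by_parts.
Qed.

Lemma eta1_time_derivative : time_derivative T (fun t => H_to_Vstar (eta1 t) : VX') eta2.
Proof.
have sj := jinv_sL2 j_lin j_le sv.
apply: (time_derivative_represents T0 zS (H_to_Vstar_represents eta1_represents) eta2_represents sj sq) => phi w tp.
(* [x0] represents the functional w |-> <v0, w> in V. The embedded velocity is then x0 plus the
   primitive of q almost everywhere, and [test_by_parts] gives its derivative. *)
have [x0 hx0] : exists x0 : Vs, forall w, dot x0 w = dot W0 (j w).
  apply: (@riesz R Vs (fun w => dot W0 (j w)) (nrm W0 * M)).
  - by move=> k x x'; rewrite j_lin !dotE.
  - move=> x; apply: le_trans (dot_le _ _) _; rewrite -mulrA.
    by apply: (ler_wpM2l (nrm_ge0 _)); exact: j_le.
rewrite -(test_by_parts T0 x0 w tp sq); have td := test_derive1_itv T0 tp.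
apply: (Rintegral_ae mJ).
- by apply: measurable_funM; [exact: (measurable_test td mJ)|exact: intg_measurable (intg_dotr w mJ (@subset_refl _ J) sj)].
- apply: measurable_funM; first exact: (measurable_test td mJ).
  exact: intg_measurable (intg_dotr w mJ (@subset_refl _ J) (prim_sL2 x0 sq)).
apply: ae_mono vv_ => t h Jt; congr (_ * _); rewrite jinvE dotDl hx0 (prim_q_dot w Jt) -(hv Jt).
by apply/eqP; rewrite -subr_eq0 -dotBl; apply/eqP; apply: dot0_nrm; exact: h.
Qed.

Lemma eta_in_Wr : in_Wr T eta eta1 eta2.
Proof.
split; [exact: (sL2_L2_time zV eta_represents sy)|exact: (sL2_L2_time zV eta1_represents sv)
  |exact: (sL2_L2_time zS eta2_represents sq)|exact: eta_time_derivative|exact: eta1_time_derivative].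
Qed.

Lemma eta_continuous : continuous_time T eta.
Proof.
apply: (continuous_time_ucont zV (v := y)) => [|t _]; first exact: prim_ucont.
exact: rz_inv zV (y t).
Qed.

Lemma eta1_H t : L2 L (eta1 t) /\ nrm (rH (eta1 t) - v_ t) = 0.
Proof.
rewrite /eta1; case: eqP => [e|_]; last exact: rz_inv zH (v_ t).
have [m ev] := rz_inv zV (v t); split; first exact: V_L2.
apply: (nrm_sub0_trans (rH_rV m)); apply: (nrm_sub0_trans _ e).
by rewrite -(jB j_lin); apply/eqP; rewrite eq_le nrm_ge0 andbT; apply: le_trans (j_le _) _; rewrite ev mulr0.
Qed.

Lemma eta1_continuous : @continuous_time R HX T eta1.
Proof.
apply: (continuous_time_ucont zH (v := v_)) => [|t _]; first exact: cv_.
exact: eta1_H.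
Qed.

Lemma eta_equation : {ae mu, forall t, t \in `]0, T[ -> forall w : VX, V_mem L bc w ->
  eta2 t w + lam * op_A kappa (eta1 t) w + op_A kappa (eta t) w = f t (eta t) w}.
Proof.
have [_ rP] := PhiP sy.
apply: ae_mono (ae_conj rP (ae_conj eta1_represents (ae_conj eta2_represents eta_represents))) => t [h [h1 [h2 h0]]] Jt w Vw.
have [m e] := h Jt; have [m1 e1] := h1 Jt; have [m2 e2] := h2 Jt; have [m0 e0] := h0 Jt.
rewrite (rS_dot m2 Vw) (rS_dot m Vw) (op_A_dot m1 Vw) (op_A_dot m0 Vw).
have d (x x' : Vs) : nrm (x - x') = 0 -> dot x (rV w) = dot x' (rV w).
  by move=> hx; apply/eqP; rewrite -subr_eq0 -dotBl; apply/eqP; exact: dot0_nrm.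
rewrite (d _ _ e) (d _ _ e1) (d _ _ e2) (d _ _ e0).
rewrite (_ : q t = Phi y t - y t - lam *: v t)// !dotE; ring.
Qed.

Lemma eta_initial : initial_value T eta u0.
Proof.
exists eta; split; [exact: eta_continuous| |].
  apply: (represents_ae zV eta_represents eta_represents).
  by apply: aeW => t _; rewrite subrr nrm0.
have [m e] := rz_inv zV (y 0).
apply/eqP; rewrite eq_le (rz_ge0 zV) andbT; apply: le_trans (rz_distB zV m Vu0) _.
suff -> : nrm (rV (eta 0) - U0) = 0 by rewrite mulr0.
apply: (nrm_sub0_trans e); rewrite /y /primitive_from addrC addKr.
exact: (prim0 (ltW T0) sv).
Qed.

Lemma v_initial : nrm (v_ 0 - W0) = 0.
Proof.
apply: j_dense => w; rewrite dotBl (hv J0).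
rewrite set_itv1 !Rintegral_set1 mulr0 subr0 addr0 subrr.
by [].
Qed.

Lemma eta1_initial : @initial_value R HX T eta1 v0.
Proof.
exists eta1; split; [exact: eta1_continuous| |].
  apply: aeW => t _; have [m e] := eta1_H t.
  apply/eqP; rewrite eq_le (rz_ge0 zH) andbT; apply: le_trans (rz_distB zH m m) _.
  by rewrite subrr nrm0 mulr0.
have [m e] := eta1_H 0.
apply/eqP; rewrite eq_le (rz_ge0 zH) andbT; apply: le_trans (rz_distB zH m Hv0) _.
by rewrite (nrm_sub0_trans e v_initial) mulr0.
Qed.

Lemma eta_weak_solution : weak_solution T f kappa lam u0 v0 eta.
Proof.
exists eta1, eta2; split; [exact: eta_in_Wr|exact: eta_equation|exact: eta_initial|exact: eta1_initial].
Qed.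

Lemma data_le : data_sqr T Phi U0 W0 <=
  (1 + b ^+ 2) * (V_norm ip u0 ^+ 2 + L2_norm L v0 ^+ 2 + L2_time_norm T (fun s => f s 0) ^+ 2).
Proof.
have s0 := sL2_0 mu mJ Vs; have [sP _] := PhiP s0.
have r0 : represents T rV (fun=> 0 : VX) (0 : R -> Vs).
  apply: aeW => t _; split; first exact: rz_mem0 zV.
  by have := rz_linB zV (rz_mem0 zV) (rz_mem0 zV); rewrite !subrr.
have [_ l1] := L2_time_norm_sqr zS (f_represents r0 s0) sP.
have l2 : dot U0 U0 <= V_norm ip u0 ^+ 2.
  rewrite -nrm_sqr lerXn2r ?nnegrE ?nrm_ge0//; first exact: (rz_ge0 zV).
  by have := rz_leA zV Vu0; rewrite mul1r.
have l3 : dot W0 W0 = L2_norm L v0 ^+ 2 by rewrite L2_normE// nrm_sqr.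
rewrite /data_sqr l3 (mulrDr _ _ (L2_time_norm T _ ^+ 2)); apply: lerD.
  apply: le_trans (lerD l2 (lexx _)) _.
  by rewrite ler_peMl ?lerDl ?sqr_ge0// addr_ge0 ?sqr_ge0.
by apply: le_trans l1 _; rewrite ler_wpM2r ?sqr_ge0// lerDr.
Qed.

(** The comparison of integrands holds only almost everywhere, and measurability of the norm of
    [eta1] is not established; [ae_le_integral] covers both. *)
Lemma eta1_integral_le t : J t ->
  \int[mu]_(s in `[0, t]) V_norm ip (eta1 s) ^+ 2 <= b ^+ 2 * L2dot mu J[t] v v.
Proof.
move=> Jt; have sub := sub_J0 (Jle Jt); have sv' := sL2S mJ (mt t) sub sv.
rewrite /L2dot -(RintegralZl (b ^+ 2) (mt t) sv'.2).
have i0 : (0 <= \int[mu]_(s in `[0%R, t]) ((V_norm ip (eta1 s)) ^+ 2)%:E)%E.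
  by apply: integral_ge0 => s _; rewrite lee_fin sqr_ge0.
have le : (\int[mu]_(s in `[0%R, t]) ((V_norm ip (eta1 s)) ^+ 2)%:E <=
    (\int[mu]_(s in J[t]) (b ^+ 2 * dot (v s) (v s)))%:E)%E.
  rewrite -(EFin_Rintegral (mt t) (intgZ (mt t) (b ^+ 2) sv'.2)).
  apply: ae_le_integral => [s|s|]; first by rewrite lee_fin sqr_ge0.
    by rewrite lee_fin mulr_ge0 ?sqr_ge0 ?dot_ge0.
  apply: ae_mono vv_ => s h Js; rewrite lee_fin /eta1 h ?eqxx; last exact: sub.
  have [m e] := rz_inv zV (v s); rewrite -nrm_sqr -exprMn lerXn2r ?nnegrE ?mulr_ge0 ?nrm_ge0 ?(ltW b0)//.
    exact: (rz_ge0 zV).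
  by rewrite -(eq_nrm e); exact: (rz_leB zV m).
have fi : (\int[mu]_(s in `[0%R, t]) ((V_norm ip (eta1 s)) ^+ 2)%:E)%E \is a fin_num.
  by rewrite ge0_fin_numE// (le_lt_trans le) ?ltry.
by rewrite -lee_fin /Rintegral fineK.
Qed.

(** The energy inequality, separated from the other hypotheses because it serves only the estimate.
    There one factor 1 + b^2 passes from the norms of the solution in [Vs] to the given ones, and
    the other does the same for the data. *)
Hypothesis hE : forall t, J t -> dot (v_ t) (v_ t) + lam * L2dot mu J[t] v v <=
  dot W0 W0 + lam^-1 * L2dot mu J[t] (rhs Phi U0 v) (rhs Phi U0 v).

Lemma eta_estimate t : J t ->
  L2_norm L (eta1 t) ^+ 2 + V_norm ip (eta t) ^+ 2 + \int[mu]_(s in `[0, t]) V_norm ip (eta1 s) ^+ 2 <=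
  (1 + b ^+ 2) * energy_const T lam K2 * (1 + b ^+ 2) *
  (V_norm ip u0 ^+ 2 + L2_norm L v0 ^+ 2 + L2_time_norm T (fun s => f s 0) ^+ 2).
Proof.
move=> Jt; have E := picard_energy (ltW T0) lam0 (sqr_ge0 (K * b ^+ 2)) Phi_L2 Phi_lip sv hE Jt.
have [m1 e1] := eta1_H t; have [m e] := rz_inv zV (y t).
have -> : L2_norm L (eta1 t) ^+ 2 = dot (v_ t) (v_ t) by rewrite L2_normE// (eq_nrm e1) nrm_sqr.
have l1 : V_norm ip (eta t) ^+ 2 <= b ^+ 2 * dot (y t) (y t).
  rewrite -nrm_sqr -exprMn lerXn2r ?nnegrE ?mulr_ge0 ?nrm_ge0 ?(ltW b0)//.
    exact: (rz_ge0 zV).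
  by rewrite -(eq_nrm e); exact: (rz_leB zV m).
have b1 : 1 <= 1 + b ^+ 2 by rewrite lerDl sqr_ge0.
have bb : b ^+ 2 <= 1 + b ^+ 2 by rewrite lerDr.
have l0 : dot (v_ t) (v_ t) <= (1 + b ^+ 2) * dot (v_ t) (v_ t) by rewrite ler_peMl ?dot_ge0.
have l2 := le_trans l1 (ler_wpM2r (dot_ge0 (y t)) bb).
have l3 := le_trans (eta1_integral_le Jt) (ler_wpM2r (L2dot_ge0 mu J[t] v) bb).
apply: le_trans (lerD (lerD l0 l2) l3) _.
rewrite -!mulrDr -!mulrA ler_wpM2l ?(le_trans ler01 b1)//.
have ec := energy_const_ge0 (ltW T0) lam0 (sqr_ge0 (K * b ^+ 2)).
by apply: le_trans E _; rewrite ler_wpM2l// data_le.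
Qed.

End Existence.

(** The distributional derivatives make zeta a primitive of p and the continuous representative of
    the velocity, tested in H, a primitive of [p2]; the equation expresses [p2] through p, which
    gives the integrated form. *)
Lemma weak_solution_parabolic zeta : weak_solution T f kappa lam u0 v0 zeta ->
  exists2 p : R -> Vs, parabolic_solution T lam j W0 (rhs Phi U0 p) p &
    represents T rV zeta (primitive_from U0 p).
Proof.
move=> [z1 [z2 [[l0 l1 l2 d1 d2] eq i0 i1]]].
have [p sp rp] := L2_time_sL2 zV l1; have [p2 sp2 rp2] := L2_time_sL2 zS l2.
have rz0 := time_derivative_primitive T0 zV l0 rp sp d1 Vu0 i0.
exists p => //; have sy := prim_sL2 U0 sp.
have [w [cw wz w0]] := i1.
have sj := jinv_sL2 j_lin j_le sp.
have rj := H_to_Vstar_represents rp.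
have e0 : nrm (rH (w 0) - W0) = 0.
  apply/eqP; rewrite eq_le nrm_ge0 andbT.
  by apply: le_trans (rz_distA zH (cw.1 0 J0) Hv0) _; rewrite w0 mulr0.
have hw : {ae mu, forall t, Jo t -> nrm (j (p t) - rH (w t)) = 0}.
  apply: ae_mono (ae_conj wz rp) => t [h1 h2] Jt; have [m e] := h2 Jt.
  have e1 : nrm (rH (w t) - rH (z1 t)) = 0.
    apply/eqP; rewrite eq_le nrm_ge0 andbT.
    by apply: le_trans (rz_distA zH (cw.1 t (oJ Jt)) (V_L2 m)) _; rewrite h1// mulr0.
  rewrite nrm_sym; apply: (nrm_sub0_trans e1); apply: (nrm_sub0_trans (rH_rV m)).
  by rewrite -(jB j_lin); apply/eqP; rewrite eq_le nrm_ge0 andbT; apply: le_trans (j_le _) _; rewrite e mulr0.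
have key t x : J t -> dot (rH (w t)) (j x) = dot W0 (j x) + dot (prim p2 t) x.
  move=> Jt.
  have [c hc] := @weak_time_derivative _ _ T0 _ p2 (fun t => dot (jj (p t)) x) x sp2
    (intg_dotr x mJ (@subset_refl _ J) sj) (fun phi tp => time_derivative_weak T0 zS rj rp2 sj sp2 d2 x tp).
  have hwc : {ae mu, forall t, Jo t -> dot (rH (w t)) (j x) = c + dot (prim p2 t) x}.
    apply: ae_mono (ae_conj hw hc) => s [h1 h2] Js; rewrite -(h2 Js) jinvE.
    by apply/eqP; rewrite -subr_eq0 -dotBl; apply/eqP; apply: dot0_nrm; rewrite nrm_sym; exact: h1.
  have g0 : dot (prim p2 0) x = 0 by apply: dot0_nrm; exact: (prim0 (ltW T0) sp2).
  have := continuous_time_affine T0 zH cw (fun t Jt => dot_prim_continuous (y := x) sp2 Jt) g0 hwc Jt.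
  move=> ->; congr (_ + _); apply/eqP; rewrite -subr_eq0 -dotBl; apply/eqP; exact: dot0_nrm.
have rf := f_represents rz0 sy; have srhs := sL2_rhs Phi_L2 U0 sp.
(* The equation tested with [vV x] identifies [p2] with the right-hand side minus lam p. *)
have hp2 : {ae mu, forall t, Jo t -> forall x : Vs, dot (p2 t) x = dot (rhs Phi U0 p t) x - lam * dot (p t) x}.
  apply: ae_mono (ae_conj eq (ae_conj rp (ae_conj rp2 (ae_conj rz0 rf)))) => t [h [h1 [h2 [h0 hf]]]] Jt x.
  have [m1 e1] := h1 Jt; have [m2 e2] := h2 Jt; have [m0 e0'] := h0 Jt; have [mf ef] := hf Jt.
  have [mx ex] := rz_inv zV x.
  have := h Jt (vV x) mx.
  rewrite (rS_dot m2 mx) (rS_dot mf mx) (op_A_dot m1 mx) (op_A_dot m0 mx).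
  have d (u u' : Vs) : nrm (u - u') = 0 -> dot u (rV (vV x)) = dot u' x.
    move=> hu; have -> : dot u (rV (vV x)) = dot u x.
      by apply/eqP; rewrite -subr_eq0 -dotBr dotC; apply/eqP; exact: dot0_nrm.
    by apply/eqP; rewrite -subr_eq0 -dotBl; apply/eqP; exact: dot0_nrm.
  rewrite (d _ _ e1) (d _ _ e2) (d _ _ e0') (d _ _ ef).
  rewrite (_ : rhs Phi U0 p t = Phi (primitive_from U0 p) t - primitive_from U0 p t)// dotBl.
  move=> <-; ring.
split=> //; apply: ae_segment; apply: ae_mono hw => t h Jt x.
have Jt' : J t := oJ Jt; have tT := Jle Jt'.
have -> : jdot j (p t) x = dot (rH (w t)) (j x).
  by rewrite /jdot; apply/eqP; rewrite -subr_eq0 -dotBl; apply/eqP; apply: dot0_nrm; exact: h.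
rewrite (key t x Jt'); congr (_ + _).
have ir := intg_dotr x (mt t) (sub_J0 tT) srhs; have ip' := intg_dotr x (mt t) (sub_J0 tT) sp.
rewrite (prim_dot x tT sp2) -(RintegralZl lam (mt t) ip') -(RintegralB (mt t) ir (intgZ (mt t) lam ip')).
apply: (Rintegral_ae (mt t)).
- exact: intg_measurable (intg_dotr x (mt t) (sub_J0 tT) sp2).
- exact: intg_measurable (intgB (mt t) ir (intgZ (mt t) lam ip')).
apply: ae_mono (ae_segment hp2) => s hs Js; apply: hs; exact: (sub_J0 tT).
Qed.

Lemma weak_solution_exists_unique : exists eta : R -> VX,
  [/\ weak_solution T f kappa lam u0 v0 eta,
      forall zeta : R -> VX, weak_solution T f kappa lam u0 v0 zeta -> ae_equal T zeta eta
    & exists (eta1 : R -> VX) (eta2 : R -> VX'),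
      [/\ in_Wr T eta eta1 eta2, continuous_time T eta, @continuous_time R HX T eta1
        & forall t, t \in `[0, T] ->
            L2_norm L (eta1 t) ^+ 2 + V_norm ip (eta t) ^+ 2
            + \int[mu]_(s in `[0, t]) V_norm ip (eta1 s) ^+ 2
            <= (1 + b ^+ 2) * energy_const T lam K2 * (1 + b ^+ 2)
               * (V_norm ip u0 ^+ 2 + L2_norm L v0 ^+ 2 + L2_time_norm T (fun s => f s 0) ^+ 2)]].
Proof.
have [v [v_ [sv [cv_ vv_] hv hE]]] := picard_existence (ltW T0) lam0 M0 (sqr_ge0 (K * b ^+ 2))
  j_lin j_le j_inj j_dense Phi_L2 Phi_lip U0 W0.
exists (eta v); split.
- exact: eta_weak_solution sv cv_ vv_ hv.
- move=> zeta /weak_solution_parabolic[p hp rp].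
  have hpv : parabolic_solution T lam j W0 (rhs Phi U0 v) v.
    split=> //; apply: ae_mono vv_ => t h Jt x; rewrite -(hv t Jt) /jdot.
    by apply/eqP; rewrite -subr_eq0 -dotBl; apply/eqP; apply: dot0_nrm; exact: h.
  have e := picard_unique (ltW T0) lam0 M0 (sqr_ge0 (K * b ^+ 2)) j_lin j_le j_inj j_dense Phi_L2 Phi_lip hp hpv.
  apply: (represents_ae zV rp (eta_represents v)); apply: aeW => t Jt.
  have tT := Jle (oJ Jt); rewrite /primitive_from opprD addrACA subrr add0r.
  apply/nrm_eq0P; set z := _ - _; have hz x : dot z x = 0; last exact: hz.
  have sp := hp.1; rewrite /z dotBl (prim_dot x tT sp) (prim_dot x tT sv).
  apply/eqP; rewrite subr_eq0; apply/eqP; apply: (Rintegral_ae (mt t)).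
  + exact: intg_measurable (intg_dotr x (mt t) (sub_J0 tT) sp).
  + exact: intg_measurable (intg_dotr x (mt t) (sub_J0 tT) sv).
  apply: ae_mono e => s h Js; apply/eqP; rewrite -subr_eq0 -dotBl; apply/eqP; apply: dot0_nrm.
  by apply: h; exact: (sub_J0 tT).
exists (eta1 v v_), (eta2 v); split.
- exact: eta_in_Wr sv vv_ hv.
- exact: eta_continuous sv.
- exact: eta1_continuous cv_.
- exact: eta_estimate sv vv_ hE.
Qed.

End Solution.

Theorem theorem2p2 (R : realType) (T lambda c0 K : R)
    (T_gt0 : 0 < T) (lambda_gt0 : 0 < lambda) (c0_gt0 : 0 < c0)
    (K_ge0 : 0 <= K) :
  exists C : R,
  forall (L : \bar R) (bc : boundary_condition)
      (ip : (R -> R) -> (R -> R) -> R) (kappa : R)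
      (f : R -> V L bc ip -> Vstar L bc ip) (u0 v0 : R -> R),
    (0 < L)%E ->
    V_inner_product L bc ip ->
    0 <= kappa ->
    form_bounded L bc ip kappa ->
    form_coercive L bc ip kappa c0 ->
    lipschitz_rhs T f K ->
    V_mem L bc u0 ->
    L2 L v0 ->
    exists eta : R -> V L bc ip,
      [/\ weak_solution T f kappa lambda u0 v0 eta,
          forall zeta : R -> V L bc ip,
            weak_solution T f kappa lambda u0 v0 zeta -> ae_equal T zeta eta
        & exists (eta1 : R -> V L bc ip) (eta2 : R -> Vstar L bc ip),
          [/\ in_Wr T eta eta1 eta2,
              continuous_time T eta,
              @continuous_time R (H L) T eta1
            & forall t, t \in `[0, T] ->
                L2_norm L (eta1 t) ^+ 2 + V_norm ip (eta t) ^+ 2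
                + \int[@lebesgue_measure R]_(s in `[0, t])
                    V_norm ip (eta1 s) ^+ 2
                <= C * (V_norm ip u0 ^+ 2 + L2_norm L v0 ^+ 2
                        + L2_time_norm T (fun s => f s 0) ^+ 2)]].
Proof.
pose b := Num.sqrt c0^-1.
(* Besides T and lambda the constant depends only on the coercivity and Lipschitz constants c0 and
   K; it is fixed before L, the boundary condition, f and the data. *)
exists ((1 + b ^+ 2) * energy_const T lambda ((K * b ^+ 2) ^+ 2) * (1 + b ^+ 2)).
move=> L bc ip kappa f u0 v0 L0 ipV _ a_bounded a_coercive f_lip Vu0 Hv0.
have [M M0 hM] := V_inj_le L0 ipV a_bounded c0_gt0 a_coercive.
exact: (weak_solution_exists_unique T_gt0 lambda_gt0 K_ge0 M0
  (V_realization L0 ipV a_bounded c0_gt0 a_coercive)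
  (S_realization L0 ipV a_bounded c0_gt0 a_coercive) (H_realization L)
  (@V_inj_lin _ _ _ _ _ _ L0 ipV a_bounded c0_gt0 a_coercive) hM
  (@V_inj_inj _ _ _ _ _ _ L0 ipV a_bounded c0_gt0 a_coercive)
  (@V_inj_dense _ _ _ _ _ _ L0 ipV a_bounded c0_gt0 a_coercive)
  (@S_rho_dot _ _ _ _ _ _ L0 ipV a_bounded c0_gt0 a_coercive)
  (@op_A_rho_dot _ _ _ _ _ _ L0 ipV a_bounded c0_gt0 a_coercive)
  (@H_to_Vstar_mem _ _ _ _ _ _ L0 ipV a_bounded c0_gt0 a_coercive)
  (@H_to_Vstar_rho_dot _ _ _ _ _ _ L0 ipV a_bounded c0_gt0 a_coercive)
  (@V_mem_L2 _ L bc ip)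
  (@H_rho_V_rho _ _ _ _ _ _ L0 ipV a_bounded c0_gt0 a_coercive)
  (@H_rho_norm _ L) f_lip Vu0 Hv0).
Qed.
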